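(* Let $(X_t)_{t\ge 0}$ be a regular jump Lévy process in $\mathbf{R}^d$ and let $V$ be a confining $X$-Kato class potential, with Feynman--Kac semigroup $\{T_t\}$ and eigenfunctions $\varphi_n$ (all as defined in the context). Then for every $n\in\{1,2,\dots\}$ there is a constant $C_{10}=C_{10}(X,V,n)$ such that $$|\varphi_n(x)|\le C_{10}\,\varphi_0(x),\qquad x\in\mathbf{R}^d.$$
   Context: Conventions. $(X_t)_{t\ge0}$ is a Lévy process in $\mathbf{R}^d$, $d\ge1$; $\mathbf{P}^x,\mathbf{E}^x$ refer to the process started at $x$. $B(x,r)$ is the open ball. $C, C_i$ denote positive constants; $C(X,a,\dots)$ depends only on the process (and the dimension $d$) and on the listed parameters. $f\asymp Cg$ means $C^{-1}g\le f\le Cg$. Regular jump Lévy process: a Lévy process satisfying (A1)--(A3). (A1) $(X_t)$ is symmetric, its Lévy measure is absolutely continuous with a strictly positive density $\nu$, and: (1) for every $0<r\le 1/2$ there is $C_1=C_1(X,r)\ge1$ with $\nu(x)\asymp C_1\nu(y)$ for $r\le|y|\le|x|\le|y|+1$; (2) there is $C_2=C_2(X)\ge1$ with $\nu(x)\le C_2\nu(y)$ for $1/2\le|y|\le|x|$; (3) there is $C_3=C_3(X)\ge1$ with $\int_{|z-x|>1/2,\,|z-y|>1/2}\nu(x-z)\nu(z-y)\,dz\le C_3\nu(x-y)$ for $|y-x|\ge1$. (A2) $(X_t)$ is strong Feller, equivalently it has transition densities $p(t,x,y)=p(t,y-x)$ for $t>0$; moreover there are $t_b>0$ and a constant $C(X,t_b)$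 with $0<p(t_b,x)\le C(X,t_b)$ for all $x\in\mathbf{R}^d$. (A3) For all $0<p<q<R\le1$, $\sup_{x\in B(0,p)}\sup_{y\in B(0,q)^c}G_{B(0,R)}(x,y)<\infty$, where for a bounded open set $D$, $G_D(x,y)=\int_0^\infty p_D(t,x,y)\,dt$ for $x,y\in D$ (and $0$ otherwise), and $p_D$ is the transition density of the process killed upon exiting $D$. Potentials. A Borel function $V:\mathbf{R}^d\to\mathbf{R}$ belongs to $\mathcal{K}^X$ if $\lim_{t\to0}\sup_x\mathbf{E}^x[\int_0^t|V(X_s)|ds]=0$, and to $\mathcal{K}^X_{\mathrm{loc}}$ if $V\mathbf{1}_B\in\mathcal{K}^X$ for every ball $B$. $V$ is an $X$-Kato class potential if $V_-\in\mathcal{K}^X$ and $V_+\in\mathcal{K}^X_{\mathrm{loc}}$. It is confining if also $V(x)\to\infty$ as $|x|\to\infty$. Feynman--Kac semigroup: $T_tf(x)=\mathbf{E}^x[e^{-\int_0^tV(X_s)ds}f(X_t)]$, $t>0$. Whenever $(X_t)$ is a regular jump Lévy process and $V$ is a confining $X$-Kato class potential, $\{T_t\}$ is a strongly continuous semigroup of symmetric compact operators on $L^2(\mathbf{R}^d)$; there is an orthonormal basis $\{\varphi_n\}_{n\ge0}$ of $L^2(\mathbf{R}^d)$ with $T_t\varphi_n=e^{-\lambda_nt}\varphi_n$, $t>0$, where $\lambda_0<\lambda_1\le\lambda_2\le\cdots\to\infty$; each $\varphi_n$ is (taken to be) bounded and continuous, and $\varphi_0$ (the ground state) is chosen strictly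 positive. *)

(* Defs.v *)
From HB Require Import structures.
From mathcomp Require Import all_boot all_order all_algebra.
From mathcomp Require Import all_classical all_reals all_analysis.
From mathcomp Require Import measurable_realfun.

Set Implicit Arguments.
Unset Strict Implicit.
Unset Printing Implicit Defensive.
Import Order.TTheory GRing.Theory Num.Theory.
Import numFieldNormedType.Exports.
Local Open Scope classical_set_scope.
Local Open Scope ring_scope.

(* Borel sigma-algebra of R^n, R^n being the row vectors with their usual
   topology *)
Definition borel_rV_display : measure_display.
Proof. exact. Qed.

Section borel_rV.
Context (R : realType) (n : nat).

Let borel0 : <<s @open 'rV[R]_n >> set0.
Proof. exact: sigma_algebra0. Qed.

Let borelC A : <<s @open 'rV[R]_n >> A -> <<s @open 'rV[R]_n >> (~` A).
Proof. exact: sigma_algebraC. Qed.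

Let borelU (F : (set 'rV[R]_n)^nat) : (forall i, <<s @open 'rV[R]_n >> (F i)) ->
  <<s @open 'rV[R]_n >> (\bigcup_i F i).
Proof. exact: sigma_algebra_bigcup. Qed.

HB.instance Definition _ := @isMeasurable.Build borel_rV_display
  'rV[R]_n <<s @open 'rV[R]_n >> borel0 borelC borelU.

End borel_rV.

Section measurable_rV.
Context (R : realType) (n : nat).

Lemma open_measurable_rV (U : set 'rV[R]_n) : open U -> measurable U.
Proof. by move=> oU; exact: sub_sigma_algebra. Qed.

Lemma measurable_coord (i : 'I_n) :
  measurable_fun setT (fun v : 'rV[R]_n => v ord0 i).
Proof.
apply: (measurability _ (measurable_realfun.RGenOpens.measurableE R)) => _ [_ [a [b ->]] <-].
rewrite setTI; apply: open_measurable_rV.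
by apply: open_comp; [move=> v _; exact: coord_continuous|exact: interval_open].
Qed.

Lemma measurable_fun_rV d (T : measurableType d) (f : T -> 'rV[R]_n) :
  (forall i, measurable_fun setT (fun w => f w ord0 i)) -> measurable_fun setT f.
Proof.
move=> mf; apply: (measurability _ (erefl : measurable = <<s @open 'rV[R]_n >>)).
move=> _ [U oU <-]; rewrite setTI.
pose B (q : 'rV[rat]_n * nat) : set 'rV[R]_n :=
  [set v | forall i, `|ratr (q.1 ord0 i) - v ord0 i| < q.2.+1%:R^-1].
have -> : f @^-1` U =
    \bigcup_(q in [set q | B q `<=` U]) \bigcap_(i in [set: 'I_n])
      (fun w => f w ord0 i) @^-1` ball (ratr (q.1 ord0 i) : R) q.2.+1%:R^-1.
  rewrite eqEsubset; split => [w Ufw|w [q qU] qw]; last first.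
    by apply: qU => i; exact: qw.
  have /nbhs_ballP[e /= e0 eU] := open_nbhs_nbhs (conj oU Ufw).
  have [k ke] : exists k, k.+1%:R^-1 < e / 2.
    have /ltr_add_invr[k] : 0 < e / 2 by rewrite divr_gt0.
    by rewrite add0r => ?; exists k.
  have k0 : 0 < k.+1%:R^-1 :> R by rewrite invr_gt0.
  have /choice[q qP] : forall i : 'I_n, exists r : rat,
      `|ratr r - f w ord0 i| < k.+1%:R^-1 :> R.
    move=> i.
    have /rat_in_itvoo[r] : f w ord0 i < f w ord0 i + k.+1%:R^-1.
      by rewrite ltrDl.
    rewrite in_itv/= => /andP[r1 r2]; exists r.
    by rewrite ger0_norm ?subr_ge0 ?ltW// ltrBlDl.
  exists (\row_i q i, k) => [v Bv|i _] /=; last by rewrite mxE; exact: qP.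
  apply: eU; split => // i j; rewrite (ord1 i) {i}.
  have := Bv j; rewrite /= mxE => vj; have wj := qP j.
  rewrite /ball/= (splitr e) (le_lt_trans (ler_distD (ratr (q j)) _ _))//.
  by apply: ltrD; [rewrite distrC|]; exact: lt_trans ke.
rewrite bigcup_mkcond.
apply: countable_bigcupT_measurable => [|q]; first exact: countableP.
case: ifPn => _ //; apply: fin_bigcap_measurable => [|i _].
  exact: finite_finset.
rewrite -[X in measurable X]setTI; apply: mf => //; apply: open_measurable; exact: ball_open.
Qed.

End measurable_rV.

Section lebesgue_rV.
Context (R : realType).

Definition rV_cons n (z : measurableTypeR R * 'rV[R]_n) : 'rV[R]_n.+1 :=
  \row_i (if unlift ord0 i is Some j then z.2 ord0 j else z.1).

Lemma measurable_rV_cons n : measurable_fun setT (@rV_cons n).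
Proof.
apply: measurable_fun_rV => i; under eq_fun do rewrite mxE.
case: (unlift ord0 i) => [j|]; last exact: measurable_fst.
by apply: (measurableT_comp (measurable_coord _)); exact: measurable_snd.
Qed.

HB.instance Definition _ n :=
  isMeasurableFun.Build _ _ _ _ (@rV_cons n) (@measurable_rV_cons n).

Lemma rV_consK n (v : 'rV[R]_n.+1) :
  rV_cons (v ord0 ord0, \row_j v ord0 (lift ord0 j)) = v.
Proof.
apply/rowP => i; rewrite mxE.
by case: unliftP => [j ->|->] //=; rewrite mxE.
Qed.

Lemma rV_cons0 n (z : measurableTypeR R * 'rV[R]_n) : rV_cons z ord0 ord0 = z.1.
Proof. by rewrite mxE unlift_none. Qed.

Lemma rV_consS n (z : measurableTypeR R * 'rV[R]_n) j :
  rV_cons z ord0 (lift ord0 j) = z.2 ord0 j.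
Proof. by rewrite mxE liftK. Qed.

Section lebesgue_cons.
Context n (m : {sigma_finite_measure set 'rV[R]_n -> \bar R}).

Definition lebesgue_cons : set 'rV[R]_n.+1 -> \bar R :=
  pushforward (@lebesgue_measure R \x m)%E (@rV_cons n).

Let lebesgue_cons0 : lebesgue_cons set0 = 0%E.
Proof. exact: measure0. Qed.

Let lebesgue_cons_ge0 A : (0 <= lebesgue_cons A)%E.
Proof. exact: measure_ge0. Qed.

Let lebesgue_cons_sigma_additive : semi_sigma_additive lebesgue_cons.
Proof. exact: measure_semi_sigma_additive. Qed.

HB.instance Definition _ := isMeasure.Build _ _ _ lebesgue_cons
  lebesgue_cons0 lebesgue_cons_ge0 lebesgue_cons_sigma_additive.

Let lebesgue_cons_sigma_finite : sigma_finite setT lebesgue_cons.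
Proof.
have /sigma_finiteP[F [TF ndF Foo]] := sigma_finiteT (@lebesgue_measure R).
have /sigma_finiteP[G [TG ndG Goo]] := sigma_finiteT m.
pose g (v : 'rV[R]_n.+1) : measurableTypeR R * 'rV[R]_n :=
  (v ord0 ord0, \row_j v ord0 (lift ord0 j)).
have mg : measurable_fun setT g.
  apply/measurable_fun_pairP; split; first exact: measurable_coord.
  apply: measurable_fun_rV => i /=; under eq_fun do rewrite mxE.
  exact: measurable_coord.
have gK z : g (rV_cons z) = z.
  case: z => x v; rewrite /g rV_cons0; congr pair.
  by apply/rowP => j; rewrite mxE rV_consS.
exists (fun k => g @^-1` (F k `*` G k)) => [|k].
  rewrite -preimage_bigcup -(preimage_setT g) -setXTT TF TG; congr (_ @^-1` _).
  apply/seteqP; split => [[x y] [/= [i _ Fx] [j _ Gy]]|[x y] [i _ []/= ? ?]].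
    exists (maxn i j) => //; split.
    - by move: x Fx; exact/subsetPset/ndF/leq_maxl.
    - by move: y Gy; exact/subsetPset/ndG/leq_maxr.
  by split; exists i.
have [mF ?] := Foo k; have [mG ?] := Goo k; split.
  by rewrite -[X in measurable X]setTI; apply: mg => //; exact: measurableX.
rewrite /lebesgue_cons /pushforward -comp_preimage (_ : g \o _ = id); last first.
  exact/funext.
by rewrite preimage_id product_measure1E// lte_mul_pinfty// ge0_fin_numE.
Qed.

HB.instance Definition _ := Measure_isSigmaFinite.Build _ _ _ lebesgue_cons
  lebesgue_cons_sigma_finite.

End lebesgue_cons.

(* n-dimensional Lebesgue measure as an iterated product *)
Fixpoint lebesgue_rV n : {sigma_finite_measure set 'rV[R]_n -> \bar R} :=
  if n is n'.+1 then lebesgue_cons (lebesgue_rV n') else \d_(0 : 'rV[R]_0).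

Lemma lebesgue_rV_box n (A : 'I_n -> set (measurableTypeR R)) :
  (forall i, measurable (A i)) ->
  lebesgue_rV n [set v | forall i, A i (v ord0 i)] =
  (\prod_(i < n) @lebesgue_measure R (A i))%E.
Proof.
elim: n => [|n IHn] in A *; move=> mA.
  by rewrite big_ord0 /= diracE mem_set// => -[].
have mB : measurable
    [set v : 'rV[R]_n | forall i, A (lift ord0 i) (v ord0 i)].
  rewrite (_ : mkset _ = \bigcap_(i in [set: 'I_n])
      (fun v : 'rV[R]_n => v ord0 i) @^-1` A (lift ord0 i)); last first.
    by apply/seteqP; split => v /= Av i; [move=> _|]; exact: Av.
  apply: fin_bigcap_measurable => [|i _]; first exact: finite_finset.
  rewrite -[X in measurable X]setTI; apply: (measurable_coord i measurableT).
  exact: mA.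
rewrite big_ord_recl -IHn// -product_measure1E//.
congr (product_measure1 _ _ _); apply/seteqP; split => -[x v] /= Av.
  split=> [|i]; first by have := Av ord0; rewrite rV_cons0.
  by have := Av (lift ord0 i); rewrite rV_consS.
by move=> i; case: (unliftP ord0 i) => [j ->|->];
  rewrite ?rV_consS ?rV_cons0; case: Av => // _; exact.
Qed.

End lebesgue_rV.

(* Euclidean norm: the library norm `|x| on row vectors is the sup norm *)
Definition enorm (R : realType) n (x : 'rV[R]_n) : R :=
  Num.sqrt (\sum_(i < n) x ord0 i ^+ 2).

Definition eball (R : realType) n (x : 'rV[R]_n) (r : R) : set 'rV[R]_n :=
  [set y | enorm (y - x) < r].

Section levy_process.
Context (R : realType) (d : nat) (disp : measure_display)
  (Omega : measurableType disp) (P : probability Omega R).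
Implicit Types (X : R -> Omega -> 'rV[R]_d) (x y z : 'rV[R]_d) (t : R).

Definition independent_increments X := forall (n : nat) (t : nat -> R)
    (A : nat -> set 'rV[R]_d),
  0 <= t 0%N -> (forall i, t i <= t i.+1) -> (forall i, measurable (A i)) ->
  P [set w | forall i, (i < n)%N -> A i (X (t i.+1) w - X (t i) w)] =
  (\prod_(i < n) P [set w | A i (X (t i.+1) w - X (t i) w)%R])%E.

Definition stationary_increments X := forall (s t : R) (A : set 'rV[R]_d),
  0 <= s -> 0 <= t -> measurable A ->
  P [set w | A (X (s + t) w - X s w)] = P [set w | A (X t w)].

Definition cadlag (f : R -> 'rV[R]_d) :=
  (forall t, 0 <= t -> f s @[s --> t^'+] --> f t) /\
  (forall t, 0 < t -> cvg (f s @[s --> t^'-])).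

(* X is started at 0; only the times t >= 0 are meaningful. The law P^x of the
   process started at x is the law under P of the path t |-> x + X t. *)
Definition levy_process X :=
  [/\ forall t, 0 <= t -> measurable_fun setT (X t),
      forall w, X 0 w = 0,
      independent_increments X,
      stationary_increments X &
      forall w, cadlag (X ^~ w)].

Definition symmetric_process X := forall t (A : set 'rV[R]_d),
  0 <= t -> measurable A -> P [set w | A (- X t w)] = P [set w | A (X t w)].

Definition jump (f : R -> 'rV[R]_d) t : 'rV[R]_d :=
  f t - lim (f s @[s --> t^'-]).

(* The Levy measure, as the expected number of jumps of a given size per unit
   of time: nu(A) = E #{t in ]0, 1] : X_t - X_{t-} in A \ {0}} *)
Definition levy_measure X (A : set 'rV[R]_d) : \bar R :=
  (\int[P]_w counting [set t | [/\ (0 < t <= 1)%R, jump (X ^~ w) t != 0%R &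
                                   A (jump (X ^~ w) t)]])%E.

Definition levy_density X (nu : 'rV[R]_d -> R) :=
  [/\ measurable_fun setT nu,
      forall x, x != 0 -> 0 < nu x &
      forall A : set 'rV[R]_d, measurable A ->
        levy_measure X A = (\int[lebesgue_rV R d]_(x in A) (nu x)%:E)%E].

Definition conditionA1 X :=
  symmetric_process X /\
  exists2 nu : 'rV[R]_d -> R, levy_density X nu &
  [/\ forall r : R, 0 < r <= 1 / 2 -> exists2 C1, 1 <= C1 &
        forall x y, r <= enorm y -> enorm y <= enorm x ->
          enorm x <= enorm y + 1 ->
          C1^-1 * nu y <= nu x <= C1 * nu y,
      exists2 C2, 1 <= C2 & forall x y,
        1 / 2 <= enorm y -> enorm y <= enorm x -> nu x <= C2 * nu y &
      exists2 C3, 1 <= C3 & forall x y, 1 <= enorm (y - x) ->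
        (\int[lebesgue_rV R d]_(z in [set z | (1 / 2 < enorm (z - x))%R /\
                                             (1 / 2 < enorm (z - y))%R])
           (nu (x - z) * nu (z - y))%:E <= (C3 * nu (x - y))%:E)%E].

Definition transition_density X (p : R -> 'rV[R]_d -> R) :=
  forall t, 0 < t ->
  [/\ measurable_fun setT (p t),
      forall x, 0 <= p t x &
      forall x (A : set 'rV[R]_d), measurable A ->
        P [set w | A (x + X t w)] =
        (\int[lebesgue_rV R d]_(y in A) (p t (y - x))%:E)%E].

Definition conditionA2 X :=
  exists2 p : R -> 'rV[R]_d -> R, transition_density X p &
  exists tb C : R, [/\ 0 < tb, 0 < C & forall x, 0 < p tb x <= C].

Definition exit_time X (D : set 'rV[R]_d) x (w : Omega) : \bar R :=
  ereal_inf [set t%:E | t in [set t | 0 <= t /\ ~ D (x + X t w)]].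

(* P^x(X_t in A, t < tau_D). The event is only measurable with respect to the
   P-completion of the sigma-algebra of Omega; the integral of its indicator
   is its probability for the completion of P. *)
Definition killed_kernel X (D : set 'rV[R]_d) t x (A : set 'rV[R]_d) : \bar R :=
  (\int[P]_w (\1_[set w | A (x + X t w)%R /\
                         (t%:E < exit_time X D x w)%E] w)%:E)%E.

Definition killed_density X (D : set 'rV[R]_d)
    (pD : R -> 'rV[R]_d -> 'rV[R]_d -> \bar R) :=
  [/\ measurable_fun setT (fun u : measurableTypeR R * ('rV[R]_d * 'rV[R]_d) =>
        pD u.1 u.2.1 u.2.2),
      forall t x y, (0 <= pD t x y)%E &
      forall t x (A : set 'rV[R]_d), 0 < t -> D x -> measurable A ->
        A `<=` D ->
        killed_kernel X D t x A = (\int[lebesgue_rV R d]_(y in A) pD t x y)%E].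

Definition green (pD : R -> 'rV[R]_d -> 'rV[R]_d -> \bar R)
    (D : set 'rV[R]_d) x y : \bar R :=
  if `[< D x /\ D y >] then
    (\int[@lebesgue_measure R]_(t in `[0%R, +oo[) pD t x y)%E
  else 0%E.

Definition conditionA3 X := forall r : R, 0 < r <= 1 ->
  exists2 pD, killed_density X (eball 0 r) pD &
  forall p q : R, 0 < p -> p < q -> q < r ->
  (ereal_sup [set u | exists x y, [/\ eball 0 p x, ~ eball 0 q y &
                                     u = green pD (eball 0 r) x y]] < +oo)%E.

Definition regular_jump_levy_process X :=
  [/\ levy_process X, conditionA1 X, conditionA2 X & conditionA3 X].

Definition kato X (V : 'rV[R]_d -> R) :=
  measurable_fun setT V /\
  (ereal_sup [set (\int[P]_w \int[@lebesgue_measure R]_(s in `[0%R, t])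
                     `|V (x + X s w)%R|%:E)%E | x in [set: 'rV[R]_d]])
    @[t --> 0^'+] --> 0%E.

Definition kato_loc X (V : 'rV[R]_d -> R) :=
  measurable_fun setT V /\
  forall x (r : R), 0 < r -> kato X (V \* \1_(eball x r)).

Definition kato_potential X (V : 'rV[R]_d -> R) :=
  [/\ measurable_fun setT V, kato X V^\- & kato_loc X V^\+].

Definition confining (V : 'rV[R]_d -> R) :=
  forall M, exists r : R, forall x, r < enorm x -> M < V x.

Definition feynman_kac X (V : 'rV[R]_d -> R) t (f : 'rV[R]_d -> R) x : R :=
  \int[P]_w
    (expR (- \int[@lebesgue_measure R]_(s in `[0, t]) V (x + X s w)) *
     f (x + X t w)).

End levy_process.

Section eigenfunctions.
Context (R : realType) (d : nat).
Implicit Types (f g : 'rV[R]_d -> R) (phi : nat -> 'rV[R]_d -> R).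
Local Notation leb := (lebesgue_rV R d).

Definition L2 f := measurable_fun setT f /\ (Lnorm leb 2%:E (EFin \o f) < +oo)%E.

Definition L2_inner f g : R := \int[leb]_x (f x * g x).

Definition L2_orthonormal_basis phi :=
  [/\ forall n, L2 (phi n),
      forall m n, L2_inner (phi m) (phi n) = (m == n)%:R &
      forall f, L2 f ->
        Lnorm leb 2%:E (fun x =>
          (f x - \sum_(k < n) L2_inner f (phi k) * phi k x)%:E)
        @[n --> \oo] --> 0%E].

(* The spectral data of the Feynman-Kac semigroup; as usual in L^2, the
   eigenvalue equation is an identity almost everywhere *)
Record eigensystem (disp : measure_display) (Omega : measurableType disp)
    (P : probability Omega R) (X : R -> Omega -> 'rV[R]_d) (V : 'rV[R]_d -> R)
    (lambda : nat -> R) phi : Prop := Eigensystem {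
  eigen_basis : L2_orthonormal_basis phi ;
  eigen_eq : forall n (t : R), 0 < t ->
    {ae leb, forall x, feynman_kac P X V t (phi n) x =
                       expR (- (lambda n * t)) * phi n x} ;
  eigen_gap : lambda 0%N < lambda 1%N ;
  eigen_mono : forall n, (0 < n)%N -> lambda n <= lambda n.+1 ;
  eigen_cvg : lambda n @[n --> \oo] --> +oo ;
  eigen_bounded : forall n, exists M : R, forall x, `|phi n x| <= M ;
  eigen_continuous : forall n, continuous (phi n) ;
  ground_state_gt0 : forall x, 0 < phi 0%N x
}.

End eigenfunctions.

(* Main.v *)
(* Put q_j = V - lambda_j + U with U = (2|V| + c) 1_B, where the ball B and then c
   are so large that q_j >= K for a large constant K, and let
   G_j psi(x) = E^x int_0^oo exp(- int_0^s q_j(X_u) du) psi(X_s) ds. Duhamel's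
   formula for the eigenvalue equation gives |phi_n| <= C G_n U and
   phi_0 >= c' G_0 U, so G_n U and G_0 U have to be compared far from B. Apply
   Dynkin's formula, with n (E f(y + X_{1/n}) - f(y)) for n -> oo in place of the
   generator, to a bounded f >= 0 vanishing at the starting point x. If f is
   comparable off the ball B(x, 1/2) to a function h that satisfies a Harnack
   inequality and int h(y - z) nu(z) dz <= C h(y) over |z| >= 3/4, then
   G(q h 1_{|y - x| >= 1/2})(x) <= C h(x) G 1(x) because K is large. For h equal to
   nu off B(0, 1/2) this yields G_n U(x) <= C nu(x) G_n 1(x). For f a bump supported
   in B(0, 1), the jumps from near x to the origin yield
   nu(x) G_0 1(x) <= C G_0 U(x). Finally G_n 1 <= C G_0 1, since both are carried
   up to a constant factor by the times s <= 1. *)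
From HB Require Import structures.
Require Import Defs.
From mathcomp Require Import all_boot all_order all_algebra.
From mathcomp Require Import all_classical all_reals all_analysis.
From mathcomp Require Import measurable_realfun.
From mathcomp Require Import ring lra zify.
Import Order.TTheory GRing.Theory Num.Theory.
Import numFieldNormedType.Exports.
Set Implicit Arguments.
Unset Strict Implicit.
Unset Printing Implicit Defensive.
Local Open Scope classical_set_scope.
Local Open Scope ring_scope.

(** * Exponential primitives and the Euclidean norm *)

(** The Levy density is only measurable and may explode at the origin, so no generator can be
    applied to it. The comparison function is therefore modified near 0 and replaced by its
    inf-convolution with a sum of hyperbolic cosines: this changes it by constant factors only and
    makes its second differences at most a multiple of itself. After symmetrization, small
    increments then enter through their second moment alone, which the characteristic function
    controls; large ones enter through one-sided limits of [n * P(X_{1/n} in A)] towards the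
    expected number of jumps in [A], obtained by counting increments along a grid. A large [K]
    serves for absorption: it makes [G f] at most half of [G h], so that [G h] is governed by the
    values of [h] near [x]. The term [2 |V|] of [U] is there because [V] may be unbounded in both
    directions inside [B]. Feynman-Kac weights and Green potentials live in [[0, +oo]], with
    potentials split into nonnegative parts, and identities are arranged without subtraction
    wherever possible. *)

Lemma measurable_expeR (R : realType) : measurable_fun setT (@expeR R).
Proof.
apply: (measurability _ (ErealGenInftyO.measurableE R)) => _ [_ [y ->] <-].
rewrite setTI; have [y0|y0] := leP y 0.
  rewrite (_ : _ @^-1` _ = set0)//; apply/seteqP; split => // x/=.
  rewrite in_itv/= => /(le_lt_trans (expeR_ge0 x)).
  by rewrite lte_fin ltNge y0.
rewrite (_ : _ @^-1` _ = `]-oo, (ln y)%:E[%classic); first exact: emeasurable_itv.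
apply/seteqP; split => x/=; rewrite !in_itv/=;
by rewrite -(@lte_expeR _ x)/= lnK// posrE.
Qed.

Section exponential_primitive_bounds.
Context (R : realType) (A J : R -> R) (a b : R).
Hypotheses (ab : a <= b) (Aa : A a = 0) (Ja : J a = 0).
Hypothesis Ac : {within `[a, b], continuous A}.
Hypothesis Ale : forall s t, a <= s -> s <= t -> t <= b -> A s <= A t.
Hypothesis JB : forall s t, a <= s -> s <= t -> t <= b ->
  expR (- A t) * (A t - A s) <= J t - J s <= expR (- A s) * (A t - A s).

Let A0 s : a <= s -> s <= b -> 0 <= A s.
Proof. by move=> as_ sb; rewrite -Aa Ale. Qed.

(** With [h := A t - A s], both increments lie between [expR (- A t) * h] and [expR (- A s) * h], by
    the tangent bound [1 + u <= expR u] at [h] and at [- h]. This interval has length at most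
    [h ^+ 2] because [A s >= 0]. *)
Let D s t : a <= s -> s <= t -> t <= b ->
  `|(J t - J s) - (expR (- A s) - expR (- A t))| <= (A t - A s) ^+ 2.
Proof.
move=> as_ st tb; have /andP[] := JB as_ st tb.
have : 0 <= A t - A s by rewrite subr_ge0 Ale.
have := A0 as_ (le_trans st tb).
move: (A s) (J t - J s) (A t) => As dJ At.
have [h ->] : exists h, At = As + h by exists (At - As); rewrite addrC subrK.
rewrite [As + h - As]addrAC subrr add0r => As0 h0 J1 J2.
have E : expR (- As) = expR (- (As + h)) * expR h.
  by rewrite -expRD; congr expR; rewrite opprD -addrA addNr addr0.
have E' : expR (- (As + h)) = expR (- As) * expR (- h) by rewrite -expRD opprD.
have es : expR (- As) <= 1 by rewrite -[leRHS]expR0 ler_expR oppr_le0.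
have u1 := expR_ge1Dx h; rewrite -(ler_pM2l (expR_gt0 (- (As + h)))) -E in u1.
have u2 := expR_ge1Dx (- h); rewrite -(ler_pM2l (expR_gt0 (- As))) -E' in u2.
move: (expR (- As)) (expR (- (As + h))) u1 u2 es J1 J2 => x y u1 u2 x1 J1 J2.
have hh : x * h - y * h <= h ^+ 2.
  rewrite -mulrBl expr2 ler_wpM2r//.
  have : x * h <= h by rewrite ler_piMl.
  lra.
rewrite ler_norml; apply/andP; split; lra.
Qed.

(* [J] and [1 - expR (- A)] have increments differing by at most the square of
   the increment of [A]; cut ]a, b] at points equally spaced for [A]. *)
Lemma eq_expN_primitive : J b = 1 - expR (- A b).
Proof.
have H N : `|J b - (1 - expR (- A b))| <= A b ^+ 2 / N.+1%:R.
  have ivt k : (k <= N.+1)%N -> exists2 c, c \in `[a, b] & A c = k%:R / N.+1%:R * A b.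
    move=> kN; apply: (@IVT _ A a b) => //.
    have k0 : 0 <= k%:R / N.+1%:R :> R by [].
    have k1 : k%:R / N.+1%:R <= 1 :> R by rewrite ler_pdivrMr// mul1r ler_nat.
    rewrite Aa ge_min le_max; apply/andP; split; apply/orP; [left|right].
      by rewrite mulr_ge0// A0.
    by rewrite ler_piMl// A0.
  have main k : (k <= N.+1)%N -> forall c, c \in `[a, b] -> A c = k%:R / N.+1%:R * A b ->
      `|J c - (1 - expR (- A c))| <= k%:R * (A b / N.+1%:R) ^+ 2.
    elim: k => [|k IH] kN c cab Ac_.
      rewrite !mul0r in Ac_ *.
      have /D : a <= a by []. move=> /(_ c); rewrite (itvP cab) => /(_ isT).
      move: cab; rewrite in_itv/= => /andP[ac cb] /(_ cb).
      by rewrite Aa Ac_ Ja !subr0 oppr0 expR0 subrr !subr0 expr0n.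
    have [e eab Ae] := ivt _ (ltnW kN).
    have := IH (ltnW kN) e eab Ae.
    have Aec : A c - A e = A b / N.+1%:R.
      rewrite Ac_ Ae -mulrBl -mulrBl -natrB// subSnn.
      by rewrite mul1r mulrC.
    move: cab eab; rewrite !in_itv/= => /andP[ac cb] /andP[ae eb].
    (* [A] is only nondecreasing, so the chosen points of levels [k] and [k + 1] may come in the
       wrong order; monotonicity then forces the increment of [A] between them to be 0. *)
    have [ec|ce] := leP e c.
      have := D ae ec cb; rewrite Aec.
      move=> d1 d2.
      rewrite -natr1 mulrDl mul1r.
      apply: le_trans (lerD d2 d1).
      apply: le_trans (ler_normD _ _).
      by rewrite le_eqVlt; apply/orP; left; apply/eqP; congr (`|_|); lra.
    have Ace := Ale ac (ltW ce) eb.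
    have h0 : A b / N.+1%:R = 0.
      apply/eqP; rewrite eq_le; apply/andP; split; last by rewrite divr_ge0// A0.
      by rewrite -Aec subr_le0.
    have := D ac (ltW ce) eb.
    have -> : A e - A c = 0 by rewrite -opprB Aec h0 oppr0.
    rewrite !h0 !expr0n/= !mulr0 => d1 d2.
    have := lerD d2 d1; rewrite addr0; apply: le_trans.
    rewrite -[X in _ <= _ + X]normrN.
    apply: le_trans (ler_normD _ _).
    by rewrite le_eqVlt; apply/orP; left; apply/eqP; congr (`|_|); lra.
  have /main := leqnn N.+1.
  move=> /(_ b); rewrite in_itv/= ab lexx => /(_ isT).
  rewrite divff// mul1r => /(_ erefl) /le_trans; apply.
  rewrite expr_div_n mulrCA ler_wpM2l ?sqr_ge0//.
  by rewrite expr2 invfM mulVKf.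
apply/eqP; rewrite -subr_eq0 -normr_le0; apply/ler_addgt0Pl => e e0.
rewrite addr0.
have [N hN] : exists N : nat, A b ^+ 2 / e < N.+1%:R.
  exists (Num.truncn (A b ^+ 2 / e)); exact: truncnS_gt.
apply: le_trans (H N) _.
by rewrite ler_pdivrMr// -ler_pdivrMl// mulrC ltW.
Qed.

End exponential_primitive_bounds.

Section exponential_primitive.
Context (R : realType).
Local Notation mu := (@lebesgue_measure R).
Variables (q : R -> R) (a b : R).
Hypotheses (ab : a <= b) (q0 : forall x, 0 <= q x).
Hypothesis qi : mu.-integrable `[a, b] (EFin \o q).

Let A (s : R) : R := \int[mu]_(u in `[a, s]) q u.
Let f (s : R) : R := q s * expR (- A s).

Let AB s t : a <= s -> s <= t -> t <= b -> A t - A s = \int[mu]_(u in `]s, t]) q u.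
Proof.
move=> as_ st tb; rewrite /A Rintegral_itvB ?bnd_simp//.
by apply: integrableS qi => //; apply: subset_itvl; rewrite bnd_simp.
Qed.

Let AA : A a = 0. Proof. by rewrite /A set_itv1 Rintegral_set1. Qed.

Let Ale s t : a <= s -> s <= t -> t <= b -> A s <= A t.
Proof.
by move=> as_ st tb; rewrite -subr_ge0 AB//; apply: Rintegral_ge0 => x _; exact: q0.
Qed.

Let A0 s : 0 <= A s. Proof. by apply: Rintegral_ge0 => x _; exact: q0. Qed.

Let Ac : {within `[a, b], continuous A}.
Proof. exact: parameterized_integral_continuous. Qed.

Let fi : mu.-integrable `[a, b] (EFin \o f).
Proof.
have mA : measurable_fun `[a, b] A.
  by apply: subspace_continuous_measurable_fun.
have mq := measurable_int _ qi.
apply: le_integrable qi => //.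
  apply/measurable_EFinP; apply: measurable_funM.
    exact/measurable_EFinP.
  by apply: measurableT_comp => //; apply: measurableT_comp.
move=> x _ /=; rewrite lee_fin /f normrM ler_piMr//.
by rewrite ger0_norm ?expR_ge0// -[leRHS]expR0 ler_expR oppr_le0.
Qed.

Let J (s : R) : R := \int[mu]_(u in `[a, s]) f u.

Let JB s t : a <= s -> s <= t -> t <= b ->
  expR (- A t) * (A t - A s) <= J t - J s <= expR (- A s) * (A t - A s).
Proof.
move=> as_ st tb.
have sub : `]s, t]%classic `<=` (`[a, b]%classic : set R).
  by apply: subset_itv; rewrite bnd_simp.
rewrite AB// /J (Rintegral_itvB (f:=f)) ?bnd_simp//; last first.
  by apply: integrableS fi => //; apply: subset_itvl; rewrite bnd_simp.
have iq : mu.-integrable `]s, t] (EFin \o q) by apply: integrableS qi.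
have if_ : mu.-integrable `]s, t] (EFin \o f) by apply: integrableS fi.
have iqc c : mu.-integrable `]s, t] (EFin \o (fun x => c * q x)).
  by apply: (integrableZl _ c iq).
have Z c : c * \int[mu]_(u in `]s, t]) q u = \int[mu]_(u in `]s, t]) (c * q u).
  by rewrite RintegralZl.
apply/andP; split; rewrite Z; apply: le_Rintegral.
- exact: measurable_itv.
- exact: iqc.
- exact: if_.
- move=> x /=; rewrite in_itv/= => /andP[sx xt].
  have e : A x <= A t by apply: Ale => //; exact: le_trans as_ (ltW sx).
  by rewrite mulrC; apply: ler_wpM2l; [exact: q0|rewrite ler_expR lerN2].
- exact: measurable_itv.
- exact: if_.
- exact: iqc.
- move=> x /=; rewrite in_itv/= => /andP[sx xt].
  have e : A s <= A x by apply: Ale => //; [exact: ltW sx|exact: le_trans xt tb].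
  by rewrite [leRHS]mulrC; apply: ler_wpM2l; [exact: q0|rewrite ler_expR lerN2].
Qed.

(** The integrand is formally the derivative of [- expR (- A s)], but [q] is merely integrable, so
    the monotonicity of [A] is used on each subinterval ([JB]) in place of a derivative. *)
Lemma Rintegral_expN_primitive : \int[mu]_(s in `[a, b]) (q s * expR (- A s)) =
  1 - expR (- A b).
Proof.
have Ja : J a = 0 by rewrite /J set_itv1 Rintegral_set1.
exact: (@eq_expN_primitive _ A J a b ab AA Ja Ac Ale JB).
Qed.

End exponential_primitive.

(** * Translation invariance of Lebesgue measure *)

Section lebesgue_shift.
Context (R : realType).
Local Notation mu := (@lebesgue_measure R).

Lemma measurable_addl (c : R) :
  measurable_fun setT ((fun v => c + v) : measurableTypeR R -> measurableTypeR R).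
Proof. by apply: measurable_funD. Qed.

Lemma lebesgue_measure_addl (c : R) (A : set (measurableTypeR R)) : measurable A ->
  mu ((fun v => c + v) @^-1` A) = mu A.
Proof.
move=> mA.
pose mf : {mfun measurableTypeR R >-> measurableTypeR R} :=
  HB.pack ((fun v => c + v) : measurableTypeR R -> measurableTypeR R)
    (isMeasurableFun.Build _ _ _ _ _ (measurable_addl c)).
rewrite -[LHS]/(pushforward mu mf A).
apply/esym/(@lebesgue_measure_unique _ (pushforward mu mf)) => //= _ [[a b]] _ <-.
rewrite /pushforward (_ : _ @^-1` _ = `]a - c, b - c]%classic); last first.
  apply/seteqP; split => x /=; rewrite !in_itv/= => /andP[? ?]; apply/andP; split; lra.
rewrite !lebesgue_measure_itv/= !lte_fin ltrD2r; case: ifP => // _.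
rewrite -!EFinD; congr EFin; lra.
Qed.

Lemma ge0_integral_addl (c : R) (D : set (measurableTypeR R)) (F : R -> \bar R) :
  measurable D -> measurable_fun D F -> (forall x, 0 <= F x)%E ->
  (\int[mu]_(x in D) F x = \int[mu]_(x in (fun v => (c + v)%R) @^-1` D) F (c + x)%R)%E.
Proof.
move=> mD mF F0.
pose mf : {mfun measurableTypeR R >-> measurableTypeR R} :=
  HB.pack ((fun v => c + v) : measurableTypeR R -> measurableTypeR R)
    (isMeasurableFun.Build _ _ _ _ _ (measurable_addl c)).
rewrite -(@ge0_integral_pushforward _ _ _ _ _ mf _ mu D F)//.
- by apply: eq_measure_integral => A mA _; apply/esym/lebesgue_measure_addl.
Qed.

Lemma ge0_integral_itv_addl (s t : R) (F : R -> \bar R) :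
  measurable_fun setT F -> (forall x, 0 <= F x)%E ->
  (\int[mu]_(x in `[s, (s + t)%R]) F x = \int[mu]_(x in `[0%R, t]) F (s + x)%R)%E.
Proof.
move=> mF F0; rewrite (@ge0_integral_addl s)//; last exact: measurable_funTS.
congr (integral _ _ _); apply/seteqP; split => x /=;
  rewrite !in_itv/= => /andP[? ?]; apply/andP; split; lra.
Qed.

End lebesgue_shift.

Section rV_basics.
Context (R : realType).

Lemma continuous_measurable_rV n (f : 'rV[R]_n -> R) :
  continuous f -> measurable_fun setT f.
Proof.
move=> cf; apply: (measurability _ (measurable_realfun.RGenOpens.measurableE R)).
move=> _ [_ [a [b ->]] <-]; rewrite setTI; apply: open_measurable_rV.
by apply: open_comp; [move=> v _; exact: cf|exact: interval_open].
Qed.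

Lemma measurable_funD_rV d (T : measurableType d) n (f g : T -> 'rV[R]_n) :
  measurable_fun setT f -> measurable_fun setT g ->
  measurable_fun setT (fun x => f x + g x).
Proof.
move=> mf mg; apply: measurable_fun_rV => i.
under eq_fun do rewrite mxE.
by apply: measurable_funD; apply: (measurableT_comp (measurable_coord i)).
Qed.

Lemma measurable_funN_rV d (T : measurableType d) n (f : T -> 'rV[R]_n) :
  measurable_fun setT f -> measurable_fun setT (fun x => - f x).
Proof.
move=> mf; apply: measurable_fun_rV => i.
under eq_fun do rewrite mxE.
by apply: measurableT_comp => //; apply: (measurableT_comp (measurable_coord i)).
Qed.

(** Induction on the dimension: Tonelli separates the first coordinate, where the one-dimensional
    invariance applies, from the remaining ones, where the induction hypothesis does. *)
Lemma ge0_integral_rV_addl n (a : 'rV[R]_n) (F : 'rV[R]_n -> \bar R) :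
  measurable_fun setT F -> (forall x, 0 <= F x)%E ->
  (\int[lebesgue_rV R n]_x F (a + x)%R = \int[lebesgue_rV R n]_x F x)%E.
Proof.
elim: n => [|n IH] in a F *; move=> mF F0.
  by congr (integral _ _ _); apply/funext => x; congr F; apply/rowP => -[].
pose m := lebesgue_rV R n.
have E (H : 'rV[R]_n.+1 -> \bar R) : measurable_fun setT H -> (forall x, 0 <= H x)%E ->
    (\int[lebesgue_rV R n.+1]_x H x =
     \int[m]_y \int[@lebesgue_measure R]_x H (rV_cons (x, y)))%E.
  move=> mH H0; rewrite /= /lebesgue_cons.
  rewrite (ge0_integral_pushforward (measurable_rV_cons (R:=R) (n:=n)))//=.
  pose G (z : measurableTypeR R * 'rV[R]_n) := H (rV_cons z).
  have mG : measurable_fun setT G.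
    exact: measurableT_comp mH (measurable_rV_cons (R:=R) (n:=n)).
  have G0 z : (0 <= G z)%E by exact: H0.
  rewrite preimage_setT (@fubini_tonelli1 _ _ _ _ _ _ _ G)//.
  exact: (@fubini_tonelli _ _ _ _ _ (@lebesgue_measure R) m G).
have mFa : measurable_fun setT (fun x => F (a + x)).
  by apply: measurableT_comp => //; apply: measurable_funD_rV.
rewrite (E _ mF F0) (E _ mFa (fun x => F0 _)).
pose a' : 'rV[R]_n := \row_j a ord0 (lift ord0 j).
transitivity (\int[m]_y \int[@lebesgue_measure R]_x F (rV_cons (x, (a' + y)%R)))%E.
  apply: eq_integral => y _.
  rewrite [RHS](@ge0_integral_addl _ (a ord0 ord0) setT)//=; last first.
    apply: measurableT_comp => //.
    apply: (measurableT_comp (measurable_rV_cons (R:=R) (n:=n))).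
    exact: pair2_measurable.
  rewrite preimage_setT; apply: eq_integral => x _; congr F.
  apply/rowP => i; rewrite !mxE; case: unliftP => [j ->|->] /=.
    by rewrite !mxE.
  by [].
rewrite (IH a' (fun y => \int[@lebesgue_measure R]_x F (rV_cons (x, y)))%E)//.
  pose G (z : measurableTypeR R * 'rV[R]_n) := F (rV_cons z).
  have mG : measurable_fun setT G.
    exact: measurableT_comp mF (measurable_rV_cons (R:=R) (n:=n)).
  have G0 z : (0 <= G z)%E by exact: F0.
  exact: (@measurable_fun_fubini_tonelli_G _ _ _ _ _ (@lebesgue_measure R) G).
by move=> y; apply: integral_ge0.
Qed.

End rV_basics.

Section euclidean_norm.
Context (R : realType) (n : nat).
Implicit Types x y z : 'rV[R]_n.

Lemma enorm_ge0 x : 0 <= enorm x. Proof. exact: sqrtr_ge0. Qed.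

Let sum_ge0 x : 0 <= \sum_(i < n) x ord0 i ^+ 2.
Proof. by apply: sumr_ge0 => i _; exact: sqr_ge0. Qed.

Lemma sqr_enorm x : enorm x ^+ 2 = \sum_(i < n) x ord0 i ^+ 2.
Proof. by rewrite sqr_sqrtr. Qed.

Lemma enormN x : enorm (- x) = enorm x.
Proof. by rewrite /enorm; congr Num.sqrt; apply: eq_bigr => i _; rewrite mxE sqrrN. Qed.

Lemma enormC x y : enorm (x - y) = enorm (y - x).
Proof. by rewrite -enormN opprB. Qed.

Lemma enorm0 : enorm (0 : 'rV[R]_n) = 0.
Proof. by rewrite /enorm big1 ?sqrtr0// => i _; rewrite mxE expr0n. Qed.

(** The sum of the squares [(x_i r - y_i s) ^+ 2], where [s] and [r] are the norms of [x] and [y],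
    expands to [2 s r] times the difference to be shown nonnegative. A vector of norm 0 has zero
    coordinates and is treated apart. *)
Lemma enorm_CS x y : \sum_(i < n) x ord0 i * y ord0 i <= enorm x * enorm y.
Proof.
set s := enorm x; set r := enorm y.
have E : 0 <= (\sum_(i < n) (x ord0 i * r - y ord0 i * s) ^+ 2).
  by apply: sumr_ge0 => i _; exact: sqr_ge0.
have {E} : 0 <= (s * r) * (s * r - \sum_(i < n) x ord0 i * y ord0 i).
  rewrite -(pmulr_rge0 _ (ltr0n R 2)).
  apply: le_trans E _.
  rewrite (eq_bigr (fun i => r ^+ 2 * x ord0 i ^+ 2 +
     (s ^+ 2 * y ord0 i ^+ 2 - 2 * (s * r) * (x ord0 i * y ord0 i)))); last first.
    by move=> i _; ring.
  rewrite !big_split/= sumrN -!mulr_sumr -!sqr_enorm -/s -/r.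
  by rewrite le_eqVlt; apply/orP; left; apply/eqP; ring.
have [/eqP sr0 _|sr0] := eqVneq (s * r) 0; last first.
  by rewrite pmulr_rge0 ?subr_ge0// lt_def sr0/= mulr_ge0// enorm_ge0.
have z (v : 'rV[R]_n) : enorm v = 0 -> forall i, v ord0 i = 0.
  move=> v0 i; have := sqr_enorm v; rewrite v0 expr0n/= => /esym/eqP.
  rewrite psumr_eq0; last by move=> j _; exact: sqr_ge0.
  by move=> /allP/(_ i); rewrite mem_index_enum sqrf_eq0 => /(_ isT)/eqP.
move: sr0; rewrite mulf_eq0 => /orP[]/eqP h.
  by rewrite h mul0r big1// => i _; rewrite (z x)// mul0r.
by rewrite h mulr0 big1// => i _; rewrite (z y)// mulr0.
Qed.

Lemma enormD x y : enorm (x + y) <= enorm x + enorm y.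
Proof.
rewrite -(ler_pXn2r (ltn0Sn 1)) ?nnegrE ?addr_ge0 ?enorm_ge0//.
rewrite sqr_enorm (eq_bigr (fun i => x ord0 i ^+ 2 +
  (y ord0 i ^+ 2 + 2 * (x ord0 i * y ord0 i)))); last by move=> i _; rewrite mxE; ring.
rewrite !big_split/= -mulr_sumr -!sqr_enorm.
have := enorm_CS x y; set c := \sum_(_ < _) _.
move=> h; rewrite sqrrD -addrA lerD2l addrC lerD2r -[leRHS]mulr_natl.
by apply: ler_wpM2l.
Qed.

Lemma enorm_dist x y : `|enorm x - enorm y| <= enorm (x - y).
Proof.
have h (u v : 'rV[R]_n) : enorm u - enorm v <= enorm (u - v).
  by rewrite lerBlDr -{1}(subrK v u) enormD.
by rewrite ler_norml lerNl opprB h enormC h.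
Qed.

Lemma coord_le_enorm x i : `|x ord0 i| <= enorm x.
Proof.
rewrite -sqrtr_sqr ler_sqrt// (bigD1 i)//= lerDl.
by apply: sumr_ge0 => j _; exact: sqr_ge0.
Qed.

Lemma enorm_le_sum x : enorm x <= \sum_(i < n) `|x ord0 i|.
Proof.
have S0 (r : seq 'I_n) : 0 <= \sum_(i <- r) `|x ord0 i| by apply: sumr_ge0.
rewrite -(ler_pXn2r (ltn0Sn 1)) ?nnegrE ?enorm_ge0 ?S0// sqr_enorm.
elim: (index_enum _) => [|i r IH]; first by rewrite !big_nil expr0n.
rewrite !big_cons sqrrD -[in leRHS]normrX [`|_ ^+ 2|]ger0_norm ?sqr_ge0//.
have := mulr_ge0 (normr_ge0 (x ord0 i)) (S0 r).
by move: IH; rewrite -mulr_natl; lra.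
Qed.

Lemma coord_le_norm x i : `|x ord0 i| <= `|x|.
Proof.
rewrite [`|x|]mx_normrE.
by apply: (le_trans _ (le_bigmax _ _ (ord0, i))).
Qed.

Lemma enorm_le_norm x : enorm x <= n%:R * `|x|.
Proof.
apply: le_trans (enorm_le_sum x) _.
apply: (@le_trans _ _ (\sum_(i < n) `|x|)).
  by apply: ler_sum => i _; exact: coord_le_norm.
by rewrite sumr_const card_ord mulr_natl.
Qed.

Lemma continuous_enormB (z : 'rV[R]_n) : continuous ((fun x => enorm (x - z)) : 'rV[R]_n -> R).
Proof.
move=> x A /nbhs_ballP[e /= e0 eA]; apply/nbhs_ballP.
have n1 : 0 < n.+1%:R :> R by [].
exists (e / n.+1%:R) => /=; first by rewrite divr_gt0.
move=> y; rewrite mx_norm_ball /ball_/= => xy; apply: eA.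
rewrite /ball/=; apply: le_lt_trans (enorm_dist _ _) _.
rewrite opprB addrA subrK.
apply: le_lt_trans (enorm_le_norm _) _.
apply: (@le_lt_trans _ _ (n.+1%:R * `|x - y|)).
  by rewrite ler_wpM2r// ler_nat.
by rewrite -ltr_pdivlMl// mulrC.
Qed.

Lemma continuous_enorm : continuous (@enorm R n).
Proof.
by move=> x; have := @continuous_enormB 0 x; under eq_fun do rewrite subr0.
Qed.

Lemma measurable_enormB (z : 'rV[R]_n) : measurable_fun setT (fun x : 'rV[R]_n => enorm (x - z)).
Proof. by apply: continuous_measurable_rV; exact: continuous_enormB. Qed.

Lemma measurable_enorm : measurable_fun setT (@enorm R n).
Proof. by apply: continuous_measurable_rV; exact: continuous_enorm. Qed.

Lemma measurable_eball (z : 'rV[R]_n) (r : R) : measurable (eball z r : set 'rV[R]_n).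
Proof.
rewrite (_ : eball z r = (fun x => enorm (x - z)) @^-1` `]-oo, r[); last first.
  by apply/seteqP; split => x /=; rewrite in_itv/=.
by rewrite -[X in measurable X]setTI; apply: measurable_enormB.
Qed.

End euclidean_norm.

(** * Path space and the Markov property *)

Lemma measurable_fun_sum_rV (R : realType) dT (T : measurableType dT) n
    (h : nat -> T -> 'rV[R]_n) k : (forall i, measurable_fun setT (h i)) ->
  measurable_fun setT (fun x => \sum_(j < k) h j x).
Proof.
move=> mh; elim: k => [|k IH].
  by under eq_fun do rewrite big_ord0; exact: measurable_cst.
by under eq_fun do rewrite big_ord_recr/=; exact: measurable_funD_rV.
Qed.

Lemma measurable_fun_expeR (R : realType) dT (T : measurableType dT) (f : T -> \bar R) :
  measurable_fun setT f -> measurable_fun setT (fun x => expeR (f x)).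
Proof. by move=> mf; exact: (measurableT_comp (@measurable_expeR R) mf). Qed.

Lemma measurable_fun_expeRN (R : realType) dT (T : measurableType dT) (f : T -> \bar R) :
  measurable_fun setT f -> measurable_fun setT (fun x => expeR (- f x)).
Proof. by move=> mf; apply: measurable_fun_expeR; exact: measurableT_comp. Qed.

Section path_space.
Context (R : realType) (d : nat).
Local Notation E := 'rV[R]_d.

(** The mesh is a fraction of [s] so that the time [s] itself is the grid point of index [2 ^ m] at
    every level; paths will be cut at [s]. *)
Definition dyadic (s : R) (m k : nat) : R := k%:R * (s / 2 ^+ m).

Definition rect (s : R) m n (A : nat -> set E) : set (R -> E) :=
  [set f | forall i, (i < n)%N -> A i (f (dyadic s m i))].

Definition rects (s : R) : set (set (R -> E)) :=
  [set B | exists m n A, (forall i, measurable (A i)) /\ B = rect s m n A].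

(** Only grid times generate the sigma-algebra. Other times are reached through right continuity,
    see [reval]. *)
Definition pathT (s : R) := g_sigma_algebraType (rects s).

Definition cyl n (A : nat -> set E) : set (nat -> E) :=
  [set z | forall i, (i < n)%N -> A i (z i)].

Definition cyls : set (set (nat -> E)) :=
  [set B | exists n A, (forall i, measurable (A i)) /\ B = cyl n A].

Definition seqT := g_sigma_algebraType cyls.

(** Point [i] of level [m] is point [2 i] of level [m + 1], and odd points carry no constraint. Two
    rectangles can thus be put on a common level, which makes [rects] closed under intersection. *)
Lemma rect_refine s m n A : (forall i, measurable (A i)) ->
  exists n' A', (forall i, measurable (A' i)) /\ rect s m n A = rect s m.+1 n' A'.
Proof.
move=> mA; exists n.*2, (fun i => if odd i then setT else A i./2); split.
  by move=> i; case: ifP.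
have e i : dyadic s m.+1 i.*2 = dyadic s m i.
  rewrite /dyadic -muln2 natrM exprS.
  have : (2 : R) != 0 by []. have : (2 : R) ^+ m != 0 by rewrite expf_neq0.
  by move=> h1 h2; field; rewrite h1.
apply/seteqP; split => f /= Af i.
  case: ifPn => // oi; have ei : i = i./2.*2 by rewrite -[LHS](odd_double_half i) (negbTE oi).
  by rewrite ei ltn_double doubleK e; exact: Af.
move=> ni; have := Af i.*2; rewrite ltn_double odd_double doubleK e; exact.
Qed.

Lemma rect_refinen s m k n A : (forall i, measurable (A i)) ->
  exists n' A', (forall i, measurable (A' i)) /\ rect s m n A = rect s (m + k)%N n' A'.
Proof.
move=> mA; elim: k => [|k [n1 [A1 [mA1 e1]]]]; first by exists n, A; rewrite addn0.
by rewrite addnS e1; exact: rect_refine.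
Qed.

Lemma rects_setI s : setI_closed (rects s).
Proof.
move=> _ _ [m1 [n1 [A1 [mA1 ->]]]] [m2 [n2 [A2 [mA2 ->]]]].
have [n1' [A1' [mA1' ->]]] := rect_refinen s m1 m2 n1 mA1.
have [n2' [A2' [mA2' ->]]] := rect_refinen s m2 m1 n2 mA2.
rewrite [(m2 + m1)%N]addnC.
exists (m1 + m2)%N, (maxn n1' n2'),
  (fun i => (if (i < n1')%N then A1' i else setT) `&` (if (i < n2')%N then A2' i else setT)).
split.
  by move=> i; apply: measurableI; case: ifP.
apply/seteqP; split => f /=.
  by move=> [h1 h2] i _; split; case: ifPn => // ?; [exact: h1|exact: h2].
move=> h; split => i ni.
  by have := h i; rewrite leq_max ni /= => /(_ isT)[].
by have := h i; rewrite leq_max ni orbT /= => /(_ isT)[].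
Qed.

Lemma measurable_seqT_coord i : measurable_fun setT (fun z : seqT => z i).
Proof.
move=> _ B mB; rewrite setTI; apply: sub_sigma_algebra.
exists i.+1, (fun j => if j == i then B else setT); split.
  by move=> j; case: ifP.
apply/seteqP; split => z /= h; first by move=> j _; case: eqP => // ->.
by have := h i (ltnSn i); rewrite eqxx.
Qed.

Lemma cyls_setI : setI_closed cyls.
Proof.
move=> _ _ [n1 [A1 [mA1 ->]]] [n2 [A2 [mA2 ->]]].
exists (maxn n1 n2),
  (fun i => (if (i < n1)%N then A1 i else setT) `&` (if (i < n2)%N then A2 i else setT)).
split.
  by move=> i; apply: measurableI; case: ifP.
apply/seteqP; split => f /=.
  by move=> [h1 h2] i _; split; case: ifPn => // ?; [exact: h1|exact: h2].
move=> h; split => i ni.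
  by have := h i; rewrite leq_max ni /= => /(_ isT)[].
by have := h i; rewrite leq_max ni orbT /= => /(_ isT)[].
Qed.

Lemma measurable_to_seqT dT (T : measurableType dT) (f : T -> seqT) :
  (forall i, measurable_fun setT (fun w => f w i)) -> measurable_fun setT f.
Proof.
move=> mf; apply: (measurability _ (erefl : @measurable _ seqT = <<s cyls >>)).
move=> _ [_ [n [A [mA ->]]] <-]; rewrite setTI.
rewrite (_ : _ @^-1` _ = \bigcap_(i in `I_n) (fun w => f w i) @^-1` A i).
  by apply: fin_bigcap_measurable => // i _; rewrite -[X in measurable X]setTI; apply: mf.
by apply/seteqP; split => w /= h.
Qed.

Lemma measurable_to_pathT s dT (T : measurableType dT) (f : T -> pathT s) :
  (forall m k, measurable_fun setT (fun w => f w (dyadic s m k))) -> measurable_fun setT f.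
Proof.
move=> mf; apply: (measurability _ (erefl : @measurable _ (pathT s) = <<s rects s >>)).
move=> _ [_ [m [n [A [mA ->]]]] <-]; rewrite setTI.
rewrite (_ : _ @^-1` _ = \bigcap_(i in `I_n) (fun w => f w (dyadic s m i)) @^-1` A i).
  by apply: fin_bigcap_measurable => // i _; rewrite -[X in measurable X]setTI; apply: mf.
by apply/seteqP; split => w /= h.
Qed.

Lemma measurable_pathT_eval s m k : measurable_fun setT (fun f : pathT s => f (dyadic s m k)).
Proof.
move=> _ B mB; rewrite setTI; apply: sub_sigma_algebra.
exists m, k.+1, (fun j => if j == k then B else setT); split.
  by move=> j; case: ifP.
apply/seteqP; split => z /= h; first by move=> j _; case: eqP => // ->.
by have := h k (ltnSn k); rewrite eqxx.
Qed.

End path_space.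

(** * Laws of paths from laws of increments *)

Section path_law.
Context (R : realType) (d : nat) (s : R).
Local Notation E := 'rV[R]_d.
Context d1 (T1 : measurableType d1) (P1 : probability T1 R) (X1 : T1 -> R -> E).
Context d2 (T2 : measurableType d2) (P2 : probability T2 R) (X2 : T2 -> R -> E).
Hypotheses (s0 : 0 <= s).
Hypotheses (mX1 : forall t, 0 <= t -> measurable_fun setT (X1 ^~ t))
  (mX2 : forall t, 0 <= t -> measurable_fun setT (X2 ^~ t)).
Hypotheses (X10 : forall w, X1 w 0 = 0) (X20 : forall w, X2 w 0 = 0).
Hypothesis X12 : forall m n (A : nat -> set E), (forall i, measurable (A i)) ->
  P1 [set w | forall i, (i < n)%N -> A i (X1 w (dyadic s m i.+1) - X1 w (dyadic s m i))] =
  P2 [set w | forall i, (i < n)%N -> A i (X2 w (dyadic s m i.+1) - X2 w (dyadic s m i))].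

Lemma dyadic_ge0 m k : 0 <= dyadic s m k.
Proof. by rewrite mulr_ge0// divr_ge0// exprn_ge0. Qed.

Let inc dT (T : measurableType dT) (X : T -> R -> E) m (w : T) : seqT R d :=
  fun i => X w (dyadic s m i.+1) - X w (dyadic s m i).

Let minc dT (T : measurableType dT) (X : T -> R -> E) m :
  (forall t, 0 <= t -> measurable_fun setT (X ^~ t)) -> measurable_fun setT (inc X m).
Proof.
move=> mX; apply: measurable_to_seqT => i.
by apply: measurable_funD_rV; [|apply: measurable_funN_rV]; apply: mX; exact: dyadic_ge0.
Qed.

Let inc_law m (C : set (seqT R d)) : measurable C ->
  P1 (inc X1 m @^-1` C) = P2 (inc X2 m @^-1` C).
Proof.
pose f1 : {mfun T1 >-> seqT R d} := HB.pack (inc X1 m)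
  (isMeasurableFun.Build _ _ _ _ _ (minc m mX1)).
pose f2 : {mfun T2 >-> seqT R d} := HB.pack (inc X2 m)
  (isMeasurableFun.Build _ _ _ _ _ (minc m mX2)).
move=> mC; rewrite -[LHS]/(pushforward P1 f1 C) -[RHS]/(pushforward P2 f2 C).
apply: (@measure_unique _ R (seqT R d) (@cyls R d) (fun=> setT)) => //.
- exact: cyls_setI.
- move=> _; exists 0%N, (fun=> setT); split => //.
  by apply/seteqP; split => z.
- by rewrite bigcup_const//; exists 0%N.
- by move=> _ [n [A [mA ->]]]; exact: X12.
- move=> _; rewrite [X in (X < _)%E](_ : _ = P1 setT)//.
  by rewrite probability_setT ltry.
Qed.

Let valE (X : R -> E) m i : X 0 = 0 ->
  X (dyadic s m i) = \sum_(j < i) (X (dyadic s m j.+1) - X (dyadic s m j)).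
Proof.
move=> X0; elim: i => [|i IH]; first by rewrite big_ord0 /dyadic mul0r.
by rewrite big_ord_recr/= -IH addrC subrK.
Qed.

Let path_mfun dT (T : measurableType dT) (X : T -> R -> E) :
  (forall t, 0 <= t -> measurable_fun setT (X ^~ t)) ->
  measurable_fun setT (X : T -> pathT d s).
Proof. by move=> mX; apply: measurable_to_pathT => m k; apply: mX; exact: dyadic_ge0. Qed.

(** A path started at 0 is the sequence of partial sums of its increments, so the joint laws of the
    increments on every grid determine the law on the generating pi-system [rects], hence the law on
    [pathT]. *)
Lemma path_law_eq (H : pathT d s -> \bar R) : measurable_fun setT H ->
  (forall f, 0 <= H f)%E -> (\int[P1]_w H (X1 w) = \int[P2]_w H (X2 w))%E.
Proof.
move=> mH H0.
pose f1 : {mfun T1 >-> pathT d s} := HB.pack (X1 : T1 -> pathT d s)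
  (isMeasurableFun.Build _ _ _ _ _ (path_mfun mX1)).
pose f2 : {mfun T2 >-> pathT d s} := HB.pack (X2 : T2 -> pathT d s)
  (isMeasurableFun.Build _ _ _ _ _ (path_mfun mX2)).
have e1 := @ge0_integral_pushforward _ _ _ _ _ f1 (path_mfun mX1) P1 setT H
  measurableT mH (fun y _ => H0 y).
have e2 := @ge0_integral_pushforward _ _ _ _ _ f2 (path_mfun mX2) P2 setT H
  measurableT mH (fun y _ => H0 y).
rewrite !preimage_setT in e1 e2; rewrite -[LHS]e1 -[RHS]e2.
apply: eq_measure_integral => A mA _.
apply: (@measure_unique _ R (pathT d s) (@rects R d s) (fun=> setT)) => //.
- exact: rects_setI.
- move=> _; exists 0%N, 0%N, (fun=> setT); split => //.
  by apply/seteqP; split => z.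
- by rewrite bigcup_const//; exists 0%N.
- move=> _ [m [n [B [mB ->]]]].
  pose C : set (seqT R d) := [set z | forall i, (i < n)%N -> B i (\sum_(j < i) (z : nat -> E) j)].
  have mC : measurable C.
    rewrite (_ : C = \bigcap_(i in `I_n) (fun z : seqT R d => \sum_(j < i) (z : nat -> E) j) @^-1` B i).
      apply: fin_bigcap_measurable => // i _; rewrite -[X in measurable X]setTI.
      suff : measurable_fun setT (fun z : seqT R d => \sum_(j < i) (z : nat -> E) j) by apply.
      exact: (@measurable_fun_sum_rV _ _ _ _ (fun j (z : seqT R d) => (z : nat -> E) j) i (@measurable_seqT_coord R d)).
    by apply/seteqP; split => w /= h.
  have := inc_law m mC; rewrite /pushforward /=.
  have sb (X : R -> E) : X 0 = 0 -> rect s m n B X = C (fun i => X (dyadic s m i.+1) - X (dyadic s m i)).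
    move=> X0; apply/propext; rewrite /rect/= /C/=; split => h i ni.
      by rewrite -(valE m i X0); exact: h.
    by rewrite (valE m i X0); exact: h.
  by under [X in P1 X]eq_set do rewrite -sb//; under [X in P2 X]eq_set do rewrite -sb//.
- move=> _; rewrite [X in (X < _)%E](_ : _ = P1 setT)//.
  by rewrite probability_setT ltry.
Qed.

End path_law.

Section markov_law.
Context (R : realType) (d : nat) (disp : measure_display)
  (Omega : measurableType disp) (P : probability Omega R)
  (X : R -> Omega -> 'rV[R]_d).
Hypothesis hX : levy_process P X.
Local Notation E := 'rV[R]_d.

(* Under P \x P this path has the law of [X], which is the Markov property at
   time [s]. *)
Definition concat_path (s : R) (w : Omega * Omega) (u : R) : E :=
  X (Num.min u s) w.1 + X (Num.max 0 (u - s)) w.2.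

Let mX t : 0 <= t -> measurable_fun setT (X t). Proof. by case: hX => h _ _ _ _; exact: h. Qed.
Let X0 w : X 0 w = 0. Proof. by case: hX. Qed.

Let stat (t h : R) (A : set E) : 0 <= t -> 0 <= h -> measurable A ->
  P [set w | A (X (t + h) w - X t w)] = P [set w | A (X h w)].
Proof. by case: hX => _ _ _ st _ t0 h0 mA; exact: st. Qed.

Let indep (n : nat) (t : nat -> R) (h : R) (A : nat -> set E) : 0 <= t 0%N -> 0 <= h ->
  (forall i, t i.+1 = t i + h) -> (forall i, measurable (A i)) ->
  P [set w | forall i, (i < n)%N -> A i (X (t i.+1) w - X (t i) w)] =
  (\prod_(i < n) P [set w | A i (X h w)])%E.
Proof.
move=> t0 h0 th mA; case: (hX) => _ _ ind _ _.
have t0i i : 0 <= t i by elim: i => // i IH; rewrite th addr_ge0.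
rewrite ind//; last by move=> i; rewrite th lerDl.
by apply: eq_bigr => i _; rewrite th stat.
Qed.

Lemma concat_path_lt s w u : 0 <= s -> u <= s -> concat_path s w u = X u w.1.
Proof.
move=> s0 us; rewrite /concat_path (min_idPl us) max_l ?subr_le0// X0.
by rewrite addr0.
Qed.

Lemma concat_path_ge s w v : 0 <= v -> concat_path s w (s + v) = X s w.1 + X v w.2.
Proof.
move=> v0; rewrite /concat_path min_r ?lerDl// addrAC subrr add0r max_r//.
Qed.

Lemma measurable_concat_path s t : 0 <= s -> 0 <= t ->
  measurable_fun setT (fun w => concat_path s w t).
Proof.
move=> s0 t0; apply: measurable_funD_rV.
  by apply: (measurableT_comp (mX _)); [rewrite le_min t0|exact: measurable_fst].
by apply: (measurableT_comp (mX _)); [rewrite le_max lexx|exact: measurable_snd].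
Qed.

(** Since [s] is the grid point of index [N = 2 ^ m], each grid increment of the concatenated path
    is an increment of exactly one of the two copies: of the first below [N], of the second from [N]
    on. The product measure gives independence between the copies, and by stationarity every factor
    is the law of [X h]. *)
Lemma concat_path_law s (H : pathT d s -> \bar R) : 0 <= s -> measurable_fun setT H ->
  (forall f, 0 <= H f)%E ->
  (\int[P]_w H (X ^~ w) = \int[P \x P]_w H (concat_path s w))%E.
Proof.
move=> s0 mH H0.
apply: (@path_law_eq _ _ _ _ _ P (fun w t => X t w) _ _ (P \x P)%E (concat_path s)) => //.
- by move=> t t0; exact: measurable_concat_path.
- by move=> w; rewrite concat_path_lt.
move=> m n A mA; set h := s / 2 ^+ m; set N := (2 ^ m)%N.
have h0 : 0 <= h by rewrite divr_ge0// exprn_ge0.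
have tS i : dyadic s m i.+1 = dyadic s m i + h.
  by rewrite /dyadic -natr1 mulrDl mul1r.
have tN i : dyadic s m (N + i) = s + dyadic s m i.
  rewrite /dyadic natrD mulrDl; congr (_ + _).
  by rewrite natrX mulrC mulfVK// expf_neq0.
have ti0 i : 0 <= dyadic s m i by exact: dyadic_ge0.
have tle i j : (i <= j)%N -> dyadic s m i <= dyadic s m j.
  by move=> ij; rewrite ler_wpM2r// ler_nat.
have tN0 : dyadic s m N = s by rewrite -[N]addn0 tN /dyadic mul0r addr0.
rewrite (indep _ (ti0 0%N) h0 tS mA).
pose S1 := [set w | forall i, (i < minn n N)%N -> A i (X (dyadic s m i.+1) w - X (dyadic s m i) w)].
pose S2 := [set w | forall i, (i < n - N)%N ->
  A (N + i)%N (X (dyadic s m i.+1) w - X (dyadic s m i) w)].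
have mS (B : nat -> set E) k : (forall i, measurable (B i)) ->
    measurable [set w | forall i, (i < k)%N -> B i (X (dyadic s m i.+1) w - X (dyadic s m i) w)].
  move=> mB.
  rewrite (_ : mkset _ = \bigcap_(i in `I_k)
    (fun w => X (dyadic s m i.+1) w - X (dyadic s m i) w) @^-1` B i).
    apply: fin_bigcap_measurable => // i _; rewrite -[X in measurable X]setTI.
    suff : measurable_fun setT (fun w => X (dyadic s m i.+1) w - X (dyadic s m i) w) by apply.
    by apply: measurable_funD_rV; [|apply: measurable_funN_rV]; apply: mX.
  by apply/seteqP; split => w /= hw.
rewrite (_ : mkset _ = S1 `*` S2); last first.
  have c1 w i : (i < N)%N -> concat_path s w (dyadic s m i.+1) - concat_path s w (dyadic s m i) =
      X (dyadic s m i.+1) w.1 - X (dyadic s m i) w.1.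
    by move=> iN; rewrite !concat_path_lt//; rewrite -[leRHS]tN0 tle// ltnW.
  have c2 w i : concat_path s w (dyadic s m (N + i).+1) - concat_path s w (dyadic s m (N + i)) =
      X (dyadic s m i.+1) w.2 - X (dyadic s m i) w.2.
    by rewrite -addnS !tN !concat_path_ge// opprD addrACA subrr add0r.
  apply/seteqP; split => w /=.
    move=> hw; split => i /=.
      by rewrite leq_min => /andP[ni iN]; rewrite -c1//; exact: hw.
    by rewrite ltn_subRL => ni; rewrite -c2; exact: hw.
  move=> [h1 h2] i ni; have [iN|Ni] := ltnP i N.
    by rewrite c1//; apply: h1; rewrite leq_min ni.
  by rewrite -(subnKC Ni) c2; apply: h2; rewrite ltn_sub2r// (leq_ltn_trans Ni).
transitivity (P S1 * P S2)%E; last first.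
  have mS1 : measurable S1 by exact: mS.
  have mS2 : measurable S2 by exact: (mS (fun i => A (N + i)%N) (n - N)%N (fun i => mA _)).
  exact: (esym (product_measure1E P P mS1 mS2)).
rewrite (indep _ (ti0 0%N) h0 tS mA) (@indep _ _ h (fun i => A (N + i)%N) (ti0 0%N) h0 tS)//.
have [nN|Nn] := leqP n N.
  by rewrite (eqP (_ : n - N == 0)%N) ?subn_eq0// big_ord0 mule1.
pose q i := P [set w | A i (X h w)].
have -> : (\prod_(i < n) P [set w | A i (X h w)] = \prod_(i < N + (n - N)) q i)%E.
  by rewrite (subnKC (ltnW Nn)).
by rewrite big_split_ord.
Qed.

End markov_law.

(** * Evaluation of a right-continuous path at arbitrary times *)

Section right_evaluation.
Context (R : realType) (d : nat) (s : R).
Hypothesis s0 : 0 < s.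
Local Notation E := 'rV[R]_d.

(** For [u >= 0], the first grid point strictly to the right of [u]; strictness is what convergence
    along [u^'+] asks for. *)
Definition dindex (m : nat) (u : R) : nat := (Num.truncn (u / (s / 2 ^+ m))).+1.

Let h0 m : 0 < s / 2 ^+ m. Proof. by rewrite divr_gt0// exprn_gt0. Qed.

Lemma dindex_gt m u : u < dyadic s m (dindex m u).
Proof. by rewrite -ltr_pdivrMr// truncnS_gt. Qed.

Lemma dindex_le m u : 0 <= u -> dyadic s m (dindex m u) <= u + s / 2 ^+ m.
Proof.
move=> u0; rewrite /dyadic /dindex -natr1 mulrDl mul1r lerD2r -ler_pdivlMr//.
by rewrite truncn_le// divr_ge0// ltW.
Qed.

Lemma dyadic_dindex_cvg u : 0 <= u -> dyadic s m (dindex m u) @[m --> \oo] --> u^'+.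
Proof.
move=> u0 A [e /= e0 eA].
have [M _ hM] : \forall m \near \oo, s / 2 ^+ m < e.
  have : (s * (2^-1 ^+ m)) @[m --> \oo] --> s * 0.
    by apply: cvgMr; apply: cvg_expr; rewrite ger0_norm ?invr_ge0// invf_lt1// ltr1n.
  rewrite mulr0 => /cvgrPdist_lt/(_ e e0); apply: filterS => m.
  by rewrite sub0r normrN exprVn ger0_norm// ltW// h0.
exists M => // m /= Mm; apply: eA; last exact: dindex_gt.
have := dindex_le m u0; have := dindex_gt m u; have := hM _ Mm => /=.
set t := dyadic _ _ _; move=> h1 h2 h3.
rewrite /ball/= distrC ger0_norm ?subr_ge0 ?(ltW h2)//.
lra.
Qed.

(** A limit superior exists for every path and is measurable jointly in time and path; on
    right-continuous paths it is the value at [u]. This turns functionals of the process at all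
    times into measurable functions on [pathT]. *)
Definition reval (u : R) (f : pathT d s) : E :=
  \row_i fine (limn_esup (fun m => (f (dyadic s m (dindex m u)) ord0 i)%:E)).

Lemma revalE u (f : R -> E) : 0 <= u -> (f v @[v --> u^'+] --> f u) -> reval u f = f u.
Proof.
move=> u0 fu; apply/rowP => i; rewrite mxE.
have : (f (dyadic s m (dindex m u)) ord0 i)%:E @[m --> \oo] --> (f u ord0 i)%:E.
  apply: cvg_EFin; first exact: nearW.
  have c : f (dyadic s m (dindex m u)) @[m --> \oo] --> f u.
    exact: (cvg_comp _ _ (dyadic_dindex_cvg u0) fu).
  by have := @coord_continuous R 1 d ord0 i (f u); exact: (cvg_comp _ _ c).
by move=> c; rewrite is_cvg_limn_esupE; [rewrite (cvg_lim _ c)|apply: cvgP c].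
Qed.

Lemma measurable_dindex_eq m k : measurable [set u : measurableTypeR R | dindex m u = k].
Proof.
have mle j : measurable [set u : measurableTypeR R | (Num.truncn (u / (s / 2 ^+ m)) <= j)%N].
  rewrite (_ : mkset _ = `]-oo, j.+1%:R * (s / 2 ^+ m)[%classic); first exact: measurable_itv.
  by apply/seteqP; split => u /=; rewrite in_itv/= truncn_le_nat ltr_pdivrMr.
case: k => [|[|k]].
- by rewrite (_ : mkset _ = set0)//; apply/seteqP; split.
- rewrite (_ : mkset _ = [set u : measurableTypeR R | (Num.truncn (u / (s / 2 ^+ m)) <= 0)%N])//.
  apply/seteqP; split => u /=; rewrite /dindex; first by move=> [->].
  by rewrite leqn0 => /eqP ->.
- rewrite (_ : mkset _ = [set u : measurableTypeR R | (Num.truncn (u / (s / 2 ^+ m)) <= k.+1)%N] `\`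
    [set u : measurableTypeR R | (Num.truncn (u / (s / 2 ^+ m)) <= k)%N]).
    exact: measurableD.
  apply/seteqP; split => u /=; rewrite /dindex; first by move=> [->]; split => //; rewrite ltnn.
  by move=> [h /negP]; rewrite -ltnNge => h'; congr S; apply/eqP; rewrite eqn_leq h h'.
Qed.

(** At a fixed level, the evaluation takes place at grid point [k] on the set where the index equals
    [k]. A countable union over [k] gives measurability, which the limit superior keeps. *)
Lemma measurable_fun_reval dZ (Z : measurableType dZ) (tau : Z -> measurableTypeR R)
    (pi : Z -> pathT d s) : measurable_fun setT tau -> measurable_fun setT pi ->
  measurable_fun setT (fun z => reval (tau z) (pi z)).
Proof.
move=> mt mp; apply: measurable_fun_rV => i; under eq_fun do rewrite mxE.
apply: measurableT_comp => //; apply: measurable_fun_limn_esup => m.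
apply/measurable_EFinP; apply: (measurableT_comp (measurable_coord i)).
move=> _ B mB; rewrite setTI.
rewrite (_ : _ @^-1` _ = \bigcup_k (tau @^-1` [set u : measurableTypeR R | dindex m u = k] `&`
    (pi @^-1` ((fun f : pathT d s => f (dyadic s m k)) @^-1` B)))).
  apply: bigcupT_measurable => k; apply: measurableI.
    by rewrite -[X in measurable X]setTI; apply: mt => //; exact: measurable_dindex_eq.
  rewrite -[X in measurable X]setTI; apply: mp => //.
  by rewrite -[X in measurable X]setTI; apply: measurable_pathT_eval.
apply/seteqP; split => z /=.
  by move=> Bf; exists (dindex m (tau z)).
by move=> [k _ [/= -> ]].
Qed.

Lemma measurable_path_integral dZ (Z : measurableType dZ) (tau1 tau2 : Z -> measurableTypeR R)
    (xi : Z -> E) (pi : Z -> pathT d s) (F : E -> \bar R) :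
  measurable_fun setT tau1 -> measurable_fun setT tau2 ->
  measurable_fun setT xi -> measurable_fun setT pi ->
  measurable_fun setT F -> (forall x, 0 <= F x)%E ->
  measurable_fun setT (fun z => \int[@lebesgue_measure R]_(u in `[tau1 z, tau2 z])
    F (xi z + reval u (pi z))%R)%E.
Proof.
move=> mt1 mt2 mxi mpi mF F0.
pose G (zu : Z * measurableTypeR R) : \bar R :=
  if (tau1 zu.1 <= zu.2) && (zu.2 <= tau2 zu.1)
  then F (xi zu.1 + reval zu.2 (pi zu.1)) else 0%E.
have mG : measurable_fun setT G.
  apply: measurable_fun_ifT.
  - apply: measurable_and.
      by apply: measurable_fun_ler => //; exact: (measurableT_comp mt1 measurable_fst).
    by apply: measurable_fun_ler => //; exact: (measurableT_comp mt2 measurable_fst).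
  - apply: (measurableT_comp mF); apply: measurable_funD_rV.
      exact: (measurableT_comp mxi measurable_fst).
    by apply: measurable_fun_reval => //; exact: (measurableT_comp mpi measurable_fst).
  - exact: measurable_cst.
have G0 z : (0 <= G z)%E by rewrite /G; case: ifP.
have := @measurable_fun_fubini_tonelli_F _ _ _ _ _ (@lebesgue_measure R) G mG G0.
apply: eq_measurable_fun => z _; rewrite /fubini_F [RHS]integral_mkcond.
apply: eq_integral => u _; rewrite patchE /G /=.
have -> : (u \in `[tau1 z, tau2 z]%classic) = (tau1 z <= u <= tau2 z) by rewrite mem_setE in_itv.
by [].
Qed.

End right_evaluation.

Section levy_measurability.
Context (R : realType) (d : nat) (disp : measure_display)
  (Omega : measurableType disp) (P : probability Omega R)
  (X : R -> Omega -> 'rV[R]_d).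
Hypothesis hX : levy_process P X.
Local Notation E := 'rV[R]_d.
Local Notation leb := (@lebesgue_measure R).

Let mX t : 0 <= t -> measurable_fun setT (X t). Proof. by case: hX => h _ _ _ _; exact: h. Qed.

Let rX w t : 0 <= t -> X v w @[v --> t^'+] --> X t w.
Proof. by case: hX => _ _ _ _ /(_ w)[h _]; exact: h. Qed.

Let mpath s : 0 <= s -> measurable_fun setT (fun w => (X ^~ w) : pathT d s).
Proof. by move=> s0; apply: measurable_to_pathT => m k; apply: mX; exact: dyadic_ge0. Qed.

Let revalX s w u : 0 < s -> 0 <= u -> reval u ((X ^~ w) : pathT d s) = X u w.
Proof. by move=> s0 u0; apply: revalE => //; exact: rX. Qed.

Lemma measurable_levy_at dZ (Z : measurableType dZ) (tau : Z -> measurableTypeR R)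
    (om : Z -> Omega) : measurable_fun setT tau -> measurable_fun setT om ->
  (forall z, 0 <= tau z) -> measurable_fun setT (fun z => X (tau z) (om z)).
Proof.
move=> mt mo t0.
have : measurable_fun setT (fun z => reval (tau z) ((X ^~ (om z)) : pathT d 1)).
  by apply: measurable_fun_reval => //; exact: (measurableT_comp (mpath ler01) mo).
by apply: eq_measurable_fun => z _; rewrite revalX.
Qed.

Lemma measurable_levy_integral dZ (Z : measurableType dZ) (tau1 tau2 : Z -> measurableTypeR R)
    (xi : Z -> E) (om : Z -> Omega) (F : E -> \bar R) :
  measurable_fun setT tau1 -> measurable_fun setT tau2 ->
  measurable_fun setT xi -> measurable_fun setT om ->
  measurable_fun setT F -> (forall x, 0 <= F x)%E -> (forall z, 0 <= tau1 z) ->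
  measurable_fun setT (fun z => \int[leb]_(u in `[tau1 z, tau2 z])
    F (xi z + X u (om z))%R)%E.
Proof.
move=> mt1 mt2 mxi mo mF F0 t0.
have := @measurable_path_integral R d 1 ltr01 _ _ _ _ _ (fun z => X ^~ (om z)) _
  mt1 mt2 mxi (measurableT_comp (mpath ler01) mo) mF F0.
apply: eq_measurable_fun => z _; apply: eq_integral => u; rewrite inE/= in_itv/= => /andP[tu _].
by rewrite revalX// (le_trans _ tu).
Qed.

(* [a] and [b] are the parts of a potential [a - b] that need not be integrable
   along the path: the product is 0 if both integrals are infinite. *)
Definition fkw (a b : E -> R) (x : E) (t1 t2 : R) (f : R -> E) : \bar R :=
  (expeR (- \int[leb]_(u in `[t1, t2]) (a (x + f u)%R)%:E) *
   expeR (\int[leb]_(u in `[t1, t2]) (b (x + f u)%R)%:E))%E.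

Lemma fkw_ge0 a b x t1 t2 f : (0 <= fkw a b x t1 t2 f)%E.
Proof. by rewrite mule_ge0// expeR_ge0. Qed.

Lemma eq_fkw a b x t1 t2 f g : (forall u, t1 <= u -> u <= t2 -> f u = g u) ->
  fkw a b x t1 t2 f = fkw a b x t1 t2 g.
Proof.
move=> fg; rewrite /fkw; congr (expeR (- _) * expeR _)%E;
by apply: eq_integral => u; rewrite inE/= in_itv/= => /andP[? ?]; rewrite fg.
Qed.

Lemma measurable_fkw_path s dZ (Z : measurableType dZ) (xi : Z -> E) (pi : Z -> pathT d s)
    (a b : E -> R) t1 t2 : 0 < s ->
  measurable_fun setT a -> measurable_fun setT b -> (forall x, 0 <= a x) -> (forall x, 0 <= b x) ->
  measurable_fun setT xi -> measurable_fun setT pi ->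
  measurable_fun setT (fun z => fkw a b (xi z) t1 t2 (fun u => reval u (pi z))).
Proof.
move=> s0 ma mb a0 b0 mxi mpi; apply: emeasurable_funM.
  apply: measurable_fun_expeRN.
  apply: (@measurable_path_integral _ _ _ _ _ _ _ _ _ _ (fun x => (a x)%:E)) => //.
  exact/measurable_EFinP.
apply: measurable_fun_expeR.
apply: (@measurable_path_integral _ _ _ _ _ _ _ _ _ _ (fun x => (b x)%:E)) => //.
exact/measurable_EFinP.
Qed.

Lemma measurable_fkw dZ (Z : measurableType dZ) (tau1 tau2 : Z -> measurableTypeR R)
    (xi : Z -> E) (om : Z -> Omega) (a b : E -> R) :
  measurable_fun setT a -> measurable_fun setT b -> (forall x, 0 <= a x) -> (forall x, 0 <= b x) ->
  measurable_fun setT tau1 -> measurable_fun setT tau2 ->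
  measurable_fun setT xi -> measurable_fun setT om -> (forall z, 0 <= tau1 z) ->
  measurable_fun setT (fun z => fkw a b (xi z) (tau1 z) (tau2 z) (X ^~ (om z))).
Proof.
move=> ma mb a0 b0 mt1 mt2 mxi mo t0; apply: emeasurable_funM.
  apply: measurable_fun_expeRN.
  apply: (@measurable_levy_integral _ _ _ _ _ _ (fun x => (a x)%:E)) => //.
  exact/measurable_EFinP.
apply: measurable_fun_expeR.
apply: (@measurable_levy_integral _ _ _ _ _ _ (fun x => (b x)%:E)) => //.
exact/measurable_EFinP.
Qed.

End levy_measurability.

Section markov.
Context (R : realType) (d : nat) (disp : measure_display)
  (Omega : measurableType disp) (P : probability Omega R)
  (X : R -> Omega -> 'rV[R]_d).
Hypothesis hX : levy_process P X.
Local Notation E := 'rV[R]_d.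
Local Notation leb := (@lebesgue_measure R).

Let mX t : 0 <= t -> measurable_fun setT (X t). Proof. by case: hX => h _ _ _ _; exact: h. Qed.

Let rX w t : 0 <= t -> X v w @[v --> t^'+] --> X t w.
Proof. by case: hX => _ _ _ _ /(_ w)[h _]; exact: h. Qed.

Let X0 w : X 0 w = 0. Proof. by case: hX. Qed.

Lemma concat_path_right_cvg s w u : 0 <= s -> 0 <= u ->
  concat_path X s w v @[v --> u^'+] --> concat_path X s w u.
Proof.
move=> s0 u0; have [us|su] := ltP u s.
  rewrite (concat_path_lt hX w s0 (ltW us)) => A hA.
  have [e /= e0 he] := @rX w.1 u u0 A hA.
  exists (Num.min e (s - u)) => /=; first by rewrite lt_min e0 subr_gt0.
  move=> v; rewrite /ball/= lt_min => /andP[uve uvs] uv.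
  rewrite /= (concat_path_lt hX w s0); first exact: he.
  by move: uvs; rewrite distrC gtr0_norm ?subr_gt0// ltrD2r => /ltW.
have -> : u = s + (u - s) by rewrite addrC subrK.
have us0 : 0 <= u - s by rewrite subr_ge0.
rewrite (concat_path_ge X s w us0); move: (u - s) us0 => t t0 A hA.
have [] := nbhs_ballP (X s w.1 + X t w.2) A => /(_ hA)[r /= r0 hr] _.
have hB : nbhs (X t w.2) (ball (X t w.2) r) by exact: nbhsx_ballx.
have [e /= e0 he] := @rX w.2 t t0 _ hB.
exists e => //= v; rewrite /ball/= => tv stv.
have vs : v = s + (v - s) by rewrite addrC subrK.
have tvs : t < v - s by rewrite ltrBrDl.
rewrite /= vs concat_path_ge; last by rewrite ltW// (le_lt_trans t0).
apply: hr; have := he (v - s); rewrite /ball/=.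
have -> : t - (v - s) = s + t - v by rewrite opprB addrCA addrA.
move=> /(_ tv tvs) [_ h]; split=> // i j.
by have := h i j; rewrite /ball/= !mxE opprD addrACA subrr add0r.
Qed.

Let rX_reval s w u : 0 < s -> 0 <= u -> reval u ((X ^~ w) : pathT d s) = X u w.
Proof. by move=> s0 u0; apply: revalE => //; exact: rX. Qed.

Let concat_reval s w u : 0 < s -> 0 <= u ->
  reval u ((concat_path X s w) : pathT d s) = concat_path X s w u.
Proof. by move=> s0 u0; apply: revalE => //; apply: concat_path_right_cvg => //; exact: ltW. Qed.

Lemma integral_concat_path s w t x (F : E -> \bar R) : 0 < s -> 0 <= t ->
  measurable_fun setT F -> (forall y, 0 <= F y)%E ->
  (\int[leb]_(u in `[s, (s + t)%R]) F (x + concat_path X s w u)%R =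
   \int[leb]_(u in `[0%R, t]) F (x + X s w.1 + X u w.2)%R)%E.
Proof.
move=> s0 t0 mF F0.
transitivity (\int[leb]_(u in `[s, (s + t)%R])
    F (x + reval u (concat_path X s w : pathT d s))%R)%E.
  apply: eq_integral => u; rewrite inE/= in_itv/= => /andP[su _].
  by rewrite concat_reval// (le_trans _ su)// ltW.
rewrite (ge0_integral_itv_addl s t (F := fun u => F (x + reval u (concat_path X s w : pathT d s))))//.
  apply: eq_integral => u; rewrite inE/= in_itv/= => /andP[u0 _].
  by rewrite concat_reval ?concat_path_ge ?addrA// addr_ge0// ltW.
apply: (measurableT_comp mF); apply: measurable_funD_rV => //.
by apply: measurable_fun_reval => //; exact: measurable_cst.
Qed.

Lemma fkw_concat_lt a b x s w : 0 <= s ->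
  fkw a b x 0 s (concat_path X s w) = fkw a b x 0 s (X ^~ w.1).
Proof. by move=> s0; apply: eq_fkw => u _ us; rewrite (concat_path_lt hX). Qed.

Lemma fkw_concat_ge (a b : E -> R) x s t w : 0 < s -> 0 <= t ->
  measurable_fun setT a -> measurable_fun setT b -> (forall y, 0 <= a y) -> (forall y, 0 <= b y) ->
  fkw a b x s (s + t) (concat_path X s w) = fkw a b (x + X s w.1) 0 t (X ^~ w.2).
Proof.
move=> s0 t0 ma mb a0 b0; rewrite /fkw.
rewrite (@integral_concat_path s w t x (fun y => (a y)%:E))//; last exact/measurable_EFinP.
rewrite (@integral_concat_path s w t x (fun y => (b y)%:E))//; exact/measurable_EFinP.
Qed.

Variables (a1 b1 a b : E -> R).
Hypotheses (ma1 : measurable_fun setT a1) (mb1 : measurable_fun setT b1)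
  (ma : measurable_fun setT a) (mb : measurable_fun setT b).
Hypotheses (a10 : forall y, 0 <= a1 y) (b10 : forall y, 0 <= b1 y)
  (a0 : forall y, 0 <= a y) (b0 : forall y, 0 <= b y).

(** The Feynman-Kac operator of the potential [c - e] on nonnegative functions. Values in [[0, +oo]]
    allow its use before any integrability is known. *)
Definition fk (c e : E -> R) (t : R) (g : E -> \bar R) (y : E) : \bar R :=
  (\int[P]_w (fkw c e y 0 t (X ^~ w) * g (y + X t w)%R))%E.

Lemma measurable_fk t g : 0 <= t -> measurable_fun setT g -> (forall y, 0 <= g y)%E ->
  measurable_fun setT (fk a b t g).
Proof.
move=> t0 mg g0.
pose G (z : E * Omega) : \bar R := (fkw a b z.1 0 t (X ^~ z.2) * g (z.1 + X t z.2)%R)%E.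
have mG : measurable_fun setT G.
  apply: emeasurable_funM.
    exact: (@measurable_fkw _ _ _ _ _ _ hX _ _ (fun=> 0) (fun=> t) _ _ a b ma mb a0 b0).
  apply: (measurableT_comp mg); apply: measurable_funD_rV => //.
  exact: (measurableT_comp (mX t0) measurable_snd).
have G0 z : (0 <= G z)%E by rewrite mule_ge0// fkw_ge0.
exact: (@measurable_fun_fubini_tonelli_F _ _ _ _ _ P G mG G0).
Qed.

Lemma fk_ge0 t g y : (forall y, 0 <= g y)%E -> (0 <= fk a b t g y)%E.
Proof. by move=> g0; apply: integral_ge0 => w _; rewrite mule_ge0// fkw_ge0. Qed.

(** Both sides become functionals of the path through [reval]; the law of the concatenated path
    splits them over two independent copies, and Tonelli integrates the second copy first. The
    potentials before and after time [s] are allowed to differ because Duhamel's formula kills at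
    rate [q] before [s] and weighs by [a - b] after it. *)
Lemma markov_fkw s t x (U g : E -> \bar R) : 0 < s -> 0 <= t ->
  measurable_fun setT U -> measurable_fun setT g ->
  (forall y, 0 <= U y)%E -> (forall y, 0 <= g y)%E ->
  (\int[P]_w (fkw a1 b1 x 0 s (X ^~ w) * U (x + X s w)%R *
     (fkw a b x s (s + t) (X ^~ w) * g (x + X (s + t) w)%R)) =
   \int[P]_w (fkw a1 b1 x 0 s (X ^~ w) * U (x + X s w)%R * fk a b t g (x + X s w)%R))%E.
Proof.
move=> s0 t0 mU mg U0 g0; have s0' := ltW s0.
have st0 : 0 <= s + t by rewrite addr_ge0.
pose ev (f : pathT d s) u := reval u f.
pose H (f : pathT d s) : \bar R := (fkw a1 b1 x 0 s (ev f) * U (x + ev f s)%R *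
     (fkw a b x s (s + t)%R (ev f) * g (x + ev f (s + t))%R))%E.
have mH : measurable_fun setT H.
  have mev u : measurable_fun setT (fun f : pathT d s => x + ev f u).
    apply: measurable_funD_rV => //.
    by apply: measurable_fun_reval => //; exact: measurable_cst.
  apply: emeasurable_funM; apply: emeasurable_funM.
  - exact: (@measurable_fkw_path _ _ s _ _ (fun=> x) id).
  - exact: (measurableT_comp mU (mev s)).
  - exact: (@measurable_fkw_path _ _ s _ _ (fun=> x) id).
  - exact: (measurableT_comp mg (mev (s + t))).
have H0 f : (0 <= H f)%E by rewrite !mule_ge0 ?expeR_ge0.
transitivity (\int[P]_w H (X ^~ w))%E.
  apply: eq_integral => w _; rewrite /H.
  have e1 : fkw a1 b1 x 0 s (ev (X ^~ w)) = fkw a1 b1 x 0 s (X ^~ w).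
    by apply: eq_fkw => u u0 _; rewrite /ev rX_reval.
  have e2 : fkw a b x s (s + t) (ev (X ^~ w)) = fkw a b x s (s + t) (X ^~ w).
    by apply: eq_fkw => u u0 _; rewrite /ev rX_reval// (le_trans s0').
  by rewrite e1 e2 /ev (rX_reval w s0 s0') (rX_reval w s0 st0).
rewrite (concat_path_law hX s0' mH H0).
pose K (w : Omega * Omega) : \bar R := (fkw a1 b1 x 0 s (X ^~ w.1) * U (x + X s w.1)%R *
  (fkw a b (x + X s w.1) 0 t (X ^~ w.2) * g (x + X s w.1 + X t w.2)%R))%E.
transitivity (\int[P \x P]_w K w)%E.
  apply: eq_integral => w _; rewrite /H /K.
  have e1 : fkw a1 b1 x 0 s (ev (concat_path X s w)) = fkw a1 b1 x 0 s (X ^~ w.1).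
    rewrite -(fkw_concat_lt a1 b1 x w s0'); apply: eq_fkw => u u0 _.
    by rewrite /ev concat_reval.
  have e2 : fkw a b x s (s + t) (ev (concat_path X s w)) =
      fkw a b (x + X s w.1) 0 t (X ^~ w.2).
    rewrite -(fkw_concat_ge x w s0 t0 ma mb a0 b0); apply: eq_fkw => u u0 _.
    by rewrite /ev concat_reval// (le_trans s0').
  have e3 : ev (concat_path X s w) s = X s w.1.
    by rewrite /ev concat_reval// (concat_path_lt hX).
  have e4 : x + ev (concat_path X s w) (s + t) = x + X s w.1 + X t w.2.
    by rewrite /ev concat_reval// concat_path_ge// addrA.
  by rewrite e1 e2 e3 e4.
have mXs1 : measurable_fun setT (fun w : Omega * Omega => x + X s w.1).
  apply: measurable_funD_rV => //; exact: (measurableT_comp (mX s0') measurable_fst).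
have mK : measurable_fun setT K.
  apply: emeasurable_funM; apply: emeasurable_funM.
  - exact: (@measurable_fkw _ _ _ _ _ _ hX _ _ (fun=> 0) (fun=> s) (fun=> x)).
  - exact: (measurableT_comp mU mXs1).
  - exact: (@measurable_fkw _ _ _ _ _ _ hX _ _ (fun=> 0) (fun=> t)).
  - apply: (measurableT_comp mg); apply: measurable_funD_rV => //.
    exact: (measurableT_comp (mX t0) measurable_snd).
have K0 w : (0 <= K w)%E by rewrite !mule_ge0 ?expeR_ge0.
rewrite (@fubini_tonelli1 _ _ _ _ _ _ _ K)//; apply: eq_integral => w _.
rewrite /fubini_F /K /= ge0_integralZl//.
- apply: emeasurable_funM.
    exact: (@measurable_fkw _ _ _ _ _ _ hX _ _ (fun=> 0) (fun=> t)).
  by apply: (measurableT_comp mg); apply: measurable_funD_rV => //; exact: mX.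
- by move=> w' _; rewrite mule_ge0// fkw_ge0.
- by rewrite mule_ge0// fkw_ge0.
Qed.

End markov.

(** * Feynman-Kac weights *)

Lemma integral_cst_itv (R : realType) (N r : R) : 0 <= r ->
  (\int[@lebesgue_measure R]_(u in `[0%R, r]) N%:E = (N * r)%:E)%E.
Proof.
move=> r0; rewrite -[LHS]/(\int[@lebesgue_measure R]_(u in `[0%R, r]) (cst N%:E) u)%E.
have e : @lebesgue_measure R `[0, r] = r%:E; last by rewrite integral_cst// EFinM -e.
rewrite lebesgue_measure_itv/= lte_fin; case: ltP => h; first by rewrite oppr0 adde0.
by congr EFin; apply/eqP; rewrite eq_le r0.
Qed.

Lemma integral_cst_prob (R : realType) dT (T : measurableType dT) (P : probability T R)
  (c : \bar R) : (\int[P]_w c = c)%E.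
Proof.
rewrite -[LHS]/(\int[P]_(w in setT) (cst c) w)%E integral_cst//.
transitivity (c * 1)%E; last by rewrite mule1.
by congr (_ * _)%E; exact: probability_setT.
Qed.

Lemma tonelli_set (R : realType) d1 d2 (T1 : measurableType d1) (T2 : measurableType d2)
    (m1 : {sigma_finite_measure set T1 -> \bar R}) (m2 : {sigma_finite_measure set T2 -> \bar R})
    (D : set T2) (F : T1 * T2 -> \bar R) : measurable D ->
  measurable_fun setT F -> (forall z, 0 <= F z)%E ->
  (\int[m1]_x \int[m2]_(y in D) F (x, y) = \int[m2]_(y in D) \int[m1]_x F (x, y))%E.
Proof.
move=> mD mF F0; pose G (z : T1 * T2) := if z.2 \in D then F z else 0%E.
have mG : measurable_fun setT G.
  apply: measurable_fun_ifT => //.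
  apply: (measurable_fun_bool true); rewrite setTI.
  rewrite (_ : _ @^-1` _ = setT `*` D); first exact: measurableX.
  apply/seteqP; split => z /=; first by move/set_mem.
  by move=> [_ ?]; rewrite mem_set.
have G0 z : (0 <= G z)%E by rewrite /G; case: ifP.
have e := @fubini_tonelli _ _ _ _ _ m1 m2 G mG G0.
transitivity (\int[m1]_x \int[m2]_y G (x, y))%E.
  by apply: eq_integral => x _; rewrite integral_mkcond.
rewrite e [RHS]integral_mkcond; apply: eq_integral => y _; rewrite patchE /G /=.
by case: ifP => // _; rewrite integral0.
Qed.

Lemma cvg_expeR (R : realType) (u : (\bar R)^nat) (l : \bar R) : l != -oo%E ->
  u @ \oo --> l -> (fun n => expeR (u n)) @ \oo --> expeR l.
Proof.
case: l => [r| |]// _ ul.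
  have /fine_cvgP[ufin uf] := ul.
  apply: (@cvg_trans _ ((expR (fine (u n)))%:E @[n --> \oo])).
    apply: near_eq_cvg; apply: filterS ufin => n un.
    by rewrite -[u n in RHS](fineK un).
  apply: cvg_EFin; first exact: nearW.
  by apply: (@continuous_cvg _ _ _ _ _ _ expR) => //; exact: continuous_expR.
apply/cvgeyPge => A.
have /cvgeyPge/(_ A) := ul; apply: filterS => n un.
apply: le_trans un _; apply: le_trans (expeR_ge1Dx _).
by rewrite leeDr.
Qed.

Section path_duhamel.
Context (R : realType).
Local Notation mu := (@lebesgue_measure R).

Lemma ge0_integrableE (t : R) (a : R -> R) : (forall u, 0 <= a u) ->
  mu.-integrable `[0, t] (EFin \o a) -> forall s s', 0 <= s -> s' <= t ->
  (\int[mu]_(u in `[s, s']) (a u)%:E)%E = (\int[mu]_(u in `[s, s']) a u)%:E.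
Proof.
move=> a0 ia s s' s0 st; rewrite fineK//; apply: integrable_fin_num => //.
by apply: integrableS ia => //; apply: subset_itv; rewrite bnd_simp.
Qed.

Lemma Rintegral_itv_split (t : R) (a : R -> R) :
  mu.-integrable `[0, t] (EFin \o a) -> forall s, 0 <= s -> s <= t ->
  \int[mu]_(u in `[s, t]) a u = \int[mu]_(u in `[0, t]) a u - \int[mu]_(u in `[0, s]) a u.
Proof.
move=> ia s s0 st; rewrite Rintegral_itvB ?bnd_simp// Rintegral_itv_obnd_cbnd//.
by apply: integrableS ia => //; apply: subset_itvr; rewrite bnd_simp.
Qed.

(** Since [q = a + U - b], the product of the two weights inside the integral is the full weight
    [exp (int (b - a))] times [exp (- int_0^s U)]. What remains is the integral of
    [U exp (- int U)], known from [Rintegral_expN_primitive]. *)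
Lemma path_duhamel (t : R) (a b U q : R -> R) : 0 <= t ->
  (forall u, 0 <= a u) -> (forall u, 0 <= b u) -> (forall u, 0 <= U u) -> (forall u, 0 <= q u) ->
  (forall u, q u + b u = a u + U u) ->
  mu.-integrable `[0, t] (EFin \o a) -> mu.-integrable `[0, t] (EFin \o b) ->
  mu.-integrable `[0, t] (EFin \o U) ->
  (expeR (- \int[mu]_(u in `[0%R, t]) (a u)%:E) * expeR (\int[mu]_(u in `[0%R, t]) (b u)%:E) =
   expeR (- \int[mu]_(u in `[0%R, t]) (q u)%:E) +
   \int[mu]_(s in `[0%R, t]) (expeR (- \int[mu]_(u in `[0%R, s]) (q u)%:E) * (U s)%:E *
      (expeR (- \int[mu]_(u in `[s, t]) (a u)%:E) * expeR (\int[mu]_(u in `[s, t]) (b u)%:E))))%E.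
Proof.
move=> t0 a0 b0 U0 q0 qbaU ia ib iU.
have mI : measurable (`[0, t]%classic : set (measurableTypeR R)) by exact: measurable_itv.
have iq : mu.-integrable `[0, t] (EFin \o q).
  have i1 := integrableB mI (integrableD mI ia iU) ib.
  apply: eq_integrable i1 => // u _ /=.
  by rewrite -!EFinD -qbaU addrK.
pose I (f : R -> R) s := \int[mu]_(u in `[0, s]) f u.
have sub s : s <= t -> `[0%R, s]%classic `<=` (`[0%R, t]%classic : set R).
  by move=> st; apply: subset_itvl; rewrite bnd_simp.
have Iq s : 0 <= s -> s <= t -> I q s = I a s + I U s - I b s.
  move=> s0 st; have iS f : mu.-integrable `[0, t] (EFin \o f) -> mu.-integrable `[0, s] (EFin \o f).
    by move=> h; apply: integrableS h => //; exact: sub.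
  have mIs : measurable (`[0, s]%classic : set (measurableTypeR R)) by exact: measurable_itv.
  apply/eqP; rewrite eq_sym subr_eq; apply/eqP.
  rewrite /I -(RintegralD mIs (iS _ ia) (iS _ iU)) -(RintegralD mIs (iS _ iq) (iS _ ib)).
  by apply: eq_Rintegral => u _.
rewrite !(@ge0_integrableE t)//= -/(I a t) -/(I b t) -/(I q t).
rewrite -EFinM -expRD.
transitivity ((expR (- I q t))%:E +
    \int[mu]_(s in `[0%R, t]) (expR (I b t - I a t) * (U s * expR (- I U s)))%:E)%E; last first.
  congr (_ + _)%E; apply: eq_integral => s; rewrite inE/= in_itv/= => /andP[s0 st].
  rewrite !(@ge0_integrableE t)//= -/(I q s) -!EFinM; congr EFin.
  rewrite (Rintegral_itv_split ia)// (Rintegral_itv_split ib)// -/(I a t) -/(I a s) -/(I b t) -/(I b s).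
  rewrite -mulrA mulrCA -!expRD mulrCA -expRD; congr (_ * expR _).
  by rewrite Iq//; move: (I a s) (I b s) (I U s) (I a t) (I b t) => x1 x2 x3 x4 x5; ring.
have iUe : mu.-integrable `[0, t] (EFin \o (fun s => U s * expR (- I U s))).
  have mA : measurable_fun `[0, t] (I U).
    apply: subspace_continuous_measurable_fun => //.
    exact: parameterized_integral_continuous.
  have mU := measurable_int _ iU.
  apply: le_integrable (iU) => //.
    apply/measurable_EFinP; apply: measurable_funM.
      exact/measurable_EFinP.
    by apply: measurableT_comp => //; apply: measurableT_comp.
  move=> u _ /=; rewrite lee_fin normrM ler_piMr//.
  by rewrite ger0_norm ?expR_ge0// -[leRHS]expR0 ler_expR oppr_le0 Rintegral_ge0.
under eq_integral do rewrite EFinM.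
rewrite (integralZl mI iUe).
have e := Rintegral_expN_primitive t0 U0 iU.
rewrite -[X in (_ * X)%E](fineK (integrable_fin_num mI iUe)) [fine _]e.
rewrite -/(I U t) -EFinM -EFinD; congr EFin.
rewrite (Iq t t0 (lexx _)); move: (I a t) (I U t) (I b t) => x y z.
have -> : - (x + y - z) = (z - x) - y by ring.
by rewrite (addrC (- x)) (expRD (z - x)); ring.
Qed.

End path_duhamel.

(** * Exponential moments: Khasminskii's lemma *)

Section khasminskii.
Context (R : realType) (d : nat) (disp : measure_display)
  (Omega : measurableType disp) (P : probability Omega R)
  (X : R -> Omega -> 'rV[R]_d).
Hypothesis hX : levy_process P X.
Local Notation E := 'rV[R]_d.
Local Notation leb := (@lebesgue_measure R).

Let mX t : 0 <= t -> measurable_fun setT (X t). Proof. by case: hX => h _ _ _ _; exact: h. Qed.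

(* [u |-> x + X u w] is only measurable on nonnegative times *)
Lemma measurable_path (x : E) w (t : R) (a : E -> R) : measurable_fun setT a ->
  measurable_fun `[0, t] (fun u : R => a (x + X u w)).
Proof.
move=> ma.
have : measurable_fun setT (fun u : measurableTypeR R => a (x + X (Num.max 0 u) w)).
  apply: (measurableT_comp ma); apply: measurable_funD_rV => //.
  apply: (measurable_levy_at hX) => //; last by move=> u; rewrite le_max lexx.
  exact: measurable_maxr.
move=> /(measurable_funTS (D := `[0, t])); apply: eq_measurable_fun => u.
by rewrite inE/= in_itv/= => /andP[u0 _]; rewrite (max_idPr u0).
Qed.

Lemma fkw0l (b : E -> R) x t1 t2 f : fkw (fun=> 0) b x t1 t2 f =
  expeR (\int[leb]_(u in `[t1, t2]) (b (x + f u)%R)%:E)%E.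
Proof. by rewrite /fkw integral0 oppe0 expeR0 mul1e. Qed.

(** The case [q = a = 0], [U = b = B] of [path_duhamel]. *)
Lemma expeR_path_identity (x : E) w (t : R) (B : E -> R) : 0 <= t -> measurable_fun setT B ->
  (forall y, 0 <= B y) -> (\int[leb]_(u in `[0%R, t]) (B (x + X u w)%R)%:E < +oo)%E ->
  (fkw (fun=> 0%R) B x 0%R t (X ^~ w) = 1 + \int[leb]_(s in `[0%R, t])
    ((B (x + X s w)%R)%:E * fkw (fun=> 0%R) B x s t (X ^~ w)))%E.
Proof.
move=> t0 mB B0 fin.
have iB : leb.-integrable `[0, t] (EFin \o (fun u => B (x + X u w))).
  apply/integrableP; split; first by apply/measurable_EFinP; exact: measurable_path.
  by under eq_integral do rewrite /= ger0_norm//.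
have i0 : leb.-integrable `[0, t] (EFin \o (fun=> 0 : R)) by exact: integrable0.
have := path_duhamel t0 (fun=> lexx 0) (fun u => B0 (x + X u w)) (fun u => B0 (x + X u w))
  (fun=> lexx 0) (fun=> erefl) i0 iB iB.
rewrite -/(fkw (fun=> 0) B x 0 t (X ^~ w)) => ->.
rewrite integral0 oppe0 expeR0; congr (_ + _)%E; apply: eq_integral => s _.
by rewrite integral0 oppe0 expeR0 mul1e.
Qed.

(** Taking expectations in [expeR_path_identity] and applying the Markov property at time [s], the
    supremum [S] of the exponential moments satisfies [S <= 1 + S / 2]. The bound [N] on [B] makes
    [S] finite, so that this can be solved to [S <= 2]. *)
Lemma khasminskii_bounded (B : E -> R) (N t : R) : 0 < t -> measurable_fun setT B ->
  (forall y, 0 <= B y) -> (forall y, B y <= N) ->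
  (forall x, \int[P]_w \int[leb]_(u in `[0%R, t]) (B (x + X u w)%R)%:E <= (2^-1)%:E)%E ->
  forall x, (fk P X (fun=> 0%R) B t (cst 1%E) x <= 2%:E)%E.
Proof.
move=> t0 mB B0 BN hB.
pose g r x := fk P X (fun=> 0) B r (cst 1%E) x.
have N0 : 0 <= N by apply: le_trans (B0 0) (BN 0).
have fin r x w : 0 <= r -> (\int[leb]_(u in `[0%R, r]) (B (x + X u w)%R)%:E <= (N * r)%:E)%E.
  move=> r0; apply: (@le_trans _ _ (\int[leb]_(u in `[0%R, r]) (cst N%:E) u)%E).
    apply: ge0_le_integral => //.
    - by move=> u _; rewrite lee_fin.
    - by apply/measurable_EFinP; exact: measurable_path.
    - by move=> u _; rewrite lee_fin.
  by rewrite integral_cst_itv.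
have gle r x : 0 <= r -> r <= t -> (g r x <= (expR (N * t))%:E)%E.
  move=> r0 rt; apply: (@le_trans _ _ (\int[P]_w (cst (expR (N * t))%:E) w)%E).
    apply: ge0_le_integral => //.
    - by move=> w _; rewrite mule_ge0// ?fkw_ge0.
    - apply: emeasurable_funM => //.
      exact: (@measurable_fkw _ _ _ _ _ _ hX _ _ (fun=> 0) (fun=> r) (fun=> x) id).
    - move=> w _; rewrite mule1 fkw0l -[X in (_ <= X)%E]/(expeR (N * t)%:E) lee_expeR.
      by apply: le_trans (fin _ _ _ r0) _; rewrite lee_fin ler_wpM2l.
  by rewrite integral_cst_prob.
(* The supremum runs over all durations up to [t] too, since the Markov property at [s] leaves the
   duration [r - s]. *)
pose S := ereal_sup [set g z.1 z.2 | z in [set z : R * E | 0 <= z.1 <= t]].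
have gS r x : 0 <= r -> r <= t -> (g r x <= S)%E.
  by move=> r0 rt; apply: ereal_sup_ubound; exists (r, x) => //=; rewrite r0 rt.
have S0 : (0 <= S)%E by apply: le_trans (gS 0 0 (lexx _) (ltW t0)); exact: fk_ge0.
have Sfin : S \is a fin_num.
  rewrite ge0_fin_numE//; apply: (@le_lt_trans _ _ (expR (N * t))%:E); last exact: ltry.
  by apply: ge_ereal_sup => _ [[r x] /= /andP[r0 rt] <-]; exact: gle.
suff : (S <= 1 + S * (2^-1)%:E)%E.
  move=> h x; apply: le_trans (gS t x (ltW t0) (lexx _)) _.
  move: h S0; rewrite -(fineK Sfin) -EFinM -EFinD !lee_fin; lra.
apply: ge_ereal_sup => _ [[r x] /= /andP[r0 rt] <-].
pose F (z : Omega * measurableTypeR R) : \bar R :=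
  ((B (x + X (Num.max 0 z.2) z.1)%R)%:E *
   fkw (fun=> 0%R) B x (Num.max 0%R z.2) r (X ^~ z.1))%E.
have mmax : measurable_fun setT (fun z : Omega * measurableTypeR R => Num.max 0 z.2 : measurableTypeR R).
  exact: measurable_maxr.
have max0 (z : Omega * measurableTypeR R) : 0 <= Num.max 0 z.2 by rewrite le_max lexx.
have mBX : measurable_fun setT (fun z : Omega * measurableTypeR R => B (x + X (Num.max 0 z.2) z.1)).
  apply: (measurableT_comp mB); apply: measurable_funD_rV => //.
  exact: (measurable_levy_at hX mmax measurable_fst max0).
have mF : measurable_fun setT F.
  apply: emeasurable_funM; first exact/measurable_EFinP.
  exact: (@measurable_fkw _ _ _ _ _ _ hX _ _ _ (fun=> r) (fun=> x) fst).
have F0 z : (0 <= F z)%E by rewrite mule_ge0 ?lee_fin ?fkw_ge0.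
have FE w s : 0 <= s -> F (w, s) = ((B (x + X s w)%R)%:E * fkw (fun=> 0%R) B x s r (X ^~ w))%E.
  by move=> s0; rewrite /F/= (max_idPr s0).
clearbody F.
have -> : g r x = (1 + \int[P]_w \int[leb]_(s in `[0%R, r]) F (w, s))%E.
  rewrite -[X in (X + _)%E](integral_cst_prob P) -ge0_integralD//; last 2 first.
    by move=> w _; apply: integral_ge0.
    pose F' (z : Omega * measurableTypeR R) := if (0 <= z.2) && (z.2 <= r) then F z else 0%E.
    have mF' : measurable_fun setT F'.
      apply: measurable_fun_ifT => //.
      by apply: measurable_and; apply: measurable_fun_ler.
    have F'0 z : (0 <= F' z)%E by rewrite /F'; case: ifP.
    have := @measurable_fun_fubini_tonelli_F _ _ _ _ _ leb F' mF' F'0.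
    apply: eq_measurable_fun => w _; rewrite /fubini_F [RHS]integral_mkcond.
    by apply: eq_integral => u _; rewrite patchE /F' mem_setE in_itv.
  apply: eq_integral => w _.
  have f1 := le_lt_trans (fin r x w r0) (ltry _).
  rewrite mule1 (expeR_path_identity r0 mB B0 f1).
  apply: (congr1 (fun z => 1 + z)%E).
  by apply: eq_integral => s; rewrite inE/= in_itv/= => /andP[s0 _]; rewrite FE.
rewrite leeD2l// (@tonelli_set _ _ _ _ _ P leb)//.
rewrite -integral_itv_obnd_cbnd; last first.
  apply: measurable_funTS; exact: (@measurable_fun_fubini_tonelli_G _ _ _ _ _ P F mF F0).
pose h (z : Omega * measurableTypeR R) : \bar R := (B (x + X (Num.max 0 z.2) z.1)%R)%:E.
have mh : measurable_fun setT h by exact/measurable_EFinP.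
have h0 z : (0 <= h z)%E by rewrite lee_fin.
have hE w s : 0 <= s -> h (w, s) = (B (x + X s w)%R)%:E.
  by move=> s0; rewrite /h/= (max_idPr s0).
clearbody h.
apply: (@le_trans _ _ (\int[leb]_(s in `]0%R, r]) (S * \int[P]_w h (w, s))))%E.
  have mhG := @measurable_fun_fubini_tonelli_G _ _ _ _ _ P h mh h0.
  apply: ge0_le_integral => //.
  - by move=> s _; exact: integral_ge0.
  - apply: measurable_funTS; exact: (@measurable_fun_fubini_tonelli_G _ _ _ _ _ P F mF F0).
  - by apply: measurable_funTS; apply: measurable_funeM.
  - move=> s /=; rewrite in_itv/= => /andP[s0 sr].
    have rs0 : 0 <= r - s by rewrite subr_ge0.
    have mk := @markov_fkw _ _ _ _ P _ hX (fun=> 0) (fun=> 0) (fun=> 0) B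
      (@measurable_cst _ _ _ _ _ _) (@measurable_cst _ _ _ _ _ _)
      (@measurable_cst _ _ _ _ _ _) mB (fun=> lexx _) (fun=> lexx _) (fun=> lexx _) B0 s (r - s) x
      (fun y => (B y)%:E) (cst 1%E) s0 rs0 (proj2 (measurable_EFinP _ _) mB)
      (@measurable_cst _ _ _ _ _ _) (fun y => B0 y) (fun=> lee01).
    have one : fkw (fun=> 0) (fun=> 0) x 0 s = (fun=> 1%E) :> ((R -> E) -> \bar R).
      by apply/funext => f; rewrite fkw0l integral0 expeR0.
    rewrite (_ : s + (r - s) = r) in mk; last by rewrite addrC subrK.
    rewrite one in mk.
    rewrite (_ : (\int[P]_w F (w, s) = \int[P]_w (1 * (B (x + X s w))%:E *
       (fkw (fun=> 0%R) B x s r (X^~ w) * cst 1%E (x + X r w)%R)))%E); last first.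
      by apply: eq_integral => w _; rewrite FE ?(ltW s0)// mul1e mule1.
    rewrite mk -ge0_integralZl//; last first.
      exact: (measurableT_comp mh (pair2_measurable s)).
    apply: ge0_le_integral => //.
    - by move=> w _; rewrite mul1e mule_ge0 ?lee_fin// fk_ge0.
    - apply: emeasurable_funM.
        apply: emeasurable_funM => //; apply/measurable_EFinP.
        by apply: (measurableT_comp mB); apply: measurable_funD_rV => //; exact/mX/ltW.
      apply: (measurableT_comp (measurable_fk hX _ mB _ B0 rs0 _ _)) => //.
      by apply: measurable_funD_rV => //; exact/mX/ltW.
    - by apply: measurable_funeM; exact: (measurableT_comp mh (pair2_measurable s)).
    - move=> w _; rewrite mul1e hE ?(ltW s0)// muleC lee_wpmul2r ?lee_fin//.
      by apply: gS => //; rewrite lerBlDr; apply: (le_trans rt); rewrite lerDl ltW.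
have mhG := @measurable_fun_fubini_tonelli_G _ _ _ _ _ P h mh h0.
rewrite ge0_integralZl//; last 2 first.
- exact: measurable_funTS.
- by move=> s _; exact: integral_ge0.
rewrite lee_wpmul2l//.
apply: le_trans (hB x).
rewrite integral_itv_obnd_cbnd; last exact: measurable_funTS.
rewrite -(@tonelli_set _ _ _ _ _ P leb)//.
have mB' : measurable_fun setT (EFin \o B) by exact/measurable_EFinP.
have mint (q : R) : 0 <= q ->
    measurable_fun setT (fun w => \int[leb]_(u in `[0%R, q]) (B (x + X u w)%R)%:E)%E.
  move=> q0; exact: (@measurable_levy_integral _ _ _ _ _ _ hX _ _ (fun=> 0) (fun=> q) (fun=> x) id (fun y => (B y)%:E)).
have hrE w : (\int[leb]_(s in `[0%R, r]) h (w, s) =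
    \int[leb]_(u in `[0%R, r]) (B (x + X u w)%R)%:E)%E.
  by apply: eq_integral => s; rewrite inE/= in_itv/= => /andP[s0 _]; rewrite hE.
under eq_integral do rewrite hrE.
apply: ge0_le_integral => //.
- by move=> w _; apply: integral_ge0 => u _; rewrite lee_fin.
- exact: mint.
- by apply: mint; exact: ltW.
- move=> w _; apply: ge0_subset_integral => //.
  + by apply/measurable_EFinP; exact: measurable_path.
  + by move=> u _; rewrite lee_fin.
  + by apply: subset_itvl; rewrite bnd_simp.
Qed.

Let mlevyI (B : E -> R) x t : measurable_fun setT B -> (forall y, 0 <= B y) -> 
  measurable_fun setT (fun w => \int[leb]_(u in `[0%R, t]) (B (x + X u w)%R)%:E)%E.
Proof.
move=> mB B0.
apply: (@measurable_levy_integral _ _ _ _ _ _ hX _ _ (fun=> 0) (fun=> t) (fun=> x) id (fun y => (B y)%:E)) => //.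
exact/measurable_EFinP.
Qed.

(** The bound 2 does not depend on the bound of the potential, so it passes from the truncations
    [min B n] to [B] by monotone convergence inside the exponential and Fatou's lemma outside. *)
Lemma khasminskii_small (B : E -> R) (t : R) : 0 < t -> measurable_fun setT B ->
  (forall y, 0 <= B y) ->
  (forall x, \int[P]_w \int[leb]_(u in `[0%R, t]) (B (x + X u w)%R)%:E <= (2^-1)%:E)%E ->
  forall x, (fk P X (fun=> 0%R) B t (cst 1%E) x <= 2%:E)%E.
Proof.
move=> t0 mB B0 hB x.
pose BN (n : nat) y := Num.min (B y) n%:R.
have BN0 n y : 0 <= BN n y by rewrite le_min B0/=.
have mBN n : measurable_fun setT (BN n) by exact: measurable_minr.
have le2 n : (fk P X (fun=> 0%R) (BN n) t (cst 1%E) x <= 2%:E)%E.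
  apply: (@khasminskii_bounded _ n%:R) => // [y|z]; first by rewrite ge_min lexx orbT.
  apply: le_trans (hB z); apply: ge0_le_integral => //.
  - by move=> w _; apply: integral_ge0 => u _; rewrite lee_fin.
  - exact: mlevyI.
  - exact: mlevyI.
  - move=> w _; apply: ge0_le_integral => //.
    + by move=> u _; rewrite lee_fin.
    + by apply/measurable_EFinP; exact: measurable_path.
    + by apply/measurable_EFinP; exact: measurable_path.
    + by move=> u _; rewrite lee_fin ge_min lexx.
have c w : (fun n => fkw (fun=> 0%R) (BN n) x 0%R t (X ^~ w) * cst 1 (x + X t w)%R)%E @ \oo -->
     (fkw (fun=> 0%R) B x 0%R t (X ^~ w) * cst 1 (x + X t w)%R)%E.
  rewrite /= mule1 fkw0l; under eq_fun do rewrite mule1 fkw0l.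
  apply: cvg_expeR.
    by rewrite gt_eqF// (lt_le_trans ltNy0)//; apply: integral_ge0 => u _; rewrite lee_fin.
  have e u : (B (x + X u w))%:E = limn (fun n => (BN n (x + X u w))%:E).
    have b : BN n (x + X u w) @[n --> \oo] --> B (x + X u w).
      by apply: cvg_near_cst; near=> n; apply/min_idPl; near: n; exact: nbhs_infty_ger.
    by apply/esym/cvg_lim => //; apply: cvg_EFin; [exact: nearW|exact: b].
  under [X in _ --> X]eq_integral do rewrite e.
  apply: cvg_monotone_convergence => //.
  - by move=> n; apply/measurable_EFinP; exact: measurable_path.
  - by move=> n u _; rewrite lee_fin.
  - move=> u _ m n mn; rewrite lee_fin le_min ge_min lexx/= ge_min.
    by rewrite ler_nat mn orbT.
have -> : fk P X (fun=> 0%R) B t (cst 1%E) x = (\int[P]_w limn_einf (fun n =>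
    fkw (fun=> 0%R) (BN n) x 0%R t (X ^~ w) * cst 1 (x + X t w)%R))%E.
  by apply: eq_integral => w _; apply/esym; rewrite is_cvg_limn_einfE; [exact/cvg_lim/c|exact: cvgP (c w)].
apply: le_trans (fatou _ _ _ _) _ => //.
- move=> n; apply: emeasurable_funM => //.
  exact: (@measurable_fkw _ _ _ _ _ _ hX _ _ (fun=> 0) (fun=> t) (fun=> x) id).
- by move=> n w _; rewrite mule_ge0// fkw_ge0.
- rewrite limn_einf_lim; apply: lime_le; first exact: is_cvg_einfs.
  apply: nearW => n; apply: le_trans (le2 n).
  by apply: ereal_inf_lbound; exists n => /=.
Unshelve. all: by end_near. Qed.

Lemma fkw_split (a b : E -> R) x s t w : measurable_fun setT a -> measurable_fun setT b ->
  (forall y, 0 <= a y) -> (forall y, 0 <= b y) -> 0 <= s -> 0 <= t ->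
  fkw a b x 0 (s + t) (X ^~ w) =
  (fkw a b x 0%R s (X ^~ w) * fkw a b x s (s + t)%R (X ^~ w))%E.
Proof.
move=> ma mb a0 b0 s0 t0.
have spl (c : E -> R) : measurable_fun setT c -> (forall y, 0 <= c y) ->
    (\int[leb]_(u in `[0%R, (s + t)%R]) (c (x + X u w)%R)%:E =
     \int[leb]_(u in `[0%R, s]) (c (x + X u w)%R)%:E +
     \int[leb]_(u in `[s, (s + t)%R]) (c (x + X u w)%R)%:E)%E.
  move=> mc c0.
  have mst : measurable_fun `[0, s + t] (fun u : R => (c (x + X u w))%:E).
    by apply/measurable_EFinP; exact: measurable_path.
  have sub : `]s, s + t]%classic `<=` (`[0, s + t]%classic : set R).
    by apply: subset_itvr; rewrite bnd_simp.
  rewrite -[X in (_ + X)%E]integral_itv_obnd_cbnd; last exact: measurable_funS mst.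
  rewrite -ge0_integral_setU//=.
  - congr (integral _ _ _); apply/seteqP; split => u /=; rewrite !in_itv/=.
      by move=> /andP[-> ->]/=; rewrite andbT; case: (leP u s) => h; [left|right].
    by move=> [/andP[-> us]|/andP[su ->]]; rewrite ?andbT; [apply: le_trans us _; rewrite lerDl|apply/ltW: (le_lt_trans s0 su)].
  - by apply: measurable_funS mst => // u [|/sub//]; rewrite /= !in_itv/= => /andP[-> us]/=; apply: le_trans us _; rewrite lerDl.
  - by move=> u _; rewrite lee_fin.
  - apply/disj_setPS => u [] /=; rewrite !in_itv/= => /andP[_ us] /andP[su _].
    by move: (lt_le_trans su us); rewrite ltxx.
have I0 (c : E -> R) D : (forall y, 0 <= c y) -> (0 <= \int[leb]_(u in D) (c (x + X u w)%R)%:E)%E.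
  by move=> c0; apply: integral_ge0 => u _; rewrite lee_fin.
rewrite /fkw (spl a)// (spl b)// expeRD oppeD; last by rewrite ge0_adde_def ?inE ?I0.
by rewrite expeRD muleACA.
Qed.

(** The Kato condition yields a time [t0] over which the expected integral is at most 1/2 from every
    starting point; the Markov property at the multiples of [t0] then multiplies the bounds 2. *)
Lemma kato_expmoment (B : E -> R) : kato P X B -> (forall y, 0 <= B y) ->
  forall t, 0 <= t -> exists2 M : R, 0 < M &
    forall x, (fk P X (fun=> 0%R) B t (cst 1%E) x <= M%:E)%E.
Proof.
move=> [mB kB] B0.
have [t0 t00 ht0] : exists2 t0, 0 < t0 & forall x,
   (\int[P]_w \int[leb]_(u in `[0%R, t0]) (B (x + X u w)%R)%:E <= (2^-1)%:E)%E.
  have /kB : nbhs 0%E [set z : \bar R | (z < (2^-1)%:E)%E].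
    by apply: open_nbhs_nbhs; split; [exact: open_ereal_lt_ereal|rewrite /= lte_fin].
  move=> [e /= e0 he]; exists (e / 2); first by rewrite divr_gt0.
  move=> x; apply/ltW; apply: le_lt_trans (he (e / 2) _ _) => /=.
  - apply: ereal_sup_ubound; exists x => //.
    by apply: eq_integral => w _; apply: eq_integral => u _; rewrite ger0_norm.
  - by rewrite /ball/= sub0r normrN gtr0_norm ?divr_gt0// ltr_pdivrMr// ltr_pMr// ltr1n.
  - by rewrite divr_gt0.
have h2 := khasminskii_small t00 mB B0 ht0.
have mcst (r : \bar R) : measurable_fun [set: E] (cst r) by exact: measurable_cst.
have step n : forall x, (fk P X (fun=> 0%R) B (n%:R * t0) (cst 1%E) x <= (2 ^+ n)%:E)%E.
  elim: n => [|n IH] x.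
    rewrite mul0r expr0 /fk; under eq_integral do rewrite mule1 fkw0l set_itv1 integral_set1 expeR0.
    by rewrite integral_cst_prob.
  have nt0 : 0 <= n%:R * t0 by rewrite mulr_ge0// ltW.
  have mk := @markov_fkw _ _ _ _ P _ hX (fun=> 0) B (fun=> 0) B
      (@measurable_cst _ _ _ _ _ _) mB (@measurable_cst _ _ _ _ _ _) mB
      (fun=> lexx _) B0 (fun=> lexx _) B0 t0 (n%:R * t0) x
      (cst 1%E) (cst 1%E) t00 nt0 (mcst _) (mcst _) (fun=> lee01) (fun=> lee01).
  have -> : fk P X (fun=> 0%R) B (n.+1%:R * t0) (cst 1%E) x =
    (\int[P]_w (fkw (fun=> 0%R) B x 0%R t0 (X^~ w) * cst 1 (x + X t0 w)%R *
       (fkw (fun=> 0%R) B x t0 (t0 + n%:R * t0) (X^~ w) * cst 1 (x + X (t0 + n%:R * t0) w)%R)))%E.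
    apply: eq_integral => w _; rewrite !mule1 -fkw_split//; last exact: ltW.
    by rewrite -natr1 mulrDl mul1r addrC.
  rewrite mk.
  have mf : measurable_fun setT (fun w => fkw (fun=> 0) B x 0 t0 (X^~ w)).
    exact: (@measurable_fkw _ _ _ _ _ _ hX _ _ (fun=> 0) (fun=> t0) (fun=> x) id).
  apply: (@le_trans _ _ (\int[P]_w ((2 ^+ n)%:E * fkw (fun=> 0%R) B x 0%R t0 (X^~ w))))%E.
    apply: ge0_le_integral => //.
    - by move=> w _; rewrite mule1 mule_ge0 ?fkw_ge0// fk_ge0.
    - apply: emeasurable_funM; first exact: emeasurable_funM.
      apply: (measurableT_comp (measurable_fk hX _ mB _ B0 nt0 _ _)) => //.
      by apply: measurable_funD_rV => //; exact/mX/ltW.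
    - exact: measurable_funeM.
    - by move=> w _; rewrite mule1 muleC lee_wpmul2r ?fkw_ge0.
  rewrite ge0_integralZl ?lee_fin ?exprn_ge0//; last by move=> w _; exact: fkw_ge0.
  rewrite exprSr EFinM lee_wpmul2l ?lee_fin ?exprn_ge0//.
  apply: le_trans (h2 x); rewrite le_eqVlt; apply/orP; left; apply/eqP.
  by apply: eq_integral => w _; rewrite mule1.
move=> t t0'.
pose n := (Num.truncn (t / t0)).+1.
have tn : t <= n%:R * t0 by rewrite -ler_pdivrMr// ltW// truncnS_gt.
exists (2 ^+ n) => [|x]; first by rewrite exprn_gt0.
apply: le_trans (step n x).
have mfk r : 0 <= r -> measurable_fun setT (fun w => fkw (fun=> 0%R) B x 0%R r (X^~ w) * cst 1 (x + X r w)%R)%E.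
  move=> r0; apply: emeasurable_funM => //.
  exact: (@measurable_fkw _ _ _ _ _ _ hX _ _ (fun=> 0) (fun=> r) (fun=> x) id).
apply: ge0_le_integral => //.
- by move=> w _; rewrite mule1 fkw_ge0.
- exact: mfk.
- exact/mfk/(le_trans t0' tn).
- move=> w _; rewrite !mule1 !fkw0l lee_expeR; apply: ge0_subset_integral => //.
  + by apply/measurable_EFinP; exact: measurable_path.
  + by move=> u _; rewrite lee_fin.
  + by apply: subset_itvl; rewrite bnd_simp.
Qed.

End khasminskii.

(** * Jumps of cadlag paths *)

Section cadlag_paths.
Context (R : realType) (d : nat).
Local Notation E := 'rV[R]_d.
Variable f : R -> E.
Hypothesis cf : cadlag f.

Lemma near_enorm (T : Type) (F : set_system T) (FF : Filter F) (g : T -> E) (l : E) (r : R) :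
  0 < r -> g @ F --> l -> \forall x \near F, enorm (g x - l) < r.
Proof.
move=> r0 gl.
have : nbhs l [set y | enorm (y - l) < r].
  apply/nbhs_ballP; exists (r / d.+1%:R) => /=; first by rewrite divr_gt0.
  move=> y; rewrite mx_norm_ball /ball_/= => ly.
  rewrite enormC; apply: le_lt_trans (enorm_le_norm _) _.
  apply: (@le_lt_trans _ _ (d.+1%:R * `|l - y|)); first by rewrite ler_wpM2r// ler_nat.
  by rewrite -ltr_pdivlMl// mulrC.
exact: gl.
Qed.

(** [s] lists the partition points of [[0, T]]. The half-open []u, v]] attaches a partition point to
    the stretch on its right, which is where right continuity places its value. *)
Definition small_osc (r T : R) (s : seq R) := forall u v, 0 <= u -> u <= v -> v <= T ->
  (forall x, x \in s -> ~~ (u < x <= v)) -> enorm (f u - f v) < r.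

(** Let [c] be the supremum of the times up to which such a list exists. The left limit at [c] shows
    that [c] is attained, after adding [c] and a nearby earlier point to the list; right continuity
    at [c] goes beyond it unless [c = T]. *)
Lemma cadlag_small_osc (r T : R) : 0 < r -> 0 <= T -> exists s, small_osc r T s.
Proof.
move=> r0 T0; case: cf => rc ll.
pose A : set R := [set t | 0 <= t <= T /\ exists s, small_osc r t s].
have A0 : A 0.
  split; first by rewrite lexx.
  exists [::] => u v u0 uv v0 _; have -> : u = v by apply/eqP; rewrite eq_le uv (le_trans v0).
  by rewrite subrr enorm0.
have hsA : has_sup A.
  by split; [exists 0|exists T => t [/andP[]]].
pose c := sup A.
have c0 : 0 <= c by exact: ub_le_sup hsA.2 _ A0.
have cT : c <= T by apply: ge_sup; [exists 0|move=> t [/andP[]]].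
have [s1 hs1] : exists s, small_osc r c s.
  have [c_eq0|cn0] := eqVneq c 0; first by case: A0 => _ [s]; rewrite c_eq0; exists s.
  have cgt : 0 < c by rewrite lt_def cn0.
  have /cvg_ex[l fl] := ll c cgt.
  have r2 : 0 < r / 2 by rewrite divr_gt0.
  have [e /= e0 he] := near_enorm _ r2 fl.
  have [t [t0T [s hs]] ct] := sup_adherent e0 hsA.
  have tc : t <= c by apply: ub_le_sup hsA.2 _ _; split => //; exists s.
  exists (t :: c :: s) => u v u0 uv vc nx.
  have [vt|tv] := leP v t.
    by apply: hs => // x xs; apply: nx; rewrite !inE xs !orbT.
  have tu : t <= u.
    rewrite leNgt; apply/negP => ut.
    by have := nx t (mem_head _ _); rewrite ut (ltW tv).
  have [vc'|cv] := ltP v c; last first.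
    have vcE : v = c by apply/eqP; rewrite eq_le vc.
    have [uc|cu] := ltP u c.
      by have := nx c; rewrite !inE eqxx orbT uc vcE lexx => /(_ isT).
    have -> : u = v by apply/eqP; rewrite eq_le uv vcE cu.
    by rewrite subrr enorm0.
  have near_l y : t <= y -> y < c -> enorm (f y - l) < r / 2.
    move=> ty yc; apply: he => //=.
    rewrite gtr0_norm ?subr_gt0//.
    by rewrite ltrBlDl -ltrBlDr (lt_le_trans ct).
  rewrite (splitr r); have -> : f u - f v = (f u - l) + (l - f v) by rewrite addrA subrK.
  apply: le_lt_trans (enormD _ _) _; apply: ltrD.
    by apply: near_l => //; exact: le_lt_trans uv vc'.
  by rewrite enormC; apply: near_l => //; exact: ltW.
have [cTe|cTn] := eqVneq c T; first by exists s1; rewrite -cTe.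
have {cTn}cT' : c < T by rewrite lt_def eq_sym cTn.
have r2 : 0 < r / 2 by rewrite divr_gt0.
have [e /= e0 he] := near_enorm _ r2 (rc c c0).
pose t := Num.min T (c + e / 2).
have ct : c < t by rewrite lt_min cT' ltrDl divr_gt0.
have tT : t <= T by rewrite ge_min lexx.
suff : A t by move=> /(ub_le_sup hsA.2); rewrite leNgt ct.
split; first by rewrite tT andbT (le_trans c0)// ltW.
exists (c :: s1) => u v u0 uv vt nx.
have [vc|cv] := leP v c.
  by apply: hs1 => // x xs; apply: nx; rewrite inE xs orbT.
have cu : c <= u.
  rewrite leNgt; apply/negP => uc.
  by have := nx c (mem_head _ _); rewrite uc (ltW cv).
have near_c y : c <= y -> y <= t -> enorm (f y - f c) < r / 2.
  rewrite le_eqVlt => /predU1P[<- _|cy yt]; first by rewrite subrr enorm0.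
  apply: he => //=; rewrite distrC gtr0_norm ?subr_gt0// ltrBlDl.
  apply: (le_lt_trans yt); rewrite gt_min ltrD2l orbC.
  by rewrite ltr_pdivrMr// ltr_pMr// ltr1n.
rewrite (splitr r); have -> : f u - f v = (f u - f c) + (f c - f v) by rewrite addrA subrK.
apply: le_lt_trans (enormD _ _) _; apply: ltrD.
  by apply: near_c => //; exact: le_trans uv vt.
by rewrite enormC; apply: near_c => //; exact: ltW.
Qed.

Lemma cadlag_bounded (T : R) : 0 <= T -> exists M, forall u, 0 <= u -> u <= T -> enorm (f u) <= M.
Proof.
move=> T0; have [s hs] := cadlag_small_osc ltr01 T0.
exists (1 + \sum_(x <- 0 :: s) enorm (f x)) => v v0 vT.
(* [x] is the last nonnegative partition point not after [v], or 0, so [f v] is within 1 of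
   [f x]. *)
have [x xs [xv nx]] : exists2 x, x \in 0 :: [seq x <- s | 0 <= x] &
    x <= v /\ forall y, y \in s -> ~~ (x < y <= v).
  elim: (s) => [|y s' [x xs [xv nx]]]; first by exists 0; rewrite ?mem_head.
  have [/andP[xy yv]|xyv] := boolP (x < y <= v).
    have x0 : 0 <= x.
      by move: xs; rewrite inE => /predU1P[->//|]; rewrite mem_filter => /andP[].
    exists y; first by rewrite /= (le_trans x0 (ltW xy)) !inE eqxx orbT.
    split => // z; rewrite inE => /predU1P[->|zs]; first by rewrite ltxx.
    by apply: contra (nx z zs) => /andP[yz ->]; rewrite (lt_trans xy yz).
  exists x; first by move: xs; rewrite /= !inE; case: ifP => _; rewrite ?inE => /orP[->//|->]; rewrite ?orbT.
  by split => // z; rewrite inE => /predU1P[->//|]; exact: nx.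
have x0 : 0 <= x.
  by move: xs; rewrite inE => /predU1P[->//|]; rewrite mem_filter => /andP[].
have xs' : x \in 0 :: s.
  by move: xs; rewrite !inE mem_filter => /orP[->//|/andP[_ ->]]; rewrite orbT.
have := hs x v x0 xv vT nx => h.
have -> : f v = (f v - f x) + f x by rewrite subrK.
apply: le_trans (enormD _ _) _; apply: lerD; first by rewrite enormC ltW.
rewrite (big_rem x)//= lerDl sumr_ge0// => y _; exact: enorm_ge0.
Qed.

Definition incr (n k : nat) : E := f (k.+1%:R / n%:R) - f (k%:R / n%:R).

Lemma straddle (n : nat) (x : R) : (0 < n)%N -> 0 < x -> x <= 1 ->
  exists k : 'I_n, k%:R / n%:R < x <= k.+1%:R / n%:R.
Proof.
move=> n0 x0 x1; have nR : 0 < n%:R :> R by rewrite ltr0n.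
have ex : exists k, x <= k.+1%:R / n%:R.
  by exists n.-1; rewrite prednK// divff ?gt_eqF.
pose k := ex_minn ex.
have kn : (k < n)%N.
  rewrite /k; case: ex_minnP => m _ mmin.
  by rewrite -[X in (_ < X)%N](prednK n0) ltnS; apply: mmin; rewrite prednK// divff ?gt_eqF.
exists (Ordinal kn) => /=; rewrite /k; case: ex_minnP => -[|m] xm mmin.
  by rewrite mul0r x0.
rewrite xm andbT ltNge; apply/negP => h.
by have := mmin m h; rewrite ltnn.
Qed.

Lemma straddle_uniq (n k l : nat) (x : R) : (0 < n)%N ->
  k%:R / n%:R < x <= k.+1%:R / n%:R -> l%:R / n%:R < x <= l.+1%:R / n%:R -> k = l.
Proof.
move=> n0 /andP[k1 k2] /andP[l1 l2]; have nR : 0 < n%:R :> R by rewrite ltr0n.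
have := lt_le_trans k1 l2; have := lt_le_trans l1 k2.
rewrite !ltr_pM2r ?invr_gt0// !ltr_nat !ltnS => lk kl.
by apply/eqP; rewrite eqn_leq lk kl.
Qed.

(** The left end of the grid interval around [x] is strictly before [x], so its value approaches the
    left limit; the right end is at or after [x], so its value approaches [f x]. *)
Lemma incr_cvg_jump (x r : R) : 0 < x -> 0 < r ->
  \forall n \near \oo, forall k : nat, k%:R / n%:R < x <= k.+1%:R / n%:R ->
    enorm (incr n k - jump f x) < r.
Proof.
move=> x0 r0; case: cf => rc ll.
have r2 : 0 < r / 2 by rewrite divr_gt0.
have [e1 /= e10 h1] := near_enorm _ r2 (rc x (ltW x0)).
have [e2 /= e20 h2] := near_enorm _ r2 (ll x x0).
have [N _ hN] : \forall n \near \oo, (n.+1%:R)^-1 < Num.min e1 e2.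
  have e0 : 0 < Num.min e1 e2 by rewrite lt_min e10.
  have /ltr_add_invr[k] := e0; rewrite add0r => hk.
  exists k => // n /= kn; apply: le_lt_trans hk.
  by rewrite lef_pV2 ?posrE ?ltr0n// ler_nat ltnS.
exists N.+1 => // -[//|n] /=; rewrite ltnS => Nn k /andP[kx xk].
have nR : 0 < n.+1%:R :> R by [].
have := hN n Nn; rewrite lt_min => /andP[d1 d2].
have E : k.+1%:R / n.+1%:R = k%:R / n.+1%:R + n.+1%:R^-1 :> R.
  by rewrite -natr1 mulrDl mul1r.
have -> : incr n.+1 k - jump f x = (f (k.+1%:R / n.+1%:R) - f x) -
    (f (k%:R / n.+1%:R) - lim (f s @[s --> x^'-])).
  by rewrite /incr /jump !opprB addrACA [RHS]addrACA; congr (_ + _); rewrite addrC.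
rewrite (splitr r); apply: le_lt_trans (enormD _ _) _; rewrite enormN; apply: ltrD.
  move: xk; rewrite le_eqVlt => /predU1P[<-|xk]; first by rewrite subrr enorm0.
  apply: h1 => //=; rewrite distrC gtr0_norm ?subr_gt0// E ltrBlDl.
  exact: ltrD.
apply: h2 => //=; rewrite gtr0_norm ?subr_gt0//.
rewrite ltrBlDl; apply: (le_lt_trans xk); rewrite E ltrD2l//.
Qed.

Lemma open_enorm (U : set E) l : open U -> U l -> exists2 e, 0 < e &
  forall z, enorm (z - l) < e -> U z.
Proof.
move=> oU Ul; have /nbhs_ballP[e /= e0 he] : nbhs l U by exact: open_nbhs_nbhs.
exists e => // z zl; apply: he; split => // i j.
rewrite /ball/= (ord1 i); apply: le_lt_trans zl.
by have := coord_le_enorm (z - l) j; rewrite !mxE distrC.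
Qed.

(** A discrete stand-in for the number of jumps in [A] during []0, 1]]. For a Levy process the [n]
    increments are independent with the law of [X_{1/n}], so this count is binomial. *)
Definition hits (A : set E) (n : nat) : nat := #|[pred k : 'I_n | `[< A (incr n k) >]]|.

Definition jumps_in (A : set E) : set R :=
  [set t | [/\ 0 < t <= 1, jump f t != 0 & A (jump f t)]].

Lemma counting_ge (T : choiceType) (J : set T) (s : seq T) : uniq s ->
  (forall x, x \in s -> J x) -> ((size s)%:R%:E <= @counting T R J)%E.
Proof.
move=> us sJ; rewrite /counting; case: asboolP => [fJ|_]; last exact: leey.
rewrite lee_fin ler_nat; apply: uniq_leq_size => // x xs.
by rewrite in_fset_set// inE; exact: sJ.
Qed.

Lemma counting_le (T : choiceType) (J : set T) (L : \bar R) :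
  (forall s : seq T, uniq s -> (forall x, x \in s -> J x) -> ((size s)%:R%:E <= L)%E) ->
  (@counting T R J <= L)%E.
Proof.
move=> h; rewrite /counting; case: asboolP => [fJ|iJ].
  by apply: h => // x; rewrite in_fset_set// inE.
have L0 : (0 <= L)%E by have := h [::] isT (fun _ => _); apply.
have [->//|Ly] := eqVneq L +oo%E.
have Lf : L \is a fin_num by rewrite ge0_fin_numE// ltey.
pose m := (Num.truncn (fine L)).+1.
have [B BJ Bm] := infinite_set_fset m iJ.
have := h (finmap.enum_fset B) (finmap.fset_uniq B) (fun x xB => BJ x xB).
rewrite -(fineK Lf) lee_fin leNgt => /negP[].
by apply: lt_le_trans (truncnS_gt _) _; rewrite ler_nat.
Qed.

(** An increment in [A] has size at least [rho], so its interval contains one of the finitely many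
    points of the partition with oscillation below [rho]. At a partition point whose jump misses the
    closed set [A], the increments eventually miss [A] as well. The increments in [A] are thus
    covered by jumps in [A]. *)
Lemma hits_le_closed (A : set E) (rho : R) : closed A -> 0 < rho ->
  (forall z, A z -> rho <= enorm z) ->
  \forall n \near \oo, ((hits A n)%:R%:E <= @counting _ R (jumps_in A))%E.
Proof.
move=> cA rho0 Arho; have [s hs] := cadlag_small_osc rho0 ler01.
have H (x : R) : \forall n \near \oo, 0 < x <= 1 -> ~ A (jump f x) ->
    forall k : nat, k%:R / n%:R < x <= k.+1%:R / n%:R -> ~ A (incr n k).
  have [h|nh] := pselect (0 < x <= 1 /\ ~ A (jump f x)); last first.
    by apply: nearW => n h1 h2; exfalso; apply: nh.
  have [[/andP[x0 _]] nA] := h.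
  have [e e0 he] := open_enorm (closed_openC cA) nA.
  by apply: filterS (incr_cvg_jump x0 e0) => n hn _ _ k hk; apply/he/hn.
have {}H : \forall n \near \oo, forall x, x \in s -> 0 < x <= 1 -> ~ A (jump f x) ->
    forall k : nat, k%:R / n%:R < x <= k.+1%:R / n%:R -> ~ A (incr n k).
  elim: (s) => [|y s' IH]; first exact: nearW.
  near=> n => x; rewrite inE => /predU1P[->|xs].
    by near: n; exact: H.
  by move: x xs; near: n; exact: IH.
near=> n.
have n0 : (0 < n)%N by near: n; exact: nbhs_infty_gt.
have Hn : forall x, x \in s -> 0 < x <= 1 -> ~ A (jump f x) ->
    forall k : nat, k%:R / n%:R < x <= k.+1%:R / n%:R -> ~ A (incr n k) by near: n.
pose s' := [seq x <- undup s | (0 < x <= 1) && `[< A (jump f x) >]].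
have : ((size s')%:R%:E <= @counting _ R (jumps_in A))%E.
  apply: counting_ge; first by rewrite filter_uniq// undup_uniq.
  move=> x; rewrite mem_filter => /andP[/andP[x01 /asboolP Ax] _]; split => //.
  by apply/eqP => j0; have := Arho _ Ax; rewrite j0 enorm0 leNgt rho0.
apply: le_trans; rewrite lee_fin ler_nat.
have nR : 0 < n%:R :> R by rewrite ltr0n.
pose kx (x : R) : 'I_n := if pselect (0 < x <= 1) is left h then
  projT1 (cid (straddle n0 (andP h).1 (andP h).2)) else Ordinal n0.
apply: leq_trans (leq_trans (subset_leq_card _) (card_size [seq kx x | x <- s'])) _; last first.
  by rewrite size_map.
apply/fintype.subsetP => k; rewrite unfold_in /= => /asboolP Ak.
have [x xs xk] : exists2 x, x \in s & k%:R / n%:R < x <= k.+1%:R / n%:R.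
  apply: contrapT => nex.
  have := Arho _ Ak; rewrite leNgt => /negP; apply; rewrite /incr enormC.
  apply: hs.
  - by rewrite divr_ge0.
  - by rewrite ler_pM2r ?invr_gt0// ler_nat.
  - by rewrite ler_pdivrMr// mul1r ler_nat.
  - by move=> x xs; apply/negP => h; apply: nex; exists x.
have x01 : 0 < x <= 1.
  move/andP: xk => [h1 h2]; apply/andP; split.
    by apply: le_lt_trans h1; rewrite divr_ge0.
  by apply: (le_trans h2); rewrite ler_pdivrMr// mul1r ler_nat.
have Ax : A (jump f x) by apply: contrapT => nA; exact: (Hn x xs x01 nA k xk).
apply/mapP; exists x; first by rewrite mem_filter x01 mem_undup xs andbT; exact/asboolP.
rewrite /kx; case: pselect => // h; case: cid => l /= hl.
exact/val_inj/(straddle_uniq n0 xk hl).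
Unshelve. all: by end_near. Qed.

(** For any finite set of jumps in the open set [A], the grid intervals around their times are
    distinct once [1 / n] is below all gaps, and the increments over them are close to the jumps,
    hence in [A]. *)
Lemma hits_ge_open (A : set E) : open A ->
  (@counting _ R (jumps_in A) <= limn_einf (fun n => (hits A n)%:R%:E))%E.
Proof.
move=> oA; apply: counting_le => s us sJ.
have H : \forall n \near \oo, (size s <= hits A n)%N.
  have H1 : \forall n \near \oo, forall x, x \in s ->
      forall k : nat, k%:R / n%:R < x <= k.+1%:R / n%:R -> A (incr n k).
    elim: s sJ {us} => [|y s' IH] sJ; first exact: nearW.
    have [/andP[y0 _] _ Ay] := sJ y (mem_head _ _).
    have [e e0 he] := open_enorm oA Ay.
    have c1 := incr_cvg_jump y0 e0.
    have c2 := IH (fun x xs => sJ x (mem_behead (s := y :: s') xs)).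
    near=> n => x; rewrite inE => /predU1P[->|xs] k hk.
      by apply: he; move: k hk; near: n; exact: c1.
    by move: x xs k hk; near: n; exact: c2.
  have H2 : \forall n \near \oo, forall x y, x \in s -> y \in s -> x != y -> n%:R^-1 < `|x - y|.
    have H3 (x y : R) : \forall n \near \oo, x != y -> n%:R^-1 < `|x - y|.
      have [->|xy] := eqVneq x y; first by apply: nearW.
      have e0 : 0 < `|x - y| by rewrite normr_gt0 subr_eq0.
      have /ltr_add_invr[k] := e0; rewrite add0r => hk.
      exists k.+1 => // n /= kn _; apply: le_lt_trans hk.
      by rewrite lef_pV2 ?posrE ?ltr0n ?ler_nat// (leq_trans _ kn).
    have H4 (s1 : seq R) (y : R) : \forall n \near \oo, forall x, x \in s1 -> x != y -> n%:R^-1 < `|x - y|.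
      elim: s1 => [|z s' IH]; first exact: nearW.
      near=> n => x; rewrite inE => /predU1P[->|xs]; first by near: n; exact: H3.
      by move: x xs; near: n; exact: IH.
    suff H5 (s1 : seq R) : \forall n \near \oo, forall x y, x \in s -> y \in s1 -> x != y -> n%:R^-1 < `|x - y| by exact: H5.
    elim: s1 => [|z s' IH]; first exact: nearW.
    near=> n => x y xs; rewrite inE => /predU1P[->|ys].
      by move: x xs; near: n; exact: H4.
    by move: x y xs ys; near: n; exact: IH.
  near=> n.
  have n0 : (0 < n)%N by near: n; exact: nbhs_infty_gt.
  have h1 : forall x, x \in s -> forall k : nat,
      k%:R / n%:R < x <= k.+1%:R / n%:R -> A (incr n k) by near: n.
  have h2 : forall x y, x \in s -> y \in s -> x != y -> n%:R^-1 < `|x - y| by near: n.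
  pose kx (x : R) : 'I_n := if pselect (0 < x <= 1) is left h then
    projT1 (cid (straddle n0 (andP h).1 (andP h).2)) else Ordinal n0.
  have kxP x : x \in s -> (kx x)%:R / n%:R < x <= (kx x).+1%:R / n%:R.
    move=> xs; have [x01 _ _] := sJ x xs.
    by rewrite /kx; case: pselect => // h; case: cid.
  have inj : {in s &, injective kx}.
    move=> x y xs ys kxy; apply/eqP; apply: contraT => xy.
    have := h2 x y xs ys xy.
    have /andP[a1 a2] := kxP x xs; have /andP[b1 b2] := kxP y ys.
    rewrite -kxy in b1 b2.
    have E : (kx x).+1%:R / n%:R = (kx x)%:R / n%:R + n%:R^-1 :> R by rewrite -natr1 mulrDl mul1r.
    rewrite E in a2 b2; rewrite ltNge => /negP[]; rewrite ler_norml.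
    move: a1 a2 b1 b2; move: ((kx x)%:R / n%:R) => a; move: (n%:R^-1) => b a1 a2 b1 b2.
    by apply/andP; split; lra.
  rewrite -(size_map kx) -(card_uniqP _); last by rewrite map_inj_in_uniq.
  apply/subset_leq_card/fintype.subsetP => k /mapP[x xs ->]; rewrite unfold_in /=.
  by apply/asboolP; apply: (h1 x xs); exact: kxP.
case: H => N _ hN; rewrite limn_einf_lim; apply: lime_ge; first exact: is_cvg_einfs.
exists N => // n /= Nn; apply: le_ereal_inf_tmp => _ [m /= nm <-].
by rewrite lee_fin ler_nat; apply: hN => /=; exact: leq_trans nm.
Unshelve. all: by end_near. Qed.

(** The interval of an increment in [A] contains a partition point, so the length of the partition
    bounds the count for every [n]. *)
Lemma hits_bounded (A : set E) (rho : R) : closed A -> 0 < rho ->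
  (forall z, A z -> rho <= enorm z) -> exists M : nat, forall n, (hits A n <= M)%N.
Proof.
move=> cA rho0 Arho; have [s hs] := cadlag_small_osc rho0 ler01.
exists (size s) => n; case: n => [|n].
  by apply: leq_trans (max_card _) _; rewrite card_ord.
have n0 : (0 < n.+1)%N by [].
have nR : 0 < n.+1%:R :> R by [].
pose kx (x : R) : 'I_n.+1 := if pselect (0 < x <= 1) is left h then
  projT1 (cid (straddle n0 (andP h).1 (andP h).2)) else Ordinal n0.
apply: leq_trans (leq_trans (subset_leq_card _) (card_size [seq kx x | x <- s])) _; last first.
  by rewrite size_map.
apply/fintype.subsetP => k; rewrite unfold_in /= => /asboolP Ak.
have [x xs xk] : exists2 x, x \in s & k%:R / n.+1%:R < x <= k.+1%:R / n.+1%:R.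
  apply: contrapT => nex.
  have := Arho _ Ak; rewrite leNgt => /negP; apply; rewrite /incr enormC.
  apply: hs.
  - by rewrite divr_ge0.
  - by rewrite ler_pM2r ?invr_gt0// ler_nat.
  - by rewrite ler_pdivrMr// mul1r ler_nat.
  - by move=> x xs; apply/negP => h; apply: nex; exists x.
have x01 : 0 < x <= 1.
  move/andP: xk => [h1 h2]; apply/andP; split.
    by apply: le_lt_trans h1; rewrite divr_ge0.
  by apply: (le_trans h2); rewrite ler_pdivrMr// mul1r ler_nat.
apply/mapP; exists x => //; rewrite /kx; case: pselect => // h; case: cid => l /= hl.
exact/val_inj/(straddle_uniq n0 xk hl).
Qed.

End cadlag_paths.

(** * Small-time rates and the Levy measure *)

(** The integral of a nonnegative function is a supremum over the simple functions below it, hence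
    monotone for arbitrary functions. This form serves for the jump count in [levy_measure], whose
    measurability is not established. *)
Lemma ge0_le_integral_nomeas (R : realType) dT (T : measurableType dT)
    (mu : {measure set T -> \bar R}) (f g : T -> \bar R) :
  (forall x, 0 <= f x)%E -> (forall x, f x <= g x)%E ->
  (\int[mu]_x f x <= \int[mu]_x g x)%E.
Proof.
move=> f0 fg; rewrite !ge0_integralTE//; last by move=> x; apply: le_trans (fg x).
apply: le_ereal_sup => _ /= [h hf <-]; exists h => // x.
exact: le_trans (hf x) (fg x).
Qed.

Lemma limn_einf_gt_near (R : realType) (u : (\bar R)^nat) (c : \bar R) :
  (c < limn_einf u)%E -> \forall n \near \oo, (c < u n)%E.
Proof.
rewrite limn_einf_lim => h.
have cv : einfs u @ \oo --> limn (einfs u) by exact: is_cvg_einfs.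
have : nbhs (limn (einfs u)) [set z | (c < z)%E].
  by apply: open_nbhs_nbhs; split => //; exact: open_ereal_gt_ereal.
move=> h1; have [N _ hN] := cv _ h1; exists N => // n Nn.
apply: lt_le_trans (hN n Nn) _.
by apply: ereal_inf_lbound; exists n => /=.
Qed.

Section jump_counts.
Context (R : realType) (d : nat) (disp : measure_display)
  (Omega : measurableType disp) (P : probability Omega R)
  (X : R -> Omega -> 'rV[R]_d).
Hypothesis hX : levy_process P X.
Local Notation E := 'rV[R]_d.

Let mX t : 0 <= t -> measurable_fun setT (X t). Proof. by case: hX => h _ _ _ _; exact: h. Qed.
Let cX w : cadlag (X ^~ w). Proof. by case: hX. Qed.

Variable A : set E.
Hypothesis mA : measurable A.

Definition hitset (n k : nat) : set Omega := [set w | A (incr (X ^~ w) n k)].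

(** The mean of [hits]. It approximates the Levy measure from one side on open sets and from the
    other on closed sets, see [rate_liminf] and [rate_limsup]. *)
Definition rate (n : nat) : R := n%:R * fine (P [set w | A (X n%:R^-1 w)]).

Let p n := fine (P [set w | A (X n%:R^-1 w)]).

Let p0 n : 0 <= p n. Proof. by rewrite fine_ge0. Qed.

Lemma measurable_hitset n k : measurable (hitset n k).
Proof.
rewrite -[X in measurable X]setTI.
suff : measurable_fun setT (fun w => incr (X ^~ w) n k) by apply.
by apply: measurable_funD_rV; [|apply: measurable_funN_rV]; apply: mX; rewrite divr_ge0.
Qed.

Lemma hitsE n w : (hits (X ^~ w) A n)%:R = \sum_(k < n) \1_(hitset n k) w :> R.
Proof.
rewrite /hits -sum1_card natr_sum big_mkcond/=; apply: eq_bigr => k _.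
rewrite indicE unfold_in/=.
have -> : (w \in hitset n k) = `[< A (incr (X^~ w) n k) >].
  by apply/idP/asboolP; rewrite inE.
by case: `[< _ >].
Qed.

Lemma hitset2_prob n k l : (0 < n)%N -> (k < n)%N -> (l < n)%N ->
  P (hitset n k `&` hitset n l) = (if k == l then p n else p n ^+ 2)%:E.
Proof.
move=> n0 kn ln; case: (hX) => _ _ ind st _.
have nR : 0 < n%:R :> R by rewrite ltr0n.
pose B i : set E := if (i == k) || (i == l) then A else setT.
have t0 : 0 <= (0%:R / n%:R : R) by rewrite mul0r.
have tle i : (i%:R / n%:R : R) <= i.+1%:R / n%:R by rewrite ler_pM2r ?invr_gt0// ler_nat.
have mB i : measurable (B i) by rewrite /B; case: ifP.
have := ind n (fun i => i%:R / n%:R) B t0 tle mB.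
have -> : [set w | forall i, (i < n)%N -> B i (X (i.+1%:R / n%:R) w - X (i%:R / n%:R) w)] =
    hitset n k `&` hitset n l.
  apply/seteqP; split => w /=.
    move=> h; split; first by have := h k kn; rewrite /B eqxx.
    by have := h l ln; rewrite /B eqxx orbT.
  by move=> [h1 h2] i ni; rewrite /B; case: eqVneq => [->//|_]/=; case: eqVneq => [->//|].
move=> ->.
have pB i : P [set w | B i (X (i.+1%:R / n%:R) w - X (i%:R / n%:R) w)] =
    if (i == k) || (i == l) then (p n)%:E else 1%E.
  rewrite /B; case: ifP => _; last first.
    rewrite -[RHS](@probability_setT _ _ _ P); congr (P _); exact/seteqP.
  have -> : i.+1%:R / n%:R = i%:R / n%:R + n%:R^-1 :> R by rewrite -natr1 mulrDl mul1r.
  have i0 : 0 <= i%:R / n%:R :> R by rewrite divr_ge0.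
  have iv0 : 0 <= n%:R^-1 :> R by rewrite invr_ge0.
  rewrite (st _ _ A i0 iv0 mA).
  by rewrite /p fineK// fin_num_measure// -[X in measurable X]setTI; apply: mX.
rewrite (eq_bigr (fun i : 'I_n => if (i == k :> nat) || (i == l :> nat) then (p n)%:E else 1%E)); last first.
  by move=> i _; rewrite pB.
rewrite (bigD1 (Ordinal kn))//= eqxx/=.
case: (eqVneq k l) => [kl|kl].
  rewrite big1 ?mule1// => i ik.
  have : (i : nat) != k by apply: contra ik => /eqP h; apply/eqP/val_inj.
  by rewrite -kl orbb => /negbTE ->.
rewrite (bigD1 (Ordinal ln))/=; last by rewrite -val_eqE/= eq_sym.
rewrite eqxx orbT big1 ?mule1 ?expr2 ?EFinM// => i /andP[ik il].
have /negbTE -> : (i : nat) != k by apply: contra ik => /eqP h; apply/eqP/val_inj.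
by have /negbTE -> : (i : nat) != l by apply: contra il => /eqP h; apply/eqP/val_inj.
Qed.

Let mind n k : measurable_fun setT (fun w => (\1_(hitset n k) w)%:E : \bar R).
Proof. by apply/measurable_EFinP; apply: measurable_indic; exact: measurable_hitset. Qed.

Lemma integral_hits n : (0 < n)%N ->
  (\int[P]_w (hits (X ^~ w) A n)%:R%:E = (rate n)%:E)%E.
Proof.
move=> n0; under eq_integral do rewrite hitsE -sumEFin.
rewrite ge0_integral_sum//.
rewrite (eq_bigr (fun _ : 'I_n => (p n)%:E)); last first.
  move=> k _; rewrite integral_indic ?setIT//; last exact: measurable_hitset.
  have h := hitset2_prob n0 (ltn_ord k) (ltn_ord k).
  by rewrite setIid eqxx in h; exact: h.
by rewrite sumEFin sumr_const card_ord /rate [in RHS]mulr_natl.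
Qed.

(** The second moment [n p + n (n - 1) p ^+ 2] of a binomial variable: the diagonal pairs give
    [n p], and the others are at most [n ^+ 2] in number. *)
Lemma integral_hits2 n : (0 < n)%N ->
  (\int[P]_w ((hits (X ^~ w) A n)%:R ^+ 2)%:E <= (rate n + rate n ^+ 2)%:E)%E.
Proof.
move=> n0.
have e w : (((hits (X ^~ w) A n)%:R ^+ 2)%:E =
    \sum_(k < n) \sum_(l < n) (\1_(hitset n k `&` hitset n l) w)%:E :> \bar R)%E.
  rewrite hitsE expr2 mulr_suml -sumEFin; apply: eq_bigr => k _.
  rewrite mulr_sumr -sumEFin; apply: eq_bigr => l _.
  by rewrite indicI.
under eq_integral do rewrite e.
have mI k l : measurable (hitset n k `&` hitset n l).
  by apply: measurableI; exact: measurable_hitset.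
rewrite ge0_integral_sum//; last 2 first.
- by move=> k; apply: emeasurable_sum => l; apply/measurable_EFinP; exact: measurable_indic.
- by move=> k w _; apply: sume_ge0 => l _; rewrite lee_fin.
rewrite (eq_bigr (fun k : 'I_n => (\sum_(l < n) (if (k : nat) == l then p n else p n ^+ 2))%:E)); last first.
  move=> k _; rewrite ge0_integral_sum//; last first.
    by move=> l; apply/measurable_EFinP; exact: measurable_indic.
  rewrite -sumEFin; apply: eq_bigr => l _.
  by rewrite integral_indic// setIT; exact: hitset2_prob.
rewrite sumEFin lee_fin.
have -> : rate n + rate n ^+ 2 = \sum_(k < n) (p n + n%:R * p n ^+ 2).
  by rewrite sumr_const card_ord /rate -/(p n) -[RHS]mulr_natl; ring.
apply: ler_sum => k _; rewrite (bigD1 k)//= eqxx lerD2l.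
apply: (@le_trans _ _ (\sum_(i < n | i != k) p n ^+ 2)).
  by apply: ler_sum => i ik; case: ifP => // /eqP h; move: ik; rewrite -val_eqE/= h eqxx.
rewrite big_mkcond/= mulr_natl -[X in _ *+ X](card_ord n) -sumr_const.
by apply: ler_sum => i _; case: ifP => // _; exact: sqr_ge0.
Qed.

Lemma rate_ge0 n : 0 <= rate n. Proof. by rewrite mulr_ge0// p0. Qed.

Let mhits n : measurable_fun setT (fun w => (hits (X ^~ w) A n)%:R : R).
Proof.
under eq_fun do rewrite hitsE.
apply: measurable_sum => k; apply: measurable_indic; exact: measurable_hitset.
Qed.

Variable rho : R.
Hypothesis rho0 : 0 < rho.
Hypothesis Arho : forall z, A z -> rho <= enorm z.

Lemma hits_variance n : (0 < n)%N ->
  (\int[P]_w (((hits (X ^~ w) A n)%:R - rate n) ^+ 2)%:E <= (rate n)%:E)%E.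
Proof.
move=> n0; set m := rate n; set S := fun w => (hits (X ^~ w) A n)%:R : R.
have mS : measurable_fun setT S by exact: mhits.
have S0 w : 0 <= S w by [].
have m0 : 0 <= m := rate_ge0 n.
have := integral_hits2 n0; rewrite -/m => h2.
have h1 := integral_hits n0; rewrite -/m in h1.
(* The expansion of the square is written as [(S - m) ^+ 2 + 2 m S = S ^+ 2 + m ^+ 2], all of whose
   terms are nonnegative. *)
have e : (\int[P]_w ((S w - m) ^+ 2)%:E + (2 * m * m)%:E =
     \int[P]_w (S w ^+ 2)%:E + (m ^+ 2)%:E)%E.
  have -> : (2 * m * m)%:E = (\int[P]_w ((2 * m)%:E * (S w)%:E))%E.
    rewrite ge0_integralZl//; first by rewrite h1 -EFinM.
    - exact/measurable_EFinP.
    - by move=> w _; rewrite lee_fin.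
    - by rewrite lee_fin mulr_ge0.
  rewrite -[X in (_ + X)%E = _]/(\int[P]_w ((2 * m)%:E * (S w)%:E))%E.
  rewrite -ge0_integralD//; last 4 first.
  - by move=> w _; rewrite lee_fin sqr_ge0.
  - by apply/measurable_EFinP; apply: measurable_funX; apply: measurable_funB.
  - by move=> w _; rewrite -EFinM lee_fin; apply: mulr_ge0 => //; exact: mulr_ge0.
  - by apply: measurable_funeM; exact/measurable_EFinP.
  rewrite -[X in (_ + X)%E](integral_cst_prob P) -ge0_integralD//; last 3 first.
  - by move=> w _; rewrite lee_fin sqr_ge0.
  - by apply/measurable_EFinP; apply: measurable_funX.
  - by move=> w _; rewrite lee_fin sqr_ge0.
  by apply: eq_integral => w _; rewrite -EFinM -!EFinD; congr EFin; ring.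
have fin : (\int[P]_w ((S w - m) ^+ 2)%:E)%E \is a fin_num.
  rewrite ge0_fin_numE; last by apply: integral_ge0 => w _; rewrite lee_fin sqr_ge0.
  apply: (@le_lt_trans _ _ (\int[P]_w ((S w - m) ^+ 2)%:E + (2 * m * m)%:E)%E).
    by rewrite leeDl// lee_fin; apply: mulr_ge0 => //; exact: mulr_ge0.
  rewrite e; apply: le_lt_trans (leeD2r _ h2) _.
  by rewrite -EFinD ltry.
move: e h2; rewrite -(fineK fin); move: (fine _) => v.
case: (\int[P]_w _)%E => [r| |]//=; rewrite -!EFinD => -[]; rewrite !lee_fin; lra.
Qed.

(** Each path has a bound on [hits] uniform in [n], so for some [M] the bound [M] holds with
    probability above 1/2. If the mean [m] exceeded [2 M] and 8, then [hits] would be at least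
    [m / 2] away from [m] on that event, and the variance would be at least [m ^+ 2 / 8 > m],
    against [hits_variance]. *)
Lemma rate_bounded : closed A -> exists C, forall n, rate n <= C.
Proof.
move=> cA.
pose C (M : nat) : set Omega := [set w | forall n, (hits (X ^~ w) A n <= M)%N].
have mC M : measurable (C M).
  rewrite (_ : C M = \bigcap_n [set w | (hits (X ^~ w) A n)%:R <= M%:R :> R]).
    apply: bigcapT_measurable => n.
    rewrite (_ : mkset _ = (fun w => (hits (X ^~ w) A n)%:R : R) @^-1` `]-oo, M%:R]).
      by rewrite -[X in measurable X]setTI; apply: mhits.
    by apply/seteqP; split => w /=; rewrite in_itv.
  by apply/seteqP; split => w /= h n; have := h n; rewrite /= ler_nat => h'; [move=> _|]; exact: h'.
have CT : \bigcup_M C M = setT.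
  apply/seteqP; split => // w _.
  by have [M hM] := hits_bounded (cX w) cA rho0 Arho; exists M.
have ndC : nondecreasing_seq C.
  move=> M M' MM'; apply/subsetPset => w h n; exact: leq_trans (h n) MM'.
have cv : (P \o C) @ \oo --> P (\bigcup_M C M).
  by apply: nondecreasing_cvg_mu => //; exact: bigcupT_measurable.
have P1 : P (\bigcup_M C M) = 1%E.
  by rewrite CT; exact: probability_setT.
rewrite P1 in cv.
have [M hM] : exists M, ((2^-1)%:E < P (C M))%E.
  have : nbhs (1%E : \bar R) [set z | ((2^-1)%:E < z)%E].
    apply: open_nbhs_nbhs; split; first exact: open_ereal_gt_ereal.
    by rewrite /= lte_fin invf_lt1// ltr1n.
  by move=> /cv [N _ hN]; exists N; exact: (hN N (leqnn N)).
exists (Num.max (2 * M%:R) 8) => -[|n]; first by rewrite /rate mul0r le_max ler0n orbT.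
have n0 : (0 < n.+1)%N by [].
rewrite leNgt; apply/negP; rewrite gt_max => /andP[mM m8].
set m := rate n.+1 in mM m8.
have v := hits_variance n0; rewrite -/m in v.
have : ((m ^+ 2 / 4)%:E * P (C M) <= m%:E)%E.
  apply: le_trans v.
  have -> : ((m ^+ 2 / 4)%:E * P (C M) = \int[P]_w ((m ^+ 2 / 4)%:E * (\1_(C M) w)%:E))%E.
    rewrite ge0_integralZl//; first by rewrite integral_indic// setIT.
    - by apply/measurable_EFinP; exact: measurable_indic.
    - by rewrite lee_fin divr_ge0// sqr_ge0.
  apply: ge0_le_integral => //.
  - by move=> w _; rewrite -EFinM lee_fin mulr_ge0// divr_ge0// sqr_ge0.
  - by apply: measurable_funeM; apply/measurable_EFinP; exact: measurable_indic.
  - by apply/measurable_EFinP; apply: measurable_funX; apply: measurable_funB => //; exact: mhits.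
  - move=> w _; rewrite -EFinM lee_fin indicE; case: (boolP (w \in C M)) => [|_].
      rewrite inE => /(_ n.+1); rewrite -(ler_nat R) mulr1 => h.
      have h' : (hits (X^~ w) A n.+1)%:R <= m / 2 by lra.
      have : 0 <= (hits (X^~ w) A n.+1)%:R :> R by [].
      move: (hits _ _ _)%:R h' => z z1 z0.
      have : m / 2 <= m - z by lra.
      move=> h1; have h0 : 0 <= m / 2 by lra.
      have := ler_pM h0 h0 h1 h1; rewrite -[(z - m) ^+ 2]sqrrN opprB !expr2; lra.
    by rewrite mulr0 sqr_ge0.
have fC : P (C M) \is a fin_num by exact: fin_num_measure.
move: hM; rewrite -(fineK fC) -EFinM !lee_fin lte_fin; move: (fine _) => z zh h.
have : m ^+ 2 / 4 * 2^-1 < m.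
  apply: lt_le_trans h; rewrite ltr_pM2l// divr_gt0// exprn_gt0//; lra.
rewrite expr2 => h3; have : m * (m / 8 - 1) < 0 by lra.
by rewrite ltNge mulr_ge0//; lra.
Qed.

Lemma levy_measureE : levy_measure P X A =
  (\int[P]_w @counting _ R (jumps_in (X ^~ w) A))%E.
Proof. by []. Qed.

Lemma counting_ge0 (T : choiceType) (J : set T) : (0 <= @counting T R J)%E.
Proof. by rewrite /counting; case: ifP. Qed.

(** Fatou's lemma applied to the pathwise bound [hits_ge_open]. *)
Lemma rate_liminf : open A -> (levy_measure P X A <= limn_einf (fun n => (rate n)%:E))%E.
Proof.
move=> oA; rewrite levy_measureE.
have h w : (@counting _ R (jumps_in (X ^~ w) A) <=
    limn_einf (fun n => (hits (X ^~ w) A n.+1)%:R%:E))%E.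
  apply: le_trans (hits_ge_open (cX w) oA) _.
  rewrite !limn_einf_lim; apply: lee_lim; [exact: is_cvg_einfs|exact: is_cvg_einfs|].
  apply: nearW => n; apply: le_ereal_inf_tmp => _ [k /= nk <-].
  by apply: ereal_inf_lbound; exists k.+1 => //=; rewrite leqW.
apply: le_trans (ge0_le_integral_nomeas _ (fun w => counting_ge0 _) h) _.
apply: le_trans (fatou _ _ _ _) _ => //.
- by move=> n; apply/measurable_EFinP; exact: mhits.
under [X in (limn_einf X <= _)%E]eq_fun do rewrite integral_hits//.
rewrite !limn_einf_lim; apply: lime_le; first exact: is_cvg_einfs.
apply: nearW => n.
apply: (@le_trans _ _ (einfs (fun n => (rate n)%:E) n.+1)); last first.
  apply: lime_ge; first exact: is_cvg_einfs.
  exists n.+1 => // k /= nk; apply: le_ereal_inf_tmp => _ [j /= kj <-].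
  by apply: ereal_inf_lbound; exists j => //=; exact: leq_trans nk kj.
apply: le_ereal_inf_tmp => _ [[//|j] /= nj <-].
by apply: ereal_inf_lbound; exists j => //=.
Qed.

(** Fatou's lemma in the reverse direction asks for a dominated sequence, so [hits] is truncated at
    [K] and the lemma applied to [K - min hits K]. The excess of [hits] over its truncation is at
    most [hits ^+ 2 / K], whose mean is small by the uniform bound on second moments. *)
Lemma rate_limsup : closed A -> (levy_measure P X A < +oo)%E -> forall eta, 0 < eta ->
  \forall n \near \oo, rate n <= fine (levy_measure P X A) + eta.
Proof.
move=> cA Loo eta eta0; have [C0 hC0] := rate_bounded cA.
pose C := Num.max C0 0; have C_ge0 : 0 <= C by rewrite le_max lexx orbT.
have hC n : rate n <= C by rewrite le_max hC0.
set L := levy_measure P X A in Loo *.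
have L0 : (0 <= L)%E by apply: integral_ge0 => w _; exact: counting_ge0.
have Lf : L \is a fin_num by rewrite ge0_fin_numE.
(* The second moments are at most [C + C ^+ 2], so this threshold makes the mean excess at most
   [eta / 2]; the added 1 keeps it positive. *)
pose K := (C + C ^+ 2) / (eta / 2) + 1.
have K1 : 0 <= (C + C ^+ 2) / (eta / 2).
  by rewrite divr_ge0 ?addr_ge0 ?sqr_ge0//; apply: divr_ge0 => //; exact: ltW.
have K0 : 0 < K by rewrite /K ltr_wpDl.
pose S n w : R := (hits (X ^~ w) A n)%:R.
pose u n w : \bar R := (K - Num.min (S n w) K)%:E.
have u0 n w : (0 <= u n w)%E by rewrite lee_fin subr_ge0 ge_min lexx orbT.
have mS n : measurable_fun setT (S n) by exact: mhits.
have mu_ n : measurable_fun setT (u n).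
  by apply/measurable_EFinP; apply: measurable_funB => //; exact: measurable_minr.
have fat := fatou P measurableT mu_ (fun n w _ => u0 n w).
pose g w := limn_einf (u ^~ w).
have mg : measurable_fun setT g.
  rewrite (_ : g = fun w => (- limn_esup (fun n => - u n w))%E); last first.
    by apply/funext => w; rewrite /g -[X in limn_einf X](@funext _ _ (fun n => - - u n w)%E) ?limn_einfN// => n; rewrite oppeK.
  apply: measurableT_comp => //; apply: measurable_fun_limn_esup => n.
  exact: measurableT_comp.
have g0 w : (0 <= g w)%E.
  by rewrite /g limn_einf_lim; apply: lime_ge; [exact: is_cvg_einfs|apply: nearW => n; apply: le_ereal_inf_tmp => _ [k /= _ <-]].
have gK w : (g w <= K%:E)%E.
  rewrite /g limn_einf_lim; apply: lime_le; first exact: is_cvg_einfs.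
  apply: nearW => n; apply: (@le_trans _ _ (u n w)).
    by apply: ereal_inf_lbound; exists n => /=.
  by rewrite lee_fin gerBl le_min ler0n ltW.
have gfin w : g w \is a fin_num by rewrite ge0_fin_numE// (le_lt_trans (gK w))// ltry.
have KgN w : (K%:E - g w <= @counting _ R (jumps_in (X ^~ w) A))%E.
  rewrite /counting; case: asboolP => [fJ|_]; last exact: leey.
  have hc := hits_le_closed (cX w) cA rho0 Arho.
  rewrite /counting in hc; case: asboolP hc => // _ hc.
  have [N _ hN] := hc.
  rewrite leeBlDr; last exact: gfin.
  rewrite addeC -leeBlDr// /g limn_einf_lim.
  apply: lime_ge; first exact: is_cvg_einfs.
  exists N => // n /= Nn; apply: le_ereal_inf_tmp => _ [k /= nk <-].
  have := hN k (leq_trans Nn nk); rewrite /= lee_fin => hk.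
  by rewrite /u -EFinB lee_fin lerB// ge_min hk.
have Kg0 w : (0 <= K%:E - g w)%E by rewrite sube_ge0 ?gfin//; exact: gK.
have Kg : (\int[P]_w (K%:E - g w) <= L)%E.
  by apply: ge0_le_integral_nomeas.
have Ig : (K%:E - L <= \int[P]_w g w)%E.
  have e : (\int[P]_w (K%:E - g w) + \int[P]_w g w = K%:E)%E.
    have mKg : measurable_fun setT (fun w => K%:E - g w)%E by exact: emeasurable_funB.
    rewrite -(ge0_integralD P measurableT (fun w _ => Kg0 w) mKg (fun w _ => g0 w) mg).
    rewrite -[RHS](integral_cst_prob P).
    by apply: eq_integral => w _; rewrite subeK.
  by rewrite leeBlDr// -e addeC leeD2l.
have : ((K - fine L - eta / 2)%:E < limn_einf (fun n => \int[P]_w u n w))%E.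
  apply: lt_le_trans fat; apply: lt_le_trans Ig.
  by rewrite -(fineK Lf) -EFinB lte_fin ltrBlDr ltrDl divr_gt0.
move=> /limn_einf_gt_near [N _ hN]; exists N.+1 => // n /= Nn.
have n0 : (0 < n)%N by exact: leq_ltn_trans Nn.
have {}hN := hN n (ltnW Nn).
have mI : measurable_fun setT (fun w => (Num.min (S n w) K)%:E).
  by apply/measurable_EFinP; apply: measurable_minr.
have min0 w : 0 <= Num.min (S n w) K by rewrite le_min ler0n ltW.
have e2 : (\int[P]_w u n w + \int[P]_w (Num.min (S n w) K)%:E = K%:E)%E.
  rewrite -ge0_integralD//; last by move=> w _; rewrite lee_fin.
  rewrite -[RHS](integral_cst_prob P).
  by apply: eq_integral => w _; rewrite -EFinD subrK.
have e3 : ((rate n)%:E <= \int[P]_w (Num.min (S n w) K)%:E + (eta / 2)%:E)%E.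
  rewrite -(integral_hits n0).
  apply: (@le_trans _ _ (\int[P]_w ((Num.min (S n w) K)%:E + (K^-1)%:E * (S n w ^+ 2)%:E))%E).
    apply: ge0_le_integral => //.
    - by apply/measurable_EFinP; exact: mS.
    - apply: emeasurable_funD => //; apply: measurable_funeM.
      by apply/measurable_EFinP; apply: measurable_funX; exact: mS.
    move=> w _; rewrite -/(S n w) -EFinM -EFinD lee_fin; have S0 : 0 <= S n w by [].
    move: (S n w) S0 => s s0; rewrite /Num.min; case: ltP => sK.
      by rewrite lerDl mulr_ge0 ?sqr_ge0// invr_ge0 ltW.
    apply: (@le_trans _ _ (K^-1 * s ^+ 2)); last by rewrite lerDr ltW.
    by rewrite mulrC ler_pdivlMr// expr2 ler_wpM2l.
  rewrite ge0_integralD//; last 3 first.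
  - by move=> w _; rewrite lee_fin.
  - by move=> w _; rewrite -EFinM lee_fin mulr_ge0 ?sqr_ge0// invr_ge0 ltW.
  - apply: measurable_funeM.
    by apply/measurable_EFinP; apply: measurable_funX; exact: mS.
  apply: leeD2l; rewrite ge0_integralZl//; last 3 first.
  - by apply/measurable_EFinP; apply: measurable_funX; exact: mS.
  - by move=> w _; rewrite lee_fin sqr_ge0.
  - by rewrite lee_fin invr_ge0 ltW.
  apply: (@le_trans _ _ ((K^-1)%:E * (C + C ^+ 2)%:E)%E).
    apply: lee_wpmul2l; first by rewrite lee_fin invr_ge0 ltW.
    apply: le_trans (integral_hits2 n0) _; rewrite lee_fin lerD// ler_pXn2r//.
    by rewrite nnegrE rate_ge0.
  rewrite -EFinM lee_fin mulrC ler_pdivrMr// /K mulrDr mulr1 mulrC divfK ?lt0r_neq0 ?divr_gt0//.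
  by rewrite lerDl divr_ge0// ltW.
have uf : (\int[P]_w u n w)%E \is a fin_num.
  rewrite ge0_fin_numE; last exact: integral_ge0.
  apply: (@le_lt_trans _ _ K%:E); last exact: ltry.
  by rewrite -e2 leeDl// integral_ge0// => w _; rewrite lee_fin.
move: hN e2 e3; rewrite -(fineK uf); move: (fine (\int[P]_w u n w)%E) => a.
case: (\int[P]_w (Num.min (S n w) K)%:E)%E => [b| |]//=.
rewrite lte_fin -!EFinD lee_fin -/L => h1 [] h2 h3; lra.
Qed.

End jump_counts.

Section levy_finite.
Context (R : realType) (d : nat) (disp : measure_display)
  (Omega : measurableType disp) (P : probability Omega R)
  (X : R -> Omega -> 'rV[R]_d).
Hypothesis hX : levy_process P X.
Local Notation E := 'rV[R]_d.

Lemma le_levy_measure (A B : set E) : A `<=` B ->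
  (levy_measure P X A <= levy_measure P X B)%E.
Proof.
move=> AB; apply: ge0_le_integral_nomeas => w; first exact: counting_ge0.
apply: counting_le => s us sA; apply: counting_ge => // x /sA [x1 x2 x3].
by split => //; exact: AB.
Qed.

Lemma le_rate (A B : set E) n : measurable A -> measurable B -> A `<=` B ->
  rate P X A n <= rate P X B n.
Proof.
case: (hX) => mX _ _ _ _ mA mB AB; rewrite /rate; apply: ler_wpM2l => //.
have n0 : 0 <= n%:R^-1 :> R by rewrite invr_ge0.
have mS (C : set E) : measurable C -> measurable [set w | C (X n%:R^-1 w)].
  by move=> mC; rewrite -[X in measurable X]setTI; exact: mX.
apply: fine_le; [exact: (fin_num_measure P _ (mS _ mA))|exact: (fin_num_measure P _ (mS _ mB))|].
by apply: le_measure; rewrite ?inE; [exact: mS|exact: mS|move=> w; exact: AB].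
Qed.

Lemma closed_enorm_ge (rho : R) : closed [set z : E | rho <= enorm z].
Proof.
rewrite (_ : mkset _ = (@enorm R d) @^-1` [set r | rho <= r]); last by [].
by apply: closed_comp; [move=> z _; exact: continuous_enorm|exact: closed_ge].
Qed.

Lemma closed_measurable_rV (A : set E) : closed A -> measurable A.
Proof.
by move=> cA; rewrite -(setCK A); apply: measurableC; apply: open_measurable_rV; exact: closed_openC.
Qed.

(** The set is enlarged to the open set [enorm z > rho / 2], where [rate_liminf] applies, and then
    to its closed version, where the rates are bounded. *)
Lemma levy_fin (A : set E) rho : 0 < rho -> (forall z, A z -> rho <= enorm z) ->
  (levy_measure P X A < +oo)%E.
Proof.
move=> rho0 Arho; pose B : set E := [set z | rho / 2 < enorm z].
have r20 : 0 < rho / 2 by rewrite divr_gt0.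
have oB : open B.
  rewrite (_ : B = (@enorm R d) @^-1` [set r | rho / 2 < r]); last by [].
  by apply: open_comp; [move=> z _; exact: continuous_enorm|exact: open_gt].
have mB : measurable B by exact: open_measurable_rV.
have cF := @closed_enorm_ge (rho / 2).
have mF := closed_measurable_rV cF.
have [C hC] := rate_bounded hX mF r20 (fun z h => h) cF.
apply: (@le_lt_trans _ _ C%:E); last exact: ltry.
apply: (@le_trans _ _ (levy_measure P X B)).
  by apply: le_levy_measure => z /Arho; apply: lt_le_trans; lra.
apply: le_trans (rate_liminf hX mB oB) _.
rewrite limn_einf_lim; apply: lime_le; first exact: is_cvg_einfs.
apply: nearW => n; apply: (@le_trans _ _ (rate P X B n)%:E).
  by apply: ereal_inf_lbound; exists n => /=.
rewrite lee_fin; apply: le_trans (hC n); apply: le_rate => // z; exact: ltW.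
Qed.

End levy_finite.

(** * Second moments of small increments *)

Section second_moment.
Context (R : realType) (d : nat) (disp : measure_display)
  (Omega : measurableType disp) (P : probability Omega R)
  (X : R -> Omega -> 'rV[R]_d).
Hypothesis hX : levy_process P X.
Hypothesis symX : symmetric_process P X.
Local Notation E := 'rV[R]_d.

Let mX t : 0 <= t -> measurable_fun setT (X t). Proof. by case: hX => h _ _ _ _; exact: h. Qed.

Lemma bounded_integrable (f : Omega -> R) M : measurable_fun setT f ->
  (forall w, `|f w| <= M) -> P.-integrable setT (EFin \o f).
Proof.
move=> mf fM; apply: (@le_integrable _ _ _ P setT measurableT _ (cst M%:E)).
- exact/measurable_EFinP.
- by move=> w _ /=; rewrite lee_fin (le_trans (fM w))// ler_norm.
- exact: finite_measure_integrable_cst.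
Qed.

Lemma Rintegral_cst_prob (c : R) : \int[P]_w c = c.
Proof. by rewrite /Rintegral (integral_cst_prob P). Qed.

Lemma fkw00 x t1 t2 (f : R -> E) : fkw (fun=> 0) (fun=> 0) x t1 t2 f = 1%E.
Proof. by rewrite /fkw !integral0 oppe0 expeR0 mule1. Qed.

Lemma markov_increment (a b : E -> R) s t x (g : E -> \bar R) : 0 < s -> 0 <= t ->
  measurable_fun setT a -> measurable_fun setT b ->
  (forall y, 0 <= a y) -> (forall y, 0 <= b y) ->
  measurable_fun setT g -> (forall y, 0 <= g y)%E ->
  (\int[P]_w (fkw a b x 0 s (X ^~ w) * g (x + X (s + t) w)%R) =
   \int[P]_w (fkw a b x 0 s (X ^~ w) * \int[P]_w' g (x + X s w + X t w')%R))%E.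
Proof.
move=> s0 t0 ma mb a0 b0 mg g0.
have := @markov_fkw _ _ _ _ _ _ hX a b (fun=> 0) (fun=> 0) ma mb (measurable_cst _)
  (measurable_cst _) a0 b0 (fun=> lexx _) (fun=> lexx _) s t x (fun=> 1%E) g s0 t0 (measurable_cst _) mg (fun=> lee01) g0.
under eq_integral do rewrite fkw00 mule1 mul1e.
move=> ->; apply: eq_integral => w _; rewrite mule1; congr (_ * _)%E.
by apply: eq_integral => w' _; rewrite fkw00 mul1e.
Qed.

Lemma symmetric_integral t (g : E -> \bar R) : 0 <= t -> measurable_fun setT g ->
  (forall y, 0 <= g y)%E -> (\int[P]_w g (- X t w)%R = \int[P]_w g (X t w))%E.
Proof.
move=> t0 mg g0.
have mN : measurable_fun setT (fun w => - X t w) by apply: measurable_funN_rV; exact: mX.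
have mXt := mX t0.
have e1 := @ge0_integral_pushforward _ _ _ _ _ _ mN P setT g measurableT mg (fun y _ => g0 y).
have e2 := @ge0_integral_pushforward _ _ _ _ _ _ (mX t0) P setT g measurableT mg (fun y _ => g0 y).
rewrite preimage_setT in e1; rewrite preimage_setT in e2.
rewrite -[LHS]e1 -[RHS]e2.
have e A : measurable A -> A `<=` setT -> pushforward P (fun w => - X t w) A = pushforward P (X t) A.
  by move=> mA _; exact: symX.
exact: (eq_measure_integral _ e).
Qed.

Section coordinate.
Variable i : 'I_d.
(** The characteristic function of the coordinate at frequency 1, real because the process is
    symmetric. *)
Let phi t := \int[P]_w cos (X t w ord0 i).

Let mc t (f : R -> R) : continuous f -> 0 <= t -> measurable_fun setT (fun w => f (X t w ord0 i)).
Proof.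
move=> cf t0; apply: (measurableT_comp (continuous_measurable_fun cf)).
by apply: (measurableT_comp (measurable_coord i)); exact: mX.
Qed.

Let icos t : 0 <= t -> P.-integrable setT (EFin \o (fun w => cos (X t w ord0 i))).
Proof. by move=> t0; apply: (@bounded_integrable _ 1) => [|w]; [exact: mc (@continuous_cos R) t0|exact: cos_max]. Qed.

Let isin t : 0 <= t -> P.-integrable setT (EFin \o (fun w => sin (X t w ord0 i))).
Proof. by move=> t0; apply: (@bounded_integrable _ 1) => [|w]; [exact: mc (@continuous_sin R) t0|exact: sin_max]. Qed.

Let icst (c : R) : P.-integrable setT (EFin \o (fun _ : Omega => c)).
Proof. exact: finite_measure_integrable_cst. Qed.

Let integral_sin0 t : 0 <= t -> \int[P]_w sin (X t w ord0 i) = 0.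
Proof.
move=> t0.
have := @symmetric_integral t (fun y => (1 + sin (y ord0 i))%:E) t0.
have mg : measurable_fun setT (fun y : E => (1 + sin (y ord0 i))%:E).
  apply/measurable_EFinP; apply: measurable_funD => //.
  by apply: (measurableT_comp (continuous_measurable_fun (@continuous_sin R))); exact: measurable_coord.
have g0 (y : E) : (0 <= (1 + sin (y ord0 i))%:E)%E.
  by rewrite lee_fin -lerBlDl sub0r sin_geN1.
move=> /(_ mg g0) /(congr1 fine).
rewrite -[fine (\int[P]_w _)%E]/(\int[P]_w (1 + sin ((- X t w) ord0 i))).
rewrite -[X in _ = X]/(\int[P]_w (1 + sin (X t w ord0 i))).
have -> : \int[P]_w (1 + sin ((- X t w) ord0 i)) = \int[P]_w (1 - sin (X t w ord0 i)).
  by apply: eq_Rintegral => w _; rewrite mxE sinN.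
rewrite RintegralB//; last exact: isin.
rewrite RintegralD//; last exact: isin.
move: (\int[P]_w _) => c; lra.
Qed.

Let phiD s t : 0 < s -> 0 <= t -> phi (s + t) = phi s * phi t.
Proof.
move=> s0 t0.
(* The Markov property is stated for nonnegative functions, hence the added constant 1. *)
pose g (y : E) : \bar R := (1 + cos (y ord0 i))%:E.
have mg : measurable_fun setT g.
  apply/measurable_EFinP; apply: measurable_funD => //.
  by apply: (measurableT_comp (continuous_measurable_fun (@continuous_cos R))); exact: measurable_coord.
have g0 (y : E) : (0 <= g y)%E.
  by rewrite lee_fin -lerBlDl sub0r cos_geN1.
have zz (y : E) : 0 <= (fun=> 0) y :> R by [].
have := @markov_increment (fun=> 0) (fun=> 0) s t 0 g s0 t0 (measurable_cst _) (measurable_cst _) zz zz mg g0.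
under eq_integral do rewrite fkw00 mul1e.
under [X in _ = X -> _]eq_integral do rewrite fkw00 mul1e.
have e w : (\int[P]_w' g (0 + X s w + X t w')%R = (1 + phi t * cos (X s w ord0 i))%:E)%E.
  have fin : (\int[P]_w' g (0 + X s w + X t w')%R)%E \is a fin_num.
    apply: integrable_fin_num => //; apply: (@bounded_integrable (fun w' => 1 + cos ((0 + X s w + X t w') ord0 i)) 2).
      apply: measurable_funD => //.
      apply: (measurableT_comp (continuous_measurable_fun (@continuous_cos R))).
      apply: (measurableT_comp (measurable_coord i)); apply: measurable_funD_rV => //; exact: mX.
    move=> w'; rewrite (le_trans (ler_normD _ _))// normr1 -[2]/(1 + 1 : R) lerD2l cos_max//.
  rewrite -(fineK fin); congr EFin.
  rewrite -[LHS]/(\int[P]_w' (1 + cos ((0 + X s w + X t w') ord0 i))).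
  have -> : \int[P]_w' (1 + cos ((0 + X s w + X t w') ord0 i)) =
      \int[P]_w' ((1 + cos (X s w ord0 i) * cos (X t w' ord0 i)) - sin (X s w ord0 i) * sin (X t w' ord0 i)).
    by apply: eq_Rintegral => w' _; rewrite add0r mxE cosD addrA.
  have i1 : P.-integrable setT (EFin \o (fun w' => cos (X s w ord0 i) * cos (X t w' ord0 i))).
    apply: (@bounded_integrable _ 1) => [|w'].
      by apply: measurable_funM => //; exact: mc (@continuous_cos R) t0.
    by rewrite normrM mulr_ile1// cos_max.
  have i2 : P.-integrable setT (EFin \o (fun w' => sin (X s w ord0 i) * sin (X t w' ord0 i))).
    apply: (@bounded_integrable _ 1) => [|w'].
      by apply: measurable_funM => //; exact: mc (@continuous_sin R) t0.
    by rewrite normrM mulr_ile1// sin_max.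
  have i3 : P.-integrable setT (EFin \o (fun w' => 1 + cos (X s w ord0 i) * cos (X t w' ord0 i))).
    apply: (@bounded_integrable _ 2) => [|w'].
      apply: measurable_funD => //; apply: measurable_funM => //; exact: mc (@continuous_cos R) t0.
    rewrite (le_trans (ler_normD _ _))// normr1 -[2]/(1 + 1 : R) lerD2l.
    by rewrite normrM mulr_ile1// cos_max.
  rewrite (RintegralB measurableT i3 i2) (RintegralD measurableT (icst 1) i1).
  rewrite RintegralZl//; last exact: icos.
  rewrite RintegralZl//; last exact: isin.
  by rewrite integral_sin0// mulr0 subr0 Rintegral_cst_prob mulrC.
under [X in _ = X -> _]eq_integral do rewrite e.
move=> /(congr1 fine).
rewrite -[LHS]/(\int[P]_w (1 + cos ((0 + X (s + t) w) ord0 i))).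
rewrite -[X in _ = X]/(\int[P]_w (1 + phi t * cos (X s w ord0 i))).
have -> : \int[P]_w (1 + cos ((0 + X (s + t) w) ord0 i)) = \int[P]_w (1 + cos (X (s + t) w ord0 i)).
  by apply: eq_Rintegral => w _; rewrite add0r.
have st0 : 0 <= s + t by rewrite addr_ge0// ltW.
have s0' := ltW s0.
have i1 : P.-integrable setT (EFin \o (fun w => phi t * cos (X s w ord0 i))).
  apply: (@bounded_integrable _ `|phi t|) => [|w].
    by apply: measurable_funM => //; exact: mc (@continuous_cos R) s0'.
  by rewrite normrM ler_piMr// cos_max.
rewrite (RintegralD measurableT (icst 1) (icos st0)) (RintegralD measurableT (icst 1) i1) RintegralZl//; last exact: icos.
by move=> /addrI; rewrite mulrC.
Qed.

Let phi_expn n k : phi (k.+1%:R / n.+1%:R) = phi n.+1%:R^-1 ^+ k.+1.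
Proof.
elim: k => [|k IH]; first by rewrite mul1r expr1.
have h1 : 0 < k.+1%:R / n.+1%:R :> R by rewrite divr_gt0.
have h2 : 0 <= n.+1%:R^-1 :> R by rewrite invr_ge0.
have -> : k.+2%:R / n.+1%:R = k.+1%:R / n.+1%:R + n.+1%:R^-1 :> R by rewrite -(natr1 k.+1) mulrDl mul1r.
by rewrite phiD// IH -exprSr.
Qed.

Let phi_cvg : phi n.+1%:R^-1 @[n --> \oo] --> (1 : R).
Proof.
have h : (\int[P]_w (cos (X n.+1%:R^-1 w ord0 i))%:E @[n --> \oo] --> \int[P]_w (1%:E : \bar R))%E.
  apply: (@dominated_cvg _ _ _ P setT measurableT (fun n w => (cos (X n.+1%:R^-1 w ord0 i))%:E) _ (cst 1%E)) => //.
  - by move=> n; apply/measurable_EFinP; apply: mc; [exact: continuous_cos|rewrite invr_ge0].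
  - move=> w _; apply: cvg_EFin; first exact: nearW.
    have [rc _] : cadlag (X ^~ w) by case: hX.
    have X0 : X 0 w = 0 by case: hX.
    have c1 := rc 0 (lexx _); rewrite X0 in c1.
    have c2 : (n.+1%:R^-1 : R) @[n --> \oo] --> (0 : R)^'+.
      move=> A [e /= e0 hA]; have := @cvg_harmonic R.
      move=> /cvgrPdist_lt /(_ e e0) [N _ hN]; exists N => // n Nn; apply: hA; last by rewrite invr_gt0.
      by have := hN n Nn.
    have c3 : X n.+1%:R^-1 w @[n --> \oo] --> (0 : E) by exact: (cvg_comp _ _ c2 c1).
    have c4 : (cos ((X n.+1%:R^-1 w) ord0 i)) @[n --> \oo] --> cos ((0 : E) ord0 i).
      have cc : {for (0 : E), continuous (cos \o (fun y : E => y ord0 i))}.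
        by apply: continuous_comp; [exact: coord_continuous|exact: continuous_cos].
      exact: (cvg_comp _ _ c3 cc).
    by move: c4; rewrite mxE cos0.
  - exact: finite_measure_integrable_cst.
  - by move=> n w _ /=; rewrite lee_fin cos_max.
rewrite (integral_cst_prob P) in h.
exact: (fine_cvg h).
Qed.

Let phi1_gt0 : 0 < phi 1.
Proof.
have [N _ hN] : \forall n \near \oo, 0 < phi n.+1%:R^-1.
  have := phi_cvg => /cvgrPdist_lt /(_ 1 ltr01) [N _ hN]; exists N => // n /hN /=.
  by rewrite ltr_norml => /andP[_]; rewrite ltrBlDr -[X in X < _]addr0 ltrD2l.
have := phi_expn N N; rewrite divff// => ->.
by rewrite exprn_gt0//; exact: (hN N (leqnn N)).
Qed.

(** As the square of the value at half the time it is nonnegative, and a zero would make its power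
    [phi 1] vanish. *)
Let phi_gt0 n : 0 < phi n.+1%:R^-1.
Proof.
have h : phi n.+1%:R^-1 = phi (n.+1 * 2)%:R^-1 ^+ 2.
  have h0 : 0 < (n.+1 * 2)%:R^-1 :> R by rewrite invr_gt0.
  rewrite expr2 -(phiD h0 (ltW h0)).
  congr phi; rewrite natrM invfM; have : 0 < n.+1%:R^-1 :> R by rewrite invr_gt0.
  move: (n.+1%:R^-1) => r _; lra.
rewrite lt_neqAle; apply/andP; split; last by rewrite h sqr_ge0.
apply/eqP => e; have := phi_expn n n; rewrite divff// -e expr0n/= => e1.
by have := phi1_gt0; rewrite e1 ltxx.
Qed.

(** Since [phi 1] is the power of order [n + 1] of [phi (1 / (n + 1))], this is [ln u <= u - 1] at
    the latter. The right side is free of [n]. *)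
Let phi_rate n : n.+1%:R * (1 - phi n.+1%:R^-1) <= - ln (phi 1).
Proof.
have := phi_expn n n; rewrite divff// => ->; rewrite lnXn//.
rewrite -[X in _ <= X]mulNrn -[X in _ <= X]mulr_natl ler_pM2l//.
have p0 := phi_gt0 n; have h : -1 < phi n.+1%:R^-1 - 1 by lra.
have := le_ln1Dx h; rewrite addrC subrK; lra.
Qed.

(** Half-angle formula [1 - cos x = 2 sin (x / 2) ^+ 2], with [sin (x / 2) >= k x / 2] by the mean
    value theorem, where [k = cos (1 / 2)] is the least slope on [[0, 1 / 2]]. *)
Lemma one_sub_cos_ge : exists2 c : R, 0 < c & forall x : R, `|x| <= 1 -> c * x ^+ 2 <= 1 - cos x.
Proof.
have p2 := @pi_ge2 R.
pose k : R := cos 2^-1.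
have k0 : 0 < k by apply: cos_gt0_pihalf; lra.
exists (k ^+ 2 / 2) => [|x x1]; first by rewrite divr_gt0// exprn_gt0.
rewrite -(real_normK (num_real x)) -(cos_norm x); move: `|x| (normr_ge0 x) x1 => {}x x0 x1.
have x20 : 0 <= x / 2 by rewrite divr_ge0.
have [c] := @MVT_segment R sin cos 0 (x / 2) x20 (fun y _ => is_derive_sin y)
  (continuous_subspaceT (@continuous_sin R)).
rewrite in_itv/= sin0 !subr0 => /andP[c0 cx] e.
have kc : k <= cos c.
  rewrite /k leNgt ltr_cos ?in_itv/=; [rewrite -leNgt|rewrite ?in_itv/=..]; lra.
have s1 : k * (x / 2) <= sin (x / 2) by rewrite e ler_wpM2r// divr_ge0.
have -> : cos x = 1 - 2 * sin (x / 2) ^+ 2.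
  have {1}-> : x = (x / 2) *+ 2 by rewrite mulr2n; lra.
  by rewrite cos_mulr2n cos2sin2 mulr2n; lra.
have h0 : 0 <= k * (x / 2) by rewrite mulr_ge0 ?divr_ge0// ltW.
have := ler_pM h0 h0 s1 s1; rewrite !expr2; lra.
Qed.

Lemma coord_second_moment : exists C, forall n,
  (n.+1%:R%:E * \int[P]_w (X n.+1%:R^-1 w ord0 i ^+ 2 * (`|X n.+1%:R^-1 w ord0 i| <= 1)%R%:R)%R%:E <= C%:E)%E.
Proof.
have [c c0 hc] := one_sub_cos_ge; exists (c^-1 * - ln (phi 1)) => n.
have n0 : 0 <= n.+1%:R^-1 :> R by rewrite invr_ge0.
apply: (@le_trans _ _ (n.+1%:R%:E * (c^-1 * (1 - phi n.+1%:R^-1))%:E)%E); last first.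
  by rewrite -EFinM lee_fin mulrCA ler_pM2l ?invr_gt0.
apply: lee_wpmul2l => //.
have -> : ((c^-1 * (1 - phi n.+1%:R^-1))%:E = \int[P]_w (c^-1 * (1 - cos (X n.+1%:R^-1 w ord0 i)))%:E)%E.
  have ii : P.-integrable setT (EFin \o (fun w => 1 - cos (X n.+1%:R^-1 w ord0 i))).
    apply: (@bounded_integrable _ 2) => [|w].
      apply: measurable_funB => //; exact: mc (@continuous_cos R) n0.
    by rewrite (le_trans (ler_normB _ _))// normr1 -[2]/(1 + 1 : R) lerD2l cos_max.
  rewrite -{1}(Rintegral_cst_prob 1) -(RintegralB measurableT (icst 1) (icos n0)).
  rewrite -RintegralZl// /Rintegral fineK//.
  apply: integrable_fin_num => //.
  apply: (@bounded_integrable (fun w => c^-1 * (1 - cos (X n.+1%:R^-1 w ord0 i))) (c^-1 * 2)) => [|w].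
    apply: measurable_funM => //; apply: measurable_funB => //; exact: mc (@continuous_cos R) n0.
  rewrite normrM (ger0_norm (ltW _)) ?invr_gt0// ler_pM2l ?invr_gt0//.
  by rewrite (le_trans (ler_normB _ _))// normr1 -[2]/(1 + 1 : R) lerD2l cos_max.
apply: ge0_le_integral_nomeas => w.
  by rewrite lee_fin mulr_ge0// sqr_ge0.
rewrite lee_fin; case: (boolP (`|X n.+1%:R^-1 w ord0 i| <= 1)) => [h|_].
  by rewrite mulr1 mulrC ler_pdivlMr// mulrC; exact: hc.
by rewrite mulr0; apply: mulr_ge0; [rewrite invr_ge0 ltW|rewrite subr_ge0 cos_le1].
Qed.

End coordinate.

(** On increments of norm at most 1, each squared coordinate is at most a constant times [1 - cos],
    whose mean is of order [1 / n] by [phi_rate]. The uniform bound plays the part of the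
    integrability of the squared norm against the Levy measure near 0. *)
Lemma second_moment : exists2 C, 0 <= C & forall n,
  (n.+1%:R%:E * \int[P]_w (enorm (X n.+1%:R^-1 w) ^+ 2 * (enorm (X n.+1%:R^-1 w) <= 1)%R%:R)%:E <= C%:E)%E.
Proof.
have /choice[C hC] : forall i, exists C, forall n,
  (n.+1%:R%:E * \int[P]_w (X n.+1%:R^-1 w ord0 i ^+ 2 * (`|X n.+1%:R^-1 w ord0 i| <= 1)%R%:R)%R%:E <= C%:E)%E.
  by move=> i; exact: coord_second_moment.
have H n : (n.+1%:R%:E * \int[P]_w (enorm (X n.+1%:R^-1 w) ^+ 2 * (enorm (X n.+1%:R^-1 w) <= 1)%R%:R)%:E <= (\sum_i C i)%:E)%E.
  have n0 : 0 <= n.+1%:R^-1 :> R by rewrite invr_ge0.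
  pose F i w : \bar R := (X n.+1%:R^-1 w ord0 i ^+ 2 * (`|X n.+1%:R^-1 w ord0 i| <= 1)%R%:R)%R%:E.
  have mF i : measurable_fun setT (F i).
    apply/measurable_EFinP.
    have mXi : measurable_fun setT (fun w => X n.+1%:R^-1 w ord0 i).
      by apply: (measurableT_comp (measurable_coord i)); exact: mX.
    apply: measurable_funM; first exact: measurable_funX.
    rewrite (_ : (fun w => _) = \1_[set w | `|X n.+1%:R^-1 w ord0 i| <= 1]); last first.
      by apply/funext => w; rewrite indicE; congr (nat_of_bool _)%:R; apply/idP/idP; rewrite inE.
    apply: measurable_indic.
    rewrite (_ : mkset _ = (fun w => `|X n.+1%:R^-1 w ord0 i|) @^-1` `]-oo, 1]).
      rewrite -[X in measurable X]setTI.
      have m' : measurable_fun setT (fun w => `|X n.+1%:R^-1 w ord0 i|) by exact: measurableT_comp.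
      exact: m'.
    by apply/seteqP; split => w /=; rewrite in_itv.
  have F0 i w : (0 <= F i w)%E by rewrite lee_fin mulr_ge0// sqr_ge0.
  apply: (@le_trans _ _ (n.+1%:R%:E * \int[P]_w \sum_i F i w)%E).
    apply: lee_wpmul2l => //; apply: ge0_le_integral_nomeas => w.
      by rewrite lee_fin mulr_ge0// sqr_ge0.
    rewrite sumEFin lee_fin; case: (boolP (enorm (X n.+1%:R^-1 w) <= 1)) => h; last first.
      by rewrite mulr0 sumr_ge0// => i _; rewrite mulr_ge0// sqr_ge0.
    rewrite mulr1 sqr_enorm; apply: ler_sum => i _.
    by rewrite (le_trans (coord_le_enorm _ _) h) mulr1.
  rewrite ge0_integral_sum// ge0_sume_distrr; last by move=> i _; exact: integral_ge0.
  rewrite -sumEFin; apply: lee_sum => i _; exact: hC.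
exists (\sum_i C i) => //.
rewrite -lee_fin; apply: le_trans (H 0%N); apply: mule_ge0 => //.
by apply: integral_ge0 => w _; rewrite lee_fin mulr_ge0// sqr_ge0.
Qed.

End second_moment.

Lemma sum_nat_lt (R : nzSemiRingType) (J m : nat) : (m <= J)%N ->
  \sum_(j < J) (j < m)%N%:R = m%:R :> R.
Proof.
move=> mJ; rewrite -natr_sum; congr (_%:R).
have -> : (\sum_(j < J) (j < m)%N = minn J m)%N; last by apply/minn_idPr.
elim: J {mJ} => [|J IH]; first by rewrite big_ord0 min0n.
by rewrite big_ord_recr /= IH; lia.
Qed.

Section levy_limits.
Context (R : realType) (d : nat) (disp : measure_display)
  (Omega : measurableType disp) (P : probability Omega R)
  (X : R -> Omega -> 'rV[R]_d).
Hypothesis hX : levy_process P X.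
Local Notation E := 'rV[R]_d.
Variable nu : E -> R.
Hypothesis hnu : levy_density P X nu.

Lemma rate_integral (A : set E) n : measurable A ->
  ((rate P X A n)%:E = n%:R%:E * \int[P]_w (\1_A (X n%:R^-1 w))%:E)%E.
Proof.
move=> mA; have n0 : 0 <= n%:R^-1 :> R by rewrite invr_ge0.
have mS : measurable [set w | A (X n%:R^-1 w)].
  rewrite -[X in measurable X]setTI; case: hX => mX _ _ _ _; exact: mX.
rewrite /rate EFinM fineK; last exact: (fin_num_measure P _ mS).
congr (_ * _)%E; have := integral_indic P measurableT mS; rewrite setIT => h.
exact: (esym h).
Qed.

(** Layer-cake approximation: up to an error [del], [psi] is [del] times the number of levels
    [j del] below it. The level sets inside [F] are closed and finitely many, so [rate_limsup]
    applies to all of them at once. [del] makes the discretization error on [F] at most [eta / 2],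
    and [eta'] shares the other half among the [J] levels. *)
Lemma far_limsup (psi : E -> R) (H rho eta L : R) : 0 < rho -> continuous psi ->
  (forall z, 0 <= psi z) -> (forall z, psi z <= H) -> 0 < eta ->
  (\int[lebesgue_rV R d]_(z in [set z | (rho <= enorm z)%R]) (psi z * nu z)%:E <= L%:E)%E ->
  \forall n \near \oo, (n%:R%:E * \int[P]_w (psi (X n%:R^-1 w) *
     (rho <= enorm (X n%:R^-1 w))%R%:R)%:E <= (L + eta)%:E)%E.
Proof.
move=> rho0 cpsi psi0 psiH eta0 hL; set F : set E := [set z | (rho <= enorm z)%R] in hL *.
have cF : closed F by exact: closed_enorm_ge.
have mF : measurable F by exact: closed_measurable_rV.
have FT (A : set E) : A `<=` F -> (forall z, A z -> rho <= enorm z) by move=> AF z /AF.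
have [C0 hC0] := rate_bounded hX mF rho0 (FT _ (@subset_refl _ F)) cF.
pose C := Num.max C0 0; have C_ge0 : 0 <= C by rewrite le_max lexx orbT.
have hC n : rate P X F n <= C by rewrite le_max hC0.
pose del := eta / (2 * (C + 1)).
have C1 : 0 < C + 1 by rewrite ltr_wpDl.
have del0 : 0 < del by rewrite divr_gt0// mulr_gt0.
have H0 : 0 <= H by apply: le_trans (psi0 0) (psiH 0).
pose J := (Num.truncn (H / del)).+1.
pose A (j : 'I_J) : set E := F `&` [set z | j.+1%:R * del <= psi z].
have AF j : A j `<=` F by move=> z [].
have cA j : closed (A j).
  apply: closedI => //.
  rewrite (_ : mkset _ = psi @^-1` [set r | j.+1%:R * del <= r]); last by [].
  by apply: closed_comp; [move=> z _; exact: cpsi|exact: closed_ge].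
have mA j : measurable (A j) by exact: closed_measurable_rV.
have fA j : (levy_measure P X (A j) < +oo)%E by apply: (levy_fin hX rho0); exact: FT.
pose m z := Num.truncn (psi z / del).
have pd z : 0 <= psi z / del by rewrite divr_ge0// ltW.
have lm z (j : 'I_J) : (j.+1%:R * del <= psi z) = (j < m z)%N.
  by rewrite -ler_pdivlMr// /m truncn_ge_nat.
have mJ z : (m z <= J)%N.
  rewrite /m /J leqW//; apply: le_truncn; rewrite ler_pM2r ?invr_gt0//.
have mle z : del * (m z)%:R <= psi z.
  by rewrite mulrC -ler_pdivlMr//; have := truncn_itv (pd z) => /andP[].
have mlt z : psi z <= del * (m z)%:R + del.
  have := truncn_itv (pd z) => /andP[_]; rewrite ltr_pdivrMr// -natr1 mulrDl mul1r mulrC.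
  exact: ltW.
have eA z j : F z -> \1_(A j) z = (j < m z)%N%:R :> R.
  move=> Fz; rewrite indicE -lm; congr (nat_of_bool _)%:R.
  by apply/idP/idP => [|h]; rewrite inE; [case|split].
have nA z j : ~ F z -> \1_(A j) z = 0 :> R.
  by move=> nF; rewrite indicE memNset// => -[].
have nu0 z : F z -> 0 <= nu z.
  case: hnu => _ h _ Fz; apply: ltW; apply: h; apply: contraPN Fz => /eqP ->.
  by rewrite /F/= enorm0; apply/negP; rewrite -ltNge.
have mnu : measurable_fun setT nu by case: hnu.
have levyE j : levy_measure P X (A j) = (\int[lebesgue_rV R d]_(z in F) (nu z * \1_(A j) z)%:E)%E.
  case: hnu => _ _ h; rewrite h//.
  rewrite integral_mkcond [in RHS]integral_mkcond; apply: eq_integral => z _.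
  rewrite !patchE indicE; case: (boolP (z \in A j)) => [|_].
    by rewrite inE => zA; rewrite (mem_set (AF j _ zA)) mulr1.
  by rewrite mulr0; case: ifP.
have sumL : del * \sum_(j < J) fine (levy_measure P X (A j)) <= L.
  rewrite -lee_fin EFinM -sumEFin.
  rewrite (eq_bigr (fun j => levy_measure P X (A j))); last first.
    move=> j _; rewrite fineK// ge0_fin_numE//.
    by apply: integral_ge0 => w _; exact: counting_ge0.
  rewrite (eq_bigr (fun j => \int[lebesgue_rV R d]_(z in F) (nu z * \1_(A j) z)%:E)%E); last by move=> j _; exact: levyE.
  have mi j : measurable_fun F (fun z => (nu z * \1_(A j) z)%:E).
    apply: measurable_funTS; apply/measurable_EFinP; apply: measurable_funM => //; exact: measurable_indic.
  rewrite -ge0_integral_sum//; last by move=> j z Fz; rewrite lee_fin mulr_ge0//; exact: nu0.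
  rewrite -ge0_integralZl//; last 3 first.
  - by apply: emeasurable_sum => j; exact: mi.
  - by move=> z Fz; apply: sume_ge0 => j _; rewrite lee_fin mulr_ge0//; exact: nu0.
  - by rewrite lee_fin ltW.
  apply: le_trans hL; apply: ge0_le_integral => //.
  - move=> z Fz; apply: mule_ge0; first by rewrite lee_fin ltW.
    by apply: sume_ge0 => j _; rewrite lee_fin mulr_ge0//; exact: nu0.
  - by apply: measurable_funeM; apply: emeasurable_sum => j; exact: mi.
  - apply: measurable_funTS; apply/measurable_EFinP; apply: measurable_funM => //; exact: continuous_measurable_rV.
  - move=> z Fz; rewrite sumEFin -EFinM lee_fin -mulr_sumr mulrCA.
    rewrite (eq_bigr (fun j : 'I_J => (j < m z)%N%:R)); last by move=> j _; exact: eA.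
    by rewrite sum_nat_lt// [leRHS]mulrC; apply: ler_wpM2l; [exact: nu0|exact: mle].
pose eta' := eta / (2 * (del * J%:R)).
have J0 : 0 < J%:R :> R by rewrite ltr0n.
have eta'0 : 0 < eta' by rewrite divr_gt0// mulr_gt0// mulr_gt0.
have near_ : \forall n \near \oo, forall j, rate P X (A j) n <= fine (levy_measure P X (A j)) + eta'.
  apply: filter_forall => j.
  by apply: (rate_limsup hX (mA j) rho0 (FT _ (AF j)) (cA j) (fA j)).
have [N _ hN] := near_; exists N => // n /hN {}hN /=.
have n0 : 0 <= n%:R^-1 :> R by rewrite invr_ge0.
have mXn : measurable_fun setT (X n%:R^-1) by case: hX => mX _ _ _ _; exact: mX.
have mI (B : set E) : measurable B -> measurable_fun setT (fun w => (\1_B (X n%:R^-1 w))%:E : \bar R).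
  move=> mB; apply/measurable_EFinP.
  have m1 : measurable_fun setT (\1_B : E -> R) by exact: measurable_indic.
  exact: (measurableT_comp m1 mXn).
apply: (@le_trans _ _ (n%:R%:E * \int[P]_w (del%:E * ((\1_F (X n%:R^-1 w))%:E + \sum_(j < J) (\1_(A j) (X n%:R^-1 w))%:E)))%E).
  apply: lee_wpmul2l => //; apply: ge0_le_integral_nomeas => w.
    by rewrite lee_fin mulr_ge0.
  rewrite sumEFin -EFinD -EFinM lee_fin; case: (boolP (rho <= enorm (X n%:R^-1 w))) => h.
    have Fz : F (X n%:R^-1 w) by [].
    rewrite (eq_bigr (fun j : 'I_J => (j < m (X n%:R^-1 w))%N%:R)); last by move=> j _; exact: eA.
    rewrite sum_nat_lt// mulr1 indicE mem_set// mulrDr mulr1 addrC; exact: mlt.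
  by rewrite mulr0; apply: mulr_ge0; [exact: ltW|rewrite addr_ge0// sumr_ge0].
rewrite ge0_integralZl//; last 3 first.
- by apply: emeasurable_funD; [exact: mI|apply: emeasurable_sum => j; exact: mI].
- by move=> w _; apply: adde_ge0; [rewrite lee_fin|apply: sume_ge0 => j _; rewrite lee_fin].
- by rewrite lee_fin ltW.
rewrite ge0_integralD//; last 3 first.
- exact: mI.
- by move=> w _; apply: sume_ge0 => j _; rewrite lee_fin.
- by apply: emeasurable_sum => j; exact: mI.
rewrite ge0_integral_sum//; last by move=> j; exact: mI.
rewrite muleCA ge0_muleDr//; last 2 first.
- by apply: integral_ge0 => w _; rewrite lee_fin.
- by apply: sume_ge0 => j _; apply: integral_ge0 => w _; rewrite lee_fin.
rewrite ge0_sume_distrr; last by move=> j _; apply: integral_ge0 => w _; rewrite lee_fin.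
rewrite -(rate_integral n mF).
rewrite (eq_bigr (fun j => (rate P X (A j) n)%:E)); last by move=> j _; rewrite -(rate_integral n (mA j)).
rewrite sumEFin -EFinD -EFinM lee_fin mulrDr.
have s1 : del * rate P X F n <= eta / 2.
  apply: (@le_trans _ _ (del * (C + 1))); first by rewrite ler_pM2l//; have := hC n; lra.
  have -> : del * (C + 1) = eta / 2 by rewrite /del; field; rewrite lt0r_neq0.
  exact: lexx.
have s2 : del * \sum_(j < J) rate P X (A j) n <= L + eta / 2.
  apply: (@le_trans _ _ (del * \sum_(j < J) (fine (levy_measure P X (A j)) + eta'))).
    by rewrite ler_pM2l//; apply: ler_sum.
  rewrite big_split/= sumr_const card_ord mulrDr; apply: lerD => //.
  have -> : del * (eta' *+ J) = eta / 2; last exact: lexx.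
  rewrite -mulr_natr /eta'; have gf (x y : R) : 0 < x -> 0 < y -> x * (eta / (2 * (x * y)) * y) = eta / 2.
    by move=> x0 y0; field; rewrite !lt0r_neq0.
  exact: gf.
lra.
Qed.

End levy_limits.

(** * Dynkin comparison for the killed process *)

Lemma ecvg_eps (R : realType) (u : (\bar R)^nat) (l : R) :
  (forall eta, 0 < eta -> \forall n \near \oo, ((l - eta)%:E <= u n /\ u n <= (l + eta)%:E)%E) ->
  u @ \oo --> l%:E.
Proof.
move=> h; apply/fine_cvgP; split.
  have [N _ hN] := h 1 ltr01; exists N => // n /hN [h1 h2].
  by rewrite fin_real// (lt_le_trans (ltNyr _) h1) (le_lt_trans h2 (ltry _)).
apply/cvgrPdist_le => e e0; have [N _ hN] := h e e0; exists N => // n /hN /= [].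
by case: (u n) => [r| |]//=; rewrite !lee_fin => h1 h2; rewrite ler_norml; lra.
Qed.

Lemma itv_avg_cvg (R : realType) (F : R -> R) (r : R) : measurable_fun setT F ->
  (forall s, 0 <= F s) -> F s @[s --> r^'+] --> F r ->
  (n.+1%:R%:E * \int[@lebesgue_measure R]_(u in `[r, (r + n.+1%:R^-1)%R]) (F u)%:E)%E
    @[n --> \oo] --> (F r)%:E.
Proof.
move=> mF F0 cF; apply: ecvg_eps => eta eta0.
have /cF [e /= e0 he] : nbhs (F r) (ball (F r) eta) by exact: nbhsx_ballx.
have [N _ hN] : \forall n \near \oo, (n.+1%:R^-1 : R) < e.
  have /cvgrPdist_lt /(_ e e0) := @cvg_harmonic R; apply: filterS => n.
  by rewrite /= sub0r normrN ger0_norm.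
exists N => // n /hN ne.
have n0 : 0 < n.+1%:R^-1 :> R by rewrite invr_gt0.
have H u : r <= u -> u <= r + n.+1%:R^-1 -> F r - eta <= F u <= F r + eta.
  rewrite le_eqVlt => /orP[/eqP <- _|ru ur]; first lra.
  have /= : ball (F r) eta (F u).
    apply: he => //=; rewrite /ball/= distrC gtr0_norm ?subr_gt0// ltrBlDl.
    by apply: le_lt_trans ur _; rewrite ltrD2l.
  by rewrite /ball/= ltr_norml; lra.
have mFe : measurable_fun setT (fun u => (F u)%:E : \bar R) by exact/measurable_EFinP.
rewrite (@ge0_integral_itv_addl R r n.+1%:R^-1 (fun u => (F u)%:E) mFe (fun u => F0 u)).
have mFr : measurable_fun (`[0, n.+1%:R^-1]%classic : set (measurableTypeR R)) (fun u : R => (F (r + u))%:E : \bar R).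
  by apply: measurable_funTS; exact: (measurableT_comp mFe (@measurable_addl R r)).
have nc (c : R) : (n.+1%:R%:E * (c * n.+1%:R^-1)%:E)%E = c%:E.
  by rewrite -EFinM mulrCA divff// mulr1.
split.
  apply: (@le_trans _ _ (Num.max 0 (F r - eta))%:E); first by rewrite lee_fin le_max lexx orbT.
  rewrite -(nc (Num.max 0 _)); apply: lee_wpmul2l => //.
  rewrite -integral_cst_itv; last exact: ltW.
  apply: ge0_le_integral => //.
  - by move=> u _; rewrite lee_fin le_max lexx.
  - move=> u /=; rewrite in_itv/= => /andP[u0 u1]; rewrite lee_fin ge_max F0/=.
    by have /andP[] := H (r + u) ltac:(by rewrite lerDl) ltac:(by rewrite lerD2l).
rewrite -(nc (F r + eta)); apply: lee_wpmul2l => //.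
rewrite -integral_cst_itv; last exact: ltW.
apply: ge0_le_integral => //.
- by move=> u _; rewrite lee_fin.
- move=> u /=; rewrite in_itv/= => /andP[u0 u1]; rewrite lee_fin.
  by have /andP[] := H (r + u) ltac:(by rewrite lerDl) ltac:(by rewrite lerD2l).
Qed.

Lemma ge0_integral_itv_split (R : realType) (f : R -> \bar R) (a c : R) (b : itv_bound R) :
  measurable_fun setT f -> (forall x, 0 <= f x)%E -> a <= c -> (BLeft c <= b)%O ->
  (\int[@lebesgue_measure R]_(x in [set` Interval (BLeft a) b]) f x =
   \int[@lebesgue_measure R]_(x in `[a, c]) f x +
   \int[@lebesgue_measure R]_(x in [set` Interval (BLeft c) b]) f x)%E.
Proof.
move=> mf f0 ac cb.
have m1 : measurable_fun ([set` Interval (BLeft a) (BLeft c)] : set (measurableTypeR R)) f.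
  exact: (measurable_funTS mf).
rewrite -(integral_itv_bndo_bndc m1).
have U : [set` Interval (BLeft a) b] = [set` Interval (BLeft a) (BLeft c)] `|` [set` Interval (BLeft c) b] :> set R.
  by rewrite -itv_bndbnd_setU ?bnd_simp.
rewrite U ge0_integral_setU.
- reflexivity.
- exact: measurable_itv.
- exact: measurable_itv.
- exact: (measurable_funTS mf).
- by move=> x _; exact: f0.
- apply/disj_setPLR => r /=; rewrite !in_itv/= => /andP[_ rs]; apply/negP.
  by rewrite negb_and -ltNge rs.
Qed.

Section path_dynkin.
Context (R : realType).
Local Notation mu := (@lebesgue_measure R).
Variables (q F : R -> R) (g : R -> \bar R).
Hypotheses (mq : measurable_fun setT q) (mF : measurable_fun setT F)
  (mg : measurable_fun setT g).
Hypotheses (q0 : forall s, 0 <= q s) (F0 : forall s, 0 <= F s).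
Hypothesis qfin : forall T, 0 <= T -> (\int[mu]_(u in `[0%R, T]) (q u)%:E < +oo)%E.
Hypothesis gE : forall s, 0 <= s -> g s = expeR (- \int[mu]_(u in `[0%R, s]) (q u)%:E)%E.
Hypothesis g0 : forall s, (0 <= g s)%E.

Let iq T : 0 <= T -> mu.-integrable `[0, T] (EFin \o q).
Proof.
move=> T0; apply/integrableP; split.
  by apply: measurable_funTS; apply/measurable_EFinP.
by under eq_integral do rewrite /= ger0_norm//; exact: qfin.
Qed.

Let mqg : measurable_fun setT (fun s => (q s)%:E * g s)%E.
Proof. by apply: emeasurable_funM => //; exact/measurable_EFinP. Qed.

Let qg0 s : (0 <= (q s)%:E * g s)%E.
Proof. by apply: mule_ge0 => //; rewrite lee_fin. Qed.

Let g_init T : 0 <= T ->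
  (1 = g T + \int[mu]_(s in `[0%R, T]) ((q s)%:E * g s))%E.
Proof.
move=> T0; have i0 : mu.-integrable `[0, T] (EFin \o (fun=> 0 : R)) by exact: integrable0.
have qq (u : R) : q u + (fun=> 0) u = (fun=> 0) u + q u by rewrite addr0 add0r.
have := path_duhamel T0 (fun=> lexx 0) (fun=> lexx 0) q0 q0 qq i0 i0 (iq T0).
rewrite !integral0 oppe0 expeR0 mule1 -(gE T0) => ->; congr (_ + _)%E.
apply: eq_integral => s; rewrite inE/= in_itv/= => /andP[s0 _].
by rewrite !integral0 oppe0 expeR0 !mule1 -(gE s0) muleC.
Qed.

Let int_fin T : 0 <= T -> (\int[mu]_(s in `[0%R, T]) ((q s)%:E * g s))%E \is a fin_num.
Proof.
move=> T0; rewrite ge0_fin_numE; last by apply: integral_ge0 => s _; exact: qg0.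
apply: (@le_lt_trans _ _ 1%E); last exact: ltry.
by rewrite [leRHS](g_init T0) leeDr.
Qed.

Lemma path_weight_split s t : 0 <= s -> s <= t ->
  (g s = g t + \int[mu]_(r in `[s, t]) ((q r)%:E * g r))%E.
Proof.
move=> s0 st; have t0 := le_trans s0 st.
have e : (\int[mu]_(r in `[0%R, t]) ((q r)%:E * g r) =
    \int[mu]_(r in `[0%R, s]) ((q r)%:E * g r) + \int[mu]_(r in `[s, t]) ((q r)%:E * g r))%E.
  by apply: (ge0_integral_itv_split mqg qg0 s0); rewrite bnd_simp.
have := g_init s0; rewrite {1}(g_init t0) e; move: (int_fin s0).
case: (\int[mu]_(r in `[0%R, s]) ((q r)%:E * g r))%E => [x| |]// _ h.
by rewrite -[LHS](@addeK _ x%:E)// -h addeCA [X in (X - _)%E]addeC addeK.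
Qed.

Lemma path_weight_le1 : (\int[mu]_(s in `[0%R, +oo[) ((q s)%:E * g s) <= 1)%E.
Proof.
have nd : nondecreasing_seq (fun n => `[0%R, n%:R]%classic : set R).
  by move=> m n mn; apply/subsetPset; apply: subset_itvl; rewrite bnd_simp ler_nat.
have U : \bigcup_n `[0%R, n%:R]%classic = `[0%R, +oo[%classic :> set R.
  apply/seteqP; split => [s [n _]|s] /=; rewrite !in_itv/= ?andbT; first by case/andP.
  move=> s0; exists (Num.truncn s).+1 => //=; rewrite in_itv/= s0/= ltW//.
  by rewrite truncnS_gt.
have := @ge0_nondecreasing_set_cvg_integral _ _ R (fun n => `[0%R, n%:R]%classic : set (measurableTypeR R))
  (fun s => (q s)%:E * g s)%E mu nd (fun n => measurable_itv _).
rewrite U => /(_ (fun n => measurable_funTS mqg)) /(_ (fun n s _ => qg0 s)) cv.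
rewrite -(cvg_lim _ cv)//; apply: lime_le; first by apply/cvg_ex; eexists; exact: cv.
apply: nearW => n; rewrite [leRHS](g_init (ler0n R n)) leeDr//.
Qed.

(** After the shift [u = s + eps], the first integral carries [g (u - eps)], which
    [path_weight_split] writes as [g u] plus the integral of [q g] over [[u - eps, u]]; Tonelli
    exchanges the two integrations. The second term on the left is the part of the integral over
    [[0, eps]] that the shift has lost. Nothing is differentiated and nothing subtracted. *)
Lemma path_dynkin eps : 0 < eps ->
  (\int[mu]_(s in `[0%R, +oo[) (g s * (F (s + eps)%R)%:E) +
   \int[mu]_(s in `[0%R, eps]) (g s * (F s)%:E) =
   \int[mu]_(s in `[0%R, +oo[) (g s * (F s)%:E) +
   \int[mu]_(r in `[0%R, +oo[) ((q r)%:E * g r *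
     \int[mu]_(u in `[Num.max r eps, (r + eps)%R]) (F u)%:E))%E.
Proof.
move=> e0; have mFe : measurable_fun setT (fun u => (F u)%:E : \bar R) by exact/measurable_EFinP.
have mgF : measurable_fun setT (fun s => g s * (F s)%:E)%E by exact: emeasurable_funM.
have gF0 s : (0 <= g s * (F s)%:E)%E by rewrite mule_ge0// lee_fin.
have mgs : measurable_fun setT (fun u : R => g (u - eps)).
  apply: (measurableT_comp mg); apply: measurable_funB => //.
have pre : (fun v => eps + v) @^-1` `[eps, +oo[%classic = `[0, +oo[%classic :> set R.
  by apply/seteqP; split => u /=; rewrite !in_itv/= !andbT lerDl.
have -> : (\int[mu]_(s in `[0%R, +oo[) (g s * (F (s + eps)%R)%:E) =
    \int[mu]_(u in `[eps, +oo[) (g (u - eps)%R * (F u)%:E))%E.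
  have mgsF : measurable_fun setT (fun u : R => g (u - eps) * (F u)%:E)%E by exact: emeasurable_funM.
  rewrite [RHS](@ge0_integral_addl R eps)//; last 2 first.
  - exact: (measurable_funTS mgsF).
  - by move=> u; rewrite mule_ge0// lee_fin.
  by rewrite pre; apply: eq_integral => s _; rewrite [(eps + s)%R]addrC addrK.
have [H HE] : exists H : measurableTypeR R * measurableTypeR R -> \bar R, forall z, H z =
    if [&& eps <= z.1, z.1 - eps <= z.2 & z.2 <= z.1] then ((q z.2)%:E * g z.2 * (F z.1)%:E)%E else 0%E.
  by eexists; move=> z; reflexivity.
have mH : measurable_fun setT H.
  rewrite (funext HE); apply: measurable_fun_ifT => //.
    apply: measurable_and; first exact: measurable_fun_ler.
    apply: measurable_and; last exact: measurable_fun_ler.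
    by apply: measurable_fun_ler => //; apply: measurable_funB.
  apply: emeasurable_funM; first exact: (measurableT_comp mqg).
  exact: (measurableT_comp mFe).
have H0 z : (0 <= H z)%E by rewrite HE; case: ifP => // _; apply: mule_ge0; [exact: qg0|rewrite lee_fin].
have ton := @fubini_tonelli _ _ _ _ _ mu mu H mH H0.
have mHF := @measurable_fun_fubini_tonelli_F _ _ _ _ _ mu H mH H0.
have e1 : (\int[mu]_(u in `[eps, +oo[) (g (u - eps)%R * (F u)%:E) =
   \int[mu]_(u in `[eps, +oo[) (g u * (F u)%:E) + \int[mu]_u \int[mu]_r H (u, r))%E.
  have -> : (\int[mu]_u \int[mu]_r H (u, r) = \int[mu]_(u in `[eps, +oo[) \int[mu]_r H (u, r))%E.
    rewrite [RHS]integral_mkcond; apply: eq_integral => u _; rewrite patchE.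
    case: ifPn => [_|]; first reflexivity.
    rewrite notin_setE/= in_itv/= andbT => /negP ue.
    by apply: integral0_eq => r _; rewrite HE/= (negbTE ue).
  rewrite -ge0_integralD//; last 3 first.
  - exact: (measurable_funTS mgF).
  - by move=> u _; apply: integral_ge0.
  - exact: (measurable_funTS mHF).
  apply: eq_integral => u; rewrite inE/= in_itv/= andbT => ue.
  have h1 : 0 <= u - eps by rewrite subr_ge0.
  have h2 : u - eps <= u by rewrite lerBlDr lerDl ltW.
  rewrite (path_weight_split h1 h2).
  rewrite ge0_muleDl//; last by apply: integral_ge0.
  congr (_ + _)%E; rewrite -ge0_integralZr//; last 2 first.
  - exact: (measurable_funTS mqg).
  - by rewrite lee_fin.
  rewrite integral_mkcond; apply: eq_integral => r _; rewrite patchE HE/= ue/=.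
  by rewrite mem_setE/= in_itv/=.
have e2 : (\int[mu]_(s in `[0%R, +oo[) (g s * (F s)%:E) =
    \int[mu]_(s in `[0%R, eps]) (g s * (F s)%:E) + \int[mu]_(u in `[eps, +oo[) (g u * (F u)%:E))%E.
  by apply: (ge0_integral_itv_split mgF gF0 (ltW e0)).
have e3 : (\int[mu]_r \int[mu]_u H (u, r) = \int[mu]_(r in `[0%R, +oo[) ((q r)%:E * g r *
     \int[mu]_(u in `[Num.max r eps, (r + eps)%R]) (F u)%:E))%E.
  rewrite [RHS]integral_mkcond; apply: eq_integral => r _; rewrite patchE.
  case: ifPn => [|]; last first.
    rewrite notin_setE/= in_itv/= andbT => /negP; rewrite -ltNge => r0.
    apply: integral0_eq => u _; rewrite HE/=; case: ifP => // /and3P[h1 h2 h3].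
    by move: r0; rewrite ltNge (le_trans _ h2)// subr_ge0.
  rewrite inE/= in_itv/= andbT => r0.
  rewrite -ge0_integralZl//; last 2 first.
  - exact: (measurable_funTS mFe).
  - by move=> u _; rewrite lee_fin.
  rewrite [RHS]integral_mkcond; apply: eq_integral => u _; rewrite patchE HE/=.
  rewrite mem_setE/= in_itv/= ge_max lerBlDr.
  by case: (r <= u); case: (eps <= u); case: (u <= r + eps).
by rewrite e1 ton e3 e2 addeAC; congr (_ + _)%E; exact: addeC.
Qed.

End path_dynkin.

Lemma le_limit_add (R : realType) (u t : (\bar R)^nat) (l a : \bar R) :
  u @ \oo --> l -> t @ \oo --> 0%E -> (forall n, (u n <= a + t n)%E) -> (l <= a)%E.
Proof.
move=> cu ct ut; apply/lee_addgt0Pr => eta eta0.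
have [N _ hN] : \forall n \near \oo, (t n < eta%:E)%E.
  have : nbhs (0%E : \bar R) [set z | (z < eta%:E)%E].
    by apply: open_nbhs_nbhs; split; [exact: open_ereal_lt_ereal|rewrite /= lte_fin].
  by move=> /ct [N _ hN]; exists N.
rewrite -(cvg_lim _ cu)//; apply: lime_le; first by apply/cvg_ex; eexists; exact: cu.
exists N => // n /hN /= tn; apply: le_trans (ut n) _; apply: leeD2l; exact: ltW.
Qed.

Lemma ae_integral_add_eq (R : realType) dT (T : measurableType dT)
    (mu : {measure set T -> \bar R}) (a b c d : T -> \bar R) :
  measurable_fun setT a -> measurable_fun setT b -> measurable_fun setT c -> measurable_fun setT d ->
  (forall x, 0 <= a x)%E -> (forall x, 0 <= b x)%E -> (forall x, 0 <= c x)%E -> (forall x, 0 <= d x)%E ->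
  {ae mu, forall x, (a x + b x = c x + d x)%E} ->
  (\int[mu]_x a x + \int[mu]_x b x = \int[mu]_x c x + \int[mu]_x d x)%E.
Proof.
move=> ma mb mc md a0 b0 c0 d0 h; rewrite -!ge0_integralD//.
apply: ge0_ae_eq_integral => //.
- exact: emeasurable_funD.
- exact: emeasurable_funD.
- by move=> x _; exact: adde_ge0.
- by move=> x _; exact: adde_ge0.
- by apply: filterS h => x hx _.
Qed.

(** * The Green operator of the killed process *)

Section green_fk.
Context (R : realType) (d : nat) (disp : measure_display)
  (Omega : measurableType disp) (P : probability Omega R)
  (X : R -> Omega -> 'rV[R]_d).
Hypothesis hX : levy_process P X.
Local Notation E := 'rV[R]_d.
Local Notation leb := (@lebesgue_measure R).

Let mX t : 0 <= t -> measurable_fun setT (X t). Proof. by case: hX => h _ _ _ _; exact: h. Qed.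

Variables (q : E -> R) (K : R).
Hypotheses (mq : measurable_fun setT q) (K0 : 0 < K) (qK : forall y, K <= q y).

Let q0 y : 0 <= q y. Proof. exact: le_trans (ltW K0) (qK y). Qed.

Definition killing x s w : \bar R := fkw q (fun=> 0) x 0 s (X ^~ w).

(* The operator [G] of the introduction, for the killing rate [q]. *)
Fact green_fk_key : unit. Proof. by []. Qed.

Definition green_fk : (E -> \bar R) -> E -> \bar R := locked_with green_fk_key
  (fun psi x => \int[P]_w \int[leb]_(s in `[0%R, +oo[) (killing x s w * psi (x + X s w)%R))%E.

Lemma green_fk_def psi x : green_fk psi x =
  (\int[P]_w \int[leb]_(s in `[0%R, +oo[) (killing x s w * psi (x + X s w)%R))%E.
Proof. by rewrite /green_fk unlock. Qed.

Definition green_integrand (psi : E -> \bar R) x (z : Omega * measurableTypeR R) : \bar R :=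
  if 0 <= z.2 then (killing x z.2 z.1 * psi (x + X z.2 z.1)%R)%E else 0%E.

Lemma killing_ge0 x s w : (0 <= killing x s w)%E. Proof. exact: fkw_ge0. Qed.

Lemma killingE x s w : killing x s w = expeR (- \int[leb]_(u in `[0%R, s]) (q (x + X u w)%R)%:E)%E.
Proof. by rewrite /killing /fkw integral0 expeR0 mule1. Qed.

Lemma killing_le1 x s w : (killing x s w <= 1)%E.
Proof.
rewrite killingE -[leRHS]expeR0 lee_expeR oppe_le0; apply: integral_ge0 => u _.
by rewrite lee_fin.
Qed.

Lemma killing_fin x s w : killing x s w \is a fin_num.
Proof. by rewrite ge0_fin_numE ?killing_ge0// (le_lt_trans (killing_le1 x s w))// ltry. Qed.

Let mabs : measurable_fun setT (fun z : Omega * measurableTypeR R => `|z.2| : measurableTypeR R).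
Proof. exact: (measurableT_comp (@normr_measurable R setT) measurable_snd). Qed.

Lemma measurable_killing x : measurable_fun setT
  (fun z : Omega * measurableTypeR R => killing x `|z.2| z.1).
Proof.
apply: (@measurable_fkw _ _ _ _ _ _ hX _ _ (fun=> 0) (fun z : Omega * measurableTypeR R => `|z.2|) (fun=> x) fst q (fun=> 0)) => //.
Qed.

Lemma measurable_levy_abs x : measurable_fun setT
  (fun z : Omega * measurableTypeR R => x + X `|z.2| z.1).
Proof.
apply: measurable_funD_rV => //.
exact: (@measurable_levy_at _ _ _ _ _ _ hX _ _ (fun z : Omega * measurableTypeR R => `|z.2|) fst).
Qed.

Let measurable_nneg (G : Omega * measurableTypeR R -> \bar R) : measurable_fun setT G ->
  measurable_fun setT (fun z : Omega * measurableTypeR R => if 0 <= z.2 then G z else 0%E).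
Proof.
by move=> mG; apply: measurable_fun_ifT => //; exact: measurable_fun_ler.
Qed.

Lemma measurable_green_integrand psi x : measurable_fun setT psi ->
  measurable_fun setT (green_integrand psi x).
Proof.
move=> mpsi.
rewrite (_ : green_integrand psi x = fun z : Omega * measurableTypeR R =>
    if 0 <= z.2 then (killing x `|z.2| z.1 * psi (x + X `|z.2| z.1)%R)%E else 0%E); last first.
  by apply/funext => z; rewrite /green_integrand; case: ifP => // z0; rewrite ger0_norm.
apply: measurable_nneg; apply: emeasurable_funM; first exact: measurable_killing.
exact: (measurableT_comp mpsi (measurable_levy_abs x)).
Qed.

Lemma green_integrand_ge0 psi x z : (forall y, 0 <= psi y)%E -> (0 <= green_integrand psi x z)%E.
Proof. by move=> p0; rewrite /green_integrand; case: ifP => // _; rewrite mule_ge0// killing_ge0. Qed.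

Let int_nneg (G : Omega -> R -> \bar R) w :
  (\int[leb]_(s in `[0%R, +oo[) G w s = \int[leb]_s (if (0 <= s)%R then G w s else 0))%E.
Proof.
rewrite [LHS]integral_mkcond; apply: eq_integral => s _; rewrite patchE.
by rewrite mem_setE/= in_itv/= andbT.
Qed.

Lemma green_fkE psi x : measurable_fun setT psi -> (forall y, 0 <= psi y)%E ->
  green_fk psi x = (\int[P \x leb]_z green_integrand psi x z)%E.
Proof.
move=> mp p0; have mG := @measurable_green_integrand psi x mp.
have G0 z := @green_integrand_ge0 psi x z p0.
rewrite green_fk_def (@fubini_tonelli1 _ _ _ _ _ P leb _ mG G0); apply: eq_integral => w _.
exact: (int_nneg (fun w s => killing x s w * psi (x + X s w)%R)%E).
Qed.

Lemma le_green_fk psi1 psi2 x : (forall y, 0 <= psi1 y)%E -> (forall y, psi1 y <= psi2 y)%E ->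
  (green_fk psi1 x <= green_fk psi2 x)%E.
Proof.
move=> p0 p12; rewrite !green_fk_def; apply: ge0_le_integral_nomeas => w.
  by apply: integral_ge0 => s _; rewrite mule_ge0// killing_ge0.
rewrite !(int_nneg (fun w s => killing x s w * _ (x + X s w)%R)%E).
apply: ge0_le_integral_nomeas => s; case: ifP => // _.
  by rewrite mule_ge0// killing_ge0.
by apply: lee_wpmul2l; rewrite ?killing_ge0.
Qed.

Lemma green_fk_ge0 psi x : (forall y, 0 <= psi y)%E -> (0 <= green_fk psi x)%E.
Proof.
move=> p0; rewrite green_fk_def; apply: integral_ge0 => w _; apply: integral_ge0 => s _.
by rewrite mule_ge0// killing_ge0.
Qed.

Lemma green_fkD psi1 psi2 x : measurable_fun setT psi1 -> measurable_fun setT psi2 ->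
  (forall y, 0 <= psi1 y)%E -> (forall y, 0 <= psi2 y)%E ->
  green_fk (fun y => psi1 y + psi2 y)%E x = (green_fk psi1 x + green_fk psi2 x)%E.
Proof.
move=> m1 m2 p1 p2; have m12 : measurable_fun setT (fun y => psi1 y + psi2 y)%E by exact: emeasurable_funD.
have p12 y : (0 <= psi1 y + psi2 y)%E by exact: adde_ge0.
rewrite (green_fkE x m12 p12) (green_fkE x m1 p1) (green_fkE x m2 p2).
rewrite -ge0_integralD; [|exact: measurableT|..].
- apply: eq_integral => z _; rewrite /green_integrand; case: ifP => _; last by rewrite adde0.
  by rewrite ge0_muleDr.
- by move=> z _; exact: green_integrand_ge0.
- exact: measurable_green_integrand.
- by move=> z _; exact: green_integrand_ge0.
- exact: measurable_green_integrand.
Qed.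

Lemma green_fkZ (c : R) psi x : 0 <= c -> measurable_fun setT psi -> (forall y, 0 <= psi y)%E ->
  green_fk (fun y => c%:E * psi y)%E x = (c%:E * green_fk psi x)%E.
Proof.
move=> c0 m1 p1; have mc : measurable_fun setT (fun y => c%:E * psi y)%E by exact: measurable_funeM.
have pc y : (0 <= c%:E * psi y)%E by exact: mule_ge0.
rewrite (green_fkE x mc pc) (green_fkE x m1 p1).
rewrite -ge0_integralZl; [|exact: measurableT|..].
- apply: eq_integral => z _; rewrite /green_integrand; case: ifP => _; last by rewrite mule0.
  by rewrite muleCA.
- exact: measurable_green_integrand.
- by move=> z _; exact: green_integrand_ge0.
- by rewrite lee_fin.
Qed.

Hypothesis qloc : forall x, {ae P, forall w, forall T, 0 <= T ->
  (\int[leb]_(u in `[0%R, T]) (q (x + X u w)%R)%:E < +oo)%E}.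

Let mpath (x : E) (a : E -> R) w : measurable_fun setT a ->
  measurable_fun setT (fun u : R => a (x + X `|u| w)).
Proof.
move=> ma; apply: (measurableT_comp ma).
have m2 : measurable_fun setT (fun u : measurableTypeR R => (w, u)) by exact: measurable_pair1.
exact: (measurableT_comp (measurable_levy_abs x) m2).
Qed.

Let mkpath (x : E) w : measurable_fun setT (fun u : R => killing x `|u| w).
Proof.
have m2 : measurable_fun setT (fun u : measurableTypeR R => (w, u)) by exact: measurable_pair1.
exact: (measurableT_comp (measurable_killing x) m2).
Qed.

Let itv_abs T (G1 G2 : R -> \bar R) : (forall u, 0 <= u -> G1 u = G2 u) ->
  (\int[leb]_(u in `[0%R, T]) G1 u = \int[leb]_(u in `[0%R, T]) G2 u)%E.
Proof. by move=> h; apply: eq_integral => u; rewrite inE/= in_itv/= => /andP[u0 _]; exact: h. Qed.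

Let itv_abs_oo (G1 G2 : R -> \bar R) : (forall u, 0 <= u -> G1 u = G2 u) ->
  (\int[leb]_(u in `[0%R, +oo[) G1 u = \int[leb]_(u in `[0%R, +oo[) G2 u)%E.
Proof. by move=> h; apply: eq_integral => u; rewrite inE/= in_itv/= andbT => u0; exact: h. Qed.

Let qfin_abs x w : (forall T, 0 <= T -> (\int[leb]_(u in `[0%R, T]) (q (x + X u w)%R)%:E < +oo)%E) ->
  forall T, 0 <= T -> (\int[leb]_(u in `[0%R, T]) (q (x + X `|u| w)%R)%:E < +oo)%E.
Proof.
move=> h T T0; rewrite (@itv_abs _ _ (fun u => (q (x + X u w))%:E)); first exact: h.
by move=> u u0; rewrite ger0_norm.
Qed.

Let kE_abs x w s : 0 <= s ->
  killing x `|s| w = expeR (- \int[leb]_(u in `[0%R, s]) (q (x + X `|u| w)%R)%:E)%E.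
Proof.
move=> s0; rewrite killingE ger0_norm//; congr (expeR (- _)%E); apply: itv_abs => u u0.
by rewrite ger0_norm.
Qed.

(** [q exp (- int q)] is the density of the killing time along a path, so its integral is at most 1.
    This bound provides the domination for the limits below. *)
Lemma green_q_le1 x : (green_fk (EFin \o q) x <= 1)%E.
Proof.
have mqe : measurable_fun setT (EFin \o q) by exact/measurable_EFinP.
have mG := @measurable_green_integrand _ x mqe.
have G0 z := @green_integrand_ge0 (EFin \o q) x z (fun y => q0 y).
have mF := @measurable_fun_fubini_tonelli_F _ _ _ _ _ leb _ mG G0.
apply: (@le_trans _ _ (\int[P]_w 1)%E); last by rewrite integral_cst_prob.
pose I w : \bar R := (\int[leb]_s green_integrand (EFin \o q) x (w, s))%E.
have e : green_fk (EFin \o q) x = (\int[P]_w I w)%E.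
  rewrite green_fk_def; apply: eq_integral => w _.
  exact: (int_nneg (fun w s => killing x s w * (q (x + X s w)%R)%:E)%E).
have I0 w : (0 <= I w)%E by apply: integral_ge0.
have -> : green_fk (EFin \o q) x = (\int[P]_w mine (I w) 1)%E.
  rewrite e; apply: ge0_ae_eq_integral => //.
  - by apply: measurable_mine.
  - by move=> w _; rewrite le_min I0/=.
  apply: filterS (qloc x) => w hw _; apply/esym/min_idPl.
  have h := @path_weight_le1 R (fun u => q (x + X `|u| w)) (fun u => killing x `|u| w)
    (mpath x w mq) (mkpath x w) (fun u => q0 _) (qfin_abs hw) (@kE_abs x w) (fun u => killing_ge0 _ _ _).
  apply: le_trans h; rewrite /I -(int_nneg (fun w s => killing x s w * (q (x + X s w)%R)%:E)%E).
  rewrite le_eqVlt; apply/orP; left; apply/eqP; apply: itv_abs_oo => u u0.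
  by rewrite ger0_norm// muleC.
apply: ge0_le_integral_nomeas => w; first by rewrite le_min I0/=.
by rewrite ge_min lexx orbT.
Qed.

Lemma green_cst_le (c : R) x : 0 <= c -> (green_fk (fun=> c%:E) x <= (c / K)%:E)%E.
Proof.
move=> c0; have mqe : measurable_fun setT (EFin \o q) by exact/measurable_EFinP.
have cK : 0 <= c / K by rewrite divr_ge0// ltW.
apply: (@le_trans _ _ (green_fk (fun y => (c / K)%:E * (q y)%:E)%E x)).
  apply: le_green_fk => y; first by rewrite lee_fin.
  rewrite -EFinM lee_fin -{1}(@divfK _ K _ c) ?lt0r_neq0//.
  by apply: ler_wpM2l.
rewrite (@green_fkZ (c / K) (EFin \o q) x cK mqe (fun y => q0 y)).
by rewrite -[leRHS]mule1; apply: lee_wpmul2l; [rewrite lee_fin|exact: green_q_le1].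
Qed.

Lemma green_bounded_fin (psi : E -> \bar R) (c : R) x : (forall y, 0 <= psi y)%E ->
  (forall y, psi y <= c%:E)%E -> green_fk psi x \is a fin_num.
Proof.
move=> p0 pc; rewrite ge0_fin_numE; last exact: green_fk_ge0.
have c0 : 0 <= c by rewrite -lee_fin; exact: le_trans (p0 0) (pc 0).
by apply: le_lt_trans (le_green_fk x p0 pc) _; apply: le_lt_trans (green_cst_le x c0) _; exact: ltry.
Qed.

Lemma green_cvg0 (o : nat -> E -> R) (c : R) x : (forall n, measurable_fun setT (o n)) ->
  (forall n y, 0 <= o n y) -> (forall n y, o n y <= c) ->
  (forall y, o n y @[n --> \oo] --> (0 : R)) ->
  green_fk (EFin \o o n) x @[n --> \oo] --> 0%E.
Proof.
move=> mo o0 oc cvo; have c0 : 0 <= c by exact: le_trans (o0 0%N 0) (oc 0%N 0).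
have moe n : measurable_fun setT (EFin \o o n) by exact/measurable_EFinP.
have p0 n y : (0 <= (EFin \o o n) y)%E by rewrite lee_fin.
under eq_fun do rewrite (green_fkE x (moe _) (p0 _)).
have -> : (0 = \int[P \x leb]_z (cst 0%E z))%E by rewrite integral0.
have mc : measurable_fun [set: E] (fun=> c%:E : \bar R) by exact: measurable_cst.
have pc (y : E) : (0 <= (fun=> c%:E) y :> \bar R)%E by rewrite lee_fin.
apply: (@dominated_cvg _ _ _ _ _ measurableT _ _ (green_integrand (fun=> c%:E) x)).
- by move=> n; exact: measurable_green_integrand.
- move=> z _; case: (boolP (0 <= z.2)) => z0; last first.
    have e n : green_integrand (EFin \o o n) x z = 0%E by rewrite /green_integrand (negbTE z0).
    by rewrite (funext e); exact: cvg_cst.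
  have e n : green_integrand (EFin \o o n) x z = (killing x z.2 z.1 * (o n (x + X z.2 z.1))%:E)%E.
    by rewrite /green_integrand z0.
  rewrite (funext e).
  have kf := killing_fin x z.2 z.1.
  rewrite [cst 0%E z](_ : _ = killing x z.2 z.1 * 0)%E; last by rewrite mule0.
  apply: cvgeZl => //.
  by apply: cvg_EFin; [exact: nearW|exact: cvo].
- move=> z _; rewrite /green_integrand; case: ifP => // _.
  by rewrite fin_numM// killing_fin.
- apply/integrableP; split; first exact: measurable_green_integrand.
  rewrite (eq_integral (green_integrand (fun=> c%:E) x)); last first.
    by move=> z _; rewrite gee0_abs// green_integrand_ge0.
  rewrite -(green_fkE x mc pc); apply: le_lt_trans (green_cst_le x c0) _; exact: ltry.
- move=> n z _; rewrite gee0_abs ?green_integrand_ge0//.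
  rewrite /green_integrand; case: ifP => // _; apply: lee_wpmul2l; first exact: killing_ge0.
  by rewrite lee_fin.
Qed.

Section dynkin.
Variables (f : E -> R) (M : R) (x : E).
Hypotheses (cf : continuous f) (f0 : forall y, 0 <= f y) (fM : forall y, f y <= M) (fx : f x = 0).

Let mf : measurable_fun setT f. Proof. exact: continuous_measurable_rV. Qed.
Let mfe : measurable_fun setT (EFin \o f). Proof. exact/measurable_EFinP. Qed.
Let M0 : 0 <= M. Proof. exact: le_trans (f0 0) (fM 0). Qed.

Definition step_mean (n : nat) (y : E) : R := \int[P]_w f (y + X n.+1%:R^-1 w).

Let eps n : R := n.+1%:R^-1.
Let eps0 n : 0 < eps n. Proof. by rewrite invr_gt0. Qed.

Let mstep n y : measurable_fun setT (fun w => f (y + X (eps n) w)).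
Proof.
by apply: (measurableT_comp mf); apply: measurable_funD_rV => //; exact: mX (ltW (eps0 n)).
Qed.

Lemma step_meanE n y : ((step_mean n y)%:E = \int[P]_w (f (y + X n.+1%:R^-1 w))%:E)%E.
Proof.
rewrite /step_mean /Rintegral fineK//; apply: integrable_fin_num => //.
apply: (@bounded_integrable _ _ _ P _ M) => [|w]; first exact: mstep.
by rewrite ger0_norm.
Qed.

Lemma step_mean_ge0 n y : 0 <= step_mean n y.
Proof. by rewrite -lee_fin step_meanE; apply: integral_ge0 => w _; rewrite lee_fin. Qed.

Lemma measurable_step_mean n : measurable_fun setT (step_mean n).
Proof.
apply/measurable_EFinP.
have m := @measurable_fk _ _ _ _ P _ hX (fun=> 0) (fun=> 0) (measurable_cst _) (measurable_cst _)
  (fun=> lexx _) (fun=> lexx _) (eps n) (EFin \o f) (ltW (eps0 n)) mfe (fun y => f0 y).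
rewrite (_ : _ \o _ = fk P X (fun=> 0) (fun=> 0) (eps n) (EFin \o f)) //; apply/funext => y /=.
by rewrite step_meanE /fk; apply: eq_integral => w _; rewrite fkw00 mul1e.
Qed.

(** The boundary term of [path_dynkin] for [eps = 1 / (n + 1)]. The functions that follow make up
    its last term, with absolute values around times because paths are meaningful only from time 0
    on. *)
Definition short_time n : \bar R :=
  (\int[P]_w \int[leb]_(s in `[0%R, n.+1%:R^-1%R]) (killing x s w * (f (x + X s w)%R)%:E))%E.
Definition step_average n (z : Omega * measurableTypeR R) : \bar R :=
  (\int[leb]_(u in `[(Num.max `|z.2| n.+1%:R^-1)%R, (`|z.2| + n.+1%:R^-1)%R]) (f (x + X u z.1)%R)%:E)%E.
Definition killing_density (z : Omega * measurableTypeR R) := green_integrand (EFin \o q) x z.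
Definition killed_mass n : \bar R :=
  (\int[P \x leb]_z (killing_density z * step_average n z))%E.
Local Notation phi := step_average.
Local Notation qk := killing_density.

Let phi0 n z : (0 <= phi n z)%E.
Proof. by apply: integral_ge0 => u _; rewrite lee_fin. Qed.

Let mphi n : measurable_fun setT (phi n).
Proof.
apply: (@measurable_levy_integral _ _ _ _ _ _ hX _ _ (fun z : Omega * measurableTypeR R => Num.max `|z.2| (eps n))
  (fun z => `|z.2| + eps n) (fun=> x) fst (EFin \o f)) => //.
- exact: measurable_maxr.
- by apply: measurable_funD.
- by move=> z; rewrite le_max normr_ge0.
Qed.

Let mqe : measurable_fun setT (EFin \o q). Proof. exact/measurable_EFinP. Qed.
Let mqk : measurable_fun setT qk. Proof. exact: measurable_green_integrand. Qed.
Let qk0 z : (0 <= qk z)%E. Proof. by apply: green_integrand_ge0 => y; exact: q0. Qed.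

Local Notation pf n := (green_fk (EFin \o step_mean n) x).
Local Notation G0f := (green_fk (EFin \o f) x).
Local Notation A := short_time.
Local Notation B := killed_mass.

Let mA n : measurable_fun setT (fun w => \int[leb]_(s in `[0%R, eps n]) (killing x s w * (f (x + X s w)%R)%:E))%E.
Proof.
have mk : measurable_fun setT (fun z : Omega * measurableTypeR R =>
    if 0 <= z.2 <= eps n then (killing x `|z.2| z.1 * (f (x + X `|z.2| z.1)%R)%:E)%E else 0%E).
  apply: measurable_fun_ifT => //.
    by apply: measurable_and; exact: measurable_fun_ler.
  apply: emeasurable_funM; first exact: measurable_killing.
  exact: (measurableT_comp mfe (measurable_levy_abs x)).
have k0 (z : Omega * measurableTypeR R) : (0 <= if (0 <= z.2 <= eps n)%R then killing x `|z.2|%R z.1 * (f (x + X `|z.2| z.1)%R)%:E else 0)%E.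
  by case: ifP => // _; rewrite mule_ge0 ?killing_ge0// lee_fin.
have := @measurable_fun_fubini_tonelli_F _ _ _ _ _ leb _ mk k0.
congr (measurable_fun _ _); apply/funext => w; rewrite /fubini_F [RHS]integral_mkcond.
apply: eq_integral => s _; rewrite patchE mem_setE/= in_itv/=.
by case: ifP => // /andP[s0 _]; rewrite ger0_norm.
Qed.

(** The expectation of [path_dynkin]. The Markov property at [s] replaces [f] at time [s + eps] by
    [step_mean] at time [s], so that [n.+1 * (step_mean - f)] can stand for the generator. *)
Lemma green_dynkin n : (pf n + A n = G0f + B n)%E.
Proof.
pose I1 (z : Omega * measurableTypeR R) : \bar R :=
  if 0 <= z.2 then (killing x `|z.2| z.1 * (f (x + X `|(z.2 + eps n)%R| z.1)%R)%:E)%E else 0%E.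
have mlev : measurable_fun setT (fun z : Omega * measurableTypeR R => x + X `|z.2 + eps n| z.1).
  apply: measurable_funD_rV => //.
  have ma : measurable_fun setT (fun z : Omega * measurableTypeR R => `|z.2 + eps n| : measurableTypeR R).
    apply: (measurableT_comp (@normr_measurable R setT)).
    by apply: measurable_funD.
  exact: (@measurable_levy_at _ _ _ _ _ _ hX _ _ (fun z : Omega * measurableTypeR R => `|z.2 + eps n|) fst ma).
have mI1 : measurable_fun setT I1.
  apply: measurable_nneg; apply: emeasurable_funM; first exact: measurable_killing.
  exact: (measurableT_comp mfe mlev).
have I10 z : (0 <= I1 z)%E.
  by rewrite /I1; case: ifP => // _; rewrite mule_ge0 ?killing_ge0// lee_fin.
have epf : pf n = (\int[P]_w \int[leb]_s I1 (w, s))%E.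
  rewrite (@fubini_tonelli _ _ _ _ _ P leb I1 mI1 I10).
  have mp : measurable_fun setT (EFin \o step_mean n) by apply/measurable_EFinP; exact: measurable_step_mean.
  have p0 y : (0 <= (EFin \o step_mean n) y)%E by rewrite lee_fin step_mean_ge0.
  have mG := @measurable_green_integrand _ x mp.
  have G0 z := @green_integrand_ge0 (EFin \o step_mean n) x z p0.
  rewrite (green_fkE x mp p0) (@fubini_tonelli1 _ _ _ _ _ P leb _ mG G0).
  rewrite [LHS](@fubini_tonelli _ _ _ _ _ P leb _ mG G0).
  apply: eq_integral => s _; rewrite /green_integrand /I1 /=.
  case: (boolP (0 <= s)) => s0; last by [].
  have mi : measurable_fun setT (fun y => (f y)%:E) by exact: mfe.
  transitivity (\int[P]_w (killing x s w * \int[P]_w' (f (x + X s w + X (eps n) w')%R)%:E))%E.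
    by apply: eq_integral => w _; rewrite step_meanE.
  rewrite (ger0_norm s0) (ger0_norm (addr_ge0 s0 (ltW (eps0 n)))).
  (* The Markov property is available for [s > 0]; at [s = 0] both sides are computed directly. *)
  move: s0; rewrite le_eqVlt => /orP[/eqP <-|s0].
    have X0 w : X 0 w = 0 by case: hX.
    under eq_integral => w _ do rewrite killingE set_itv1 integral_set1 oppe0 expeR0 mul1e X0 addr0.
    rewrite integral_cst_prob add0r; apply: eq_integral => w _.
    by rewrite killingE set_itv1 integral_set1 oppe0 expeR0 mul1e.
  exact/esym/(@markov_increment _ _ _ _ P X hX q (fun=> 0) s (eps n) x (EFin \o f) s0 (ltW (eps0 n)) mq (measurable_cst _) q0 (fun=> lexx _) mfe (fun y => f0 y)).
have mgf := @measurable_green_integrand _ x mfe.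
have gf0 z := @green_integrand_ge0 (EFin \o f) x z (fun y => f0 y).
have eG : G0f = (\int[P]_w \int[leb]_s green_integrand (EFin \o f) x (w, s))%E.
  by rewrite (green_fkE x mfe (fun y => f0 y)); exact: (@fubini_tonelli1 _ _ _ _ _ P leb _ mgf gf0).
have mB : measurable_fun setT (fun z : Omega * measurableTypeR R => qk z * phi n z)%E by exact: emeasurable_funM.
have B0 z : (0 <= qk z * phi n z)%E by exact: mule_ge0.
have eB : B n = (\int[P]_w \int[leb]_s (qk (w, s) * phi n (w, s)))%E.
  exact: (@fubini_tonelli1 _ _ _ _ _ P leb _ mB B0).
rewrite epf eG eB.
have m1 := @measurable_fun_fubini_tonelli_F _ _ _ _ _ leb _ mI1 I10.
have m2 := @measurable_fun_fubini_tonelli_F _ _ _ _ _ leb _ mgf gf0.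
have m3 := @measurable_fun_fubini_tonelli_F _ _ _ _ _ leb _ mB B0.
apply: (@ae_integral_add_eq _ _ _ P (fun w => \int[leb]_s I1 (w, s))%E
  (fun w => \int[leb]_(s in `[0%R, eps n]) (killing x s w * (f (x + X s w)%R)%:E))%E
  (fun w => \int[leb]_s green_integrand (EFin \o f) x (w, s))%E
  (fun w => \int[leb]_s (qk (w, s) * phi n (w, s)))%E m1 (mA n) m2 m3).
- by move=> w; apply: integral_ge0.
- by move=> w; apply: integral_ge0 => s _; rewrite mule_ge0 ?killing_ge0// lee_fin.
- by move=> w; apply: integral_ge0.
- by move=> w; apply: integral_ge0.
apply: filterS (qloc x) => w hw.
have := @path_dynkin R (fun u => q (x + X `|u| w)) (fun u => f (x + X `|u| w)) (fun u => killing x `|u| w)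
    (mpath x w mq) (mpath x w mf) (mkpath x w) (fun u => q0 _) (fun u => f0 _) (qfin_abs hw) (@kE_abs x w) (fun u => killing_ge0 _ _ _) (eps n) (eps0 n).
have c1 : (\int[leb]_s I1 (w, s) = \int[leb]_(s in `[0%R, +oo[) (killing x `|s| w * (f (x + X `|(s + eps n)%R| w)%R)%:E))%E.
  by rewrite (int_nneg (fun w s => killing x `|s| w * (f (x + X `|(s + eps n)%R| w)%R)%:E)%E).
have c2 : (\int[leb]_s green_integrand (EFin \o f) x (w, s) = \int[leb]_(s in `[0%R, +oo[) (killing x `|s| w * (f (x + X `|s| w)%R)%:E))%E.
  rewrite (int_nneg (fun w s => killing x `|s| w * (f (x + X `|s| w)%R)%:E)%E).
  by apply: eq_integral => s _; rewrite /green_integrand/=; case: ifP => // s0; rewrite ger0_norm.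
have c3 : (\int[leb]_(s in `[0%R, eps n]) (killing x s w * (f (x + X s w)%R)%:E) =
    \int[leb]_(s in `[0%R, eps n]) (killing x `|s| w * (f (x + X `|s| w)%R)%:E))%E.
  by apply: itv_abs => s s0; rewrite ger0_norm.
have c4 : (\int[leb]_s (qk (w, s) * phi n (w, s)) = \int[leb]_(r in `[0%R, +oo[) ((q (x + X `|r| w)%R)%:E * killing x `|r| w *
     \int[leb]_(u in `[Num.max r (eps n), (r + eps n)%R]) (f (x + X `|u| w)%R)%:E))%E.
  rewrite (int_nneg (fun w r => (q (x + X `|r| w)%R)%:E * killing x `|r| w *
     \int[leb]_(u in `[Num.max r (eps n), (r + eps n)%R]) (f (x + X `|u| w)%R)%:E)%E).
  apply: eq_integral => r _; rewrite /killing_density /green_integrand/=; case: ifP => r0; last by rewrite mul0e.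
  rewrite /step_average /= (ger0_norm r0) [(killing _ _ _ * _)%E]muleC; congr (_ * _)%E.
  apply: eq_integral => u; rewrite inE/= in_itv/= => /andP[h _].
  by rewrite ger0_norm// (le_trans _ h)// le_max r0.
by rewrite c1 c2 c3 c4.
Qed.

Let rcF w r : 0 <= r -> f (x + X `|s| w) @[s --> r^'+] --> f (x + X `|r| w).
Proof.
move=> r0; have [rc _] : cadlag (X ^~ w) by case: hX.
have h := rc r r0; rewrite (ger0_norm r0).
have c1 : X `|s| w @[s --> r^'+] --> X r w.
  move=> S hS; have [e /= e0 he] := h S hS; exists e => // s se rs /=.
  by rewrite ger0_norm ?(le_trans r0 (ltW rs))//; exact: he.
have c2 : {for X r w, continuous (fun y => f (x + y))}.
  apply: continuous_comp; last exact: cf.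
  apply: (@continuousD R E E (fun=> x) id (X r w)); [exact: cst_continuous|exact: cvg_id].
exact: (cvg_comp _ _ c1 c2).
Qed.

Let avg_le n a b w : a <= b -> b <= a + eps n -> 0 <= a ->
  (n.+1%:R%:E * \int[leb]_(u in `[a, b]) (f (x + X u w)%R)%:E <= M%:E)%E.
Proof.
move=> ab ban a0.
apply: (@le_trans _ _ (n.+1%:R%:E * \int[leb]_(u in `[a, b]) (cst M%:E) u)%E).
  apply: lee_wpmul2l => //; rewrite integral_mkcond [leRHS]integral_mkcond.
  by apply: ge0_le_integral_nomeas => u; rewrite !patchE; case: ifP => // _; rewrite lee_fin.
rewrite integral_cst//= lebesgue_measure_itv/= lte_fin; case: ifP => _; last by rewrite !mule0 lee_fin.
rewrite -EFinB -!EFinM lee_fin mulrCA -[leRHS]mulr1; apply: ler_wpM2l => //.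
by rewrite mulrC -ler_pdivlMr// mul1r lerBlDl.
Qed.

(** After multiplication by [n + 1] the term is at most a mean of the average of [f] along the path
    over [[0, 1 / (n + 1)]], which tends to [f x = 0] by right continuity. *)
Lemma short_time_cvg : (n.+1%:R%:E * A n @[n --> \oo] --> 0)%E.
Proof.
pose a n w : \bar R := (n.+1%:R%:E * \int[leb]_(u in `[0%R, eps n]) (f (x + X u w)%R)%:E)%E.
have ma n : measurable_fun setT (a n).
  apply: measurable_funeM.
  exact: (@measurable_levy_integral _ _ _ _ _ _ hX _ _ (fun=> 0) (fun=> eps n) (fun=> x) id (EFin \o f)).
have a0 n w : (0 <= a n w)%E.
  by apply: mule_ge0 => //; apply: integral_ge0 => u _; rewrite lee_fin.
have aM n w : (a n w <= M%:E)%E by apply: avg_le => //; rewrite ?add0r// ltW.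
have h : (\int[P]_w a n w @[n --> \oo] --> \int[P]_w (cst 0 w : \bar R))%E.
  apply: (@dominated_cvg _ _ _ P setT measurableT a _ (cst M%:E)) => //.
  - move=> w _.
    have := @itv_avg_cvg R (fun u => f (x + X `|u| w)) 0 (mpath x w mf) (fun s => f0 _) (@rcF w 0 (lexx _)).
    have X0 : X 0 w = 0 by case: hX.
    rewrite normr0 X0 addr0 fx; apply: cvg_trans; apply: near_eq_cvg; apply: nearW => n.
    rewrite /a add0r; congr (_ * _)%E; apply: itv_abs => u u0; by rewrite ger0_norm.
  - exact: finite_measure_integrable_cst.
  - by move=> n w _; rewrite gee0_abs.
rewrite integral0 in h.
apply: (squeeze_cvge _ (cvg_cst 0%E) h); apply: nearW => n; apply/andP; split.
  by apply: mule_ge0 => //; apply: integral_ge0 => w _; apply: integral_ge0 => s _; rewrite mule_ge0 ?killing_ge0// lee_fin.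
rewrite -ge0_integralZl//; last 2 first.
- exact: mA.
- by move=> w _; apply: integral_ge0 => s _; rewrite mule_ge0 ?killing_ge0// lee_fin.
apply: ge0_le_integral_nomeas => w.
  by apply: mule_ge0 => //; apply: integral_ge0 => s _; rewrite mule_ge0 ?killing_ge0// lee_fin.
apply: lee_wpmul2l => //; rewrite integral_mkcond [leRHS]integral_mkcond.
apply: ge0_le_integral_nomeas => u; rewrite !patchE; case: ifP => // _.
  by rewrite mule_ge0 ?killing_ge0// lee_fin.
by rewrite -[leRHS]mul1e; apply: lee_wpmul2r; [rewrite lee_fin|exact: killing_le1].
Qed.

(** The averages over [[r, r + eps]] tend to [f] at time [r] by right continuity, and [M] times the
    killing density dominates, integrable by [green_q_le1]. *)
Lemma killed_mass_cvg : (n.+1%:R%:E * B n @[n --> \oo] --> green_fk (fun y => (q y * f y)%:E) x)%E.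
Proof.
have mqf : measurable_fun setT (fun y => (q y * f y)%:E) by apply/measurable_EFinP; exact: measurable_funM.
have qf0 y : (0 <= (q y * f y)%:E)%E by rewrite lee_fin mulr_ge0.
rewrite (green_fkE x mqf qf0).
have mB n : measurable_fun setT (fun z : Omega * measurableTypeR R => qk z * (n.+1%:R%:E * phi n z))%E.
  by apply: emeasurable_funM => //; exact: measurable_funeM.
have -> : (fun n => n.+1%:R%:E * B n)%E = (fun n => \int[P \x leb]_z (qk z * (n.+1%:R%:E * phi n z)))%E.
  apply/funext => n; rewrite /killed_mass -ge0_integralZl.
  - by apply: eq_integral => z _; rewrite muleCA.
  - exact: measurableT.
  - exact: emeasurable_funM.
  - by move=> z _; exact: mule_ge0.
  - by [].
have qkfin z : qk z \is a fin_num.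
  by rewrite /killing_density /green_integrand; case: ifP => // _; rewrite fin_numM// killing_fin.
have phiM n z : (n.+1%:R%:E * phi n z <= M%:E)%E.
  apply: avg_le; rewrite ?le_max ?normr_ge0//.
    by rewrite ge_max lerDl lerDr normr_ge0 ltW.
  by rewrite lerD2r le_max lexx.
apply: (@dominated_cvg _ _ _ _ _ measurableT _ _ (fun z : Omega * measurableTypeR R => M%:E * qk z)%E).
- exact: mB.
- move=> z _; case: (boolP (0 <= z.2)) => z0; last first.
    have e n : (qk z * (n.+1%:R%:E * phi n z) = 0)%E.
      by rewrite /killing_density /green_integrand (negbTE z0) mul0e.
    by rewrite (funext e) /green_integrand (negbTE z0); exact: cvg_cst.
  have -> : green_integrand (fun y => (q y * f y)%:E) x z = (qk z * (f (x + X `|z.2| z.1))%:E)%E.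
    by rewrite /killing_density /green_integrand z0 (ger0_norm z0) EFinM muleA.
  (* At time 0 the averaging interval shrinks to the single point [eps], so the terms are 0; the
     limit [f x] is 0 as well. *)
  apply: cvgeZl => //; move: z0; rewrite le_eqVlt => /orP[/eqP z0|z0].
    have X0 w : X 0 w = 0 by case: hX.
    rewrite -z0 normr0 X0 addr0 fx.
    have e n : (n.+1%:R%:E * phi n z = 0)%E.
      rewrite /step_average -z0 normr0 add0r max_r ?ltW//.
      by rewrite set_itv1 integral_set1 mule0.
    by rewrite (funext e); exact: cvg_cst.
  have := @itv_avg_cvg R (fun u => f (x + X `|u| z.1)) z.2 (mpath x z.1 mf) (fun s => f0 _) (@rcF z.1 z.2 (ltW z0)).
  apply: cvg_trans; apply: near_eq_cvg.
  have [N _ hN] : \forall n \near \oo, (n.+1%:R^-1 : R) < z.2.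
    have /cvgrPdist_lt /(_ _ z0) := @cvg_harmonic R; apply: filterS => n.
    by rewrite /= sub0r normrN ger0_norm.
  exists N => // n /hN nz; congr (_ * _)%E; rewrite /step_average (ger0_norm (ltW z0)) max_l ?ltW//.
  apply: eq_integral => u; rewrite inE/= in_itv/= => /andP[h _].
  by rewrite ger0_norm// (le_trans (ltW z0) h).
- by move=> z _; rewrite fin_numM.
- apply/integrableP; split; first exact: measurable_funeM.
  rewrite (eq_integral (fun z : Omega * measurableTypeR R => M%:E * qk z)%E); last first.
    by move=> z _; rewrite gee0_abs// mule_ge0// lee_fin.
  rewrite ge0_integralZl.
  + rewrite -(green_fkE x mqe (fun y => q0 y)); apply: (@le_lt_trans _ _ (M%:E * 1)%E); last by rewrite mule1 ltry.
    by apply: lee_wpmul2l; [rewrite lee_fin|exact: green_q_le1].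
  + exact: measurableT.
  + exact: mqk.
  + by move=> z _; exact: qk0.
  + by rewrite lee_fin.
- move=> n z _; rewrite gee0_abs; last by apply: mule_ge0 => //; exact: mule_ge0.
  by rewrite muleC; apply: lee_wpmul2r.
Qed.

Let G0f_fin : G0f \is a fin_num.
Proof. by apply: (@green_bounded_fin _ M) => y; rewrite lee_fin. Qed.

Let mstepe n : measurable_fun setT (EFin \o step_mean n).
Proof. by apply/measurable_EFinP; exact: measurable_step_mean. Qed.

(** The bound on the generator holds only in the limit, at a speed depending on the point. The
    amount [o n] by which it fails is bounded and tends to 0 pointwise, so its Green potential tends
    to 0. The finite [G f] is then cancelled in [green_dynkin], and multiplication by [n + 1] leads
    to the limit. *)
Lemma green_upper (h : E -> R) (C c : R) : measurable_fun setT h -> (forall y, 0 <= h y) -> 0 <= C -> 0 <= c ->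
  (forall n y, n.+1%:R * (step_mean n y - f y) <= c) ->
  (forall y eta, 0 < eta -> \forall n \near \oo, n.+1%:R * (step_mean n y - f y) <= C * h y + eta) ->
  (green_fk (fun y => (q y * f y)%:E) x <= C%:E * green_fk (EFin \o h) x)%E.
Proof.
move=> mh h0 C0 c0 hc hlim.
pose o n y : R := Num.max 0 (n.+1%:R * (step_mean n y - f y) - C * h y).
have mo n : measurable_fun setT (o n).
  apply: measurable_maxr => //; apply: measurable_funB; last by apply: measurable_funM.
  by apply: measurable_funM => //; apply: measurable_funB => //; exact: measurable_step_mean.
have o0 n y : 0 <= o n y by rewrite le_max lexx.
have oc n y : o n y <= c.
  rewrite ge_max c0/= (le_trans _ (hc n y))// gerBl.
  exact: mulr_ge0.
have cvo y : o n y @[n --> \oo] --> (0 : R).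
  apply/cvgrPdist_le => eta eta0; have [N _ hN] := hlim y eta eta0.
  exists N => // n /hN /= hn; rewrite sub0r normrN ger0_norm//.
  by rewrite ge_max ltW//= lerBlDl.
have co := green_cvg0 x mo o0 oc cvo.
have cA := short_time_cvg.
have cB := killed_mass_cvg.
have gd := green_dynkin; have A0 n : (0 <= A n)%E.
  by apply: integral_ge0 => w _; apply: integral_ge0 => s _; rewrite mule_ge0 ?killing_ge0// lee_fin.
move: cA cB gd A0; move: short_time killed_mass => a1 b1 cA cB gd A0.
have tcv : (green_fk (EFin \o o n) x + n.+1%:R%:E * a1 n @[n --> \oo] --> 0)%E.
  rewrite -[X in _ --> X](adde0 0%E); apply: cvgeD => //.
apply: (le_limit_add cB tcv) => n.
have n0 : 0 <= n.+1%:R^-1 :> R by rewrite invr_ge0.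
have le1 : (pf n <= G0f + (n.+1%:R^-1)%:E * (C%:E * green_fk (EFin \o h) x + green_fk (EFin \o o n) x))%E.
  have mhe : measurable_fun setT (EFin \o h) by exact/measurable_EFinP.
  have moe : measurable_fun setT (EFin \o o n) by exact/measurable_EFinP.
  have mCh : measurable_fun setT (fun y => C%:E * (EFin \o h) y)%E by exact: measurable_funeM.
  have mS : measurable_fun setT (fun y => C%:E * (EFin \o h) y + (EFin \o o n) y)%E by exact: emeasurable_funD.
  have Ch0 y : (0 <= C%:E * (EFin \o h) y)%E by rewrite mule_ge0// lee_fin.
  have S0 y : (0 <= C%:E * (EFin \o h) y + (EFin \o o n) y)%E by rewrite adde_ge0// lee_fin.
  rewrite -(green_fkZ x C0 mhe (fun y => h0 y)).
  rewrite -(green_fkD x mCh moe Ch0 (fun y => o0 n y)).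
  rewrite -(green_fkZ x n0 mS S0).
  have mZ : measurable_fun setT (fun y => (n.+1%:R^-1)%:E * (C%:E * (EFin \o h) y + (EFin \o o n) y))%E by exact: measurable_funeM.
  have Z0 y : (0 <= (n.+1%:R^-1)%:E * (C%:E * (EFin \o h) y + (EFin \o o n) y))%E by exact: mule_ge0.
  rewrite -(green_fkD x mfe mZ (fun y => f0 y) Z0).
  apply: le_green_fk => y; first by rewrite lee_fin step_mean_ge0.
  rewrite /= -?EFinM -?EFinD -?EFinM -?EFinD lee_fin -lerBlDl ler_pdivlMl//.
  by rewrite -lerBlDl /o le_max lexx orbT.
have nd : (G0f + b1 n <= G0f + ((n.+1%:R^-1)%:E * (C%:E * green_fk (EFin \o h) x + green_fk (EFin \o o n) x) + a1 n))%E.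
  by rewrite -gd addeA; apply: leeD2r.
rewrite leeD2lE// in nd.
have N0 : (0 <= n.+1%:R%:E :> \bar R)%E by rewrite lee_fin.
have := lee_wpmul2l N0 nd.
have g1 : (0 <= C%:E * green_fk (EFin \o h) x)%E.
  by apply: mule_ge0; [rewrite lee_fin|apply: green_fk_ge0 => y; rewrite lee_fin].
have g2 : (0 <= green_fk (EFin \o o n) x)%E by apply: green_fk_ge0 => y; rewrite lee_fin.
rewrite ge0_muleDr//; last by apply: mule_ge0 => //; exact: adde_ge0.
by rewrite muleA -EFinM divff// mul1e -addeA.
Qed.

(** The mirror image of [green_upper]: [b] bounds the loss of the generator for every [n], and [m]
    is a gain present only in the limit. *)
Lemma green_lower (b m : E -> R) (c : R) : measurable_fun setT b -> measurable_fun setT m ->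
  (forall y, 0 <= b y) -> (forall y, 0 <= m y) -> (forall y, m y <= c) ->
  (forall n y, - b y <= n.+1%:R * (step_mean n y - f y)) ->
  (forall y eta, 0 < eta -> \forall n \near \oo, m y - b y - eta <= n.+1%:R * (step_mean n y - f y)) ->
  (green_fk (EFin \o m) x <= green_fk (EFin \o b) x + green_fk (fun y => (q y * f y)%:E) x)%E.
Proof.
move=> mb mm b0 m0 mc hb hlim.
pose o n y : R := Num.max 0 (m y - b y - n.+1%:R * (step_mean n y - f y)).
have mo n : measurable_fun setT (o n).
  apply: measurable_maxr => //; apply: measurable_funB; first exact: measurable_funB.
  by apply: measurable_funM => //; apply: measurable_funB => //; exact: measurable_step_mean.
have o0 n y : 0 <= o n y by rewrite le_max lexx.
have c0 : 0 <= c by exact: le_trans (m0 0) (mc 0).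
have oc n y : o n y <= c.
  by rewrite ge_max c0/=; have := hb n y; have := mc y; lra.
have cvo y : o n y @[n --> \oo] --> (0 : R).
  apply/cvgrPdist_le => eta eta0; have [N _ hN] := hlim y eta eta0.
  exists N => // n /hN /= hn; rewrite sub0r normrN ger0_norm//.
  by rewrite ge_max ltW//=; lra.
have co := green_cvg0 x mo o0 oc cvo.
have cB := killed_mass_cvg.
have qf0 y : (0 <= (q y * f y)%:E)%E by rewrite lee_fin mulr_ge0.
have gd := green_dynkin; have A0 n : (0 <= A n)%E.
  by apply: integral_ge0 => w _; apply: integral_ge0 => s _; rewrite mule_ge0 ?killing_ge0// lee_fin.
have B0 n : (0 <= B n)%E by apply: integral_ge0 => z _; exact: mule_ge0.
move: cB gd A0 B0; move: short_time killed_mass => a1 b1 cB gd A0 B0.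
have tcv : (green_fk (EFin \o o n) x + n.+1%:R%:E * b1 n @[n --> \oo] --> 0 + green_fk (fun y => (q y * f y)%:E) x)%E.
  by apply: cvgeD => //; rewrite ge0_adde_def ?inE// green_fk_ge0.
rewrite add0e in tcv.
have key n : (green_fk (EFin \o m) x <= green_fk (EFin \o b) x + (green_fk (EFin \o o n) x + n.+1%:R%:E * b1 n))%E.
  have n0 : 0 <= n.+1%:R^-1 :> R by rewrite invr_ge0.
  have mme : measurable_fun setT (EFin \o m) by exact/measurable_EFinP.
  have mbe : measurable_fun setT (EFin \o b) by exact/measurable_EFinP.
  have moe : measurable_fun setT (EFin \o o n) by exact/measurable_EFinP.
  have mS : measurable_fun setT (fun y => (EFin \o b) y + (EFin \o o n) y)%E by exact: emeasurable_funD.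
  have S0 y : (0 <= (EFin \o b) y + (EFin \o o n) y)%E by rewrite adde_ge0// lee_fin.
  have mZ : measurable_fun setT (fun y => (n.+1%:R^-1)%:E * ((EFin \o b) y + (EFin \o o n) y))%E by exact: measurable_funeM.
  have Z0 y : (0 <= (n.+1%:R^-1)%:E * ((EFin \o b) y + (EFin \o o n) y))%E by exact: mule_ge0.
  have mZ' : measurable_fun setT (fun y => (n.+1%:R^-1)%:E * (EFin \o m) y)%E by exact: measurable_funeM.
  have Z0' y : (0 <= (n.+1%:R^-1)%:E * (EFin \o m) y)%E by rewrite mule_ge0// lee_fin.
  have s0 y : (0 <= (EFin \o step_mean n) y)%E by rewrite lee_fin step_mean_ge0.
  have le1 : (G0f + (n.+1%:R^-1)%:E * green_fk (EFin \o m) x <=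
      pf n + (n.+1%:R^-1)%:E * (green_fk (EFin \o b) x + green_fk (EFin \o o n) x))%E.
    rewrite -(green_fkD x mbe moe (fun y => b0 y) (fun y => o0 n y)) -(green_fkZ x n0 mS S0).
    rewrite -(green_fkD x (mstepe n) mZ s0 Z0).
    rewrite -(green_fkZ x n0 mme (fun y => m0 y)) -(green_fkD x mfe mZ' (fun y => f0 y) Z0').
    apply: le_green_fk => y; first by apply: adde_ge0; [rewrite lee_fin|exact: Z0'].
    rewrite /= -?EFinM -?EFinD -?EFinM -?EFinD lee_fin.
    have : m y - b y - n.+1%:R * (step_mean n y - f y) <= o n y by rewrite le_max lexx orbT.
    have : n.+1%:R^-1 * (n.+1%:R * (step_mean n y - f y)) = step_mean n y - f y by rewrite mulKf.
    move: (n.+1%:R * _) => z ez /(ler_wpM2l n0); move: (n.+1%:R^-1 : R) ez => r; lra.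
  have le2 : (G0f + (n.+1%:R^-1)%:E * green_fk (EFin \o m) x <=
     G0f + (b1 n + (n.+1%:R^-1)%:E * (green_fk (EFin \o b) x + green_fk (EFin \o o n) x)))%E.
    by apply: le_trans le1 _; rewrite addeA -gd; apply: leeD2r; rewrite leeDl.
  rewrite leeD2lE// in le2.
  have N0 : (0 <= n.+1%:R%:E :> \bar R)%E by rewrite lee_fin.
  have := lee_wpmul2l N0 le2.
  have g1 : (0 <= green_fk (EFin \o b) x)%E by apply: green_fk_ge0 => y; rewrite lee_fin.
  have g2 : (0 <= green_fk (EFin \o o n) x)%E by apply: green_fk_ge0 => y; rewrite lee_fin.
  rewrite ge0_muleDr//; last by apply: mule_ge0 => //; exact: adde_ge0.
  rewrite !muleA -!EFinM divff// !mul1e => h; apply: le_trans h _.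
  by rewrite addeC addeA.
rewrite -(cvg_lim _ (cvgeD _ (cvg_cst (green_fk (EFin \o b) x)) tcv))//; last first.
  rewrite ge0_adde_def ?inE//; first by apply: green_fk_ge0 => y; rewrite lee_fin.
  exact: green_fk_ge0.
apply: lime_ge; last exact: nearW.
apply/cvg_ex; exists (green_fk (EFin \o b) x + green_fk (fun y => (q y * f y)%:E) x)%E.
apply: cvgeD => //; last exact: cvg_cst.
rewrite ge0_adde_def ?inE//; first by apply: green_fk_ge0 => y; rewrite lee_fin.
exact: green_fk_ge0.
Qed.

End dynkin.

End green_fk.

(** * Functions with a Harnack inequality *)

Section cosh_bounds.
Context (R : realType).
Implicit Types s t : R.

Let half s : expR s = expR (s / 2) ^+ 2.
Proof. by rewrite expr2 -expRD; congr expR; lra. Qed.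

Let halfV s : expR (s / 2) * expR (- s / 2) = 1.
Proof. by rewrite -expRD mulNr addrN expR0. Qed.

(** [expR s + expR (- s) - 2] is the square of [expR (s / 2) - expR (- s / 2)], which for [s >= 0]
    lies between [s / 2] and [s * expR (s / 2)]; [cosh_le] uses the upper bound. *)
Lemma cosh_ge s : 2 + s ^+ 2 / 4 <= expR s + expR (- s).
Proof.
wlog s0 : s / 0 <= s => [H|].
  have [s0|s0] := leP 0 s; first exact: H.
  have := H (- s); rewrite opprK sqrrN oppr_ge0 => /(_ (ltW s0)); lra.
rewrite (half s) (half (- s)); have h := halfV s.
have a1 := expR_ge1Dx (s / 2); have b0 := expR_gt0 (- s / 2).
have b1 : expR (- s / 2) <= 1 by rewrite -[leRHS]expR0 ler_expR; lra.
move: (expR (s / 2)) (expR (- s / 2)) h a1 b0 b1 => a b h a1 b0 b1.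
have d : s / 2 <= a - b by lra.
have s20 : 0 <= s / 2 by lra.
have := ler_pM s20 s20 d d; rewrite !expr2; lra.
Qed.

Lemma cosh_le s : expR s + expR (- s) <= 2 + s ^+ 2 * expR `|s|.
Proof.
wlog s0 : s / 0 <= s => [H|].
  have [s0|s0] := leP 0 s; first exact: H.
  have := H (- s); rewrite opprK sqrrN oppr_ge0 normrN => /(_ (ltW s0)); lra.
rewrite (ger0_norm s0) (half s) (half (- s)); have h := halfV s.
have a0 := expR_gt0 (s / 2); have b0 := expR_gt0 (- s / 2).
have b1 : expR (- s / 2) <= 1 by rewrite -[leRHS]expR0 ler_expR; lra.
have b2 := expR_ge1Dx (- s); rewrite (half (- s)) in b2.
have ba : expR (- s / 2) <= expR (s / 2) by rewrite ler_expR; lra.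
move: (expR (s / 2)) (expR (- s / 2)) h a0 b0 b1 b2 ba => a b h a0 b0 b1 b2 ba.
have d : a - b <= a * s.
  have -> : a - b = a * (1 - b ^+ 2) by rewrite mulrBr mulr1 expr2 mulrA h mul1r.
  by rewrite ler_pM2l//; lra.
have ab0 : 0 <= a - b by lra.
have := ler_pM ab0 ab0 d d; rewrite !expr2; lra.
Qed.

End cosh_bounds.

Section kcosh.
Context (R : realType) (d : nat) (L : R).
Hypothesis L0 : 0 < L.
Local Notation E := 'rV[R]_d.
Implicit Types u v w x y z : E.

(** The sum of [2 cosh (L u_i)]. It is a smooth substitute for [exp (L |u|)]: of exponential growth,
    submultiplicative, and with second differences bounded by a multiple of itself. Its minimum
    [2 d] is attained at 0. *)
Definition kcosh u : R := \sum_i (expR (L * u ord0 i) + expR (- (L * u ord0 i))).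

Let dR : R := (d.*2)%:R.

Let term_gt0 u i : 0 < expR (L * u ord0 i) + expR (- (L * u ord0 i)).
Proof. by rewrite addr_gt0// expR_gt0. Qed.

Lemma kcosh_ge0 u : 0 <= kcosh u.
Proof. by apply: sumr_ge0 => i _; exact: ltW. Qed.

Lemma kcosh0 : kcosh 0 = dR.
Proof.
rewrite /kcosh (eq_bigr (fun=> 2 : R)); last by move=> i _; rewrite mxE mulr0 oppr0 expR0.
by rewrite sumr_const card_ord /dR -muln2 natrM mulr_natl.
Qed.

Lemma kcosh_quad u : dR + L ^+ 2 / 4 * enorm u ^+ 2 <= kcosh u.
Proof.
rewrite sqr_enorm mulr_sumr -kcosh0 /kcosh -big_split/=.
apply: ler_sum => i _; rewrite mxE mulr0 oppr0 expR0.
by have := cosh_ge (L * u ord0 i); rewrite exprMn; lra.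
Qed.

Lemma kcosh_min u : dR <= kcosh u.
Proof. by apply: le_trans (kcosh_quad u); rewrite lerDl mulr_ge0 ?sqr_ge0// divr_ge0 ?sqr_ge0. Qed.

Lemma kcosh_submult u v : kcosh (u + v) <= kcosh u * kcosh v.
Proof.
rewrite {2}/kcosh mulr_suml; apply: ler_sum => i _.
apply: (@le_trans _ _ ((expR (L * u ord0 i) + expR (- (L * u ord0 i))) *
    (expR (L * v ord0 i) + expR (- (L * v ord0 i))))).
  rewrite mxE mulrDr opprD !expRD.
  have := expR_gt0 (L * u ord0 i); have := expR_gt0 (- (L * u ord0 i)).
  have := expR_gt0 (L * v ord0 i); have := expR_gt0 (- (L * v ord0 i)).
  move: (expR _) (expR _) (expR _) (expR _) => a b c e a0 b0 c0 e0.
  rewrite mulrDl !mulrDr; have := mulr_ge0 (ltW e0) (ltW a0); have := mulr_ge0 (ltW c0) (ltW b0); lra.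
rewrite ler_pM2l// /kcosh (bigD1 i)//= lerDl; apply: sumr_ge0 => j _; exact: ltW.
Qed.

Lemma kcosh_shift u v : kcosh (u + v) <= expR (L * `|v|) * kcosh u.
Proof.
rewrite /kcosh mulr_sumr; apply: ler_sum => i _; rewrite mxE mulrDr opprD !expRD mulrDr.
have h := coord_le_norm v i.
by apply: lerD; rewrite mulrC ler_pM2r ?expR_gt0// ler_expR -?mulrN ler_pM2l// (le_trans _ h)// ?ler_norm// -normrN ler_norm.
Qed.

Definition kcosh_curv : R := L ^+ 2 * expR L.

Lemma kcosh_curv_gt0 : 0 < kcosh_curv.
Proof. by rewrite mulr_gt0 ?expR_gt0// exprn_gt0. Qed.

(** The addition formula gives each term of the sum the factor [2 cosh (L v_i)], which [cosh_le]
    bounds. *)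
Lemma kcosh_second_diff u v : enorm v <= 1 ->
  kcosh (u + v) + kcosh (u - v) <= (2 + kcosh_curv * enorm v ^+ 2) * kcosh u.
Proof.
move=> v1; rewrite /kcosh -big_split mulr_sumr /=; apply: ler_sum => i _.
have hi : `|v ord0 i| <= enorm v by exact: coord_le_enorm.
have c : expR (L * v ord0 i) + expR (- (L * v ord0 i)) <= 2 + kcosh_curv * enorm v ^+ 2.
  have h1 : v ord0 i ^+ 2 <= enorm v ^+ 2.
    by rewrite -(real_normK (num_real (v ord0 i))) ler_pXn2r ?nnegrE ?enorm_ge0.
  have h2 : expR `|L * v ord0 i| <= expR L.
    by rewrite ler_expR normrM (gtr0_norm L0) ler_piMr ?(ltW L0)// (le_trans hi).
  apply: le_trans (cosh_le _) _; rewrite lerD2l exprMn /kcosh_curv -mulrA -mulrA.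
  rewrite ler_pM2l ?exprn_gt0// [leRHS]mulrC.
  exact: ler_pM (sqr_ge0 _) (expR_ge0 _) h1 h2.
rewrite !mxE !mulrDr !mulrN !opprD !opprK !expRD.
have := ler_pM2l (term_gt0 u i) (expR (L * v ord0 i) + expR (- (L * v ord0 i))) (2 + kcosh_curv * enorm v ^+ 2).
rewrite c => /esym; move: (expR (L * u ord0 i)) (expR (- (L * u ord0 i))) (expR (L * v ord0 i)) (expR (- (L * v ord0 i))) => a b e f.
by move: (2 + _) => z; lra.
Qed.

(** Some coordinate has absolute value at least [enorm u / d], and its term alone suffices; this
    costs the factor [d] between [L'] and [L]. *)
Lemma enorm_expR_kcosh (L' : R) u : (0 < d)%N -> 0 <= L' -> L' * d%:R <= L ->
  expR (L' * enorm u) <= kcosh u.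
Proof.
move=> d0 L'0 LL.
have [i hi] : exists i, enorm u <= d%:R * `|u ord0 i|.
  apply: contrapT => /forallNP h.
  have : \sum_(i < d) `|u ord0 i| < \sum_(i < d) (enorm u / d%:R).
    apply: ltr_sum; first by apply/hasP; exists (Ordinal d0); rewrite ?mem_index_enum.
    move=> i _; rewrite ltr_pdivlMr ?ltr0n// mulrC ltNge; apply/negP; exact: h.
  have -> : \sum_(i < d) (enorm u / d%:R) = enorm u.
    by rewrite sumr_const card_ord -[LHS]mulr_natr divfK ?pnatr_eq0 -?lt0n.
  by rewrite ltNge enorm_le_sum.
apply: (@le_trans _ _ (expR (L * `|u ord0 i|))).
  rewrite ler_expR; apply: (@le_trans _ _ (L' * (d%:R * `|u ord0 i|))); first exact: ler_wpM2l.
  by rewrite mulrA; apply: ler_wpM2r.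
rewrite /kcosh (bigD1 i)//=; apply: (@le_trans _ _ (expR (L * u ord0 i) + expR (- (L * u ord0 i)))); last first.
  by rewrite lerDl; apply: sumr_ge0 => j _; exact: ltW.
have [h|h] := leP 0 (u ord0 i); [rewrite ger0_norm// lerDl|rewrite ltr0_norm// mulrN lerDr]; exact: expR_ge0.
Qed.

End kcosh.

Lemma log_lipschitz_continuous (R : realType) d (f : 'rV[R]_d -> R) (L : R) : 0 <= L -> (forall x, 0 <= f x) ->
  (forall x y, f y <= expR (L * `|y - x|) * f x) -> continuous f.
Proof.
move=> L0 f0 hf x A /nbhs_ballP[e /= e0 eA]; apply/nbhs_ballP.
have f1 : 0 < f x + 1 by rewrite ltr_wpDl.
have L1 : 0 < L + 1 by rewrite ltr_wpDl.
have := @continuous_expR R 0; rewrite /continuous_at expR0.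
move=> /cvgrPdist_lt /(_ (e / (f x + 1)) (divr_gt0 e0 f1)) /nbhs_ballP[r /= r0 hr].
exists (r / (L + 1)) => /=; first by rewrite divr_gt0.
move=> y; rewrite mx_norm_ball /ball_/= ltr_pdivlMr// => xy; apply: eA; rewrite /ball/=.
have s0 : 0 <= L * `|x - y| by rewrite mulr_ge0.
have sr : L * `|x - y| < r.
  by apply: le_lt_trans xy; rewrite mulrC ler_wpM2l// lerDl.
have := hr (L * `|x - y|); rewrite /ball/= sub0r normrN ger0_norm// => /(_ sr).
have := hr (- (L * `|x - y|)); rewrite /ball/= sub0r opprK ger0_norm// => /(_ sr).
have h1 := hf x y; have h2 := hf y x; rewrite -normrN opprB in h1.
rewrite -(ler_pdivrMl _ _ (expR_gt0 _)) -expRN in h2.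
move: (expR (L * `|x - y|)) (expR (- (L * `|x - y|))) h1 h2 => a b h1 h2.
rewrite !ltr_pdivlMr// => u1 u2.
have w1 := le_lt_trans (ler_wpM2r (ltW f1) (ler_norm _)) u1.
have w2 : (a - 1) * (f x + 1) < e.
  by apply: le_lt_trans u2; rewrite ler_wpM2r ?(ltW f1)// -normrN opprB ler_norm.
have fx0 := f0 x.
have w3 : (1 - b) * f x < e.
  have [b1|b1] := leP 0 (1 - b); first by move: w1; rewrite mulrDr mulr1; lra.
  by apply: le_lt_trans e0; rewrite mulr_le0_ge0// ltW.
have w4 : (a - 1) * f x < e.
  have [a1|a1] := leP 0 (a - 1); first by move: w2; rewrite mulrDr mulr1; lra.
  by apply: le_lt_trans e0; rewrite mulr_le0_ge0// ltW.
move: w3 w4 h1 h2; rewrite !mulrBl !mul1r ltr_norml; lra.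
Qed.

(** This and the next lemma isolate the nonlinear arithmetic of the two branches of
    [harnack_test_second_diff]. *)
Lemma second_diff_arith1 (R : realType) (D m t hy e kc : R) :
  0 <= D -> 0 <= m -> 0 <= t -> 0 <= hy -> 0 <= e -> 0 <= kc ->
  (2 + kc * e) * hy <= 2 * hy + kc * (1 + D * m * t) * hy * e.
Proof.
move=> D0 m0 t0 h0 e0 k0.
have h1 := mulr_ge0 (mulr_ge0 (mulr_ge0 (mulr_ge0 D0 m0) t0) (mulr_ge0 k0 h0)) e0; lra.
Qed.

Lemma second_diff_arith2 (R : realType) (hx D m t hy e kc kx kp km : R) :
  0 <= hx -> 0 <= D -> 0 <= m -> 0 <= t -> 0 <= hy -> 0 <= e -> 0 <= kc ->
  kp + km <= (2 + kc * e) * kx -> m * hx * (kx - D) <= hy -> hx <= t * hy ->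
  m * hx * (kp - D) + m * hx * (km - D) <= 2 * (m * hx * (kx - D)) + kc * (1 + D * m * t) * hy * e.
Proof.
move=> hx0 D0 m0 t0 h0 e0 k0 ks hle hn.
have s1 := ler_wpM2l (mulr_ge0 m0 hx0) ks.
have s2 := ler_wpM2l (mulr_ge0 D0 m0) hn.
have s3 : m * hx * kx <= hy + D * m * (t * hy) by lra.
have s4 := ler_wpM2r (mulr_ge0 k0 e0) s3; lra.
Qed.

Lemma norm_le_enorm (R : realType) d (x : 'rV[R]_d) : `|x| <= enorm x.
Proof.
rewrite [`|x|]mx_normrE; apply/bigmax_leP; split; first exact: enorm_ge0.
by move=> [i j] _ /=; rewrite (ord1 i); exact: coord_le_enorm.
Qed.

(** * Regularization by inf-convolution *)

Section inf_convolution.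
Context (R : realType) (d : nat) (L : R).
Hypotheses (L0 : 0 < L) (d0 : (0 < d)%N).
Local Notation E := 'rV[R]_d.
Local Notation k := (kcosh L).
Variables (g : E -> R) (H c : R).
Hypotheses (g0 : forall y, 0 < g y) (gH : forall y, g y <= H) (c0 : 0 < c)
  (gk : forall y z, g y <= c * k (y - z) * g z).

(** A multiplicative inf-convolution of [g] with the kernel. It stays comparable to [g] by the
    assumed Harnack inequality, and inherits from the kernel its Harnack, Lipschitz and second
    difference bounds, because inequalities that are linear in the kernel pass to the infimum. [g]
    itself may be discontinuous. *)
Definition infconv y : R := inf [set g z * k (y - z) | z in [set: E]].
Local Notation h := infconv.

Let dR : R := (d.*2)%:R.
Let dR0 : 0 < dR. Proof. by rewrite ltr0n double_gt0. Qed.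

Let lb y : lbound [set g z * k (y - z) | z in [set: E]] (g y / c).
Proof. by move=> _ [z _ <-]; rewrite ler_pdivrMr// mulrC mulrA mulrAC; exact: gk. Qed.

Let ne y : [set g z * k (y - z) | z in [set: E]] !=set0.
Proof. by exists (g 0 * k (y - 0)), 0. Qed.

Let hasinf y : has_inf [set g z * k (y - z) | z in [set: E]].
Proof. by split; [exact: ne|exists (g y / c); exact: lb]. Qed.

Lemma infconv_ge y : g y / c <= h y.
Proof. by apply: lb_le_inf; [exact: ne|exact: lb]. Qed.

Lemma infconv_le_at y z : h y <= g z * k (y - z).
Proof. by apply: ge_inf; [case: (hasinf y)|exists z]. Qed.

Lemma infconv_le y : h y <= dR * g y.
Proof. by apply: le_trans (infconv_le_at y y) _; rewrite subrr kcosh0 mulrC. Qed.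

Lemma infconv_gt0 y : 0 < h y.
Proof. by apply: lt_le_trans (infconv_ge y); rewrite divr_gt0. Qed.

Let infconv_transfer (a b : R) (y : E) : 0 <= b ->
  (forall z, a <= b * (g z * k (y - z))) -> a <= b * h y.
Proof.
move=> b0 hz; move: b0; rewrite le_eqVlt => /orP[/eqP b0|b0].
  by have := hz 0; rewrite -b0 !mul0r.
rewrite -ler_pdivrMl//; apply: lb_le_inf; first exact: ne.
by move=> _ [z _ <-]; rewrite ler_pdivrMl.
Qed.

Lemma infconv_harnack x y : h y <= k (y - x) * h x.
Proof.
apply: infconv_transfer => [|z]; first exact: kcosh_ge0.
apply: le_trans (infconv_le_at y z) _; rewrite mulrCA ler_pM2l//.
have -> : y - z = (y - x) + (x - z) by rewrite addrA subrK.
exact: kcosh_submult.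
Qed.

Lemma infconv_lipschitz x y : h y <= expR (L * `|y - x|) * h x.
Proof.
apply: infconv_transfer => [|z]; first exact: expR_ge0.
apply: le_trans (infconv_le_at y z) _; rewrite mulrCA ler_pM2l//.
have -> : y - z = (x - z) + (y - x) by rewrite [RHS]addrC addrA subrK.
exact: kcosh_shift.
Qed.

Lemma infconv_second_diff y v : enorm v <= 1 ->
  h (y + v) + h (y - v) <= (2 + kcosh_curv L * enorm v ^+ 2) * h y.
Proof.
move=> v1; have b0 : 0 <= 2 + kcosh_curv L * enorm v ^+ 2.
  by rewrite addr_ge0// mulr_ge0 ?sqr_ge0// ltW// kcosh_curv_gt0.
apply: infconv_transfer => [//|z].
apply: le_trans (lerD (infconv_le_at (y + v) z) (infconv_le_at (y - v) z)) _.
rewrite -mulrDr mulrCA ler_pM2l//.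
have -> : y + v - z = (y - z) + v by rewrite addrAC.
have -> : y - v - z = (y - z) - v by rewrite addrAC.
exact: kcosh_second_diff.
Qed.

Lemma infconv_continuous : continuous h.
Proof.
apply: (@log_lipschitz_continuous _ _ _ L); [exact: ltW|by move=> x; exact/ltW/infconv_gt0|].
exact: infconv_lipschitz.
Qed.

(* The test function of the Dynkin comparison: it vanishes at [x], equals [h]
   at distance 1/2 from [x], and keeps the second difference bound of [h]. *)
Definition harnack_height : R := 1 + 8 * dR * 2 / L ^+ 2.
Definition harnack_test x y : R := Num.min (h y) (harnack_height * h x * (k (y - x) - dR)).
Local Notation M := harnack_height.

Let L20 : 0 < L ^+ 2. Proof. exact: exprn_gt0. Qed.

Let M1 : 1 <= M.
Proof. by rewrite lerDl divr_ge0 ?(ltW L20)// !mulr_ge0// ltW. Qed.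

Let kd (u : E) : 0 <= k u - dR. Proof. by rewrite subr_ge0; exact: kcosh_min. Qed.

Lemma harnack_test_ge0 x y : 0 <= harnack_test x y.
Proof.
rewrite le_min ltW ?infconv_gt0//= mulr_ge0 ?kd// mulr_ge0 ?ltW ?infconv_gt0//.
exact: lt_le_trans M1.
Qed.

Lemma harnack_test_le x y : harnack_test x y <= h y. Proof. by rewrite ge_min lexx. Qed.

Lemma harnack_test_center x : harnack_test x x = 0.
Proof. by rewrite /harnack_test subrr kcosh0 subrr mulr0 min_r// ltW// infconv_gt0. Qed.

Lemma harnack_test_far x y : 1 / 2 <= enorm (y - x) -> harnack_test x y = h y.
Proof.
move=> yx; rewrite /harnack_test min_l//; apply: le_trans (infconv_harnack x y) _.
rewrite mulrAC ler_pM2r ?infconv_gt0//.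
have q : dR + L ^+ 2 / 16 <= k (y - x).
  apply: le_trans (kcosh_quad L _); rewrite lerD2l.
  have h0 : 0 <= 1 / 2 :> R by [].
  have := ler_pM h0 h0 yx yx; rewrite -!expr2 => h1.
  have -> : L ^+ 2 / 16 = L ^+ 2 / 4 * (1 / 2) ^+ 2 by field.
  by rewrite ler_wpM2l// divr_ge0// sqr_ge0.
(* This identity fixes the constant of [harnack_height]: at distance 1/2 the kernel exceeds its
   minimum by [L ^+ 2 / 16], so [M (k - dR) >= k] there. *)
have e : (M - 1) * (L ^+ 2 / 16) = dR.
  by rewrite /harnack_height addrAC subrr add0r; field; rewrite lt0r_neq0.
have M10 : 0 <= M - 1 by rewrite subr_ge0.
have q2 : L ^+ 2 / 16 <= k (y - x) - dR by lra.
have := ler_wpM2l M10 q2; rewrite e mulrBl mul1r; lra.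
Qed.

Lemma harnack_test_continuous x : continuous (harnack_test x).
Proof.
have ck : continuous (fun y : E => k (y - x)).
  apply: (@log_lipschitz_continuous _ _ _ L); [exact: ltW|by move=> y; exact: kcosh_ge0|].
  move=> y z; have -> : z - x = (y - x) + (z - y) by rewrite [RHS]addrC addrA subrK.
  exact: kcosh_shift.
move=> y; apply: continuous_min; first exact: infconv_continuous.
exact: (cvgM (cvg_cst _) (cvgB (ck y) (cvg_cst dR))).
Qed.

Definition harnack_curv : R := kcosh_curv L * (1 + dR * M * (16 / L ^+ 2 + dR * expR L)).

(** Where the second branch realizes the minimum, [h x] has to be absorbed into [h y]: away from [x]
    the branch is itself at least [h x * L ^+ 2 / 16], and within distance 1/2 the Harnack
    inequality applies. *)
Let near_le x y : harnack_height * h x * (k (y - x) - dR) <= h y ->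
  h x <= (16 / L ^+ 2 + dR * expR L) * h y.
Proof.
move=> hb; have hx := infconv_gt0 x; have hy := infconv_gt0 y.
have [yx|yx] := leP (1 / 2) (enorm (y - x)).
  apply: (@le_trans _ _ (16 / L ^+ 2 * h y)); last first.
    by rewrite ler_pM2r// lerDl mulr_ge0 ?expR_ge0// ltW.
  have q : L ^+ 2 / 16 <= k (y - x) - dR.
    rewrite lerBrDl; apply: le_trans (kcosh_quad L _); rewrite lerD2l.
    have h0 : 0 <= 1 / 2 :> R by [].
    have := ler_pM h0 h0 yx yx; rewrite -!expr2 => h1.
    have -> : L ^+ 2 / 16 = L ^+ 2 / 4 * (1 / 2) ^+ 2 by field.
    by rewrite ler_wpM2l// divr_ge0// sqr_ge0.
  have : h x * (L ^+ 2 / 16) <= h y.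
    apply: le_trans hb; rewrite -mulrA.
    apply: (@le_trans _ _ (h x * (k (y - x) - dR))); first by rewrite ler_pM2l.
    rewrite -[leLHS]mul1r; apply: ler_wpM2r; [apply: mulr_ge0; [exact: ltW|exact: kd]|exact: M1].
  rewrite -ler_pdivlMr ?divr_gt0// => hh; apply: le_trans hh _.
  have -> : h y / (L ^+ 2 / 16) = 16 / L ^+ 2 * h y by field; rewrite lt0r_neq0.
  exact: lexx.
apply: le_trans (infconv_harnack y x) _; rewrite ler_pM2r//.
apply: (@le_trans _ _ (dR * expR L)); last by rewrite lerDr divr_ge0 ?ltW.
rewrite -[x - y]add0r; apply: le_trans (kcosh_shift L0 _ _) _.
rewrite kcosh0 mulrC ler_pM2l// ler_expR ler_piMr ?(ltW L0)//.
have := norm_le_enorm (x - y); by rewrite enormC; lra.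
Qed.

(** The second difference of a minimum is at most that of the branch realizing it at the centre [y].
    The first branch inherits the bound of [h]; the second has that of the kernel, turned into a
    multiple of [h y] by [near_le]. *)
Lemma harnack_test_second_diff x y v : enorm v <= 1 ->
  harnack_test x (y + v) + harnack_test x (y - v) <= 2 * harnack_test x y + harnack_curv * h y * enorm v ^+ 2.
Proof.
move=> v1; have hy := infconv_gt0 y; have hx := infconv_gt0 x.
have kc := kcosh_curv_gt0 L0.
have t0 : 0 <= 16 / L ^+ 2 + dR * expR L.
  by apply: addr_ge0; [apply: divr_ge0; [|exact: ltW]|apply: mulr_ge0; [exact: ltW|exact: expR_ge0]].
have M0 : 0 <= M by exact: le_trans M1.
have e2 := sqr_ge0 (enorm v).
rewrite /harnack_curv {3}/harnack_test; case: (leP (h y) (M * h x * (k (y - x) - dR))) => [hle|hlt].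
  apply: le_trans (lerD (harnack_test_le x (y + v)) (harnack_test_le x (y - v))) _.
  apply: le_trans (infconv_second_diff y v1) _.
  exact: second_diff_arith1 (ltW dR0) M0 t0 (ltW hy) e2 (ltW kc).
have le2 z : harnack_test x z <= M * h x * (k (z - x) - dR) by rewrite ge_min lexx orbT.
apply: le_trans (lerD (le2 _) (le2 _)) _.
have -> : y + v - x = (y - x) + v by rewrite addrAC.
have -> : y - v - x = (y - x) - v by rewrite addrAC.
exact: second_diff_arith2 (ltW hx) (ltW dR0) M0 t0 (ltW hy) e2 (ltW kc) (kcosh_second_diff L0 (y - x) v1) (ltW hlt) (near_le (ltW hlt)).
Qed.

End inf_convolution.

Lemma prob_integral_le_sum (R : realType) dT (T : measurableType dT) (P : probability T R)
    (u1 u2 v1 v2 v3 : T -> \bar R) (c : \bar R) :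
  measurable_fun setT u1 -> measurable_fun setT u2 -> measurable_fun setT v1 ->
  measurable_fun setT v2 -> measurable_fun setT v3 ->
  (forall w, 0 <= u1 w)%E -> (forall w, 0 <= u2 w)%E -> (forall w, 0 <= v1 w)%E ->
  (forall w, 0 <= v2 w)%E -> (forall w, 0 <= v3 w)%E -> (0 <= c)%E ->
  (forall w, u1 w + u2 w <= c + (v1 w + (v2 w + v3 w)))%E ->
  (\int[P]_w u1 w + \int[P]_w u2 w <= c + (\int[P]_w v1 w + (\int[P]_w v2 w + \int[P]_w v3 w)))%E.
Proof.
move=> mu1 mu2 mv1 mv2 mv3 u10 u20 v10 v20 v30 c0 h.
have m23 : measurable_fun setT (fun w => v2 w + v3 w)%E by exact: emeasurable_funD.
have m123 : measurable_fun setT (fun w => v1 w + (v2 w + v3 w))%E by exact: emeasurable_funD.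
have p23 w : (0 <= v2 w + v3 w)%E by exact: adde_ge0.
have p123 w : (0 <= v1 w + (v2 w + v3 w))%E by exact: adde_ge0.
rewrite -{1}(integral_cst_prob P c) -!ge0_integralD//.
by apply: ge0_le_integral_nomeas => // w; exact: adde_ge0.
Qed.

(** * Bounds on the discrete generator *)

Section step_mean_bounds.
Context (R : realType) (d : nat) (disp : measure_display)
  (Omega : measurableType disp) (P : probability Omega R)
  (X : R -> Omega -> 'rV[R]_d).
Hypotheses (hX : levy_process P X) (symX : symmetric_process P X).
Local Notation E := 'rV[R]_d.
Variables (f : E -> R) (M : R).
Hypotheses (cf : continuous f) (f0 : forall y, 0 <= f y) (fM : forall y, f y <= M).

Let mf : measurable_fun setT f. Proof. exact: continuous_measurable_rV. Qed.
Let mX n : measurable_fun setT (X n.+1%:R^-1).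
Proof. by case: hX => h _ _ _ _; apply: h; rewrite invr_ge0. Qed.

Let n0 n : 0 <= n.+1%:R^-1 :> R. Proof. by rewrite invr_ge0. Qed.

Let mfp n y : measurable_fun setT (fun w => f (y + X n.+1%:R^-1 w)).
Proof. by apply: (measurableT_comp mf); exact: measurable_funD_rV. Qed.

Let mfm n y : measurable_fun setT (fun w => f (y - X n.+1%:R^-1 w)).
Proof.
by apply: (measurableT_comp mf); apply: measurable_funD_rV => //; exact: measurable_funN_rV.
Qed.

Let mean_sym n y : ((step_mean P X f n y)%:E = \int[P]_w (f (y - X n.+1%:R^-1 w))%:E)%E.
Proof.
rewrite (step_meanE hX cf f0 fM).
have mg : measurable_fun setT (fun z => (f (y + z))%:E : \bar R).
  by apply/measurable_EFinP; apply: (measurableT_comp mf); exact: measurable_funD_rV.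
exact: (esym (@symmetric_integral _ _ _ _ P X hX symX n.+1%:R^-1 (fun z => (f (y + z))%:E) (n0 n) mg (fun z => f0 _))).
Qed.

Let mnorm n : measurable_fun setT (fun w => enorm (X n.+1%:R^-1 w)).
Proof. exact: (measurableT_comp (@measurable_enorm R d) (mX n)). Qed.

Let mle n (r : R) : measurable_fun setT (fun w => (enorm (X n.+1%:R^-1 w) <= r)%R%:R : R).
Proof.
rewrite (_ : (fun w => _) = fun w => if enorm (X n.+1%:R^-1 w) <= r then 1 else 0); last first.
  by apply/funext => w; case: (_ <= _).
by apply: measurable_fun_ifT => //; exact: measurable_fun_ler.
Qed.

Let mge n (r : R) : measurable_fun setT (fun w => (r <= enorm (X n.+1%:R^-1 w))%R%:R : R).
Proof.
rewrite (_ : (fun w => _) = fun w => if r <= enorm (X n.+1%:R^-1 w) then 1 else 0); last first.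
  by apply/funext => w; case: (_ <= _).
by apply: measurable_fun_ifT => //; exact: measurable_fun_ler.
Qed.

Let near_int n : \bar R := (\int[P]_w (enorm (X n.+1%:R^-1 w) ^+ 2 * (enorm (X n.+1%:R^-1 w) <= 1)%R%:R)%:E)%E.
Let mnear n : measurable_fun setT (fun w => (enorm (X n.+1%:R^-1 w) ^+ 2 * (enorm (X n.+1%:R^-1 w) <= 1)%R%:R)%:E : \bar R).
Proof. by apply/measurable_EFinP; apply: measurable_funM; [apply: measurable_funX; exact: mnorm|exact: mle]. Qed.

Variable S : R.
Hypothesis hS : forall n, (n.+1%:R%:E * near_int n <= S%:E)%E.

Let far_int n (y : E) (rho : R) : \bar R := (\int[P]_w (f (y + X n.+1%:R^-1 w) * (rho <= enorm (X n.+1%:R^-1 w))%R%:R)%:E)%E.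

(* symmetrization removes the first-order term *)
Lemma step_mean_upper (a : R) n y : 0 <= a ->
  (forall v, enorm v <= 1 -> f (y + v) + f (y - v) <= 2 * f y + a * enorm v ^+ 2) ->
  ((n.+1%:R * (step_mean P X f n y - f y))%:E <= (a * S)%:E + n.+1%:R%:E * far_int n y (3 / 4))%E.
Proof.
move=> a0 hf; set m := step_mean P X f n y.
have nR : 0 < n.+1%:R :> R by [].
have S0 : 0 <= S.
  rewrite -lee_fin; apply: le_trans (hS n); apply: mule_ge0; first by rewrite lee_fin ltW.
  by apply: integral_ge0 => w _; rewrite lee_fin mulr_ge0// sqr_ge0.
have m1 : measurable_fun setT (fun w => (f (y + X n.+1%:R^-1 w))%:E : \bar R) by apply/measurable_EFinP; exact: mfp.
have m2 : measurable_fun setT (fun w => (f (y - X n.+1%:R^-1 w))%:E : \bar R) by apply/measurable_EFinP; exact: mfm.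
have mf1 : measurable_fun setT (fun w => (f (y + X n.+1%:R^-1 w) * (3 / 4 <= enorm (X n.+1%:R^-1 w))%R%:R)%:E : \bar R).
  by apply/measurable_EFinP; apply: measurable_funM; [exact: mfp|exact: mge].
have mf2 : measurable_fun setT (fun w => (f (y - X n.+1%:R^-1 w) * (3 / 4 <= enorm (X n.+1%:R^-1 w))%R%:R)%:E : \bar R).
  by apply/measurable_EFinP; apply: measurable_funM; [exact: mfm|exact: mge].
have farE : (\int[P]_w (f (y - X n.+1%:R^-1 w) * (3 / 4 <= enorm (X n.+1%:R^-1 w))%R%:R)%:E = far_int n y (3 / 4))%E.
  have mg : measurable_fun setT (fun z => (f (y + z) * (3 / 4 <= enorm z)%R%:R)%:E : \bar R).
    apply/measurable_EFinP; apply: measurable_funM.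
      by apply: (measurableT_comp mf); exact: measurable_funD_rV.
    rewrite (_ : (fun z => _) = fun z => if 3 / 4 <= enorm z then 1 else 0); last first.
      by apply/funext => z; case: (_ <= _).
    by apply: measurable_fun_ifT => //; apply: measurable_fun_ler => //; exact: measurable_enorm.
  have := @symmetric_integral _ _ _ _ P X hX symX n.+1%:R^-1 (fun z => (f (y + z) * (3 / 4 <= enorm z)%R%:R)%:E) (n0 n) mg (fun z => mulr_ge0 (f0 _) (ler0n _ _)).
  move=> e; rewrite /far_int -e; apply: eq_integral => w _; by rewrite enormN.
have F0 w : (0 <= (f (y + X n.+1%:R^-1 w) * (3 / 4 <= enorm (X n.+1%:R^-1 w))%R%:R)%:E)%E by rewrite lee_fin mulr_ge0.
have F1 w : (0 <= (f (y - X n.+1%:R^-1 w) * (3 / 4 <= enorm (X n.+1%:R^-1 w))%R%:R)%:E)%E by rewrite lee_fin mulr_ge0.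
have N0 w : (0 <= (a * (enorm (X n.+1%:R^-1 w) ^+ 2 * (enorm (X n.+1%:R^-1 w) <= 1)%R%:R))%:E)%E.
  by rewrite lee_fin mulr_ge0// mulr_ge0// sqr_ge0.
have mN : measurable_fun setT (fun w => (a * (enorm (X n.+1%:R^-1 w) ^+ 2 * (enorm (X n.+1%:R^-1 w) <= 1)%R%:R))%:E : \bar R).
  apply/measurable_EFinP; apply: measurable_funM => //.
  by apply: measurable_funM; [apply: measurable_funX; exact: mnorm|exact: mle].
have key : ((m + m)%:E <= (2 * f y)%:E + (a%:E * near_int n + (far_int n y (3 / 4) + far_int n y (3 / 4))))%E.
  have -> : ((m + m)%:E = \int[P]_w (f (y + X n.+1%:R^-1 w))%:E + \int[P]_w (f (y - X n.+1%:R^-1 w))%:E)%E.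
    by rewrite EFinD; congr (_ + _)%E; [exact: (step_meanE hX cf f0 fM)|exact: mean_sym].
  rewrite -{2}farE.
  have U1 w : (0 <= (f (y + X n.+1%:R^-1 w))%:E)%E by rewrite lee_fin.
  have U2 w : (0 <= (f (y - X n.+1%:R^-1 w))%:E)%E by rewrite lee_fin.
  have eN : (a%:E * near_int n = \int[P]_w (a * (enorm (X n.+1%:R^-1 w) ^+ 2 * (enorm (X n.+1%:R^-1 w) <= 1)%R%:R))%:E)%E.
    rewrite /near_int -ge0_integralZl//; last by move=> w _; rewrite lee_fin mulr_ge0// sqr_ge0.
  rewrite eN /far_int; apply: (@prob_integral_le_sum _ _ _ P _ _ _ _ _ _ m1 m2 mN mf1 mf2 U1 U2 N0 F0 F1).
    by rewrite lee_fin mulr_ge0.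
  move=> w.
  rewrite -?EFinM -?EFinD lee_fin.
  have [hn|hn] := leP (enorm (X n.+1%:R^-1 w)) 1.
    rewrite mulr1; have := hf _ hn; have := F0 w; have := F1 w; rewrite !lee_fin; lra.
  have -> : 3 / 4 <= enorm (X n.+1%:R^-1 w) by lra.
  by rewrite !mulr0 !mulr1 add0r lerDr mulr_ge0.
have ni : near_int n \is a fin_num.
  rewrite ge0_fin_numE; last by apply: integral_ge0 => w _; rewrite lee_fin mulr_ge0// sqr_ge0.
  have := hS n; case: (near_int n) => [r _| |]; rewrite ?ltry//.
  by rewrite gt0_muley ?lte_fin.
have fi : far_int n y (3 / 4) \is a fin_num.
  rewrite ge0_fin_numE; last by apply: integral_ge0.
  apply: (@le_lt_trans _ _ m%:E); last exact: ltry.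
  rewrite /m (step_meanE hX cf f0 fM); apply: ge0_le_integral_nomeas => // w.
  by rewrite lee_fin ler_piMr// lern1 leq_b1.
move: key (hS n); rewrite -(fineK ni) -(fineK fi); move: (fine (near_int n)) (fine (far_int n y (3 / 4))) => p r.
rewrite -?EFinM -?EFinD !lee_fin => h1 h2.
have h3 : a * (n.+1%:R * p) <= a * S by rewrite ler_wpM2l.
have h4 : n.+1%:R * (m + m) <= n.+1%:R * (2 * f y + (a * p + (r + r))) by rewrite ler_pM2l.
have aS : 0 <= a * S by rewrite mulr_ge0.
move: h3 h4; rewrite mulrCA !mulrDr mulrN; move: (n.+1%:R * m) (n.+1%:R * r) (n.+1%:R * (a * p)) => u1 u2 u3.
have -> : n.+1%:R * (2 * f y) = 2 * (n.+1%:R * f y) by ring.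
move: (n.+1%:R * f y) (a * S) aS => u4 u5 u50; lra.
Qed.

Lemma far_int_le n y (rho : R) : (n.+1%:R%:E * far_int n y rho <=
  (M * rate P X [set z | (rho <= enorm z)%R] n.+1)%:E)%E.
Proof.
have M0 : 0 <= M by exact: le_trans (f0 0) (fM 0).
have mA : measurable [set z : E | (rho <= enorm z)%R].
  by apply: closed_measurable_rV; exact: closed_enorm_ge.
rewrite EFinM (rate_integral hX n.+1 mA) muleCA; apply: lee_wpmul2l => //.
have mI : measurable_fun setT (fun w => (\1_[set z : E | (rho <= enorm z)%R] (X n.+1%:R^-1 w))%:E : \bar R).
  apply/measurable_EFinP.
  have m1 : measurable_fun setT (\1_[set z : E | (rho <= enorm z)%R] : E -> R) by exact: measurable_indic.
  exact: (measurableT_comp m1 (mX n)).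
rewrite -ge0_integralZl//.
apply: ge0_le_integral_nomeas => w; first by rewrite lee_fin mulr_ge0.
rewrite -EFinM lee_fin indicE; case: (boolP (rho <= enorm (X n.+1%:R^-1 w))) => h.
  by rewrite mem_set// !mulr1.
by rewrite mulr0 mulr_ge0.
Qed.

End step_mean_bounds.

(** * Comparison with the Levy density *)

Section harnack_upper.
Context (R : realType) (d : nat) (disp : measure_display)
  (Omega : measurableType disp) (P : probability Omega R)
  (X : R -> Omega -> 'rV[R]_d).
Hypotheses (hX : levy_process P X) (symX : symmetric_process P X) (d0 : (0 < d)%N).
Local Notation E := 'rV[R]_d.
Local Notation leb := (@lebesgue_measure R).
Variable nu : E -> R.
Hypothesis hnu : levy_density P X nu.

Definition locally_killed (q : E -> R) := forall x, {ae P, forall w, forall T, 0 <= T ->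
  (\int[leb]_(u in `[0%R, T]) (q (x + X u w)%R)%:E < +oo)%E}.

Lemma far_sym (f : E -> R) n y rho : continuous f -> (forall z, 0 <= f z) ->
  (\int[P]_w (f (y + X n.+1%:R^-1 w) * (rho <= enorm (X n.+1%:R^-1 w))%R%:R)%:E =
   \int[P]_w (f (y - X n.+1%:R^-1 w) * (rho <= enorm (X n.+1%:R^-1 w))%R%:R)%:E)%E.
Proof.
move=> cf f0; have n0 : 0 <= n.+1%:R^-1 :> R by rewrite invr_ge0.
have mg : measurable_fun setT (fun z => (f (y + z) * (rho <= enorm z)%R%:R)%:E : \bar R).
  apply/measurable_EFinP; apply: measurable_funM.
    apply: (measurableT_comp (continuous_measurable_rV cf)); exact: measurable_funD_rV.
  rewrite (_ : (fun z => _) = fun z => if rho <= enorm z then 1 else 0); last first.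
    by apply/funext => z; case: (_ <= _).
  by apply: measurable_fun_ifT => //; apply: measurable_fun_ler => //; exact: measurable_enorm.
have := @symmetric_integral _ _ _ _ P X hX symX n.+1%:R^-1
  (fun z => (f (y + z) * (rho <= enorm z)%R%:R)%:E) n0 mg (fun z => mulr_ge0 (f0 _) (ler0n _ _)).
by move=> e; rewrite -e; apply: eq_integral => w _; rewrite enormN.
Qed.

Variables (L : R) (g : E -> R) (H c Cg : R).
Hypotheses (L0 : 0 < L) (mg : measurable_fun setT g) (g0 : forall y, 0 < g y) (gH : forall y, g y <= H)
  (c0 : 0 < c) (gk : forall y z, g y <= c * kcosh L (y - z) * g z) (Cg0 : 0 <= Cg).
Hypothesis gfar : forall y,
  (\int[lebesgue_rV R d]_(z in [set z | (3 / 4 <= enorm z)%R]) (g (y - z) * nu z)%:E <= (Cg * g y)%:E)%E.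

Let h := infconv L g.
Let D : R := (d.*2)%:R.
Let D0 : 0 < D. Proof. by rewrite ltr0n double_gt0. Qed.
Let h0 y : 0 < h y. Proof. exact: (infconv_gt0 g0 c0 gk). Qed.
Let hg y : h y <= D * g y. Proof. exact: (infconv_le c0 gk). Qed.
Let gh y : g y <= c * h y. Proof. by rewrite mulrC -ler_pdivrMr//; exact: (infconv_ge c0 gk). Qed.
Let ch : continuous h. Proof. exact: (infconv_continuous L0 g0 c0 gk). Qed.
Let H0 : 0 < H. Proof. exact: lt_le_trans (g0 0) (gH 0). Qed.
Let hM y : h y <= D * H. Proof. by apply: le_trans (hg y) _; rewrite ler_pM2l. Qed.

Let F : set E := [set z | (3 / 4 <= enorm z)%R].
Let cF : closed F. Proof. exact: closed_enorm_ge. Qed.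
Let mF : measurable F. Proof. exact: closed_measurable_rV. Qed.

Let nuF z : F z -> 0 <= nu z.
Proof.
case: hnu => _ hp _ Fz; apply: ltW; apply: hp; apply: contraPN Fz => /eqP ->.
by rewrite /F/= enorm0; apply/negP; rewrite -ltNge.
Qed.

Let mnu : measurable_fun setT nu. Proof. by case: hnu. Qed.

Let hfar y : (\int[lebesgue_rV R d]_(z in F) (h (y - z) * nu z)%:E <= (D * Cg * g y)%:E)%E.
Proof.
have msub : measurable_fun setT (fun z : E => y - z).
  by apply: measurable_funD_rV => //; exact: measurable_funN_rV.
apply: (@le_trans _ _ (\int[lebesgue_rV R d]_(z in F) (D%:E * (g (y - z) * nu z)%:E))%E).
  apply: ge0_le_integral => //.
  - by move=> z Fz; rewrite lee_fin mulr_ge0 ?nuF// ltW.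
  - apply: measurable_funTS; apply/measurable_EFinP; apply: measurable_funM => //.
    exact: (measurableT_comp (continuous_measurable_rV ch) msub).
  - apply: measurable_funTS; apply: measurable_funeM; apply/measurable_EFinP; apply: measurable_funM => //.
    exact: (measurableT_comp mg msub).
  - by move=> z Fz; rewrite -EFinM lee_fin mulrA; apply: ler_wpM2r; [exact: nuF|exact: hg].
rewrite ge0_integralZl//.
- by rewrite -mulrA EFinM; apply: lee_wpmul2l; [rewrite lee_fin ltW|exact: gfar].
- apply: measurable_funTS; apply/measurable_EFinP; apply: measurable_funM => //.
  exact: (measurableT_comp mg msub).
- by move=> z Fz; rewrite lee_fin mulr_ge0 ?nuF// ltW.
- by rewrite lee_fin ltW.
Qed.

(** Small increments contribute the second difference bound times the second moment [S], large ones
    the integral of [h] against [nu], which is at most a multiple of [h y]. The bound uniform in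
    [n], used for domination, comes from the boundedness of the rates. *)
Let excess : exists2 C1, 0 < C1 & forall x,
  (forall y eta, 0 < eta -> \forall n \near \oo,
     n.+1%:R * (step_mean P X (harnack_test L g x) n y - harnack_test L g x y) <= C1 * h y + eta) /\
  exists2 c', 0 <= c' & forall n y, n.+1%:R * (step_mean P X (harnack_test L g x) n y - harnack_test L g x y) <= c'.
Proof.
have [S S0 hS] := second_moment hX symX.
have [C2 hC2] := rate_bounded hX mF (ltac:(by []) : 0 < (3 / 4 : R)) (fun z Fz => Fz) cF.
have kc := kcosh_curv_gt0 L0.
have bc0 : 0 <= harnack_curv d L.
  rewrite /harnack_curv; apply: mulr_ge0; first exact: ltW.
  apply: addr_ge0 => //; apply: mulr_ge0; last first.
    by apply: addr_ge0; [apply: divr_ge0 => //; exact: sqr_ge0|apply: mulr_ge0 => //; exact: expR_ge0].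
  apply: mulr_ge0 => //; rewrite /harnack_height; apply: addr_ge0 => //; apply: divr_ge0; last exact: sqr_ge0.
  by rewrite !mulr_ge0.
exists (harnack_curv d L * S + D * Cg * c + 1).
  rewrite ltr_wpDl//; apply: addr_ge0; apply: mulr_ge0 => //; last exact: ltW.
  by apply: mulr_ge0 => //; exact: ltW.
move=> x; set f := harnack_test L g x.
have cf : continuous f by exact: (harnack_test_continuous L0 g0 c0 gk).
have f0 y : 0 <= f y by exact: (harnack_test_ge0 L0 g0 c0 gk).
have fh y : f y <= h y by exact: harnack_test_le.
have fM y : f y <= D * H by exact: le_trans (hM y).
have up n y := @step_mean_upper _ _ _ _ P X hX symX f (D * H) cf f0 fM S hS (harnack_curv d L * h y) n y
  (mulr_ge0 bc0 (ltW (h0 y))) (fun v v1 => @harnack_test_second_diff _ _ _ L0 d0 g c g0 c0 gk x y v v1).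
split.
  move=> y eta eta0.
  have cy : continuous (fun z : E => h (y - z)).
    move=> z; apply: (@continuous_comp _ _ _ (fun z : E => y - z) h); last exact: ch.
    by apply: (@continuousB R E E (fun=> y) id); [exact: cst_continuous|exact: cvg_id].
  have [N _ hN] := @far_limsup _ _ _ _ P X hX nu hnu (fun z => h (y - z)) (D * H) (3 / 4) eta (D * Cg * g y)
    ltac:(by []) cy (fun z => ltW (h0 _)) (fun z => hM _) eta0 (hfar y).
  exists N => // n /= Nn; have := hN n.+1 (leqW Nn) => /= hn.
  rewrite -lee_fin; apply: le_trans (up n y) _.
  apply: (@le_trans _ _ ((harnack_curv d L * h y * S)%:E + (D * Cg * g y + eta)%:E)%E); last first.
    rewrite -EFinD lee_fin addrA lerD2r !mulrDl mul1r -[X in _ <= _ + X]addr0.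
    have h1 := ler_wpM2l (mulr_ge0 (ltW D0) Cg0) (gh y).
    have h2 := h0 y; lra.
  apply: leeD2l; apply: le_trans hn; apply: lee_wpmul2l => //.
  rewrite (far_sym n y (3 / 4) cf f0); apply: ge0_le_integral_nomeas => w.
    by rewrite lee_fin mulr_ge0.
  by rewrite lee_fin ler_wpM2r.
have C20 : 0 <= C2 by apply: le_trans (hC2 0%N); exact: rate_ge0.
have DH : 0 <= D * H by rewrite mulr_ge0// ltW.
exists (harnack_curv d L * (D * H) * S + D * H * C2) => [|n y].
  by apply: addr_ge0; apply: mulr_ge0 => //; exact: mulr_ge0.
rewrite -lee_fin; apply: le_trans (up n y) _; rewrite EFinD; apply: leeD.
  by rewrite lee_fin ler_wpM2r// ler_wpM2l.
apply: le_trans (far_int_le hX f0 fM n y (3 / 4)) _.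
by rewrite lee_fin ler_wpM2l.
Qed.

(** [K G f <= G (q f) <= C1 G h] by Dynkin. Moreover [G h <= G f + exp L * h x * G 1], as [f = h] at
    distance 1/2 or more and the Harnack inequality bounds [h] closer to [x]. With [K >= 2 C1] the
    term [G f] is at most half of [G h] and is absorbed; feeding the bound on [G h] back into
    [G (q f) <= C1 G h] concludes. *)
Lemma green_harnack_upper : exists2 C, 0 < C & forall (q : E -> R) (K : R), measurable_fun setT q -> C <= K ->
  (forall y, K <= q y) -> locally_killed q -> forall x,
  (green_fk P X q (fun y => (q y * g y * (1 / 2 <= enorm (y - x))%R%:R)%:E) x <=
   (C * g x)%:E * green_fk P X q (cst 1) x)%E.
Proof.
have [C1 C10 hC1] := excess.
pose C := 2 * C1 + c * C1 * (2 * expR L * D).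
have C20 : 0 < c * C1 * (2 * expR L * D) by rewrite !mulr_gt0 ?expR_gt0.
exists C => [|q K mq CK qK qloc x]; first by rewrite addr_gt0// mulr_gt0.
have K2 : 2 * C1 <= K by apply: le_trans CK; rewrite lerDl ltW.
have K0 : 0 < K by apply: lt_le_trans K2; rewrite mulr_gt0.
have q0 y : 0 <= q y by exact: le_trans (ltW K0) (qK y).
have [hlim [c' c'0 hc']] := hC1 x; set f := harnack_test L g x in hlim hc'.
have cf : continuous f by exact: (harnack_test_continuous L0 g0 c0 gk).
have f0 y : 0 <= f y by exact: (harnack_test_ge0 L0 g0 c0 gk).
have fh y : f y <= h y by exact: harnack_test_le.
have fM y : f y <= D * H by exact: le_trans (hM y).
have fx : f x = 0 by exact: (harnack_test_center g0 c0 gk).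
have mh : measurable_fun setT h by exact: continuous_measurable_rV.
have mf : measurable_fun setT f by exact: continuous_measurable_rV.
have dyn := @green_upper _ _ _ _ P X hX q K mq K0 qK qloc f (D * H) x cf f0 fM fx h C1 c' mh (fun y => ltW (h0 y)) (ltW C10) c'0 hc' hlim.
have mhe : measurable_fun setT (EFin \o h) by exact/measurable_EFinP.
have mfe : measurable_fun setT (EFin \o f) by exact/measurable_EFinP.
have mqf : measurable_fun setT (fun y => (q y * f y)%:E) by apply/measurable_EFinP; exact: measurable_funM.
have qf0 y : (0 <= (q y * f y)%:E)%E by rewrite lee_fin mulr_ge0.
have m1 : measurable_fun [set: E] (cst 1%E : E -> \bar R) by exact: measurable_cst.
have Gf : ((K%:E * green_fk P X q (EFin \o f) x <= green_fk P X q (fun y => (q y * f y)%:E) x))%E.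
  rewrite -(@green_fkZ _ _ _ _ P X hX q K mq K0 qK K (EFin \o f) x (ltW K0) mfe (fun y => f0 y)).
  apply: (@le_green_fk _ _ _ _ P X q) => y; first by rewrite mule_ge0// lee_fin// ltW.
  by rewrite -EFinM lee_fin ler_wpM2r.
have Gh : (green_fk P X q (EFin \o h) x <= green_fk P X q (EFin \o f) x + (expR L * h x)%:E * green_fk P X q (cst 1%E) x)%E.
  have eh0 : 0 <= expR L * h x by rewrite mulr_ge0 ?expR_ge0// ltW.
  rewrite -(@green_fkZ _ _ _ _ P X hX q K mq K0 qK (expR L * h x) (cst 1%E) x eh0 m1 (fun=> lee01)).
  rewrite -(@green_fkD _ _ _ _ P X hX q K mq K0 qK (EFin \o f) _ x mfe _ (fun y => f0 y)); last 2 first.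
  - exact: measurable_funeM.
  - by move=> y; rewrite mule1 lee_fin.
  apply: (@le_green_fk _ _ _ _ P X q) => y; first by rewrite lee_fin ltW.
  rewrite mule1 /= -EFinD lee_fin; have [yx|yx] := leP (1 / 2) (enorm (y - x)).
    by rewrite /f (harnack_test_far L0 g0 c0 gk yx) lerDl.
  apply: (@le_trans _ _ (expR L * h x)); last by rewrite lerDr.
  apply: le_trans (infconv_lipschitz L0 g0 c0 gk x y) _; rewrite ler_pM2r// ler_expR.
  rewrite ler_piMr ?(ltW L0)//; have := norm_le_enorm (y - x); lra.
have fin_h : green_fk P X q (EFin \o h) x \is a fin_num.
  apply: (@green_bounded_fin _ _ _ _ P X hX q K mq K0 qK qloc _ (D * H)) => y; rewrite lee_fin; last exact: hM.
  exact: ltW.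
have fin_f : green_fk P X q (EFin \o f) x \is a fin_num.
  by apply: (@green_bounded_fin _ _ _ _ P X hX q K mq K0 qK qloc _ (D * H)) => y; rewrite lee_fin.
have fin_1 : green_fk P X q (cst 1%E) x \is a fin_num.
  by apply: (@green_bounded_fin _ _ _ _ P X hX q K mq K0 qK qloc _ 1) => y; rewrite /cst lee_fin.
have qg : (green_fk P X q (fun y => (q y * g y * (1 / 2 <= enorm (y - x))%R%:R)%:E) x <=
    c%:E * green_fk P X q (fun y => (q y * f y)%:E) x)%E.
  rewrite -(@green_fkZ _ _ _ _ P X hX q K mq K0 qK c _ x (ltW c0) mqf qf0).
  apply: (@le_green_fk _ _ _ _ P X q) => y; first by rewrite lee_fin !mulr_ge0// ltW.
  rewrite -EFinM lee_fin; case: (boolP (1 / 2 <= enorm (y - x))) => yx; last by rewrite mulr0 !mulr_ge0// ltW.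
  by rewrite mulr1 /f (harnack_test_far L0 g0 c0 gk yx) mulrCA ler_wpM2l.
have G10 : (0 <= green_fk P X q (cst 1%E) x)%E by apply: green_fk_ge0 => y; rewrite /cst lee_fin.
apply: le_trans qg _.
have cdyn := lee_wpmul2l (ltac:(by rewrite lee_fin ltW) : (0 <= c%:E)%E) dyn.
apply: le_trans cdyn _.
have KGf := le_trans Gf dyn.
move: KGf Gh G10; rewrite -(fineK fin_h) -(fineK fin_f) -(fineK fin_1).
have f_ge0 : 0 <= fine (green_fk P X q (EFin \o f) x) by rewrite fine_ge0//; apply: green_fk_ge0 => y; rewrite lee_fin.
move: f_ge0; move: (fine (green_fk P X q (EFin \o h) x)) (fine (green_fk P X q (EFin \o f) x)) (fine (green_fk P X q (cst 1%E) x)) => u v w v0.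
rewrite -!EFinM -EFinD !lee_fin => k1 k2 w0.
have s1 : 2 * v <= u.
  have : 2 * C1 * v <= C1 * u by apply: le_trans k1; rewrite ler_wpM2r.
  by rewrite -mulrA mulrCA ler_pM2l.
have s2 : u <= 2 * (expR L * h x * w) by lra.
have s3 : expR L * h x * w <= expR L * (D * g x) * w.
  by rewrite ler_wpM2r// ler_pM2l ?expR_gt0.
apply: (@le_trans _ _ (c * C1 * (2 * (expR L * (D * g x) * w)))).
  by rewrite -[leRHS]mulrA ler_pM2l// ler_pM2l//; apply: le_trans s2 _; rewrite ler_pM2l.
have -> : c * C1 * (2 * (expR L * (D * g x) * w)) = c * C1 * (2 * expR L * D) * g x * w by ring.
by rewrite ler_wpM2r// ler_pM2r// lerDr mulr_ge0// ltW.
Qed.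

End harnack_upper.

Section enorm_scale.
Context (R : realType) (d : nat).
Implicit Types z : 'rV[R]_d.

Lemma enormZ (a : R) z : enorm (a *: z) = `|a| * enorm z.
Proof.
rewrite /enorm -sqrtr_sqr -sqrtrM ?sqr_ge0//; congr Num.sqrt.
by rewrite mulr_sumr; apply: eq_bigr => i _; rewrite mxE exprMn.
Qed.

Lemma enorm_exists (a : R) : (0 < d)%N -> 0 <= a -> exists z, enorm z = a.
Proof.
move=> d0 a0; exists (a *: delta_mx ord0 (Ordinal d0)); rewrite enormZ ger0_norm//.
rewrite /enorm (bigD1 (Ordinal d0))//= big1 => [|i id].
  by rewrite mxE !eqxx/= expr1n addr0 sqrtr1 mulr1.
by rewrite mxE eqxx/= (negbTE id) expr0n.
Qed.

Lemma lebesgue_rV_cube (y : 'rV[R]_d) (r : R) : 0 <= r ->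
  lebesgue_rV R d [set z | forall i, `[(y ord0 i - r)%R, (y ord0 i + r)%R]%classic (z ord0 i)] =
  ((2 * r) ^+ d)%:E.
Proof.
move=> r0; rewrite (lebesgue_rV_box (fun i => measurable_itv _)).
rewrite (eq_bigr (fun=> (2 * r)%:E)) => [|i _].
  by rewrite prodEFin prodr_const card_ord.
rewrite lebesgue_measure_itv/= lte_fin; case: ltP => h.
  by rewrite -EFinB; congr EFin; lra.
by congr EFin; lra.
Qed.

Lemma measurable_cube (y : 'rV[R]_d) (r : R) :
  measurable [set z : 'rV[R]_d | forall i, `[(y ord0 i - r)%R, (y ord0 i + r)%R]%classic (z ord0 i)].
Proof.
rewrite (_ : mkset _ = \bigcap_(i in [set: 'I_d])
    (fun v : 'rV[R]_d => v ord0 i) @^-1` `[(y ord0 i - r)%R, (y ord0 i + r)%R]%classic).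
  apply: fin_bigcap_measurable => [|i _]; first exact: finite_finset.
  by rewrite -[X in measurable X]setTI; exact: (measurable_coord i measurableT).
by apply/seteqP; split => z h; [move=> i _|move=> i]; exact: h.
Qed.

End enorm_scale.

(** * The Levy density as a comparison function *)

Section levy_profile.
Context (R : realType) (d : nat) (disp : measure_display)
  (Omega : measurableType disp) (P : probability Omega R)
  (X : R -> Omega -> 'rV[R]_d).
Hypotheses (hX : levy_process P X) (d0 : (0 < d)%N).
Local Notation E := 'rV[R]_d.
Variables (nu : E -> R) (C1 C2 C3 : R).
Hypotheses (hnu : levy_density P X nu) (C11 : 1 <= C1) (C21 : 1 <= C2) (C31 : 1 <= C3).
Hypothesis A11 : forall x y, 1 / 2 <= enorm y -> enorm y <= enorm x -> enorm x <= enorm y + 1 ->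
  C1^-1 * nu y <= nu x <= C1 * nu y.
Hypothesis A12 : forall x y, 1 / 2 <= enorm y -> enorm y <= enorm x -> nu x <= C2 * nu y.
Hypothesis A13 : forall x y, 1 <= enorm (y - x) ->
  (\int[lebesgue_rV R d]_(z in [set z | (1 / 2 < enorm (z - x))%R /\ (1 / 2 < enorm (z - y))%R])
     (nu (x - z) * nu (z - y))%:E <= (C3 * nu (x - y))%:E)%E.

Let C10 : 0 < C1. Proof. exact: lt_le_trans C11. Qed.
Let C20 : 0 < C2. Proof. exact: lt_le_trans C21. Qed.

Let nu0 x : 1 / 2 <= enorm x -> 0 < nu x.
Proof.
case: hnu => _ h _ hx; apply: h; apply: contraPN hx => /eqP ->.
by rewrite enorm0; apply/negP; rewrite -ltNge.
Qed.

Let mnu : measurable_fun setT nu. Proof. by case: hnu. Qed.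

(** The local comparison handles radii differing by at most 1, so [z] is moved radially towards the
    origin by one unit per step, at the cost of a factor [C1] each. *)
Let nu_chain j : forall y z, 1 / 2 <= enorm y -> enorm y <= enorm z ->
  enorm z <= enorm y + j%:R -> nu y <= C1 ^+ j.+1 * nu z.
Proof.
elim: j => [|j IH] y z y1 yz zy.
  have /andP[h _] := A11 y1 yz ltac:(by lra).
  by rewrite expr1 -ler_pdivrMl.
have z1 : 1 / 2 <= enorm z by exact: le_trans yz.
have z0 := nu0 z1.
have [zl|zl] := leP (enorm z) (enorm y + 1).
  have /andP[h _] := A11 y1 yz zl.
  rewrite ler_pdivrMl// in h; apply: le_trans h _; rewrite ler_pM2r//.
  by rewrite exprS -[leLHS]mulr1 ler_pM2l// exprn_ege1.
pose w := ((enorm z - 1) / enorm z) *: z.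
have ze : 0 < enorm z by apply: lt_le_trans z1.
have zm : 0 < enorm z - 1 by lra.
have we : enorm w = enorm z - 1.
  by rewrite enormZ ger0_norm ?divfK ?lt0r_neq0// divr_ge0// ltW.
have s1 : nu y <= C1 ^+ j.+1 * nu w.
  apply: IH => //; rewrite we; first lra.
  by move: zy; rewrite -natr1; lra.
have /andP[s2 _] : C1^-1 * nu w <= nu z <= C1 * nu w by apply: A11; rewrite we; lra.
rewrite ler_pdivrMl// in s2; apply: le_trans s1 _.
by rewrite [C1 ^+ j.+2]exprSr -[leRHS]mulrA ler_pM2l ?exprn_gt0.
Qed.

Let lam := ln C1.
Let lam0 : 0 <= lam. Proof. exact: ln_ge0. Qed.

(** The chain has about [enorm z - enorm y] steps, which is at most the distance of the points, and
    [C1] to that power is an exponential of rate [ln C1]. Rounding up costs the factor [C1 ^+ 2]. *)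
Let nu_decay y z : 1 / 2 <= enorm y -> enorm y <= enorm z ->
  nu y <= C1 ^+ 2 * expR (lam * enorm (y - z)) * nu z.
Proof.
move=> y1 yz; set t := enorm z - enorm y; have t0 : 0 <= t by rewrite subr_ge0.
have zy : enorm z <= enorm y + (Num.truncn t).+1%:R by have := truncnS_gt t; rewrite /t; lra.
apply: le_trans (nu_chain y1 yz zy) _.
have z0 : 0 < nu z by apply: nu0; exact: le_trans yz.
rewrite ler_pM2r// exprS exprS mulrA -expr2 ler_pM2l ?exprn_gt0//.
rewrite -[in leLHS](@lnK _ C1) ?posrE// -expRM_natl ler_expR mulrC ler_wpM2l//.
apply: (@le_trans _ _ t); first by have /andP[] := truncn_itv t0.
apply: le_trans (ler_norm _) _; apply: le_trans (enorm_dist _ _) _.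
by rewrite enormC.
Qed.

(** The density is cut off inside radius 1/2, where it need not be bounded. The result is bounded,
    positive everywhere and satisfies a global Harnack inequality. *)
Definition levy_profile (y : E) : R := if 1 / 2 <= enorm y then nu y else 1.
Local Notation g := levy_profile.
(** The factor [d] is the price of [enorm_expR_kcosh], and the added 1 keeps the rate positive when
    [C1 = 1]. *)
Definition levy_rate : R := lam * d%:R + 1.
Local Notation L := levy_rate.

Lemma levy_rate_gt0 : 0 < L.
Proof. by rewrite ltr_wpDl// mulr_ge0. Qed.

Lemma levy_profile_gt0 y : 0 < g y.
Proof. by rewrite /g; case: ifP => // /nu0. Qed.

Lemma measurable_levy_profile : measurable_fun setT g.
Proof.
by apply: measurable_fun_ifT => //; apply: measurable_fun_ler => //; exact: measurable_enorm.
Qed.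

Lemma levy_profileE y : 1 / 2 <= enorm y -> g y = nu y.
Proof. by rewrite /g => ->. Qed.

Lemma levy_profile_bounded : exists H, forall y, g y <= H.
Proof.
have [p hp] := @enorm_exists R d (1 / 2) d0 ltac:(by []).
have p0 : 0 < nu p by apply: nu0; rewrite hp.
exists (1 + C2 * nu p) => y; rewrite /g; case: ifP => hy.
  by apply: (@le_trans _ _ (C2 * nu p)); [apply: A12; rewrite hp|rewrite lerDr].
by rewrite lerDl mulr_ge0// ltW.
Qed.

(** Four cases, whose constants add up to [c]: [z] inside radius 1/2 ([H]), both points outside with
    [z] the farther ([C1 ^+ 2]) or the nearer ([C2]), and only [y] inside. In the last case a point
    [p] of norm 1/2 starts the chain in place of [y], hence the division by [nu p]. *)
Lemma levy_profile_harnack : exists2 c, 0 < c & forall y z, g y <= c * kcosh L (y - z) * g z.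
Proof.
have [p hp] := @enorm_exists R d (1 / 2) d0 ltac:(by []).
have p0 : 0 < nu p by apply: nu0; rewrite hp.
have [H hH] := levy_profile_bounded.
have H0 : 0 < H by apply: lt_le_trans (hH 0); exact: levy_profile_gt0.
pose c := C1 ^+ 2 + C2 + H + C1 ^+ 2 / nu p.
have q1 : 0 < C1 ^+ 2 by rewrite exprn_gt0.
have q2 : 0 < C1 ^+ 2 / nu p by rewrite divr_gt0.
exists c => [|y z]; first by rewrite !addr_gt0.
have e1 : 1 <= expR (lam * enorm (y - z)) by rewrite -[leLHS]expR0 ler_expR mulr_ge0// enorm_ge0.
have ek : expR (lam * enorm (y - z)) <= kcosh L (y - z).
  by apply: enorm_expR_kcosh => //; rewrite /levy_rate lerDl.
have gz := levy_profile_gt0 z.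
suff : g y <= c * expR (lam * enorm (y - z)) * g z.
  move=> h; apply: le_trans h _; rewrite ler_pM2r// ler_pM2l//.
  by rewrite !addr_gt0.
set e := expR (lam * enorm (y - z)) in e1 ek *.
have ge a : 0 <= a -> a <= c -> g y <= a * e * g z -> g y <= c * e * g z.
  move=> a0 ac h; apply: le_trans h _; rewrite ler_pM2r// ler_wpM2r//.
  by apply: le_trans e1.
have [zs|zs] := boolP (1 / 2 <= enorm z); last first.
  apply: (ge H); [exact: ltW|by move: q1 q2 H0 (ltW C20); rewrite /c; lra|].
  apply: le_trans (hH y) _; rewrite /g (negbTE zs) mulr1 -[leLHS]mulr1 ler_pM2l//.
have [ys|ys] := boolP (1 / 2 <= enorm y).
  rewrite (levy_profileE ys) (levy_profileE zs) in ge *.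
  have [yz|zy] := leP (enorm y) (enorm z).
    apply: (ge (C1 ^+ 2)); [exact: ltW|by move: q1 q2 H0 (ltW C20); rewrite /c; lra|exact: nu_decay].
  apply: (ge C2); [exact: ltW|by move: q1 q2 H0 (ltW C20); rewrite /c; lra|].
  apply: le_trans (A12 zs (ltW zy)) _; rewrite ler_pM2r; last exact: nu0.
  by rewrite -[leLHS]mulr1 ler_pM2l.
apply: (ge (C1 ^+ 2 / nu p)); [exact: ltW|by move: q1 q2 H0 (ltW C20); rewrite /c; lra|].
rewrite (levy_profileE zs) /g (negbTE ys).
have pz : enorm p <= enorm z by rewrite hp.
set t := enorm z - enorm p; have t0 : 0 <= t by rewrite subr_ge0.
have zy : enorm z <= enorm p + (Num.truncn t).+1%:R by have := truncnS_gt t; rewrite /t; lra.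
have p1 : 1 / 2 <= enorm p by rewrite hp.
have h := nu_chain p1 pz zy.
have z0 : 0 < nu z by apply: nu0.
have -> : C1 ^+ 2 / nu p * e * nu z = (C1 ^+ 2 * e * nu z) / nu p by ring.
rewrite ler_pdivlMr// mul1r; apply: le_trans h _.
rewrite ler_pM2r// exprS exprS mulrA -expr2 ler_pM2l//.
rewrite -[in leLHS](@lnK _ C1) ?posrE// -expRM_natl ler_expR mulrC ler_wpM2l//.
apply: (@le_trans _ _ t); first by have /andP[] := truncn_itv t0.
have := enorm_dist z y; rewrite enormC => h2; have := le_trans (ler_norm _) h2.
by rewrite /t hp; move: ys; rewrite -ltNge; lra.
Qed.

(** If [enorm y < 1], the profile is bounded below at [y], while it is bounded and [nu] has finite
    mass far from 0. Otherwise the convolution bound covers the [z] farther than 1/2 from [y]. The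
    remaining [z] lie in the unit cube around [y], of volume 1, where the profile is at most [H] and
    [nu z <= C1 * C2 * nu y]. *)
Lemma levy_profile_far : exists2 Cg, 0 <= Cg & forall y,
  (\int[lebesgue_rV R d]_(z in [set z | (3 / 4 <= enorm z)%R]) (g (y - z) * nu z)%:E <= (Cg * g y)%:E)%E.
Proof.
have [H hH] := levy_profile_bounded; have [c c0 hc] := levy_profile_harnack.
have H0 : 0 < H by apply: lt_le_trans (hH 0); exact: levy_profile_gt0.
set F : set E := [set z | (3 / 4 <= enorm z)%R].
have mF : measurable F by apply: closed_measurable_rV; exact: closed_enorm_ge.
have nuF z : F z -> 0 < nu z by move=> Fz; apply: nu0; apply: le_trans Fz; lra.
have lF := @levy_fin _ _ _ _ P X hX F (3 / 4) ltac:(by []) (fun z h => h).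
have LE : (levy_measure P X F = \int[lebesgue_rV R d]_(z in F) (nu z)%:E)%E by case: hnu => _ _; apply.
have L0 : (0 <= levy_measure P X F)%E by apply: integral_ge0 => w _; exact: counting_ge0.
have Lf : levy_measure P X F \is a fin_num by rewrite ge0_fin_numE.
pose N0 := fine (levy_measure P X F); have N00 : 0 <= N0 by exact: fine_ge0.
pose D : R := (d.*2)%:R.
have D0 : 0 <= D by [].
exists (H * N0 * (c * (expR L * D)) + (C3 + H * (C1 * C2))) => [|y].
  apply: addr_ge0; first by rewrite !mulr_ge0 ?expR_ge0// ltW.
  by apply: addr_ge0; [exact: le_trans C31|rewrite !mulr_ge0// ltW].
have gy := levy_profile_gt0 y.
have mg := measurable_levy_profile.
have msub : measurable_fun setT (fun z : E => y - z).
  by apply: measurable_funD_rV => //; exact: measurable_funN_rV.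
have [y1|y1] := ltP (enorm y) 1.
  apply: (@le_trans _ _ (H * N0)%:E).
    rewrite EFinM fineK// LE -ge0_integralZl//; last 3 first.
    - by apply: measurable_funTS; exact/measurable_EFinP.
    - by move=> z Fz; rewrite lee_fin ltW// nuF.
    - by rewrite lee_fin ltW.
    apply: ge0_le_integral => //.
    - by move=> z Fz; rewrite lee_fin mulr_ge0// ltW// ?nuF// levy_profile_gt0.
    - apply: measurable_funTS; apply/measurable_EFinP; apply: measurable_funM => //.
      exact: (measurableT_comp mg msub).
    - by apply: measurable_funTS; apply: measurable_funeM; exact/measurable_EFinP.
    - by move=> z Fz; rewrite -EFinM lee_fin ler_wpM2r// ltW// nuF.
  rewrite lee_fin mulrDl; apply: (@le_trans _ _ (H * N0 * (c * (expR L * D)) * g y)); last first.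
    rewrite lerDl mulr_ge0// ?(ltW gy)//.
    by apply: addr_ge0; [exact: le_trans C31|rewrite !mulr_ge0// ltW].
  rewrite -[leLHS]mulr1 -[leRHS]mulrA; apply: ler_wpM2l; first by rewrite mulr_ge0// ltW.
  have := hc 0 y; rewrite {1}/g enorm0 ifF; last by apply/negbTE; rewrite -ltNge.
  move=> h; apply: le_trans h _; rewrite ler_pM2r// ler_pM2l// sub0r -[- y]add0r.
  apply: le_trans (kcosh_shift levy_rate_gt0 _ _) _; rewrite kcosh0 ler_wpM2r// ler_expR.
  rewrite ler_piMr ?(ltW levy_rate_gt0)//; apply: le_trans (norm_le_enorm _) _.
  by rewrite enormN ltW.
have gyE : g y = nu y by apply: levy_profileE; lra.
pose T : set E := [set z | (1 / 2 < enorm (z - y))%R /\ (1 / 2 < enorm (z - 0))%R].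
pose B : set E := [set z | forall i, `[(y ord0 i - 1 / 2)%R, (y ord0 i + 1 / 2)%R]%classic (z ord0 i)].
have mB : measurable B by exact: measurable_cube.
have mT : measurable T.
  have mgt a : measurable ([set z | (1 / 2 < enorm (z - a))%R] : set E).
    rewrite (_ : mkset _ = (fun z => enorm (z - a)) @^-1` `]1 / 2, +oo[%classic); last first.
      by apply/seteqP; split => z /=; rewrite in_itv/= andbT.
    rewrite -[X in measurable X]setTI; exact: (measurable_enormB a measurableT).
  exact: measurableI (mgt y) (mgt 0).
have hA := @A13 y 0; rewrite sub0r enormN in hA; have {}hA := hA y1; rewrite subr0 in hA.
pose cB := H * (C1 * C2) * nu y.
have y12 : 1 / 2 <= enorm y by lra.
have ny := nu0 y12.
have cB0 : 0 <= cB by rewrite /cB !mulr_ge0// ltW.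
have mA' : measurable_fun setT (fun z => if z \in T then (nu (y - z) * nu (z - 0))%:E else 0%E).
  apply: measurable_fun_ifT => //.
    apply: (measurable_fun_bool true); rewrite setTI.
    by rewrite (_ : _ @^-1` _ = T)//; apply/seteqP; split => z /=; [move/set_mem|move/mem_set].
  apply/measurable_EFinP; apply: measurable_funM; first exact: (measurableT_comp mnu msub).
  by under eq_fun do rewrite subr0.
have A0 z : (0 <= if z \in T then (nu (y - z) * nu (z - 0))%:E else 0)%E.
  case: ifPn => // /set_mem [h1 h2]; rewrite lee_fin mulr_ge0// ltW// nu0//; last exact: ltW.
  by rewrite enormC ltW.
have mB' : measurable_fun setT (fun z => (cB * \1_B z)%:E : \bar R).
  by apply/measurable_EFinP; apply: measurable_funM => //; exact: measurable_indic.
have B0 z : (0 <= (cB * \1_B z)%:E)%E by rewrite lee_fin mulr_ge0.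
apply: (@le_trans _ _ (\int[lebesgue_rV R d]_z ((if z \in T then (nu (y - z) * nu (z - 0))%:E else 0) + (cB * \1_B z)%:E))%E).
  rewrite integral_mkcond; apply: ge0_le_integral_nomeas => z; rewrite patchE.
    case: ifPn => // /set_mem Fz; rewrite lee_fin mulr_ge0// ltW// ?nuF//; exact: levy_profile_gt0.
  case: ifPn => [/set_mem Fz|_]; last exact: adde_ge0.
  have [zy|zy] := ltP (1 / 2) (enorm (z - y)).
    rewrite mem_set; last by split => //; rewrite subr0; apply: lt_le_trans Fz; lra.
    rewrite levy_profileE; last by rewrite enormC ltW.
    by rewrite subr0 leeDl.
  rewrite [X in (_ <= _ + X)%E](_ : _ = cB%:E); last first.
    rewrite indicE mem_set ?mulr1// => i /=; rewrite in_itv/=.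
    have := le_trans (coord_le_enorm (z - y) i) zy; rewrite !mxE ler_norml; lra.
  apply: (@le_trans _ _ cB%:E); last by rewrite leeDr.
  rewrite lee_fin /cB -mulrA; apply: ler_pM => //; [exact/ltW/levy_profile_gt0|exact/ltW/nuF|].
  have z1 : 1 / 2 <= enorm z by apply: le_trans Fz; lra.
  have /ler_normlP[d1 d2] := le_trans (enorm_dist z y) zy.
  have [yz|yz] := leP (enorm y) (enorm z).
    apply: le_trans (A12 y12 yz) _; rewrite ler_pM2r//; apply: ler_peMl => //; exact: ltW.
  have /andP[h _] : C1^-1 * nu z <= nu y <= C1 * nu z by apply: A11 => //; [exact: ltW|lra].
  rewrite ler_pdivrMl// in h; apply: le_trans h _.
  by rewrite ler_pM2r//; apply: ler_peMr => //; exact: ltW.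
rewrite ge0_integralD//.
have -> : (\int[lebesgue_rV R d]_z (if z \in T then (nu (y - z) * nu (z - 0))%:E else 0) =
   \int[lebesgue_rV R d]_(z in T) (nu (y - z) * nu (z - 0))%:E)%E.
  by rewrite [RHS]integral_mkcond; apply: eq_integral => z _; rewrite patchE.
apply: (@le_trans _ _ ((C3 * nu y)%:E + cB%:E)%E).
  apply: leeD => //; under eq_integral do rewrite EFinM.
  rewrite ge0_integralZl//; last by apply/measurable_EFinP; exact: measurable_indic.
  have eB : lebesgue_rV R d B = 1%E.
    have := lebesgue_rV_cube y (ltac:(by []) : 0 <= 1 / 2 :> R).
    have -> : 2 * (1 / 2) = 1 :> R by field.
    by rewrite expr1n => h; exact: h.
  rewrite integral_indic// setIT [X in (_ * X)%E](_ : _ = 1%E) ?mule1//.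
rewrite -EFinD lee_fin gyE /cB -mulrDl ler_pM2r// lerDr !mulr_ge0 ?expR_ge0//; exact: ltW.
Qed.

Lemma levy_upper : symmetric_process P X -> exists2 C, 0 < C & forall (q : E -> R) (K : R),
  measurable_fun setT q -> C <= K -> (forall y, K <= q y) -> locally_killed P X q -> forall x,
  (green_fk P X q (fun y => (q y * g y * (1 / 2 <= enorm (y - x))%R%:R)%:E) x <=
   (C * g x)%:E * green_fk P X q (cst 1%E) x)%E.
Proof.
move=> symX; have [H hH] := levy_profile_bounded; have [c c0 hc] := levy_profile_harnack.
have [Cg Cg0 hCg] := levy_profile_far.
exact: (green_harnack_upper hX symX d0 hnu levy_rate_gt0 measurable_levy_profile levy_profile_gt0 hH c0 hc Cg0 hCg).
Qed.

(** The choice of the constant 1 as comparison function. It says that killing happens mainly within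
    distance 1/2 of the start, which [levy_lower] uses to localize [G 1]. *)
Lemma local_upper : symmetric_process P X -> exists2 C, 0 < C & forall (q : E -> R) (K : R),
  measurable_fun setT q -> C <= K -> (forall y, K <= q y) -> locally_killed P X q -> forall x,
  (green_fk P X q (fun y => (q y * (1 / 2 <= enorm (y - x))%R%:R)%:E) x <=
   C%:E * green_fk P X q (cst 1%E) x)%E.
Proof.
move=> symX.
set F : set E := [set z | (3 / 4 <= enorm z)%R].
have mF : measurable F by apply: closed_measurable_rV; exact: closed_enorm_ge.
have lF := @levy_fin _ _ _ _ P X hX F (3 / 4) ltac:(by []) (fun z h => h).
have LE : (levy_measure P X F = \int[lebesgue_rV R d]_(z in F) (nu z)%:E)%E by case: hnu => _ _; apply.
have L0 : (0 <= levy_measure P X F)%E by apply: integral_ge0 => w _; exact: counting_ge0.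
have Lf : levy_measure P X F \is a fin_num by rewrite ge0_fin_numE.
have one0 (y : E) : 0 < (fun=> 1) y :> R by [].
have one1 (y : E) : (fun=> 1) y <= 1 :> R by [].
have m1 : measurable_fun [set: E] (fun=> 1 : R) by exact: measurable_cst.
have k1 (y z : E) : (fun=> 1) y <= 1 * kcosh 1 (y - z) * (fun=> 1) z :> R.
  rewrite mul1r mulr1; apply: le_trans (kcosh_min _ _) => //.
  by rewrite ler1n double_gt0.
have far (y : E) : (\int[lebesgue_rV R d]_(z in F) ((fun=> 1) (y - z) * nu z)%:E <= (fine (levy_measure P X F) * (fun=> 1) y)%:E)%E.
  rewrite mulr1 fineK// LE; under eq_integral do rewrite mul1r; exact: lexx.
have [C C0 hC] := green_harnack_upper hX symX d0 hnu ltr01 m1 one0 one1 ltr01 k1 (fine_ge0 L0) far.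
exists C => // q K mq CK qK qloc x; have := hC q K mq CK qK qloc x.
rewrite mulr1; apply: le_trans; apply: (@le_green_fk _ _ _ _ P X q) => y.
  by rewrite lee_fin mulr_ge0// (le_trans _ (qK y))// (le_trans (ltW C0)).
by rewrite mulr1.
Qed.

(** The bump of the lower bound: a paraboloid truncated at 0, whose only kink is convex. Hence the
    second differences of [1 - tent] are bounded from above. *)
Let tent (y : E) : R := Num.max 0 (1 - enorm y ^+ 2).

Let tent_ge0 y : 0 <= tent y. Proof. by rewrite /tent le_max lexx. Qed.

Let tent_le1 y : tent y <= 1.
Proof. by rewrite /tent ge_max ler01/= gerBl sqr_ge0. Qed.

Let tent0 y : 1 <= enorm y -> tent y = 0.
Proof.
by move=> y1; rewrite /tent max_l// subr_le0 exprn_ege1.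
Qed.

Let continuous_tent : continuous tent.
Proof.
move=> y; apply: (@continuous_max R E (fun=> 0) (fun y => 1 - enorm y ^+ 2)); first exact: cst_continuous.
apply: (@continuousB R R E (fun=> 1) (fun y => enorm y ^+ 2)); first exact: cst_continuous.
apply: (@continuous_comp _ _ _ (@enorm R d) (fun r => r ^+ 2)); first exact: continuous_enorm.
exact: exprn_continuous.
Qed.

(** The parallelogram law inside the unit ball. Outside, [1 - tent] is at its maximum 1 and there is
    nothing to gain. *)
Let tent_second_diff y v :
  (1 - tent (y + v)) + (1 - tent (y - v)) <= 2 * (1 - tent y) + 2 * enorm v ^+ 2.
Proof.
have par : enorm (y + v) ^+ 2 + enorm (y - v) ^+ 2 = 2 * enorm y ^+ 2 + 2 * enorm v ^+ 2.
  rewrite !sqr_enorm !mulr_sumr -!big_split/=; apply: eq_bigr => i _; rewrite !mxE; ring.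
have [y1|y1] := leP 1 (enorm y).
  rewrite (tent0 y1); have := tent_ge0 (y + v); have := tent_ge0 (y - v).
  by have := sqr_ge0 (enorm v); lra.
have ly z : 1 - enorm z ^+ 2 <= tent z by rewrite /tent le_max lexx orbT.
have -> : tent y = 1 - enorm y ^+ 2.
  by rewrite /tent max_r// subr_ge0 -[leRHS](expr1n _ 2) lerXn2r ?nnegrE ?enorm_ge0// ltW.
by have := ly (y + v); have := ly (y - v); lra.
Qed.

(** Off the unit ball [tent] vanishes and its mean can only be larger; inside, the upper bound for
    steps applies to [1 - tent]. *)
Let tent_excess : symmetric_process P X -> exists2 B, 0 <= B & forall n y,
  - (B * \1_(eball 0 1) y) <= n.+1%:R * (step_mean P X tent n y - tent y).
Proof.
move=> symX; have [S S0 hS] := second_moment hX symX.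
have [C hC] := @rate_bounded _ _ _ _ P X hX [set z | (3 / 4 <= enorm z)%R]
  (closed_measurable_rV (@closed_enorm_ge _ _ _)) (3 / 4) ltac:(by []) (fun z Fz => Fz) (@closed_enorm_ge _ _ _).
have C0 : 0 <= C by apply: le_trans (hC 0%N); exact: rate_ge0.
have ct : continuous (fun y => 1 - tent y : R).
  by move=> y; apply: (@continuousB R R E (fun=> 1) tent); [exact: cst_continuous|exact: continuous_tent].
have t0 y : 0 <= 1 - tent y by rewrite subr_ge0.
have t1 y : 1 - tent y <= 1 by rewrite gerBl.
exists (2 * S + C) => [|n y]; first by rewrite addr_ge0// mulr_ge0.
have msm : 0 <= step_mean P X tent n y.
  by rewrite /step_mean /Rintegral fine_ge0//; apply: integral_ge0 => w _; rewrite lee_fin.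
rewrite indicE; have [yB|yB] := boolP (y \in eball 0 1); last first.
  rewrite mulr0 oppr0 tent0 ?subr0 ?mulr_ge0// leNgt; apply: contra yB => y1.
  by rewrite inE /eball/= subr0.
rewrite mulr1.
have := @step_mean_upper _ _ _ _ P X hX symX (fun y => 1 - tent y) 1 ct t0 t1 S hS 2 n y ltac:(by [])
  (fun v _ => tent_second_diff y v).
move=> h; have := le_trans h (leeD2l _ (far_int_le hX t0 t1 n y (3 / 4))).
rewrite -EFinD lee_fin mul1r => h2.
have -> : step_mean P X tent n y = 1 - step_mean P X (fun y => 1 - tent y) n y.
  apply/EFin_inj; rewrite EFinB (step_meanE hX ct t0 t1) (step_meanE hX continuous_tent tent_ge0 tent_le1).
  have mt : measurable_fun setT (fun w => tent (y + X n.+1%:R^-1 w)).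
    apply: (measurableT_comp (continuous_measurable_rV continuous_tent)); apply: measurable_funD_rV => //.
    by case: hX => h' _ _ _ _; apply: h'; rewrite invr_ge0.
  have i1 := @bounded_integrable _ _ _ P _ 1 mt (fun w => ltac:(by rewrite ger0_norm)).
  have e : (\int[P]_w (tent (y + X n.+1%:R^-1 w))%:E + \int[P]_w (1 - tent (y + X n.+1%:R^-1 w))%:E = 1)%E.
    rewrite -ge0_integralD//.
    - rewrite -[RHS](@integral_cst_prob _ _ _ P 1%E); apply: eq_integral => w _.
      by rewrite -EFinD addrC subrK.
    - by move=> w _; rewrite lee_fin.
    - exact/measurable_EFinP.
    - by move=> w _; rewrite lee_fin.
    - by apply/measurable_EFinP; apply: measurable_funB.
  have f1 := integrable_fin_num measurableT i1.
  have gen (a b : \bar R) : a \is a fin_num -> (a + b = 1)%E -> a = (1 - b)%E.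
    by case: a => // a _; case: b => // b [e1]; rewrite -EFinB; congr EFin; lra.
  exact: gen f1 e.
have := hC n.+1; lra.
Qed.

(** The jumps from [y] into the ball of radius 1/2 around 0 contain a cube centred at [- y] of
    half-side [1 / (4 d)]. There the norms of [z] and [x] differ by less than 1, so [nu z] is at
    least [nu x / (C1 * C2)]. *)
Let levy_lower_near x y : 3 <= enorm x -> enorm (y - x) < 1 / 2 ->
  (((C1 * C2)^-1 * (2 * (4 * d%:R)^-1) ^+ d * nu x)%:E <= levy_measure P X [set z | (enorm (y + z) < 1 / 2)%R])%E.
Proof.
move=> x3 yx; set c3 := (C1 * C2)^-1; have c30 : 0 <= c3 by rewrite invr_ge0 mulr_ge0// ltW.
set r : R := (4 * d%:R)^-1; have dR : 0 < d%:R :> R by rewrite ltr0n.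
have r0 : 0 <= r by rewrite invr_ge0 mulr_ge0// ltW.
have x12 : 1 / 2 <= enorm x by lra.
pose B : set E := [set z | forall i, `[((- y) ord0 i - r)%R, ((- y) ord0 i + r)%R]%classic (z ord0 i)].
have mB : measurable B by exact: measurable_cube.
have BA : B `<=` [set z | (enorm (y + z) < 1 / 2)%R].
  move=> z Bz /=; apply: le_lt_trans (enorm_le_sum _) _.
  apply: (@le_lt_trans _ _ (\sum_(i < d) r)).
    apply: ler_sum => i _; have := Bz i; rewrite /= in_itv/= !mxE ler_norml; lra.
  rewrite sumr_const card_ord /r invfM -mulrnAr -(mulr_natr _ d) mulVf ?lt0r_neq0// mulr1; lra.
apply: le_trans (@le_levy_measure _ _ _ _ P X _ _ BA).
case: hnu => _ _ /(_ B mB) ->.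
have -> : ((c3 * (2 * r) ^+ d * nu x)%:E = \int[lebesgue_rV R d]_(z in B) (c3 * nu x)%:E)%E.
  rewrite integral_cst//; transitivity ((c3 * nu x)%:E * ((2 * r) ^+ d)%:E)%E.
    by rewrite -EFinM; congr EFin; rewrite mulrAC.
  congr (_ * _)%E; exact: esym (lebesgue_rV_cube (- y) r0).
have h z : B z -> c3 * nu x <= nu z.
  move=> /BA /= zy; have hz : `|enorm z - enorm x| < 1.
    have e : z + x = (y + z) - (y - x) by apply/rowP => i; rewrite !mxE; ring.
    have := enorm_dist z (- x); rewrite enormN opprK => h; apply: le_lt_trans h _.
    rewrite e; apply: le_lt_trans (enormD _ _) _; rewrite enormN; lra.
  move: hz; rewrite ltr_norml => /andP[h1 h2].
  have z12 : 1 / 2 <= enorm z by lra.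
  have z0 := nu0 z12; rewrite /c3 ler_pdivrMl ?mulr_gt0//.
  have [xz|zx] := leP (enorm x) (enorm z).
    have /andP[h _] : C1^-1 * nu x <= nu z <= C1 * nu x by apply: A11 => //; lra.
    rewrite ler_pdivrMl// in h; apply: le_trans h _; rewrite mulrAC; apply: ler_peMr => //.
    by rewrite mulr_ge0// ltW.
  apply: le_trans (A12 z12 (ltW zx)) _; rewrite -mulrA; apply: ler_peMl => //.
  by rewrite mulr_ge0// ltW.
apply: ge0_le_integral => //.
- by move=> z Bz; rewrite lee_fin mulr_ge0// ltW// nu0.
- by apply: measurable_funTS; apply/measurable_EFinP.
Qed.

(** Near [x] the bump vanishes, and a jump landing within 1/2 of the origin gains at least 3/4. The
    target set is open, so [rate_liminf] bounds the frequency of such jumps from below. *)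
Let tent_far x y eta : 3 <= enorm x -> enorm (y - x) < 1 / 2 -> 0 < eta ->
  \forall n \near \oo, 3 / 4 * ((C1 * C2)^-1 * (2 * (4 * d%:R)^-1) ^+ d) * nu x - eta <=
    n.+1%:R * (step_mean P X tent n y - tent y).
Proof.
move=> x3 yx eta0; set c := (C1 * C2)^-1 * _.
have y1 : 1 <= enorm y by have := enorm_dist x y; rewrite enormC ler_norml => /andP[_]; lra.
set A : set E := [set z | (enorm (y + z) < 1 / 2)%R].
have oA : open A.
  rewrite (_ : A = (fun z => enorm (z - - y)) @^-1` [set r | r < 1 / 2]); last first.
    by apply/seteqP; split => z /=; rewrite opprK addrC.
  by apply: open_comp; [move=> z _; exact: continuous_enormB|exact: open_lt].
have mA : measurable A by exact: open_measurable_rV.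
have h : ((c * nu x - eta)%:E < limn_einf (fun n => (rate P X A n)%:E))%E.
  apply: lt_le_trans (rate_liminf hX mA oA); apply: lt_le_trans (levy_lower_near x3 yx).
  by rewrite lte_fin ltrBlDr ltrDl.
have [N _ hN] := limn_einf_gt_near h; exists N => // n /= Nn.
have {hN} := hN n.+1 (leqW Nn); rewrite /= lte_fin => hn.
rewrite (tent0 y1) subr0; apply: (@le_trans _ _ (3 / 4 * rate P X A n.+1)); first lra.
rewrite -lee_fin EFinM (rate_integral hX n.+1 mA) muleCA [leRHS]EFinM; apply: lee_wpmul2l => //.
rewrite (step_meanE hX continuous_tent tent_ge0 tent_le1) -ge0_integralZl//; last first.
  apply/measurable_EFinP; apply: (measurableT_comp (measurable_indic mA)).
  by case: hX => h' _ _ _ _; apply: h'; rewrite invr_ge0.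
apply: ge0_le_integral_nomeas => w; first by rewrite mule_ge0// lee_fin.
rewrite -EFinM lee_fin indicE; have [/set_mem Aw|_] := boolP (_ \in A); last by rewrite mulr0.
rewrite mulr1 /tent le_max; apply/orP; right.
have := enorm_ge0 (y + X n.+1%:R^-1 w); move: Aw; rewrite /A/= => a1 a2.
have := ler_pM a2 a2 (ltW a1) (ltW a1); rewrite -expr2; lra.
Qed.

(** [G 1] splits into the parts within and beyond distance 1/2 of [x]. By [local_upper] and
    [K >= 2 Cl] the far part is at most the near one. Dynkin's formula for the bump bounds [nu x]
    times the near part by the Green potentials of the unit ball and of [q] times the bump, both
    below that of [(q + 1)] on the unit ball. *)
Lemma levy_lower : symmetric_process P X -> exists2 C, 0 < C & forall (q : E -> R) (K : R),
  measurable_fun setT q -> C <= K -> (forall y, K <= q y) -> locally_killed P X q ->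
  forall x, 3 <= enorm x ->
  ((nu x)%:E * green_fk P X q (cst 1%E) x <=
   C%:E * green_fk P X q (fun y => ((q y + 1) * \1_(eball 0 1) y)%:E) x)%E.
Proof.
move=> symX; have [Cl Cl0 hCl] := local_upper symX; have [B B0 hB] := tent_excess symX.
pose c1 := 3 / 4 * ((C1 * C2)^-1 * (2 * (4 * d%:R)^-1) ^+ d).
have dR : 0 < d%:R :> R by rewrite ltr0n.
have c10 : 0 < c1.
  by rewrite /c1 !mulr_gt0 ?invr_gt0 ?exprn_gt0 ?mulr_gt0 ?invr_gt0 ?mulr_gt0.
have k10 : 0 <= 2 * (B + 1) / c1 by apply: divr_ge0 (ltW c10); rewrite mulr_ge0// addr_ge0.
exists (2 * Cl + 2 * (B + 1) / c1) => [|q K mq CK qK qloc x x3].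
  by apply: ltr_pwDl => //; rewrite mulr_gt0.
have ClK : 2 * Cl <= K by apply: le_trans CK; rewrite lerDl.
have K0 : 0 < K by apply: lt_le_trans ClK; rewrite mulr_gt0.
have CK' : Cl <= K by lra.
have q0 y : 0 <= q y by exact: le_trans (ltW K0) (qK y).
have nx : 0 < nu x by apply: nu0; lra.
pose near1 (y : E) : R := (enorm (y - x) < 1 / 2)%R%:R.
pose far1 (y : E) : R := (1 / 2 <= enorm (y - x))%R%:R.
have mn : measurable_fun setT near1.
  rewrite (_ : near1 = fun y => if enorm (y - x) < 1 / 2 then 1 else 0); last first.
    by apply/funext => z; rewrite /near1; case: (_ < _).
  by apply: measurable_fun_ifT => //; apply: measurable_fun_ltr => //; exact: measurable_enormB.
have mf : measurable_fun setT far1.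
  rewrite (_ : far1 = fun y => if 1 / 2 <= enorm (y - x) then 1 else 0); last first.
    by apply/funext => z; rewrite /far1; case: (_ <= _).
  by apply: measurable_fun_ifT => //; apply: measurable_fun_ler => //; exact: measurable_enormB.
have n0 y : 0 <= near1 y by exact: ler0n.
have n1 y : near1 y <= 1 by rewrite /near1; case: (_ < _).
have f0 y : 0 <= far1 y by exact: ler0n.
have f1 y : far1 y <= 1 by rewrite /far1; case: (1 / 2 <= _).
pose G := green_fk P X q.
have mne : measurable_fun setT (EFin \o near1) by exact/measurable_EFinP.
have mfe : measurable_fun setT (EFin \o far1) by exact/measurable_EFinP.
have fin_n : G (EFin \o near1) x \is a fin_num.
  by apply: (@green_bounded_fin _ _ _ _ P X hX q K mq K0 qK qloc _ 1) => y; rewrite lee_fin.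
have fin_f : G (EFin \o far1) x \is a fin_num.
  by apply: (@green_bounded_fin _ _ _ _ P X hX q K mq K0 qK qloc _ 1) => y; rewrite lee_fin.
have G1 : G (cst 1%E) x = (G (EFin \o near1) x + G (EFin \o far1) x)%E.
  rewrite /G -(@green_fkD _ _ _ _ P X hX q K mq K0 qK _ _ x mne mfe (fun y => n0 y) (fun y => f0 y)).
  congr (green_fk _ _ _ _ x); apply/funext => y /=.
  by rewrite -EFinD /near1 /far1; case: ltP => _; rewrite ?addr0 ?add0r.
have GfK : (K%:E * G (EFin \o far1) x <= Cl%:E * G (cst 1%E) x)%E.
  apply: le_trans (hCl q K mq CK' qK qloc x).
  rewrite /G -(@green_fkZ _ _ _ _ P X hX q K mq K0 qK K (EFin \o far1) x (ltW K0) mfe (fun y => f0 y)).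
  apply: (@le_green_fk _ _ _ _ P X q) => y; first by rewrite mule_ge0// lee_fin// ltW.
  by rewrite -EFinM lee_fin ler_wpM2r.
pose iB (y : E) : R := \1_(eball 0 1) y.
have miB : measurable_fun setT iB by apply: measurable_indic; exact: measurable_eball.
have iB0 y : 0 <= iB y by rewrite /iB indicE.
have mb : measurable_fun setT (fun y => B * iB y) by exact: measurable_funM.
have mm : measurable_fun setT (fun y => c1 * nu x * near1 y) by exact: measurable_funM.
have tx : tent x = 0 by apply: tent0; lra.
have mB y : c1 * nu x * near1 y <= c1 * nu x by rewrite ler_piMr// mulr_ge0// ltW.
have low : (G (fun y => (c1 * nu x * near1 y)%:E) x <=
    G (fun y => (B * iB y)%:E) x + G (fun y => (q y * tent y)%:E) x)%E.
  apply: (@green_lower _ _ _ _ P X hX q K mq K0 qK qloc tent 1 x continuous_tent tent_ge0 tent_le1 tx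
    (fun y => B * iB y) (fun y => c1 * nu x * near1 y) (c1 * nu x) mb mm) => //.
  - by move=> y; exact: mulr_ge0.
  - by move=> y; apply: mulr_ge0 => //; apply: mulr_ge0; exact: ltW.
  - move=> y eta eta0; have [yx|yx] := ltP (enorm (y - x)) (1 / 2).
      have [N _ hN] := tent_far x3 yx eta0; exists N => // n Nn; apply: le_trans (hN n Nn).
      rewrite /near1 yx mulr1 lerD2r -/c1 gerBl mulr_ge0//.
    apply: nearW => n; apply: le_trans (hB n y).
    rewrite /near1 ltNge yx/= mulr0 sub0r gerBl; exact: ltW.
pose Q (y : E) : R := (q y + 1) * iB y.
have mQ : measurable_fun setT (EFin \o Q).
  by apply/measurable_EFinP; apply: measurable_funM => //; exact: measurable_funD.
have Q0 y : 0 <= Q y by rewrite mulr_ge0// addr_ge0.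
have tB y : tent y <= iB y.
  rewrite /iB indicE; have [_|yB] := boolP (y \in eball 0 1); first exact: tent_le1.
  rewrite tent0// leNgt; apply: contra yB => y1; by rewrite inE /eball/= subr0.
have GB : (G (fun y => (B * iB y)%:E) x <= B%:E * G (EFin \o Q) x)%E.
  rewrite /G -(@green_fkZ _ _ _ _ P X hX q K mq K0 qK B (EFin \o Q) x B0 mQ (fun y => Q0 y)).
  apply: (@le_green_fk _ _ _ _ P X q) => y; first by rewrite lee_fin mulr_ge0.
  by rewrite -EFinM lee_fin ler_wpM2l// /Q mulrDl mul1r lerDr mulr_ge0.
have Gt : (G (fun y => (q y * tent y)%:E) x <= G (EFin \o Q) x)%E.
  apply: (@le_green_fk _ _ _ _ P X q) => y; first by rewrite lee_fin mulr_ge0.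
  rewrite lee_fin /Q mulrDl mul1r; apply: ler_wpDr => //; exact: ler_wpM2l.
have Gm : (G (fun y => (c1 * nu x * near1 y)%:E) x = (c1 * nu x)%:E * G (EFin \o near1) x)%E.
  rewrite /G -(@green_fkZ _ _ _ _ P X hX q K mq K0 qK (c1 * nu x) (EFin \o near1) x _ mne (fun y => n0 y))//.
  by rewrite mulr_ge0// ltW.
have GQ0 : (0 <= G (EFin \o Q) x)%E by apply: green_fk_ge0 => y; rewrite lee_fin.
have [GQoo|GQf] := eqVneq (G (EFin \o Q) x) +oo%E.
  rewrite -/G -/(EFin \o Q) GQoo gt0_muley ?leey// lte_fin.
  by apply: ltr_pwDl => //; rewrite mulr_gt0.
have fin_Q : G (EFin \o Q) x \is a fin_num by rewrite ge0_fin_numE// lt_neqAle GQf leey.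
have low' := le_trans low (leeD GB Gt).
rewrite -/G -/(EFin \o Q); change (green_fk P X q (cst 1%E) x) with (G (cst 1%E) x).
change (green_fk P X q (fun y => ((q y + 1) * \1_(eball 0 1) y)%:E) x) with (G (EFin \o Q) x).
move: low' GfK GQ0; rewrite Gm G1 -(fineK fin_n) -(fineK fin_f) -(fineK fin_Q).
have fn0 : 0 <= fine (G (EFin \o near1) x) by rewrite fine_ge0//; apply: green_fk_ge0 => y; rewrite lee_fin.
move: fn0; move: (fine (G (EFin \o near1) x)) (fine (G (EFin \o far1) x)) (fine (G (EFin \o Q) x)) => a b w a0.
rewrite -!EFinM -!EFinD -?EFinM !lee_fin => h1 h2 w0.
have ba : b <= a.
  rewrite leNgt; apply/negP => ab; have := ltr_pM2l Cl0 a b; rewrite ab => h3.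
  have : 2 * Cl * b <= K * b by rewrite ler_wpM2r//; apply: le_trans (ltW ab).
  by move: h2; rewrite mulrDr; lra.
have h4 : nu x * a <= (B + 1) / c1 * w.
  rewrite -(ler_pM2l c10) mulrA [leRHS]mulrA [c1 * ((B + 1) / c1)]mulrCA divff ?lt0r_neq0// mulr1; lra.
have : nu x * b <= nu x * a by rewrite ler_pM2l.
rewrite mulrDr mulrDl -[2 * (B + 1) / c1]mulrA -mulrA.
have : 0 <= 2 * Cl * w by rewrite !mulr_ge0// ltW.
lra.
Qed.

(** On the ball of radius [rad] the profile is bounded below, by its Harnack inequality from 0, and
    [x] is at distance at least 1/2 from this ball. The threshold [C0] for [K] precedes [rad] in the
    quantifiers, because the radius at which the confining potential exceeds [K] is chosen after
    [K]. *)
Lemma levy_upper_ball : symmetric_process P X -> exists2 C0, 0 < C0 & forall rad, exists2 C, 0 < C &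
  forall (q : E -> R) (K : R), measurable_fun setT q -> C0 <= K -> (forall y, K <= q y) ->
  locally_killed P X q -> forall x, rad + 1 / 2 <= enorm x -> 1 / 2 <= enorm x ->
  (green_fk P X q (fun y => (q y * \1_(eball 0 rad) y)%:E) x <=
   (C * nu x)%:E * green_fk P X q (cst 1%E) x)%E.
Proof.
move=> symX; have [C0 C00 h] := levy_upper symX; have [c c0 hc] := levy_profile_harnack.
exists C0 => // rad; pose D : R := (d.*2)%:R; pose m := c * (expR (L * rad) * D).
have D0 : 0 < D by rewrite ltr0n double_gt0.
have m0 : 0 < m by rewrite /m !mulr_gt0 ?expR_gt0.
have gm z : enorm z < rad -> 1 <= m * g z.
  move=> zr; have := hc 0 z; rewrite {1}/g enorm0 ifF; last by apply/negbTE; rewrite -ltNge.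
  move=> h1; apply: le_trans h1 _; rewrite ler_pM2r; last exact: levy_profile_gt0.
  rewrite ler_pM2l// sub0r -[- z]add0r; apply: le_trans (kcosh_shift levy_rate_gt0 _ _) _.
  rewrite kcosh0 ler_pM2r// ler_expR ler_pM2l ?levy_rate_gt0//; apply: le_trans (norm_le_enorm _) _.
  by rewrite enormN ltW.
exists (m * C0) => [|q K mq CK qK qloc x x1 x2]; first by rewrite mulr_gt0.
have K0 : 0 < K by exact: lt_le_trans CK.
have q0 y : 0 <= q y by exact: le_trans (ltW K0) (qK y).
pose far1 (y : E) : R := (1 / 2 <= enorm (y - x))%R%:R.
have mf : measurable_fun setT far1.
  rewrite (_ : far1 = fun y => if 1 / 2 <= enorm (y - x) then 1 else 0); last first.
    by apply/funext => z; rewrite /far1; case: (_ <= _).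
  by apply: measurable_fun_ifT => //; apply: measurable_fun_ler => //; exact: measurable_enormB.
have mqg : measurable_fun setT (fun y => (q y * g y * far1 y)%:E : \bar R).
  apply/measurable_EFinP; apply: measurable_funM => //; apply: measurable_funM => //.
  exact: measurable_levy_profile.
have qg0 y : (0 <= (q y * g y * far1 y)%:E)%E.
  by rewrite lee_fin; apply: mulr_ge0; [apply: mulr_ge0 => //; exact/ltW/levy_profile_gt0|exact: ler0n].
apply: (@le_trans _ _ (m%:E * green_fk P X q (fun y => (q y * g y * far1 y)%:E) x)%E).
  rewrite -(@green_fkZ _ _ _ _ P X hX q K mq K0 qK m _ x (ltW m0) mqg qg0).
  apply: (@le_green_fk _ _ _ _ P X q) => y; first by rewrite lee_fin mulr_ge0.
  rewrite -EFinM lee_fin indicE; have [/set_mem|_] := boolP (y \in eball 0 rad); last first.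
    by rewrite mulr0 mulr_ge0// ?(ltW m0)// -lee_fin.
  rewrite /eball/= subr0 => yr; have -> : far1 y = 1.
    rewrite /far1; have -> : (1 / 2 <= enorm (y - x)) = true; last by [].
    by have := enorm_dist x y; rewrite enormC ler_norml => /andP[_ k]; apply: le_trans k; lra.
  by rewrite !mulr1 mulrCA; apply: ler_peMr => //; exact: gm.
have -> : (m * C0 * nu x)%:E = (m%:E * (C0 * nu x)%:E)%E by rewrite -EFinM mulrA.
rewrite -muleA; apply: lee_wpmul2l; first by rewrite lee_fin ltW.
by rewrite -(levy_profileE x2); exact: (h q K mq CK qK qloc x).
Qed.

End levy_profile.

(** * Duhamel formula for eigenfunctions *)

Section locally_killed.
Context (R : realType) (d : nat) (disp : measure_display)
  (Omega : measurableType disp) (P : probability Omega R)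
  (X : R -> Omega -> 'rV[R]_d).
Hypothesis hX : levy_process P X.
Local Notation E := 'rV[R]_d.
Local Notation leb := (@lebesgue_measure R).

(** A finite exponential moment makes the integral along the path almost surely finite, at all
    integer times simultaneously. *)
Lemma kato_locally_killed (B : E -> R) : kato P X B -> (forall y, 0 <= B y) -> locally_killed P X B.
Proof.
move=> kB B0 x; have mB : measurable_fun setT B by case: kB.
have h (n : nat) : {ae P, forall w, (\int[leb]_(u in `[0%R, n%:R]) (B (x + X u w)%R)%:E < +oo)%E}.
  have [M M0 hM] := @kato_expmoment _ _ _ _ P X hX B kB B0 n%:R (ler0n _ _).
  have mf : measurable_fun setT (fun w => fkw (fun=> 0) B x 0 n%:R (X ^~ w)).
    exact: (@measurable_fkw _ _ _ _ _ _ hX _ _ (fun=> 0) (fun=> n%:R) (fun=> x) id (fun=> 0) B).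
  have f0 w : (0 <= fkw (fun=> 0%R) B x 0%R n%:R (X ^~ w))%E by exact: fkw_ge0.
  have int : P.-integrable setT (fun w => fkw (fun=> 0) B x 0 n%:R (X ^~ w)).
    apply/integrableP; split => //; apply: le_lt_trans (ltry M); apply: le_trans (hM x).
    rewrite /fk; under eq_integral do rewrite gee0_abs ?f0//.
    by under [leRHS]eq_integral do rewrite mule1.
  apply: filterS (integrable_ae measurableT int) => w /(_ I).
  rewrite /fkw integral0 oppe0 expeR0 mul1e.
  have : (0 <= \int[leb]_(u in `[0%R, n%:R]) (B (x + X u w)%R)%:E)%E.
    by apply: integral_ge0 => u _; rewrite lee_fin.
  by case: (\int[leb]_(u in _) _)%E => //= r _ _; exact: ltry.
apply: filterS (ae_foralln h) => w hw T T0.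
apply: le_lt_trans (hw (Num.truncn T).+1).
apply: ge0_subset_integral => //.
- by apply/measurable_EFinP; exact: (@measurable_path _ _ _ _ P X hX).
- by move=> u _; rewrite lee_fin.
- by apply: subset_itvl; rewrite bnd_simp ltW// truncnS_gt.
Qed.

(** A cadlag path stays in some ball with integer radius up to time [T], and there the potential
    agrees with its restriction to that ball. *)
Lemma kato_loc_locally_killed (B : E -> R) : kato_loc P X B -> (forall y, 0 <= B y) -> locally_killed P X B.
Proof.
move=> [mB kB] B0 x.
have h (m : nat) : {ae P, forall w, forall T, 0 <= T ->
    (\int[leb]_(u in `[0%R, T]) ((B \* \1_(eball 0 m.+1%:R))%R (x + X u w)%R)%:E < +oo)%E}.
  apply: kato_locally_killed; first exact: kB.
  by move=> y; rewrite /= mulr_ge0.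
apply: filterS (ae_foralln h) => w hw T T0.
have cw : cadlag (X ^~ w) by case: hX.
have [M hM] := cadlag_bounded cw T0.
have := hw (Num.truncn (enorm x + M)) T T0; congr (_ < _)%E; apply: eq_integral => u.
rewrite inE/= in_itv/= => /andP[u0 uT]; congr EFin; rewrite indicE mem_set ?mulr1//.
rewrite /eball/= subr0; apply: le_lt_trans (enormD _ _) _.
by apply: le_lt_trans (truncnS_gt _); rewrite lerD2l hM.
Qed.

Lemma le_locally_killed (q p1 p2 : E -> R) (c1 c : R) : locally_killed P X p1 -> locally_killed P X p2 ->
  measurable_fun setT q -> measurable_fun setT p1 -> measurable_fun setT p2 ->
  (forall y, 0 <= q y) -> (forall y, 0 <= p1 y) -> (forall y, 0 <= p2 y) -> 0 <= c1 -> 0 <= c ->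
  (forall y, q y <= c1 * (p1 y + p2 y) + c) -> locally_killed P X q.
Proof.
move=> l1 l2 mq m1 m2 q0 p10 p20 c10 c0 hq x; apply: filterS2 (l1 x) (l2 x) => w h1 h2 T T0.
have mp (p : E -> R) : measurable_fun setT p -> measurable_fun `[0, T] (fun u : R => (p (x + X u w))%:E).
  by move=> mp; apply/measurable_EFinP; exact: (@measurable_path _ _ _ _ P X hX).
have p0 (p : E -> R) u : (forall y, 0 <= p y) -> (0 <= (p (x + X u w)%R)%:E)%E by move=> p0; rewrite lee_fin.
have mc : measurable_fun `[0, T] (fun u : R => c1%:E * ((p1 (x + X u w))%:E + (p2 (x + X u w))%:E))%E.
  by apply: measurable_funeM; apply: emeasurable_funD; exact: mp.
have c00 (u : R) : (0 <= c1%:E * ((p1 (x + X u w))%:E + (p2 (x + X u w))%:E))%E.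
  by rewrite mule_ge0// adde_ge0// p0.
apply: (@le_lt_trans _ _ (\int[leb]_(u in `[0%R, T]) (c1%:E * ((p1 (x + X u w)%R)%:E + (p2 (x + X u w)%R)%:E) + c%:E))%E).
  apply: ge0_le_integral => //.
  - by move=> u _; exact: p0.
  - exact: mp.
  - exact: emeasurable_funD.
  - by move=> u _; have := hq (x + X u w); rewrite -lee_fin EFinD EFinM EFinD.
rewrite ge0_integralD// ?integral_cst_itv//.
rewrite ge0_integralZl//; last 2 first.
- by apply: emeasurable_funD; exact: mp.
- by move=> u _; rewrite adde_ge0// p0.
rewrite ge0_integralD//; last 4 first.
- by move=> u _; exact: p0.
- exact: mp.
- by move=> u _; exact: p0.
- exact: mp.
have i0 (p : E -> R) : (forall y, 0 <= p y) -> (0 <= \int[leb]_(u in `[0%R, T]) (p (x + X u w)%R)%:E)%E.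
  by move=> p00; apply: integral_ge0 => u _; exact: p0.
have := h1 T T0; have := h2 T T0; have := i0 _ p10; have := i0 _ p20.
case: (\int[leb]_(u in _) (p1 _)%:E)%E => // r1; case: (\int[leb]_(u in _) (p2 _)%:E)%E => // r2 _ _ _ _.
exact: ltry.
Qed.

(** The eigenvalue equation holds Lebesgue-almost everywhere; absolute continuity of the law at
    positive times makes it available at the random point [x + X s]. *)
Lemma ae_levy_density p (Q : E -> Prop) s x : transition_density P X p -> 0 < s ->
  {ae lebesgue_rV R d, forall y, Q y} -> {ae P, forall w, Q (x + X s w)}.
Proof.
move=> hp s0 [N [mN N0 QN]]; have [mp p0 hpd] := hp s s0.
have mXs : measurable_fun setT (fun w => x + X s w).
  by apply: measurable_funD_rV => //; case: hX => h _ _ _ _; exact/h/ltW.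
exists ((fun w => x + X s w) @^-1` N); split.
- by rewrite -[X in measurable X]setTI; exact: mXs.
- rewrite [LHS](hpd x N mN); apply: null_set_integral => //.
  apply: measurable_funTS; apply/measurable_EFinP; apply: (measurableT_comp mp).
  exact: (measurable_funD_rV (@measurable_id _ _ setT) (@measurable_cst _ _ _ _ setT (- x))).
- by move=> w /= nQ; exact: QN.
Qed.

End locally_killed.

(** * Duhamel's formula in expectation *)

Section duhamel.
Context (R : realType) (d : nat) (disp : measure_display)
  (Omega : measurableType disp) (P : probability Omega R)
  (X : R -> Omega -> 'rV[R]_d).
Hypothesis hX : levy_process P X.
Local Notation E := 'rV[R]_d.
Local Notation leb := (@lebesgue_measure R).
Variables (a b U q : E -> R) (K : R).
Hypotheses (ma : measurable_fun setT a) (mb : measurable_fun setT b)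
  (mU : measurable_fun setT U) (mq : measurable_fun setT q)
  (a0 : forall y, 0 <= a y) (b0 : forall y, 0 <= b y) (U0 : forall y, 0 <= U y)
  (K0 : 0 < K) (qK : forall y, K <= q y) (qabU : forall y, q y + b y = a y + U y)
  (la : locally_killed P X a) (lb : locally_killed P X b) (lU : locally_killed P X U).

Let q0 y : 0 <= q y. Proof. exact: le_trans (ltW K0) (qK y). Qed.
Let mX t : 0 <= t -> measurable_fun setT (X t). Proof. by case: hX => h _ _ _ _; exact: h. Qed.
Let mUe : measurable_fun setT (EFin \o U). Proof. exact/measurable_EFinP. Qed.

Variable x : E.

Let kU s w : \bar R := (killing X q x s w * (U (x + X s w)%R)%:E)%E.

Let kU0 s w : (0 <= kU s w)%E.
Proof. by rewrite /kU mule_ge0 ?killing_ge0// lee_fin. Qed.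

Let mkU : measurable_fun setT (fun z : Omega * measurableTypeR R => kU `|z.2| z.1).
Proof.
apply: emeasurable_funM; first exact: (@measurable_killing _ _ _ _ P X hX q K mq K0 qK).
exact: (measurableT_comp mUe (@measurable_levy_abs _ _ _ _ P X hX x)).
Qed.

Let I s : \bar R := (\int[P]_w kU s w)%E.

Let I0 s : (0 <= I s)%E. Proof. by apply: integral_ge0 => w _; exact: kU0. Qed.

Let mI : measurable_fun setT (fun s : measurableTypeR R => I `|s|).
Proof.
exact: (@measurable_fun_fubini_tonelli_G _ _ _ _ _ P _ mkU (fun z => kU0 _ _)).
Qed.

Let green_I : (green_fk P X q (EFin \o U) x = \int[leb]_(s in `[0%R, +oo[) I `|s|)%E.
Proof.
rewrite green_fk_def; transitivity (\int[P]_w \int[leb]_(s in `[0%R, +oo[) kU `|s|%R w)%E; last first.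
  exact: (@tonelli_set _ _ _ _ _ P leb `[0, +oo[ (fun z => kU `|z.2| z.1) (measurable_itv _) mkU (fun z => kU0 _ _)).
apply: eq_integral => w _; apply: eq_integral => s; rewrite inE/= in_itv/= andbT => s0.
by rewrite ger0_norm.
Qed.

Section fixed_time.
Variables (t : R) (psi : E -> \bar R).
Hypotheses (t0 : 0 < t) (mpsi : measurable_fun setT psi) (psi0 : forall y, (0 <= psi y)%E).

Let F (z : Omega * measurableTypeR R) : \bar R :=
  (kU `|z.2| z.1 * (fkw a b x `|z.2| t (X ^~ z.1) * psi (x + X t z.1)%R))%E.

Let mpsiX : measurable_fun setT (fun w => psi (x + X t w)).
Proof.
by apply: (measurableT_comp mpsi); apply: measurable_funD_rV => //; exact/mX/ltW.
Qed.

Let mF : measurable_fun setT F.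
Proof.
apply: emeasurable_funM => //; apply: emeasurable_funM; last first.
  exact: (measurableT_comp mpsiX measurable_fst).
apply: (@measurable_fkw _ _ _ _ _ _ hX _ _ (fun z : Omega * measurableTypeR R => `|z.2|) (fun=> t) (fun=> x) fst) => //.
exact: (measurableT_comp (@normr_measurable R setT) measurable_snd).
Qed.

Let F0 z : (0 <= F z)%E.
Proof. by apply: mule_ge0; [exact: kU0|apply: mule_ge0; [exact: fkw_ge0|exact: psi0]]. Qed.

Let mkill : measurable_fun setT (fun w => killing X q x t w).
Proof.
exact: (@measurable_fkw _ _ _ _ _ _ hX _ _ (fun=> 0) (fun=> t) (fun=> x) id q (fun=> 0)).
Qed.

Let iloc (c : E -> R) w : measurable_fun setT c -> (forall y, 0 <= c y) ->
  (forall T, 0 <= T -> (\int[leb]_(u in `[0%R, T]) (c (x + X u w)%R)%:E < +oo)%E) ->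
  leb.-integrable `[0, t] (EFin \o (fun u => c (x + X u w))).
Proof.
move=> mc c0 lc; apply/integrableP; split; first by apply/measurable_EFinP; exact: (@measurable_path _ _ _ _ P X hX).
by under eq_integral do rewrite /= ger0_norm//; exact/lc/ltW.
Qed.

Definition duhamel_rest s : \bar R := (\int[P]_w F (w, s))%E.

Lemma measurable_duhamel_rest : measurable_fun setT (duhamel_rest : measurableTypeR R -> \bar R).
Proof. exact: (@measurable_fun_fubini_tonelli_G _ _ _ _ _ P F mF F0). Qed.

Lemma duhamel_rest_ge0 s : (0 <= duhamel_rest s)%E.
Proof. by apply: integral_ge0 => w _; exact: F0. Qed.

(** [path_duhamel] holds along almost every path; expectation and Tonelli give the formula. The open
    interval of times ensures both [s > 0], needed for the Markov property, and [t - s > 0], needed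
    for the eigenvalue equation afterwards. *)
Lemma duhamel : (fk P X a b t psi x = \int[P]_w (killing X q x t w * psi (x + X t w)%R) +
  \int[leb]_(s in `]0%R, t[) duhamel_rest s)%E.
Proof.
have mFi w : measurable_fun setT (fun s : measurableTypeR R => F (w, s)).
  exact: (measurableT_comp mF (@pair1_measurable _ _ _ (measurableTypeR R) w)).
have -> : (\int[leb]_(s in `]0%R, t[) duhamel_rest s = \int[leb]_(s in `[0%R, t]) duhamel_rest s)%E.
  rewrite -[RHS]integral_itv_bndo_bndc; last exact: (measurable_funTS measurable_duhamel_rest).
  by rewrite integral_itv_obnd_cbnd//; exact: (measurable_funTS measurable_duhamel_rest).
have -> : (\int[leb]_(s in `[0%R, t]) duhamel_rest s = \int[P]_w \int[leb]_(s in `[0%R, t]) F (w, s))%E.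
  exact: esym (@tonelli_set _ _ _ _ _ P leb `[0, t] F (measurable_itv _) mF F0).
have mL : measurable_fun setT (fun w => \int[leb]_(s in `[0%R, t]) F (w, s))%E.
  have -> : (fun w => \int[leb]_(s in `[0%R, t]) F (w, s))%E = (fun w => \int[leb]_s (if s \in `[0%R, t]%classic then F (w, s) else 0))%E.
    by apply/funext => w; rewrite integral_mkcond; apply: eq_integral => s _; rewrite patchE.
  apply: (@measurable_fun_fubini_tonelli_F _ _ _ _ _ leb (fun z => if z.2 \in `[0%R, t]%classic then F z else 0%E)).
    apply: measurable_fun_ifT => //.
    apply: (measurable_fun_bool true); rewrite setTI.
    rewrite (_ : _ @^-1` _ = snd @^-1` `[0%R, t]%classic); last first.
      by apply/seteqP; split => z /=; [move/set_mem|move/mem_set].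
    by rewrite -[X in measurable X]setTI; apply: measurable_snd.
  by move=> z; case: ifP => // _; exact: F0.
have mk : measurable_fun setT (fun w => killing X q x t w * psi (x + X t w)%R)%E by exact: emeasurable_funM.
have k0 w : (0 <= killing X q x t w * psi (x + X t w)%R)%E by rewrite mule_ge0 ?killing_ge0.
have L0 w : (0 <= \int[leb]_(s in `[0%R, t]) F (w, s))%E by apply: integral_ge0 => s _; exact: F0.
rewrite -ge0_integralD// /fk.
have mfk : measurable_fun setT (fun w => fkw a b x 0%R t (X ^~ w) * psi (x + X t w)%R)%E.
  apply: emeasurable_funM => //.
  exact: (@measurable_fkw _ _ _ _ _ _ hX _ _ (fun=> 0) (fun=> t) (fun=> x) id a b).
apply: ge0_ae_eq_integral => //.
- exact: emeasurable_funD.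
- by move=> w _; rewrite mule_ge0 ?fkw_ge0.
- by move=> w _; exact: adde_ge0.
apply: filterS2 (la x) (filterI (lb x) (lU x)) => w law [lbw lUw] _.
have qq u : q (x + X u w) + b (x + X u w) = a (x + X u w) + U (x + X u w) by exact: qabU.
have := @path_duhamel R t (fun u => a (x + X u w)) (fun u => b (x + X u w)) (fun u => U (x + X u w)) (fun u => q (x + X u w))
  (ltW t0) (fun u => a0 _) (fun u => b0 _) (fun u => U0 _) (fun u => q0 _) qq (iloc ma a0 law) (iloc mb b0 lbw) (iloc mU U0 lUw).
rewrite -/(fkw a b x 0 t (X ^~ w)) => ->.
rewrite ge0_muleDl; last 2 first.
- exact: expeR_ge0.
- by apply: integral_ge0 => s _; rewrite !mule_ge0 ?expeR_ge0// lee_fin.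
rewrite killingE; congr (_ + _)%E.
rewrite -ge0_integralZr//; last 2 first.
- apply: (@eq_measurable_fun _ _ _ _ _ (fun s : measurableTypeR R => kU `|s| w * fkw a b x `|s| t (X ^~ w))%E).
    move=> s; rewrite inE/= in_itv/= => /andP[s0 _]; rewrite ger0_norm// /kU killingE /fkw//.
  apply: measurable_funTS; apply: emeasurable_funM.
    exact: (measurableT_comp mkU (@pair1_measurable _ _ _ (measurableTypeR R) w)).
  apply: (@measurable_fkw _ _ _ _ _ _ hX _ _ (fun s : measurableTypeR R => `|s|) (fun=> t) (fun=> x) (fun=> w)) => //.
  exact: (@normr_measurable R setT).
- by move=> s _; rewrite !mule_ge0 ?expeR_ge0// lee_fin.
apply: eq_integral => s; rewrite inE/= in_itv/= => /andP[s0 _].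
by rewrite /F /kU /= ger0_norm// killingE /fkw -!muleA.
Qed.

Lemma duhamel_restE s : 0 < s -> s < t ->
  (duhamel_rest s = \int[P]_w (kU s w * fk P X a b (t - s) psi (x + X s w)%R))%E.
Proof.
move=> s0 st; rewrite /duhamel_rest /F /= ger0_norm ?ltW// /kU /killing.
have ts : 0 <= t - s by rewrite subr_ge0 ltW.
have z0 (y : E) : 0 <= (fun=> 0) y :> R by [].
have mz : measurable_fun setT ((fun=> 0) : E -> R) by exact: measurable_cst.
have := @markov_fkw _ _ _ _ P X hX q (fun=> 0) a b mq mz ma mb q0 z0 a0 b0 s (t - s) x (EFin \o U) psi s0 ts mUe mpsi (fun y => U0 y) psi0.
by rewrite addrC subrK.
Qed.

End fixed_time.

Let I_le t : (\int[leb]_(s in `]0%R, t[) I `|s| <= green_fk P X q (EFin \o U) x)%E.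
Proof.
rewrite green_I; apply: ge0_subset_integral => //.
- exact: (measurable_funTS mI).
- by move=> s /=; rewrite !in_itv/= andbT => /andP[/ltW].
Qed.

(** For the positive and negative parts [psi1], [psi2] of an eigenfunction, the hypothesis is the
    bound [M] on it, written without subtraction. It is inserted into Duhamel's formula for [psi1],
    and the terms in [psi2] are collected by Duhamel's formula for [psi2]. The term without [U] is
    at most [M exp (- K t)]. *)
Lemma eigen_upper p t (psi1 psi2 : E -> \bar R) (M : R) : transition_density P X p -> 0 < t -> 0 <= M ->
  measurable_fun setT psi1 -> measurable_fun setT psi2 ->
  (forall y, 0 <= psi1 y)%E -> (forall y, 0 <= psi2 y)%E -> (forall y, psi1 y <= M%:E)%E ->
  (forall r, 0 < r -> {ae lebesgue_rV R d, forall y,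
      (fk P X a b r psi1 y <= M%:E + fk P X a b r psi2 y)%E}) ->
  (fk P X a b t psi1 x <= (M * expR (- (K * t)))%:E +
     M%:E * green_fk P X q (EFin \o U) x + fk P X a b t psi2 x)%E.
Proof.
move=> hp t0 M0 m1 m2 p10 p20 p1M h.
rewrite (duhamel t0 m1 p10) -[leRHS]addeA; apply: leeD.
  apply: (@le_trans _ _ (\int[P]_w (M * expR (- (K * t)))%:E)%E); last by rewrite integral_cst_prob.
  apply: ge0_le_integral_nomeas => w.
    by rewrite mule_ge0 ?killing_ge0.
  rewrite mulrC EFinM; apply: lee_pmul => //; first exact: killing_ge0.
  rewrite killingE -[leRHS]/(expeR (- (K * t))%:E) lee_expeR EFinN leeN2 -integral_cst_itv ?(ltW t0)//.
  apply: ge0_le_integral => //.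
  - by move=> u _; rewrite lee_fin ltW.
  - by apply/measurable_EFinP; exact: (@measurable_path _ _ _ _ P X hX).
  - by move=> u _; rewrite lee_fin.
apply: (@le_trans _ _ (M%:E * \int[leb]_(s in `]0%R, t[) I `|s| + \int[leb]_(s in `]0%R, t[) duhamel_rest t psi2 s)%E); last first.
  apply: leeD; first by apply: lee_wpmul2l => //; exact: I_le.
  by rewrite (duhamel t0 m2 p20) leeDr//; apply: integral_ge0 => w _; rewrite mule_ge0 ?killing_ge0.
have mr1 := measurable_duhamel_rest t0 m1 p10; have mr2 := measurable_duhamel_rest t0 m2 p20.
rewrite -ge0_integralZl//; last exact: (measurable_funTS mI).
have mMI : measurable_fun `]0, t[ (fun s : measurableTypeR R => M%:E * I `|s|)%E.
  by apply: measurable_funeM; exact: (measurable_funTS mI).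
rewrite -(ge0_integralD leb (measurable_itv _) (fun s _ => mule_ge0 (M0 : (0 <= M%:E)%E) (I0 _)) mMI
  (fun s _ => duhamel_rest_ge0 t p20 s) (measurable_funTS mr2)).
apply: ge0_le_integral => //.
- by move=> s _; exact: duhamel_rest_ge0.
- exact: (measurable_funTS mr1).
- by apply: emeasurable_funD; [apply: measurable_funeM; exact: (measurable_funTS mI)|exact: (measurable_funTS mr2)].
move=> s; rewrite /= in_itv/= => /andP[s0 st]; rewrite (duhamel_restE m1 p10 s0 st) (duhamel_restE m2 p20 s0 st).
have ts : 0 < t - s by rewrite subr_gt0.
have mks : measurable_fun setT (kU s).
  rewrite -(gtr0_norm s0); exact: (measurableT_comp mkU (@pair2_measurable _ _ Omega (measurableTypeR R) s)).
have mXs : measurable_fun setT (fun w => x + X s w) by apply: measurable_funD_rV => //; exact/mX/ltW.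
have mf (psi : E -> \bar R) : measurable_fun setT psi -> (forall y, 0 <= psi y)%E ->
    measurable_fun setT (fun w => kU s w * fk P X a b (t - s) psi (x + X s w)%R)%E.
  move=> mp p0; apply: emeasurable_funM => //.
  exact: (measurableT_comp (@measurable_fk _ _ _ _ P X hX a b ma mb a0 b0 (t - s) psi (ltW ts) mp p0) mXs).
have f0 (psi : E -> \bar R) w : (forall y, 0 <= psi y)%E -> (0 <= kU s w * fk P X a b (t - s) psi (x + X s w)%R)%E.
  by move=> p0; rewrite mule_ge0// fk_ge0.
rewrite ger0_norm ?(ltW s0)// /I -ge0_integralZl//.
rewrite -ge0_integralD//; last 4 first.
- by move=> w _; rewrite mule_ge0.
- exact: measurable_funeM.
- by move=> w _; exact: f0.
- exact: mf.
apply: ae_ge0_le_integral => //.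
- by move=> w _; exact: f0.
- exact: mf.
- by move=> w _; apply: adde_ge0; [rewrite mule_ge0|exact: f0].
- by apply: emeasurable_funD; [exact: measurable_funeM|exact: mf].
apply: filterS (ae_levy_density hX x hp s0 (h (t - s) ts)) => w hw _.
rewrite [(M%:E * _)%E]muleC -ge0_muleDr//; last exact: fk_ge0.
exact: lee_wpmul2l.
Qed.

(** The first term of Duhamel's formula is nonnegative and dropped; in the other a lower bound on
    the support of [U] suffices. Letting the time tend to infinity gives the full Green potential by
    monotone convergence. *)
Lemma eigen_lower p (psi : E -> \bar R) (c : R) (v : \bar R) : transition_density P X p -> 0 <= c ->
  measurable_fun setT psi -> (forall y, 0 <= psi y)%E ->
  (forall r, 0 < r -> {ae lebesgue_rV R d, forall y, U y != 0 -> (c%:E <= fk P X a b r psi y)%E}) ->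
  (forall n : nat, fk P X a b n.+1%:R psi x <= v)%E ->
  (c%:E * green_fk P X q (EFin \o U) x <= v)%E.
Proof.
move=> hp c0 mp p0 h hv.
have step (n : nat) : (c%:E * \int[leb]_(s in `]0%R, n.+1%:R[) I `|s| <= v)%E.
  have n0 : 0 < n.+1%:R :> R by [].
  apply: le_trans (hv n); rewrite (duhamel n0 mp p0).
  apply: (@le_trans _ _ (\int[leb]_(s in `]0%R, n.+1%:R[) duhamel_rest n.+1%:R psi s)%E); last first.
    by rewrite leeDr//; apply: integral_ge0 => w _; rewrite mule_ge0 ?killing_ge0.
  rewrite -ge0_integralZl//; last exact: (measurable_funTS mI).
  apply: ge0_le_integral => //.
  - by move=> s _; rewrite mule_ge0.
  - by apply: measurable_funeM; exact: (measurable_funTS mI).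
  - exact: (measurable_funTS (measurable_duhamel_rest n0 mp p0)).
  move=> s; rewrite /= in_itv/= => /andP[s0 st]; rewrite (duhamel_restE mp p0 s0 st) ger0_norm ?(ltW s0)//.
  have ts : 0 < n.+1%:R - s by rewrite subr_gt0.
  have mks : measurable_fun setT (kU s).
    rewrite -(gtr0_norm s0); exact: (measurableT_comp mkU (@pair2_measurable _ _ Omega (measurableTypeR R) s)).
  have mXs : measurable_fun setT (fun w => x + X s w) by apply: measurable_funD_rV => //; exact/mX/ltW.
  rewrite /I -ge0_integralZl//.
  apply: ae_ge0_le_integral => //.
  - by move=> w _; rewrite mule_ge0.
  - exact: measurable_funeM.
  - by move=> w _; rewrite mule_ge0// fk_ge0.
  - apply: emeasurable_funM => //.
    exact: (measurableT_comp (@measurable_fk _ _ _ _ P X hX a b ma mb a0 b0 (n.+1%:R - s) psi (ltW ts) mp p0) mXs).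
  apply: filterS (ae_levy_density hX x hp s0 (h _ ts)) => w hw _; rewrite muleC.
  have [u0|u0] := eqVneq (U (x + X s w)) 0; last exact: lee_wpmul2l (hw u0).
  by rewrite /kU u0 mule0 !mul0e.
have cvg : (\int[leb]_(s in `]0%R, n.+1%:R[) I `|s|)%E @[n --> \oo] --> green_fk P X q (EFin \o U) x.
  have UE : \bigcup_n `]0%R, n.+1%:R[%classic = `]0%R, +oo[%classic :> set R.
    apply/seteqP; split => [s [n _]|s] /=; rewrite !in_itv/= ?andbT; first by case/andP.
    by move=> s0; exists (Num.truncn s) => //=; rewrite in_itv/= s0/= truncnS_gt.
  rewrite green_I -integral_itv_obnd_cbnd; last exact: (measurable_funTS mI).
  rewrite -UE; apply: ge0_nondecreasing_set_cvg_integral => //.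
  - move=> m n mn; apply/subsetPset; apply: subset_itvl; rewrite bnd_simp ler_nat; exact: mn.
  - by move=> n; exact: (measurable_funTS mI).
have h2 := cvgeZl (y := c%:E) (isT : c%:E \is a fin_num) cvg.
by apply: (cvge_le _ h2); apply: nearW => n; exact: step.
Qed.

End duhamel.

Lemma measurable_integral_section (R : realType) d1 d2 (T1 : measurableType d1) (T2 : measurableType d2)
    (m2 : {sigma_finite_measure set T2 -> \bar R}) (D : set T2) (F : T1 * T2 -> \bar R) : measurable D ->
  measurable_fun setT F -> (forall z, 0 <= F z)%E ->
  measurable_fun setT (fun x => \int[m2]_(y in D) F (x, y))%E.
Proof.
move=> mD mF F0.
have -> : (fun x => \int[m2]_(y in D) F (x, y))%E = (fun x => \int[m2]_y (if y \in D then F (x, y) else 0))%E.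
  by apply/funext => x; rewrite integral_mkcond; apply: eq_integral => y _; rewrite patchE.
apply: (@measurable_fun_fubini_tonelli_F _ _ _ _ _ m2 (fun z => if z.2 \in D then F z else 0%E)).
  apply: measurable_fun_ifT => //.
  apply: (measurable_fun_bool true); rewrite setTI.
  rewrite (_ : _ @^-1` _ = snd @^-1` D); last first.
    by apply/seteqP; split => z /=; [move/set_mem|move/mem_set].
  by rewrite -[X in measurable X]setTI; apply: measurable_snd.
by move=> z; case: ifP.
Qed.

Section feynman_kac_fk.
Context (R : realType) (d : nat) (disp : measure_display)
  (Omega : measurableType disp) (P : probability Omega R)
  (X : R -> Omega -> 'rV[R]_d).
Hypothesis hX : levy_process P X.
Local Notation E := 'rV[R]_d.
Local Notation leb := (@lebesgue_measure R).
Variable V : E -> R.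
Hypothesis hV : kato_potential P X V.

Let mV : measurable_fun setT V. Proof. by case: hV. Qed.
Let mp : measurable_fun setT V^\+. Proof. exact: measurable_funrpos. Qed.
Let mn : measurable_fun setT V^\-. Proof. exact: measurable_funrneg. Qed.
Let mX t : 0 <= t -> measurable_fun setT (X t). Proof. by case: hX => h _ _ _ _; exact: h. Qed.

(** With [weight_neg], a splitting of [V - lam] into nonnegative parts. Moving the eigenvalue into
    the potential makes the eigenfunction invariant under the resulting operators. *)
Definition weight_pos lam y := V^\+ y + Num.max 0 (- lam).
Definition weight_neg lam y := V^\- y + Num.max 0 lam.

Lemma Vpos_ge0 y : 0 <= V^\+ y. Proof. by rewrite /funrpos le_max lexx orbT. Qed.
Lemma Vneg_ge0 y : 0 <= V^\- y. Proof. by rewrite /funrneg le_max lexx orbT. Qed.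

Lemma Vpos_locally_killed : locally_killed P X V^\+.
Proof. by apply: (kato_loc_locally_killed hX _ Vpos_ge0); case: hV. Qed.

Lemma Vneg_locally_killed : locally_killed P X V^\-.
Proof. by apply: (kato_locally_killed hX _ Vneg_ge0); case: hV. Qed.

Lemma dominated_locally_killed (q : E -> R) (c1 c : R) : measurable_fun setT q -> (forall y, 0 <= q y) ->
  0 <= c1 -> 0 <= c -> (forall y, q y <= c1 * `|V y| + c) -> locally_killed P X q.
Proof.
move=> mq q0 c10 c0 hq.
apply: (@le_locally_killed _ _ _ _ P X hX q _ _ c1 c Vpos_locally_killed Vneg_locally_killed mq mp mn q0 Vpos_ge0 Vneg_ge0 c10 c0) => y.
apply: le_trans (hq y) _; rewrite lerD2r ler_wpM2l// /funrpos /funrneg.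
have h1 : V y <= Num.max (V y) 0 by rewrite le_max lexx.
have h2 : - V y <= Num.max (- V y) 0 by rewrite le_max lexx.
have h3 : 0 <= Num.max (V y) 0 by rewrite le_max lexx orbT.
have h4 : 0 <= Num.max (- V y) 0 by rewrite le_max lexx orbT.
by rewrite ler_norml; apply/andP; split; lra.
Qed.

Variable lam : R.
Local Notation a := (weight_pos lam).
Local Notation b := (weight_neg lam).

Lemma measurable_weight_pos : measurable_fun setT a.
Proof. exact: measurable_funD. Qed.
Lemma measurable_weight_neg : measurable_fun setT b.
Proof. exact: measurable_funD. Qed.
Lemma weight_pos_ge0 y : 0 <= a y.
Proof. by rewrite addr_ge0 ?Vpos_ge0// le_max lexx. Qed.
Lemma weight_neg_ge0 y : 0 <= b y.
Proof. by rewrite addr_ge0 ?Vneg_ge0// le_max lexx. Qed.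
Lemma weight_posB y : a y - b y = V y - lam.
Proof.
rewrite /weight_pos /weight_neg /funrpos /funrneg /Num.max.
by case: ifP; case: ifP; case: ifP; case: ifP; lra.
Qed.

Variables (t : R) (t0 : 0 <= t).

Let shift (c : E -> R) (m : R) x w : measurable_fun setT c -> (forall y, 0 <= c y) -> 0 <= m ->
  (\int[leb]_(u in `[0%R, t]) (c (x + X u w)%R + m)%:E =
   \int[leb]_(u in `[0%R, t]) (c (x + X u w)%R)%:E + (m * t)%:E)%E.
Proof.
move=> mc c0 m0; under eq_integral do rewrite EFinD.
rewrite ge0_integralD// ?integral_cst_itv//.
- by move=> u _; rewrite lee_fin.
- by apply/measurable_EFinP; exact: (@measurable_path _ _ _ _ P X hX).
Qed.

Let mfkw x : measurable_fun setT (fun w => fkw a b x 0 t (X ^~ w)).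
Proof.
apply: (@measurable_fkw _ _ _ _ _ _ hX _ _ (fun=> 0) (fun=> t) (fun=> x) id a b) => //.
- exact: measurable_weight_pos.
- exact: measurable_weight_neg.
- exact: weight_pos_ge0.
- exact: weight_neg_ge0.
Qed.

Lemma fk_expmoment : exists2 M, 0 < M & forall x, (fk P X a b t (cst 1%E) x <= M%:E)%E.
Proof.
have kn : kato P X V^\- by case: hV.
have [M M0 hM] := @kato_expmoment _ _ _ _ P X hX _ kn Vneg_ge0 t t0.
pose c := expR (Num.max 0 lam * t).
have c0 : 0 < c by exact: expR_gt0.
exists (c * M) => [|x]; first by rewrite mulr_gt0.
have m0 : measurable_fun setT (fun w => fkw (fun=> 0) V^\- x 0 t (X ^~ w)).
  by apply: (@measurable_fkw _ _ _ _ _ _ hX _ _ (fun=> 0) (fun=> t) (fun=> x) id (fun=> 0) V^\-) => //; exact: Vneg_ge0.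
apply: (@le_trans _ _ (c%:E * fk P X (fun=> 0%R) V^\-%R t (cst 1%E) x)%E); last first.
  by rewrite EFinM; apply: lee_wpmul2l => //; rewrite lee_fin ltW.
rewrite /fk -ge0_integralZl//; last 3 first.
- by apply: emeasurable_funM.
- by move=> w _; rewrite mule1 fkw_ge0.
- by rewrite lee_fin ltW.
apply: ge0_le_integral_nomeas => w; first by rewrite mule1 fkw_ge0.
have m2 : 0 <= Num.max 0 lam by rewrite le_max lexx.
rewrite !mule1 /fkw integral0 oppe0 expeR0 mul1e /weight_neg (shift _ _ mn Vneg_ge0 m2).
rewrite expeRD -[leRHS]mul1e [(c%:E * _)%E]muleC; apply: lee_pmul.
- exact: expeR_ge0.
- by apply: mule_ge0; exact: expeR_ge0.
- rewrite -expeR0 lee_expeR oppe_le0; apply: integral_ge0 => u _; rewrite lee_fin; exact: weight_pos_ge0.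
- exact: lexx.
Qed.

Lemma fk_bounded (psi : E -> \bar R) (c : R) x : measurable_fun setT psi -> (forall y, 0 <= psi y)%E ->
  (forall y, psi y <= c%:E)%E -> fk P X a b t psi x \is a fin_num.
Proof.
move=> mpsi p0 pc; have [M M0 hM] := fk_expmoment.
rewrite ge0_fin_numE; last exact: fk_ge0.
have c0 : 0 <= c by rewrite -lee_fin; exact: le_trans (p0 0) (pc 0).
apply: (@le_lt_trans _ _ (c%:E * fk P X a b t (cst 1%E) x)%E).
  rewrite /fk -ge0_integralZl//; last 2 first.
  - exact: emeasurable_funM.
  - by move=> w _; rewrite mule1 fkw_ge0.
  apply: ge0_le_integral_nomeas => w; first by rewrite mule_ge0 ?fkw_ge0.
  by rewrite mule1 muleC lee_wpmul2r ?fkw_ge0.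
by apply: (@le_lt_trans _ _ (c%:E * M%:E)%E); [exact: lee_wpmul2l|exact: ltry].
Qed.

Definition potential_integral (x : E) (w : Omega) : R := \int[leb]_(s in `[0, t]) V (x + X s w).
Local Notation iV := potential_integral.

(** Almost surely both parts of [V] are integrable along the path, and the extended weight is the
    exponential of a genuine difference. On the exceptional null set the real integral of
    [feynman_kac] may be a default value. *)
Lemma ae_weight x : {ae P, forall w, fkw a b x 0 t (X ^~ w) = (expR (lam * t) * expR (- iV x w))%:E}.
Proof.
apply: filterS2 (Vpos_locally_killed x) (Vneg_locally_killed x) => w hp hn.
have e : (\int[leb]_(s in `[0%R, t]) (V (x + X s w)%R)%:E =
    \int[leb]_(s in `[0%R, t]) (V^\+ (x + X s w)%R)%:E - \int[leb]_(s in `[0%R, t]) (V^\- (x + X s w)%R)%:E)%E.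
  rewrite integralE; congr (_ - _)%E; apply: eq_integral => s _.
    by rewrite funeposE /funrpos EFin_max.
  by rewrite funenegE /funrneg EFin_max.
have m1 : 0 <= Num.max 0 (- lam) by rewrite le_max lexx.
have m2 : 0 <= Num.max 0 lam by rewrite le_max lexx.
rewrite /fkw /weight_pos /weight_neg (shift _ _ mp Vpos_ge0 m1) (shift _ _ mn Vneg_ge0 m2).
rewrite /potential_integral /Rintegral e; have := hp t t0; have := hn t t0.
have p0 : (0 <= \int[leb]_(s in `[0%R, t]) (V^\+ (x + X s w)%R)%:E)%E.
  by apply: integral_ge0 => s _; rewrite lee_fin Vpos_ge0.
have n0 : (0 <= \int[leb]_(s in `[0%R, t]) (V^\- (x + X s w)%R)%:E)%E.
  by apply: integral_ge0 => s _; rewrite lee_fin Vneg_ge0.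
move: p0 n0; case: (\int[leb]_(s in _) (V^\+ _)%:E)%E => // A _; case: (\int[leb]_(s in _) (V^\- _)%:E)%E => // B _ _ _.
rewrite -!EFinD -EFinN /= -EFinM -!expRD; congr (expR _)%:E.
have e2 : Num.max 0 lam = lam + Num.max 0 (- lam) by rewrite /Num.max; case: ifP; case: ifP; lra.
by rewrite e2; ring.
Qed.

Lemma measurable_potential_integral x : measurable_fun setT (iV x).
Proof.
have mi (c : E -> R) : measurable_fun setT c -> (forall y, 0 <= c y) ->
    measurable_fun setT (fun w => \int[leb]_(s in `[0%R, t]) (c (x + X s w)%R)%:E)%E.
  move=> mc c0.
  apply: (@measurable_levy_integral _ _ _ _ _ _ hX _ _ (fun=> 0) (fun=> t) (fun=> x) id (EFin \o c)) => //; exact/measurable_EFinP.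
have -> : iV x = fun w => fine (\int[leb]_(s in `[0%R, t]) (V^\+ (x + X s w)%R)%:E -
    \int[leb]_(s in `[0%R, t]) (V^\- (x + X s w)%R)%:E)%E.
  apply/funext => w; rewrite /potential_integral /Rintegral integralE; congr (fine (_ - _)%E); apply: eq_integral => s _.
    by rewrite funeposE /funrpos EFin_max.
  by rewrite funenegE /funrneg EFin_max.
apply: (measurableT_comp (@fine_measurable R setT measurableT)).
by apply: emeasurable_funB; [exact: (mi _ mp Vpos_ge0)|exact: (mi _ mn Vneg_ge0)].
Qed.

(** The bridge between the signed, real-valued [feynman_kac] and the nonnegative, extended-valued
    [fk]; both [fk] terms are finite by [fk_bounded]. *)
Lemma feynman_kac_fk (f : E -> R) (M : R) x : measurable_fun setT f -> (forall y, `|f y| <= M) ->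
  (fk P X a b t (EFin \o f^\+%R) x =
   (expR (lam * t) * feynman_kac P X V t f x)%:E + fk P X a b t (EFin \o f^\-%R) x)%E.
Proof.
move=> mf fM.
have mfp : measurable_fun setT (EFin \o f^\+%R) by apply/measurable_EFinP; exact: measurable_funrpos.
have mfn : measurable_fun setT (EFin \o f^\-%R) by apply/measurable_EFinP; exact: measurable_funrneg.
have fp0 y : 0 <= f^\+ y by rewrite /funrpos le_max lexx orbT.
have fn0 y : 0 <= f^\- y by rewrite /funrneg le_max lexx orbT.
have M0 : 0 <= M by apply: le_trans (fM 0).
have fpM y : f^\+ y <= M by rewrite /funrpos ge_max M0 andbT (le_trans (ler_norm _)).
have fnM y : f^\- y <= M by rewrite /funrneg ge_max M0 andbT (le_trans (ler_norm _))// normrN.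
have finp := fk_bounded x mfp fp0 fpM; have finn := fk_bounded x mfn fn0 fnM.
pose k w := fkw a b x 0 t (X ^~ w).
have k0 w : (0 <= k w)%E by exact: fkw_ge0.
have mfX : measurable_fun setT (fun w => f (x + X t w)).
  by apply: (measurableT_comp mf); apply: measurable_funD_rV => //; exact: mX.
pose H w := (k w * (f (x + X t w))%:E)%E.
have mfXe : measurable_fun setT (fun w => (f (x + X t w))%:E) by exact/measurable_EFinP.
have mH : measurable_fun setT H by exact: (emeasurable_funM (mfkw x) mfXe).
have gmax (l : \bar R) (r : R) : (0 <= l)%E -> maxe (l * r%:E)%E 0%E = (l * (Num.max r 0%R)%:E)%E.
  move=> l0; have [r0|r0] := leP 0 r; first by rewrite max_l// mule_ge0.
  by rewrite mule0 max_r// mule_ge0_le0// lee_fin ltW.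
have Hp w : H^\+%E w = (k w * (f^\+%R (x + X t w)%R)%:E)%E.
  by rewrite funeposE /H /funrpos gmax.
have Hn w : H^\-%E w = (k w * (f^\-%R (x + X t w)%R)%:E)%E.
  by rewrite funenegE /H /funrneg -gmax// EFinN muleN.
have iH : (\int[P]_w H w = fk P X a b t (EFin \o f^\+%R) x - fk P X a b t (EFin \o f^\-%R) x)%E.
  by rewrite integralE; congr (_ - _)%E; apply: eq_integral => w _; [exact: Hp|exact: Hn].
have intH : P.-integrable setT H.
  apply/integrableP; split => //.
  have fa0 y : (0 <= (`|f y|%R)%:E)%E by rewrite lee_fin.
  have mfa : measurable_fun setT (fun y => (`|f y|)%:E) by apply/measurable_EFinP; exact: measurableT_comp.
  have := fk_bounded x mfa fa0 fM; rewrite ge0_fin_numE; last exact: fk_ge0.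
  congr (_ < _)%E; apply: eq_integral => w _.
  by rewrite /H abseM (gee0_abs (k0 w)).
pose h w : R := expR (- iV x w) * f (x + X t w).
have mh : measurable_fun setT h.
  apply: measurable_funM => //; apply: (measurableT_comp (@measurable_expR R)).
  exact: (measurable_funN (measurable_potential_integral x)).
have aeh : {ae P, forall w, (setT w -> (h w)%:E = ((expR (- (lam * t)))%:E * H w))%E}.
  apply: filterS (ae_weight x) => w hw _; rewrite /H /k hw -!EFinM /h; congr EFin.
  by rewrite !mulrA -expRD addNr expR0 mul1r.
have eh : (\int[P]_w (h w)%:E = (expR (- (lam * t)))%:E * \int[P]_w H w)%E.
  rewrite -(integralZl measurableT intH); apply: ae_eq_integral aeh => //.
  - exact/measurable_EFinP.
  - exact: measurable_funeM.
rewrite [feynman_kac _ _ _ _ _ _](_ : _ = fine (\int[P]_w (h w)%:E)%E)// eh iH.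
move: finp finn; case: (fk _ _ _ _ _ _ _) => // p _; case: (fk _ _ _ _ _ _ _) => // m _ /=.
by rewrite -EFinD; congr EFin; rewrite mulrA -expRD subrr expR0 mul1r subrK.
Qed.

End feynman_kac_fk.

(** * Eigenfunctions of one eigensystem *)

Lemma ae_integral_le_scale (R : realType) dT (T : measurableType dT) (mu : {measure set T -> \bar R})
    (f g : T -> \bar R) (c : R) : 0 <= c -> measurable_fun setT f -> measurable_fun setT g ->
  (forall x, 0 <= f x)%E -> (forall x, 0 <= g x)%E -> {ae mu, forall x, (f x <= c%:E * g x)%E} ->
  (\int[mu]_x f x <= c%:E * \int[mu]_x g x)%E.
Proof.
move=> c0 mf mg f0 g0 h; rewrite -ge0_integralZl//.
apply: ae_ge0_le_integral => //.
- by move=> x _; rewrite mule_ge0.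
- exact: measurable_funeM.
- by apply: filterS h.
Qed.

Section continuous_rV.
Context (R : realType) (d : nat).
Local Notation E := 'rV[R]_d.

(** A violation would persist on a neighbourhood, which contains a cube of positive measure. *)
Lemma ae_continuous_le (f g : E -> R) : continuous f -> continuous g ->
  {ae lebesgue_rV R d, forall x, f x <= g x} -> forall x, f x <= g x.
Proof.
move=> cf cg [N [mN N0 fgN]] x; rewrite leNgt; apply/negP => gf.
have cfg : continuous (fun y => f y - g y).
  by move=> y; apply: (@continuousB R R E f g); [exact: cf|exact: cg].
have oU : open [set y | 0 < f y - g y].
  by rewrite (_ : mkset _ = (fun y => f y - g y) @^-1` [set r | 0 < r])//; apply: open_comp => // y _; exact: cfg.
have /nbhs_ballP[e /= e0 eU] : nbhs x [set y | 0 < f y - g y].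
  by apply: open_nbhs_nbhs; split => //=; rewrite subr_gt0.
pose B : set E := [set z | forall i, `[(x ord0 i - e / 2)%R, (x ord0 i + e / 2)%R]%classic (z ord0 i)].
have BN : B `<=` N.
  move=> z Bz; apply: fgN => /=; apply/negP; rewrite -ltNge -subr_gt0; apply: eU.
  rewrite mx_norm_ball /ball_/= [`|_|]mx_normrE; apply/bigmax_ltP; split => // -[i j] _ /=.
  have := Bz j; rewrite /= in_itv/= (ord1 i) !mxE ltr_norml; lra.
have mB : measurable B by exact: measurable_cube.
have : (lebesgue_rV R d B <= lebesgue_rV R d N)%E by apply: le_measure; rewrite ?inE.
have e2 : 0 <= e / 2 by rewrite divr_ge0// ltW.
have -> : lebesgue_rV R d N = 0%E by exact: N0.
have -> : lebesgue_rV R d B = ((2 * (e / 2)) ^+ d)%:E by exact: (lebesgue_rV_cube x e2).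
by rewrite lee_fin leNgt exprn_gt0// mulr_gt0// divr_gt0.
Qed.

Lemma continuous_pos_lower (f : E -> R) rad : continuous f -> (forall x, 0 < f x) ->
  exists2 c, 0 < c & forall y, enorm y <= rad -> c <= f y.
Proof.
move=> cf f0; pose A : set E := [set y | enorm y <= rad].
have [[z Az]|A0] := pselect (A !=set0); last first.
  by exists 1 => // y yr; exfalso; apply: A0; exists y.
have cA : compact A.
  apply: bounded_closed_compact.
    exists rad; split; first exact: num_real.
    by move=> M rM y /= Ay; apply: le_trans (norm_le_enorm y) _; apply: le_trans (ltW rM).
  rewrite (_ : A = (@enorm R d) @^-1` [set r | r <= rad])//.
  by apply: closed_comp; [move=> y _; exact: continuous_enorm|exact: closed_le].
have [c _ hc] := @EVT_min_rV R d f A (ex_intro _ z Az) cA (continuous_subspaceT cf).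
by exists (f c) => // y yr; apply: hc; rewrite inE.
Qed.

End continuous_rV.

Section green_shift.
Context (R : realType) (d : nat) (disp : measure_display)
  (Omega : measurableType disp) (P : probability Omega R)
  (X : R -> Omega -> 'rV[R]_d).
Hypothesis hX : levy_process P X.
Local Notation E := 'rV[R]_d.
Local Notation leb := (@lebesgue_measure R).
Variables (q q' : E -> R) (K delta : R).
Hypotheses (mq : measurable_fun setT q) (mq' : measurable_fun setT q') (K0 : 0 < K)
  (qK : forall y, K <= q y) (delta0 : 0 <= delta) (qE : forall y, q' y = q y + delta)
  (qloc : locally_killed P X q).

Let q0 y : 0 <= q y. Proof. exact: le_trans (ltW K0) (qK y). Qed.
Let qK' y : K <= q' y. Proof. by rewrite qE; apply: le_trans (qK y) _; rewrite lerDl. Qed.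

Let k (s : R) (x : E) w := killing X q x `|s| w.
Let k' (s : R) (x : E) w := killing X q' x `|s| w.

Let kk' (s : R) (x : E) w : 0 <= s -> k' s x w = (k s x w * (expR (- (delta * s)))%:E)%E.
Proof.
move=> s0; rewrite /k /k' !killingE ger0_norm//.
have -> : (\int[leb]_(u in `[0%R, s]) (q' (x + X u w)%R)%:E =
    \int[leb]_(u in `[0%R, s]) (q (x + X u w)%R)%:E + (delta * s)%:E)%E.
  rewrite -integral_cst_itv// -ge0_integralD//.
  - by apply: eq_integral => u _; rewrite qE EFinD.
  - by move=> u _; rewrite lee_fin.
  - by apply/measurable_EFinP; exact: (@measurable_path _ _ _ _ P X hX).
rewrite oppeD; last by rewrite fin_num_adde_defl.
by rewrite expeRD.
Qed.

Let mk x : measurable_fun setT (fun z : Omega * measurableTypeR R => k z.2 x z.1).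
Proof. exact: (@measurable_killing _ _ _ _ P X hX q K mq K0 qK). Qed.
Let mk' x : measurable_fun setT (fun z : Omega * measurableTypeR R => k' z.2 x z.1).
Proof. exact: (@measurable_killing _ _ _ _ P X hX q' K mq' K0 qK'). Qed.
Let k0 s x w : (0 <= k s x w)%E. Proof. exact: killing_ge0. Qed.
Let k0' s x w : (0 <= k' s x w)%E. Proof. exact: killing_ge0. Qed.

Let green1 (r : E -> R) x :
  (green_fk P X r (cst 1%E) x = \int[P]_w \int[leb]_(s in `[0%R, +oo[) killing X r x `|s|%R w)%E.
Proof.
rewrite green_fk_def; apply: eq_integral => w _; apply: eq_integral => s.
by rewrite inE/= in_itv/= andbT mule1 => s0; rewrite ger0_norm.
Qed.

(* Since the killing rate is at least K, the mass of the killing weight after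
   time 1 is at most 1/K times its mass before time 1, where the two weights are
   comparable. *)
Let path_bound x w : (forall T, 0 <= T -> (\int[leb]_(u in `[0%R, T]) (q (x + X u w)%R)%:E < +oo)%E) ->
  (\int[leb]_(s in `[0%R, +oo[) k s x w <= ((1 + K^-1) * expR delta)%:E * \int[leb]_(s in `[0%R, +oo[) k' s x w)%E.
Proof.
move=> hq.
have mkw : measurable_fun setT (fun s : R => k s x w).
  exact: (measurableT_comp (mk x) (@pair1_measurable _ _ _ (measurableTypeR R) w)).
have mkw' : measurable_fun setT (fun s : R => k' s x w).
  exact: (measurableT_comp (mk' x) (@pair1_measurable _ _ _ (measurableTypeR R) w)).
have mqw : measurable_fun setT (fun u : R => q (x + X `|u| w)).
  apply: (measurableT_comp mq); apply: measurable_funD_rV => //.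
  apply: (@measurable_levy_at _ _ _ _ _ _ hX _ _ (fun u : measurableTypeR R => `|u|) (fun=> w)) => //.
  exact: (@normr_measurable R setT).
have absE T : (\int[leb]_(u in `[0%R, T]) (q (x + X `|u|%R w)%R)%:E = \int[leb]_(u in `[0%R, T]) (q (x + X u w)%R)%:E)%E.
  by apply: eq_integral => u; rewrite inE/= in_itv/= => /andP[u0 _]; rewrite ger0_norm.
have hq' T : 0 <= T -> (\int[leb]_(u in `[0%R, T]) (q (x + X `|u|%R w)%R)%:E < +oo)%E.
  by move=> T0; rewrite absE; exact: hq.
have kE s : 0 <= s -> k s x w = expeR (- \int[leb]_(u in `[0%R, s]) (q (x + X `|u|%R w)%R)%:E)%E.
  by move=> s0; rewrite absE /k killingE ger0_norm.
have split := @path_weight_split R (fun u => q (x + X `|u| w)) (fun s => k s x w) mqw mkw (fun u => q0 _) hq' kE (fun s => k0 s x w).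
have mono s t : 0 <= s -> s <= t -> (k t x w <= k s x w)%E.
  move=> s0 st; rewrite (split _ _ s0 st) leeDl//; apply: integral_ge0 => u _.
  by rewrite mule_ge0// lee_fin.
have k1f : k 1 x w \is a fin_num by apply: (@killing_fin _ _ _ _ X q K K0 qK).
have K00 : 0 <= K by exact: ltW.
(* On [[1, T]] the integral of [q k] is [k 1 - k T], and [K <= q]. *)
have tail : (\int[leb]_(s in `[1%R, +oo[) k s x w <= K^-1%:E * k 1 x w)%E.
  have fin T : 1 <= T -> (\int[leb]_(s in `[1%R, T]) k s x w <= K^-1%:E * k 1 x w)%E.
    move=> T1; rewrite lee_pdivlMl//.
    rewrite -ge0_integralZl//; last exact: (measurable_funTS mkw).
    rewrite [leRHS](split 1 T)// ; apply: (@le_trans _ _ (\int[leb]_(r in `[1%R, T]) ((q (x + X `|r|%R w)%R)%:E * k r x w))%E); last by rewrite leeDr.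
    apply: ge0_le_integral => //.
    - by move=> s _; rewrite mule_ge0.
    - by apply: measurable_funeM; exact: (measurable_funTS mkw).
    - by apply: emeasurable_funM; [apply/measurable_EFinP; exact: (measurable_funTS mqw)|exact: (measurable_funTS mkw)].
    - by move=> s _; apply: lee_wpmul2r => //; rewrite lee_fin.
  have UE : \bigcup_n `[1%R, n.+1%:R]%classic = `[1%R, +oo[%classic :> set R.
    apply/seteqP; split => [s [n _]|s] /=; rewrite !in_itv/= ?andbT; first by case/andP.
    by move=> s1; exists (Num.truncn s) => //=; rewrite in_itv/= s1/= ltW// truncnS_gt.
  have cvg : (\int[leb]_(s in `[1%R, n.+1%:R]) k s x w)%E @[n --> \oo] --> (\int[leb]_(s in `[1%R, +oo[) k s x w)%E.
    rewrite -UE; apply: ge0_nondecreasing_set_cvg_integral => //.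
    - by move=> m n mn; apply/subsetPset; apply: subset_itvl; rewrite bnd_simp ler_nat.
    - by move=> n; exact: (measurable_funTS mkw).
  by apply: (cvge_le _ cvg); apply: nearW => n; apply: fin; rewrite ler1n.
have head : (k 1 x w <= \int[leb]_(s in `[0%R, 1%R]) k s x w)%E.
  rewrite -[leLHS](fineK k1f) -[X in (X%:E <= _)%E]mulr1 -integral_cst_itv//.
  apply: ge0_le_integral => //.
  - by move=> s _; rewrite fineK.
  - exact: (measurable_funTS mkw).
  - by move=> s /=; rewrite in_itv/= => /andP[s0 s1]; rewrite fineK//; exact: mono.
have e1 : (\int[leb]_(s in `[0%R, +oo[) k s x w <= (1 + K^-1)%:E * \int[leb]_(s in `[0%R, 1%R]) k s x w)%E.
  rewrite (@ge0_integral_itv_split R (fun s => k s x w) 0 1 (BInfty _ false))//.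
  rewrite EFinD ge0_muleDl ?lee_fin ?invr_ge0// mul1e leeD2l//; apply: le_trans tail _.
  by apply: lee_wpmul2l => //; rewrite lee_fin invr_ge0.
apply: le_trans e1 _; rewrite EFinM -muleA; apply: lee_wpmul2l.
  by rewrite lee_fin addr_ge0// invr_ge0.
have ed0 : (0 <= (expR delta)%:E)%E by rewrite lee_fin expR_ge0.
apply: (@le_trans _ _ ((expR delta)%:E * \int[leb]_(s in `[0%R, 1%R]) k' s x w)%E); last first.
  apply: lee_wpmul2l; first exact: ed0.
  apply: (ge0_subset_integral leb (measurable_itv _) (measurable_itv _) (measurable_funTS mkw') (fun s _ => k0' s x w)).
  by move=> s /=; rewrite !in_itv/= andbT => /andP[].
rewrite -ge0_integralZl//; last exact: (measurable_funTS mkw').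
apply: ge0_le_integral => //.
- exact: (measurable_funTS mkw).
- by apply: measurable_funeM; exact: (measurable_funTS mkw').
- move=> s /=; rewrite in_itv/= => /andP[s0 s1]; rewrite (kk' _ _ s0) muleCA -EFinM -expRD.
  rewrite -[leLHS]mule1; apply: lee_wpmul2l => //; rewrite lee_fin -[leLHS]expR0 ler_expR.
  by rewrite subr_ge0 ler_piMr.
Qed.

Lemma green_shift x : (green_fk P X q (cst 1%E) x <=
  ((1 + K^-1) * expR delta)%:E * green_fk P X q' (cst 1%E) x)%E.
Proof.
have c0 : 0 <= (1 + K^-1) * expR delta by rewrite mulr_ge0 ?expR_ge0// addr_ge0// invr_ge0 ltW.
have mi := @measurable_integral_section R _ _ Omega (measurableTypeR R) leb `[0, +oo[ _ (measurable_itv _) (mk x) (fun z => k0 _ _ _).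
have mi' := @measurable_integral_section R _ _ Omega (measurableTypeR R) leb `[0, +oo[ _ (measurable_itv _) (mk' x) (fun z => k0' _ _ _).
have i0 w : (0 <= \int[leb]_(s in `[0%R, +oo[) k s x w)%E by apply: integral_ge0 => s _; exact: k0.
have i0' w : (0 <= \int[leb]_(s in `[0%R, +oo[) k' s x w)%E by apply: integral_ge0 => s _; exact: k0'.
rewrite !green1; apply: (ae_integral_le_scale c0 mi mi' i0 i0').
by apply: filterS (qloc x) => w hw; exact: path_bound.
Qed.

End green_shift.

Section eigen_compare.
Context (R : realType) (d : nat) (disp : measure_display)
  (Omega : measurableType disp) (P : probability Omega R)
  (X : R -> Omega -> 'rV[R]_d).
Hypothesis hX : levy_process P X.
Local Notation E := 'rV[R]_d.
Local Notation leb := (@lebesgue_measure R).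
Variables (p : R -> E -> R) (V : E -> R).
Hypotheses (hp : transition_density P X p) (hV : kato_potential P X V).
Variables (rad Lam K lam : R).
Hypotheses (K0 : 0 < K) (Lam1 : 1 <= Lam) (lamL : 2 * lam <= Lam) (lamL' : - (2 * lam) <= Lam)
  (KL : K + lam <= Lam) (Vout : forall y, rad <= enorm y -> K <= V y - lam).

Let mV : measurable_fun setT V. Proof. by case: hV. Qed.

(** Inside the ball [V + 2 |V| >= |V|], whatever the sign of [V], and [Lam] absorbs the eigenvalue
    and [K]. The eigenvalue does not occur, so that the same [U] serves for the eigenfunction and
    for the ground state. *)
Definition ball_rate (y : E) : R := (2 * `|V y| + Lam) * \1_(eball 0 rad) y.
Definition total_rate (y : E) : R := V y - lam + ball_rate y.
Local Notation U := ball_rate.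
Local Notation q := total_rate.
Local Notation a := (weight_pos V lam).
Local Notation b := (weight_neg V lam).

Let inP (y : E) : (enorm y < rad /\ \1_(eball 0 rad) y = 1 :> R) \/ (rad <= enorm y /\ \1_(eball 0 rad) y = 0 :> R).
Proof.
rewrite indicE; have [yr|yr] := ltP (enorm y) rad; [left|right]; split => //.
  by rewrite mem_set//= /eball/= subr0.
by rewrite memNset//= /eball/= subr0 => /(le_lt_trans yr); rewrite ltxx.
Qed.

Lemma measurable_ball_rate : measurable_fun setT U.
Proof.
apply: measurable_funM; last by apply: measurable_indic; exact: measurable_eball.
apply: measurable_funD => //; apply: measurable_funM => //.
exact: (measurableT_comp (@normr_measurable R setT) mV).
Qed.

Lemma measurable_total_rate : measurable_fun setT q.
Proof.
apply: measurable_funD; last exact: measurable_ball_rate.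
exact: (measurable_funB mV (measurable_cst lam)).
Qed.

Lemma ball_rate_ge0 y : 0 <= U y.
Proof.
by rewrite /U; case: (inP y) => -[_ ->]; rewrite ?mulr0// mulr1; have [h|h] := leP 0 (V y); rewrite ?(ger0_norm h) ?(ltr0_norm h); move: Lam1 lamL lamL' KL K0; lra.
Qed.


Lemma total_rate_ge y : K <= q y.
Proof.

rewrite /q /U; case: (inP y) => -[yr ->]; rewrite ?mulr0 ?mulr1; last by have := Vout yr; lra.
have [h|h] := leP 0 (V y); rewrite ?(ger0_norm h) ?(ltr0_norm h); move: Lam1 lamL lamL' KL K0; lra.
Qed.

Lemma ball_rate_le y : U y <= 2 * (q y * \1_(eball 0 rad) y).
Proof.

by rewrite /q /U; case: (inP y) => -[yr ->]; rewrite ?mulr0 ?mulr1; have [h|h] := leP 0 (V y); rewrite ?(ger0_norm h) ?(ltr0_norm h); move: Lam1 lamL lamL' KL K0; lra.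
Qed.

(** In the ball, [q + 1 <= 3 |V| + Lam - lam + 1], where [- lam <= Lam / 2] and [1 <= Lam]: this is
    the origin of 5/2. The condition on [rad] puts the unit ball inside. *)
Lemma total_rate_le y : 1 <= rad -> (q y + 1) * \1_(eball 0 1) y <= 5 / 2 * U y.
Proof.
move=> r1; 
rewrite [\1_(eball 0 1) y]indicE; have [/set_mem|_] := boolP (y \in eball 0 1); last first.
  by rewrite mulr0 mulr_ge0// ball_rate_ge0.
rewrite /eball/= subr0 mulr1 => y1.
rewrite /q /U; case: (inP y) => -[yr ->]; rewrite ?mulr0 ?mulr1; first by have [h|h] := leP 0 (V y); rewrite ?(ger0_norm h) ?(ltr0_norm h); move: Lam1 lamL lamL' KL K0; lra.
by move: (lt_le_trans y1 (le_trans r1 yr)); rewrite ltxx.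
Qed.

Let qabU y : q y + b y = a y + U y.
Proof. by have := weight_posB V lam y; rewrite /q; lra. Qed.

Let locU : locally_killed P X U.
Proof.
apply: (dominated_locally_killed hX hV (c1 := 2) (c := Lam) measurable_ball_rate ball_rate_ge0) => //.
  by apply: le_trans Lam1.
move=> y; by rewrite /U; case: (inP y) => -[yr ->]; rewrite ?mulr0 ?mulr1; have [h|h] := leP 0 (V y); rewrite ?(ger0_norm h) ?(ltr0_norm h); move: Lam1 lamL lamL' KL K0; lra.
Qed.

Let q0 y : 0 <= q y. Proof. exact: le_trans (ltW K0) (total_rate_ge y). Qed.

Lemma total_rate_locally_killed : locally_killed P X q.
Proof.
apply: (dominated_locally_killed hX hV (c1 := 3) (c := 2 * Lam) measurable_total_rate q0) => //.
  by rewrite mulr_ge0//; apply: le_trans Lam1.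
move=> y; 
by rewrite /q /U; case: (inP y) => -[yr ->]; rewrite ?mulr0 ?mulr1; have [h|h] := leP 0 (V y); rewrite ?(ger0_norm h) ?(ltr0_norm h); move: Lam1 lamL lamL' KL K0; lra.
Qed.

Let loca : locally_killed P X a.
Proof.
apply: (dominated_locally_killed hX hV (c1 := 1) (c := Lam) (measurable_weight_pos hV lam) (weight_pos_ge0 V lam)) => //.
  by apply: le_trans Lam1.
move=> y; 
rewrite /weight_pos /funrpos mul1r; apply: lerD; rewrite ge_max; apply/andP; split => //; have [h|h] := leP 0 (V y); rewrite ?(ger0_norm h) ?(ltr0_norm h); move: Lam1 lamL lamL' KL K0; lra.
Qed.

Let locb : locally_killed P X b.
Proof.
apply: (dominated_locally_killed hX hV (c1 := 1) (c := Lam) (measurable_weight_neg hV lam) (weight_neg_ge0 V lam)) => //.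
  by apply: le_trans Lam1.
move=> y; 
rewrite /weight_neg /funrneg mul1r; apply: lerD; rewrite ge_max; apply/andP; split => //; have [h|h] := leP 0 (V y); rewrite ?(ger0_norm h) ?(ltr0_norm h); move: Lam1 lamL lamL' KL K0; lra.
Qed.

Let mUe : measurable_fun setT (EFin \o U). Proof. by apply/measurable_EFinP; exact: measurable_ball_rate. Qed.

Lemma green_ball_rate_fin x : green_fk P X q (EFin \o U) x \is a fin_num.
Proof.
have mq := measurable_total_rate; have qK := total_rate_ge.
have mqe : measurable_fun setT (EFin \o q) by exact/measurable_EFinP.
rewrite ge0_fin_numE; last by apply: green_fk_ge0 => y; rewrite lee_fin ball_rate_ge0.
apply: (@le_lt_trans _ _ (2%:E * green_fk P X q (EFin \o q) x)%E).
  rewrite -(@green_fkZ _ _ _ _ P X hX q K mq K0 qK 2 _ x (ler0n _ 2) mqe (fun y => q0 y)).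
  apply: (@le_green_fk _ _ _ _ P X q) => y; first by rewrite lee_fin ball_rate_ge0.
  rewrite -EFinM lee_fin; apply: le_trans (ball_rate_le y) _; rewrite ler_pM2l//.
  by case: (inP y) => -[_ ->]; rewrite ?mulr1// mulr0.
apply: (@le_lt_trans _ _ (2%:E * 1%:E)%E); last exact: ltry.
apply: lee_wpmul2l => //; exact: (@green_q_le1 _ _ _ _ P X hX q K mq K0 qK total_rate_locally_killed x).
Qed.

(** [eigen_upper] at the times [n + 1], where the finite term in [psi2] cancels and the term
    [M exp (- K t)] tends to 0. *)
Let duhamel_upper (f : E -> R) (psi1 psi2 : E -> \bar R) (M : R) :
  measurable_fun setT psi1 -> measurable_fun setT psi2 -> (forall y, 0 <= psi1 y)%E -> (forall y, 0 <= psi2 y)%E ->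
  (forall y, psi1 y <= M%:E)%E -> (forall y, psi2 y <= M%:E)%E -> (forall y, f y <= M) -> 0 <= M ->
  (forall t, 0 < t -> {ae lebesgue_rV R d, forall y, (fk P X a b t psi1 y = (f y)%:E + fk P X a b t psi2 y)%E}) ->
  {ae lebesgue_rV R d, forall x, ((f x)%:E <= M%:E * green_fk P X q (EFin \o U) x)%E}.
Proof.
move=> m1 m2 p10 p20 p1M p2M fM M0 h.
have hr r : 0 < r -> {ae lebesgue_rV R d, forall y, (fk P X a b r psi1 y <= M%:E + fk P X a b r psi2 y)%E}.
  by move=> r0; apply: filterS (h r r0) => y ->; apply: leeD2r; rewrite lee_fin.
apply: filterS (ae_foralln (fun n : nat => h n.+1%:R (ltr0Sn _ _))) => x hx.
have G0 : (0 <= green_fk P X q (EFin \o U) x)%E by apply: green_fk_ge0 => y; rewrite lee_fin ball_rate_ge0.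
have bnd (n : nat) : ((f x)%:E <= (M * expR (- (K * n.+1%:R)))%:E + M%:E * green_fk P X q (EFin \o U) x)%E.
  have := @eigen_upper _ _ _ _ P X hX a b U q K (measurable_weight_pos hV lam) (measurable_weight_neg hV lam)
    measurable_ball_rate measurable_total_rate (weight_pos_ge0 V lam) (weight_neg_ge0 V lam) ball_rate_ge0 K0 total_rate_ge
    qabU loca locb locU x p n.+1%:R psi1 psi2 M hp (ltr0Sn _ _) M0 m1 m2 p10 p20 p1M hr.
  rewrite hx leeD2rE//; exact: (fk_bounded hX hV lam (ler0n R n.+1) x m2 p20 p2M).
move: bnd; rewrite -(fineK (green_ball_rate_fin x)); move: (fine _) => g bnd.
rewrite -EFinM lee_fin leNgt; apply/negP => fg; pose e := f x - M * g.
have e0 : 0 < e by rewrite subr_gt0.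
(* With [n + 1 > M / (K e)] the bound [expR u >= 1 + u] gives [M * expR (- K (n + 1)) < e]. *)
pose n := Num.truncn (M / (K * e)).
have := bnd n; rewrite -EFinM -EFinD lee_fin -lerBlDr leNgt => /negP; apply.
have nK : M / (K * e) < n.+1%:R by exact: truncnS_gt.
rewrite ltr_pdivrMr ?mulr_gt0// in nK.
have h1 := expR_ge1Dx (K * n.+1%:R); rewrite expRN -/e.
have Kn : 0 < K * n.+1%:R by rewrite mulr_gt0.
rewrite ltr_pdivrMr ?expR_gt0//; apply: lt_le_trans nK _; rewrite mulrA [_ * K]mulrC [leLHS]mulrC.
by rewrite ler_pM2l//; apply: le_trans h1; rewrite lerDr.
Qed.

Section eigenfunction.
Variables (f : E -> R) (M : R).
Hypotheses (mf : measurable_fun setT f) (fM : forall y, `|f y| <= M)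
  (feq : forall t, 0 < t -> {ae lebesgue_rV R d, forall x, feynman_kac P X V t f x = expR (- (lam * t)) * f x}).

Let mfp : measurable_fun setT (EFin \o f^\+%R). Proof. by apply/measurable_EFinP; exact: measurable_funrpos. Qed.
Let mfn : measurable_fun setT (EFin \o f^\-%R). Proof. by apply/measurable_EFinP; exact: measurable_funrneg. Qed.
Let fp0 y : 0 <= f^\+%R y. Proof. by rewrite /funrpos le_max lexx orbT. Qed.
Let fn0 y : 0 <= f^\-%R y. Proof. by rewrite /funrneg le_max lexx orbT. Qed.
Let M0 : 0 <= M. Proof. exact: le_trans (normr_ge0 _) (fM 0). Qed.
Let fpM y : f^\+%R y <= M. Proof. by rewrite /funrpos ge_max M0 andbT (le_trans (ler_norm _)). Qed.
Let fnM y : f^\-%R y <= M. Proof. by rewrite /funrneg ge_max M0 andbT (le_trans (ler_norm _))// normrN. Qed.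

Let fk_eq t : 0 < t -> {ae lebesgue_rV R d, forall y,
  (fk P X a b t (EFin \o f^\+%R) y = (f y)%:E + fk P X a b t (EFin \o f^\-%R) y)%E}.
Proof.
move=> t0; apply: filterS (feq t0) => y hy.
rewrite (feynman_kac_fk hX hV lam (ltW t0) y mf fM) hy; congr (_%:E + _)%E.
by rewrite mulrA -expRD subrr expR0 mul1r.
Qed.

(** The one-sided bound is applied to [f] and to [- f], the latter by exchanging the positive and
    negative parts. *)
Lemma eigenfunction_upper :
  {ae lebesgue_rV R d, forall x, (`|f x|%:E <= M%:E * green_fk P X q (EFin \o U) x)%E}.
Proof.
have fM1 y : f y <= M by exact: le_trans (ler_norm _) (fM y).
have fM2 y : - f y <= M by apply: le_trans (ler_norm _) _; rewrite normrN.
have u1 := duhamel_upper mfp mfn fp0 fn0 fpM fnM fM1 M0 fk_eq.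
have fk_eq2 t : 0 < t -> {ae lebesgue_rV R d, forall y,
    (fk P X a b t (EFin \o f^\-%R) y = (- f y)%:E + fk P X a b t (EFin \o f^\+%R) y)%E}.
  move=> t0; apply: filterS (fk_eq t0) => y ->.
  have := fk_bounded hX hV lam (ltW t0) y mfn fn0 fnM.
  by case: (fk _ _ _ _ _ _ _) => // r _; rewrite -!EFinD; congr EFin; rewrite addrA addNr add0r.
have u2 := duhamel_upper mfn mfp fn0 fp0 fnM fpM fM2 M0 fk_eq2.
apply: filterS2 u1 u2 => x h1 h2.
by have [h|h] := leP 0 (f x); [rewrite ger0_norm|rewrite ltr0_norm].
Qed.

Lemma eigenfunction_lower (c : R) : 0 <= c -> (forall y, 0 <= f y) -> (forall y, enorm y <= rad -> c <= f y) ->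
  {ae lebesgue_rV R d, forall x, (c%:E * green_fk P X q (EFin \o U) x <= (f x)%:E)%E}.
Proof.
move=> c0 f0 fc.
have fpE : (EFin \o f^\+%R) = EFin \o f by apply/funext => y /=; rewrite /funrpos max_l.
have fk0 t y : 0 < t -> fk P X a b t (EFin \o f^\-%R) y = 0%E.
  move=> t0; rewrite /fk; under eq_integral do rewrite /= /funrneg max_r ?oppr_le0// mule0.
  exact: integral0.
have fkE t : 0 < t -> {ae lebesgue_rV R d, forall y, fk P X a b t (EFin \o f) y = (f y)%:E}.
  move=> t0; apply: filterS (fk_eq t0) => y; rewrite fpE => ->; rewrite fk0// adde0//.
have mfe : measurable_fun setT (EFin \o f) by exact/measurable_EFinP.
have h r : 0 < r -> {ae lebesgue_rV R d, forall y, U y != 0 -> (c%:E <= fk P X a b r (EFin \o f) y)%E}.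
  move=> r0; apply: filterS (fkE r r0) => y -> Uy; rewrite lee_fin; apply: fc.
  by move: Uy; rewrite /U; case: (inP y) => -[yr ->]; [rewrite ltW|rewrite mulr0 eqxx].
apply: filterS (ae_foralln (fun n : nat => fkE n.+1%:R (ltr0Sn _ _))) => x hx.
exact: (@eigen_lower _ _ _ _ P X hX a b U q K (measurable_weight_pos hV lam) (measurable_weight_neg hV lam)
    measurable_ball_rate measurable_total_rate (weight_pos_ge0 V lam) (weight_neg_ge0 V lam) ball_rate_ge0 K0 total_rate_ge
    qabU loca locb locU x p (EFin \o f) c (f x)%:E hp c0 mfe (fun y => f0 y) h
    (fun n => ltac:(by rewrite hx))).
Qed.

End eigenfunction.
End eigen_compare.

(* From the bounds |phi_n| <= M G_n U, G_n U <= C nu G_n 1, G_n 1 <= C G_0 1,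
   nu G_0 1 <= C G_0 U and c G_0 U <= phi_0 at points far from the origin. *)
Theorem eigenfunction_le_ground (R : realType) (d : nat) (d0 : (0 < d)%N) (disp : measure_display)
    (Omega : measurableType disp) (P : probability Omega R) (X : R -> Omega -> 'rV[R]_d)
    (hX : regular_jump_levy_process P X) (V : 'rV[R]_d -> R) (hV : kato_potential P X V)
    (Vconf : confining V) (lambda : nat -> R) (phi : nat -> 'rV[R]_d -> R)
    (hphi : eigensystem P X V lambda phi) (n : nat) :
  exists2 C : R, 0 < C & forall x, `|phi n x| <= C * phi 0%N x.
Proof.
case: hX => hL [symX [nu hnu [A11 [C2 C21 A12] [C3 C31 A13]]]] [p hp _] _.
have [C1 C11 {}A11] := A11 (1 / 2) ltac:(by rewrite lexx andbT).
have [C0 C00 upper] := levy_upper_ball hL d0 hnu C11 C21 C31 A11 A12 A13 symX.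
have [Cl Cl0 lower] := levy_lower hL d0 hnu C11 C21 A11 A12 symX.
have nu0 x : 1 / 2 <= enorm x -> 0 < nu x.
  case: hnu => _ h _ hx; apply: h; apply: contraPN hx => /eqP ->.
  by rewrite enorm0; apply/negP; rewrite -ltNge.
have [basis heig gap lmono _ bounded cphi phi0] := hphi.
have mphi m : measurable_fun setT (phi m) by case: basis => /(_ m) [].
(* [K] is above the thresholds of both comparisons and is fixed before the radius of the ball, which
   depends on it. *)
pose K := C0 + Cl + 1; have K0 : 0 < K by rewrite !addr_gt0.
have C0K : C0 <= K by rewrite /K -addrA lerDl addr_ge0// ltW.
have ClK : Cl <= K by rewrite /K addrAC lerDr addr_ge0// ltW.
pose lam := lambda n; pose lam0 := lambda 0%N; pose delta := lam - lam0.
have delta0 : 0 <= delta.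
  rewrite subr_ge0 /lam /lam0; have h m : lambda 0%N <= lambda m.+1.
    elim: m => [|m IH]; first exact: ltW.
    by apply: le_trans IH _; exact: lmono.
  by case: (n) => [|m].
have [r hr] := Vconf (lam + K).
pose rad := Num.max r 0 + 1.
have rad1 : 1 <= rad by rewrite lerDr le_max lexx orbT.
have outn y : rad <= enorm y -> K <= V y - lam.
  move=> yr; have : r < enorm y.
    by apply: lt_le_trans yr; rewrite /rad ltr_pwDr// le_max lexx.
  by move/hr; lra.
have out0 y : rad <= enorm y -> K <= V y - lam0.
  by move=> yr; have := outn y yr; move: delta0; rewrite /delta; lra.
pose Lam := 1 + K + 2 * `|lam| + 2 * `|lam0|.
have l1 := normr_ge0 lam; have l2 := normr_ge0 lam0.
have l3 := ler_norm lam; have l4 := ler_norm lam0.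
have l5 : - lam <= `|lam| by rewrite -normrN ler_norm.
have l6 : - lam0 <= `|lam0| by rewrite -normrN ler_norm.
have Lam1 : 1 <= Lam by rewrite /Lam; lra.
have a1 : 2 * lam <= Lam by rewrite /Lam; lra.
have a2 : - (2 * lam) <= Lam by rewrite /Lam; lra.
have a3 : K + lam <= Lam by rewrite /Lam; lra.
have b1 : 2 * lam0 <= Lam by rewrite /Lam; lra.
have b2 : - (2 * lam0) <= Lam by rewrite /Lam; lra.
have b3 : K + lam0 <= Lam by rewrite /Lam; lra.
pose U := ball_rate V rad Lam.
pose qn := total_rate V rad Lam lam; pose q0 := total_rate V rad Lam lam0.
have mqn : measurable_fun setT qn := measurable_total_rate hV rad Lam lam.
have mq0 : measurable_fun setT q0 := measurable_total_rate hV rad Lam lam0.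
have qnK y : K <= qn y by exact: total_rate_ge.
have q0K y : K <= q0 y by exact: total_rate_ge.
have qnloc : locally_killed P X qn.
  exact: (total_rate_locally_killed hL hV K0 Lam1 a1 a2 a3 outn).
have q0loc : locally_killed P X q0.
  exact: (total_rate_locally_killed hL hV K0 Lam1 b1 b2 b3 out0).
have qE y : q0 y = qn y + delta by rewrite /q0 /qn /total_rate /delta; ring.
have U0 y : 0 <= U y := @ball_rate_ge0 _ _ V rad Lam K lam K0 Lam1 a1 a2 a3 y.
have mU : measurable_fun setT U := measurable_ball_rate hV rad Lam.
have qn0 y : 0 <= qn y by exact: le_trans (ltW K0) (qnK y).
have q00 y : 0 <= q0 y by exact: le_trans (ltW K0) (q0K y).
have [M0 hM0] := bounded n; pose M := Num.max M0 1.
have hM y : `|phi n y| <= M by rewrite le_max hM0.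
have M1 : 0 < M by rewrite lt_max ltr01 orbT.
have [c c0 hc] := continuous_pos_lower rad (cphi 0%N) phi0.
(* Within radius [rad + 3] compactness and the bound [M] suffice. Beyond it, both [enorm x >= 3] and
   distance at least 1/2 from the ball are available. *)
have [c' c'0 hc'] := continuous_pos_lower (rad + 3) (cphi 0%N) phi0.
have [Cu Cu0 hCu] := upper rad.
pose Cs := (1 + K^-1) * expR delta.
have Cs0 : 0 < Cs by rewrite mulr_gt0 ?expR_gt0// addr_gt0// invr_gt0.
pose B := M * 2 * Cu * Cs * Cl * (5 / 2).
have cc : 0 < M * 2 * Cu * Cs by apply: mulr_gt0 Cs0; apply: mulr_gt0 Cu0; exact: mulr_gt0.
have B0 : 0 < B by apply: mulr_gt0; [exact: mulr_gt0 cc Cl0|rewrite divr_gt0].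
exists (B * c^-1 + M * c'^-1).
  by rewrite addr_gt0// mulr_gt0 ?invr_gt0.
have phi00 y : 0 <= phi 0%N y by exact: ltW.
(* The Duhamel bounds hold almost everywhere; continuity of both eigenfunctions extends the
   comparison to every point. *)
apply: ae_continuous_le.
- move=> x; apply: (@continuous_comp _ _ _ (phi n) Num.norm); [exact: cphi|exact: norm_continuous].
- by move=> x; apply: (@continuousM R 'rV[R]_d (fun=> _) (phi 0%N)); [exact: cst_continuous|exact: cphi].
have up := eigenfunction_upper hL hp hV K0 Lam1 a1 a2 a3 outn (mphi n) hM (fun t t0 => heig n t t0).
have f0M : exists M', forall x, `|phi 0%N x| <= M' by exact: bounded.
have [M' hM'] := f0M.
have low := eigenfunction_lower hL hp hV K0 Lam1 b1 b2 b3 out0 (mphi 0%N) hM' (fun t t0 => heig 0%N t t0) (ltW c0) phi00 hc.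
apply: filterS2 up low => x hup hlow.
have [xr|xr] := leP (enorm x) (rad + 3).
  apply: (@le_trans _ _ (M * c'^-1 * phi 0%N x)); last first.
    by rewrite ler_wpM2r// lerDr mulr_ge0 ?invr_ge0// ltW.
  rewrite -mulrA; apply: le_trans (hM x) _; rewrite ler_peMr ?(ltW M1)//.
  by rewrite ler_pdivlMl// mulr1; exact: hc'.
have x12 : 1 / 2 <= enorm x by lra.
have xrad : rad + 1 / 2 <= enorm x by lra.
have x3 : 3 <= enorm x by lra.
have nx := nu0 x x12.
have miB : measurable_fun setT (\1_(eball 0 rad) : 'rV[R]_d -> R).
  by apply: measurable_indic; exact: measurable_eball.
have s2 : (green_fk P X qn (EFin \o U) x <= 2%:E * green_fk P X qn (fun y => (qn y * \1_(eball 0 rad) y)%:E) x)%E.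
  have mm : measurable_fun setT (fun y => (qn y * \1_(eball 0 rad) y)%:E : \bar R).
    by apply/measurable_EFinP; exact: measurable_funM.
  have m0 y : (0 <= (qn y * \1_(eball 0 rad) y)%:E)%E by rewrite lee_fin mulr_ge0.
  rewrite -(@green_fkZ _ _ _ _ P X hL qn K mqn K0 qnK 2 _ x (ler0n _ 2) mm m0).
  apply: (@le_green_fk _ _ _ _ P X qn) => y; first by rewrite lee_fin.
  by rewrite -EFinM lee_fin; exact: (@ball_rate_le _ _ V rad Lam K lam K0 Lam1 a1 a2 a3 y).
have s3 := hCu qn K mqn C0K qnK qnloc x xrad x12.
have s4 := green_shift hL mqn mq0 K0 qnK delta0 qE qnloc x; rewrite -/Cs in s4.
have s5 := lower q0 K mq0 ClK q0K q0loc x x3.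
have s6 : (green_fk P X q0 (fun y => ((q0 y + 1) * \1_(eball 0 1) y)%:E) x <= (5 / 2)%:E * green_fk P X q0 (EFin \o U) x)%E.
  have mUe : measurable_fun setT (EFin \o U) by exact/measurable_EFinP.
  have h52 : 0 <= 5 / 2 :> R by rewrite divr_ge0.
  rewrite -(@green_fkZ _ _ _ _ P X hL q0 K mq0 K0 q0K (5 / 2) _ x h52 mUe (fun y => U0 y)).
  apply: (@le_green_fk _ _ _ _ P X q0) => y; first by rewrite lee_fin mulr_ge0// addr_ge0.
  by rewrite -EFinM lee_fin; exact: (@total_rate_le _ _ V rad Lam K lam0 K0 Lam1 b1 b2 b3 y rad1).
have pos (a : R) : 0 < a -> (0 <= a%:E)%E by move=> a0; rewrite lee_fin ltW.
have chain : (`|phi n x|%:E <= B%:E * green_fk P X q0 (EFin \o U) x)%E.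
  apply: le_trans hup _.
  apply: le_trans (lee_wpmul2l (pos _ M1) s2) _.
  apply: le_trans (lee_wpmul2l (pos _ M1) (lee_wpmul2l (pos 2 ltac:(by [])) s3)) _.
  apply: le_trans (lee_wpmul2l (pos _ M1) (lee_wpmul2l (pos 2 ltac:(by []))
    (lee_wpmul2l (pos _ (mulr_gt0 Cu0 nx)) s4))) _.
  have s56 := le_trans s5 (lee_wpmul2l (pos _ Cl0) s6).
  have := lee_wpmul2l (pos _ cc) s56.
  move: (green_fk P X q0 (cst 1%E) x) (green_fk P X q0 (EFin \o U) x) => g h.
  rewrite !muleA -!EFinM -/B => k; apply: le_trans k; rewrite le_eqVlt; apply/orP; left; apply/eqP.
  by congr (_%:E * _)%E; ring.
rewrite mulrDl ler_wpDr ?mulr_ge0 ?invr_ge0 ?(ltW M1) ?(ltW c'0)//.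
rewrite -lee_fin; apply: le_trans chain _.
have -> : (B * c^-1 * phi 0%N x)%:E = (B%:E * (c^-1%:E * (phi 0%N x)%:E))%E by rewrite -!EFinM mulrA.
apply: lee_wpmul2l; first exact: pos.
by rewrite lee_pdivlMl.
Qed.

(** * Uniformity over eigensystems *)

Section square_integrable.
Context (R : realType) (d : nat).
Local Notation E := 'rV[R]_d.
Local Notation leb := (lebesgue_rV R d).
Implicit Types f g h : E -> R.

Definition sqint f := (\int[leb]_x (f x ^+ 2)%:E)%E.

Lemma sqint_ge0 f : (0 <= sqint f)%E.
Proof. by apply: integral_ge0 => x _; rewrite lee_fin sqr_ge0. Qed.

Lemma Lnorm2_sqr f : (Lnorm leb 2%:E (EFin \o f) `^ 2 = sqint f)%E.
Proof.
rewrite poweR_Lnorm//; apply: eq_integral => x _ /=.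
by rewrite (powR_mulrn 2)// -normrX ger0_norm// sqr_ge0.
Qed.

Lemma L2_sqint f : L2 f -> (sqint f < +oo)%E.
Proof.
move=> [_ h]; rewrite -Lnorm2_sqr; move: h (@Lnorm_ge0 _ _ _ leb 2%:E (EFin \o f)).
by case: (Lnorm _ _ _) => // r _ _; rewrite poweR_EFin ltry.
Qed.

Lemma Lnorm2_cvg0 (r : nat -> E -> R) : Lnorm leb 2%:E (EFin \o r n) @[n --> \oo] --> 0%E ->
  forall e, 0 < e -> exists N : nat, forall n, (N <= n)%N -> (sqint (r n) <= e%:E)%E.
Proof.
move=> h e e0; pose dl := Num.min 1 e; have dl0 : 0 < dl by rewrite lt_min ltr01.
have /h[N _ hN] : nbhs 0%E [set z : \bar R | (z < dl%:E)%E].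
  by apply: open_nbhs_nbhs; split; [exact: open_ereal_lt_ereal|rewrite /= lte_fin].
exists N => n Nn; have := hN n Nn; rewrite /= -Lnorm2_sqr.
have := @Lnorm_ge0 _ _ _ leb 2%:E (EFin \o r n).
case: (Lnorm _ _ _) => // s; rewrite lee_fin lte_fin => s0 sd; rewrite poweR_EFin lee_fin powR_mulrn//.
have : dl <= 1 by rewrite ge_min lexx.
have : dl <= e by rewrite ge_min lexx orbT.
have : s ^+ 2 <= s * dl by rewrite expr2 ler_wpM2l// ltW.
have : s * dl <= dl * dl by rewrite ler_wpM2r// ltW.
move=> h1 h2 h3 h4; have : dl * dl <= dl * 1 by rewrite ler_wpM2l// ltW.
lra.
Qed.

Lemma mul_integrable f g : measurable_fun setT f -> measurable_fun setT g ->
  (sqint f < +oo)%E -> (sqint g < +oo)%E -> leb.-integrable setT (EFin \o (fun x => f x * g x)).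
Proof.
move=> mf mg sf sg.
have m2 (u : E -> R) : measurable_fun setT u -> measurable_fun setT (fun x => (u x ^+ 2)%:E).
  by move=> mu; apply/measurable_EFinP; exact: measurable_funX.
apply/integrableP; split; first by apply/measurable_EFinP; exact: measurable_funM.
apply: (@le_lt_trans _ _ (sqint f + sqint g)%E); last exact: lte_add_pinfty.
rewrite /sqint -ge0_integralD//.
- apply: ge0_le_integral_nomeas => x; first exact: abse_ge0.
  rewrite /= lee_fin normrM -[f x ^+ 2]real_normK ?num_real// -[g x ^+ 2]real_normK ?num_real//.
  by have := sqr_ge0 (`|f x| - `|g x|); have := sqr_ge0 `|f x|; have := sqr_ge0 `|g x|; rewrite sqrrB; lra.
- by move=> x _; rewrite lee_fin sqr_ge0.
- exact: m2.
- by move=> x _; rewrite lee_fin sqr_ge0.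
- exact: m2.
Qed.

Lemma sqint_lin f g (a : R) : measurable_fun setT f -> measurable_fun setT g ->
  (sqint f < +oo)%E -> (sqint g < +oo)%E -> (sqint (fun x => f x + a * g x)%R < +oo)%E.
Proof.
move=> mf mg sf sg.
have m2 (u : E -> R) : measurable_fun setT u -> measurable_fun setT (fun x => (u x ^+ 2)%:E).
  by move=> mu; apply/measurable_EFinP; exact: measurable_funX.
have a2 : 0 <= 2 * a ^+ 2 by rewrite mulr_ge0// sqr_ge0.
apply: (@le_lt_trans _ _ (2%:E * sqint f + (2 * a ^+ 2)%:E * sqint g)%E); last first.
  by apply: lte_add_pinfty; rewrite lte_mul_pinfty// lee_fin.
rewrite /sqint -ge0_integralZl//; last 2 first.
- exact: m2.
- by move=> x _; rewrite lee_fin sqr_ge0.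
rewrite -ge0_integralZl//; last 2 first.
- exact: m2.
- by move=> x _; rewrite lee_fin sqr_ge0.
rewrite -ge0_integralD//.
- apply: ge0_le_integral_nomeas => x; first by rewrite lee_fin sqr_ge0.
  rewrite -!EFinM -EFinD lee_fin; have := sqr_ge0 (f x - a * g x).
  by rewrite sqrrB sqrrD exprMn; lra.
- by move=> x _; rewrite mule_ge0 ?lee_fin ?sqr_ge0.
- by apply: measurable_funeM; exact: m2.
- by move=> x _; rewrite mule_ge0 ?lee_fin ?sqr_ge0.
- by apply: measurable_funeM; exact: m2.
Qed.

Lemma L2_inner_lin f g h (a : R) : measurable_fun setT f -> measurable_fun setT g -> measurable_fun setT h ->
  (sqint f < +oo)%E -> (sqint g < +oo)%E -> (sqint h < +oo)%E ->
  L2_inner (fun x => f x + a * g x) h = L2_inner f h + a * L2_inner g h.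
Proof.
move=> mf mg mh sf sg sh; rewrite /L2_inner.
have i1 := mul_integrable mf mh sf sh; have i2 := mul_integrable mg mh sg sh.
rewrite -RintegralZl//.
have i3 : leb.-integrable setT (EFin \o (fun x => a * (g x * h x))).
  by have := integrableZl measurableT a i2.
rewrite -RintegralD//; apply: eq_Rintegral => x _; ring.
Qed.

Lemma L2_inner_le f g : measurable_fun setT f -> measurable_fun setT g ->
  (`|L2_inner f g|%:E <= \int[leb]_x (`|f x * g x|)%:E)%E.
Proof.
move=> mf mg; rewrite /L2_inner /Rintegral.
have mfg : measurable_fun setT (fun x => (f x * g x)%:E) by apply/measurable_EFinP; exact: measurable_funM.
apply: le_trans (le_abse_integral leb measurableT mfg).
by case: (integral _ _ _) => [r| |] //=; rewrite ?normr0 leey.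
Qed.

Section orthonormal.
Variable phi : nat -> E -> R.
Hypothesis basis : L2_orthonormal_basis phi.

Let mphi k : measurable_fun setT (phi k). Proof. by case: basis => /(_ k) []. Qed.
Let sphi k : (sqint (phi k) < +oo)%E. Proof. by apply: L2_sqint; case: basis. Qed.

Lemma sqint_basis k : sqint (phi k) = 1%E.
Proof.
have : L2_inner (phi k) (phi k) = 1 by case: basis => _ -> _; rewrite eqxx.
rewrite /L2_inner /Rintegral.
have -> : (\int[leb]_x (phi k x * phi k x)%:E = sqint (phi k))%E by apply: eq_integral => x _; rewrite expr2.
have := sphi k; have := sqint_ge0 (phi k); case: (sqint _) => // r _ _ /= ->.
by [].
Qed.

Lemma L2_inner_sum f (a : nat -> R) N m : measurable_fun setT f -> (sqint f < +oo)%E ->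
  [/\ measurable_fun setT (fun x => f x + \sum_(k < N) a k * phi k x),
     (sqint (fun x => f x + \sum_(k < N) a k * phi k x)%R < +oo)%E &
     L2_inner (fun x => f x + \sum_(k < N) a k * phi k x) (phi m) =
     L2_inner f (phi m) + (if (m < N)%N then a m else 0)].
Proof.
move=> mf sf; elim: N => [|N [IH1 IH2 IH3]].
  by under eq_fun do rewrite big_ord0 addr0; rewrite addr0; split.
have e : (fun x => f x + \sum_(k < N.+1) a k * phi k x) = (fun x => (f x + \sum_(k < N) a k * phi k x) + a N * phi N x).
  by apply/funext => x; rewrite big_ord_recr/= addrA.
rewrite e; split.
- by apply: measurable_funD => //; exact: measurable_funM.
- exact: sqint_lin.
- rewrite L2_inner_lin// IH3; case: basis => _ -> _; rewrite -addrA; congr (_ + _).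
  have [->|Nm] := eqVneq N m; first by rewrite ltnn ltnS leqnn add0r mulr1.
  by rewrite mulr0 addr0 ltnS [in LHS]ltn_neqAle eq_sym Nm.
Qed.

Lemma basis_remainder f : L2 f -> forall e, 0 < e -> exists N : nat, forall n, (N <= n)%N ->
  (sqint (fun x => f x + \sum_(k < n) - L2_inner f (phi k) * phi k x)%R <= e%:E)%E.
Proof.
move=> Lf; apply: Lnorm2_cvg0; case: basis => _ _ /(_ f Lf).
rewrite (_ : (fun n => Lnorm leb 2%:E (fun x => _)) = (fun n => Lnorm leb 2%:E (EFin \o (fun x : E => f x + \sum_(k < n) - L2_inner f (phi k) * phi k x))))//.
apply/funext => n; congr Lnorm; apply/funext => x /=; congr EFin; congr (_ + _).
by rewrite -sumrN; apply: eq_bigr => k _; rewrite mulNr.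
Qed.

(** The pointwise bound [|f g| <= (f ^+ 2 + g ^+ 2) / 2] is enough for unit vectors. *)
Lemma L2_inner_le1 f k : measurable_fun setT f -> sqint f = 1%E -> `|L2_inner f (phi k)| <= 1.
Proof.
move=> mf sf; rewrite -lee_fin; apply: le_trans (L2_inner_le mf (mphi k)) _.
have m2 (u : E -> R) : measurable_fun setT u -> measurable_fun setT (fun x => (2^-1)%:E * (u x ^+ 2)%:E)%E.
  by move=> mu; apply: measurable_funeM; apply/measurable_EFinP; exact: measurable_funX.
have z0 (u : E -> R) x : (0 <= (2^-1)%:E * (u x ^+ 2)%:E)%E by rewrite mule_ge0 ?lee_fin ?sqr_ge0.
have h (u : E -> R) : measurable_fun setT u -> sqint u = 1%E -> (\int[leb]_x ((2^-1)%:E * (u x ^+ 2)%:E) = (2^-1)%:E)%E.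
  move=> mu su; rewrite ge0_integralZl//; [by rewrite -/(sqint u) su mule1|by apply/measurable_EFinP; exact: measurable_funX|].
  by move=> x _; rewrite lee_fin sqr_ge0.
have -> : (1%:E = \int[leb]_x ((2^-1)%:E * (f x ^+ 2)%:E + (2^-1)%:E * (phi k x ^+ 2)%:E))%E.
  rewrite ge0_integralD//; [|exact: m2|exact: m2].
  by rewrite (h f mf sf) (h _ (mphi k) (sqint_basis k)) -EFinD; congr EFin; lra.
apply: ge0_le_integral_nomeas => x; first by rewrite lee_fin.
rewrite -!EFinM -EFinD lee_fin normrM -[f x ^+ 2]real_normK ?num_real// -[phi k x ^+ 2]real_normK ?num_real//.
by have := sqr_ge0 (`|f x| - `|phi k x|); rewrite sqrrB; lra.
Qed.

(** Beyond [N] the partial sums of the expansion no longer change, so the remainder has norm 0; it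
    vanishes almost everywhere, and everywhere by continuity. *)
Lemma basis_finite f N : continuous f -> (forall k, continuous (phi k)) -> L2 f ->
  (forall k, (N <= k)%N -> L2_inner f (phi k) = 0) ->
  forall x, f x = \sum_(k < N) L2_inner f (phi k) * phi k x.
Proof.
move=> cf cphi Lf h0.
pose s x := \sum_(k < N) L2_inner f (phi k) * phi k x.
have cs : continuous s.
  rewrite /s; elim: (N) => [|n IH] x.
    by under eq_fun do rewrite big_ord0; exact: cst_continuous.
  under eq_fun do rewrite big_ord_recr/=.
  apply: (@continuousD R R E (fun y => \sum_(k < n) L2_inner f (phi k) * phi k y) (fun y => L2_inner f (phi n) * phi n y) x); first exact: IH.
  by apply: (@continuousM R E (fun=> _) (phi n)); [exact: cst_continuous|exact: cphi].
have [mf _] := Lf; have sf := L2_sqint Lf.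
have [mr _ _] := L2_inner_sum (fun k => - L2_inner f (phi k)) N 0 mf sf.
set r := (fun x => f x + _) in mr.
have r0 : sqint r = 0%E.
  apply/eqP; rewrite eq_le sqint_ge0 andbT; apply/lee_addgt0Pr => e e0; rewrite add0e.
  have [N1 hN1] := basis_remainder Lf e0.
  apply: le_trans (hN1 (maxn N N1) (leq_maxr _ _)); rewrite le_eqVlt; apply/orP; left; apply/eqP.
  apply: eq_integral => x _; congr ((_ ^+ 2)%:E); rewrite /r; congr (_ + _).
  rewrite (big_ord_widen _ (fun k => - L2_inner f (phi k) * phi k x) (leq_maxl N N1)).
  rewrite big_mkcond/=; apply: eq_bigr => k _; case: ltnP => // Nk.
  by rewrite h0// oppr0 mul0r.
have aer : {ae leb, forall x, r x = 0}.
  have mr2 : measurable_fun setT (fun x => (r x ^+ 2)%:E) by apply/measurable_EFinP; exact: measurable_funX.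
  have /(ae_eq_integral_abs leb measurableT mr2) : (\int[leb]_x `|(r x ^+ 2)%:E| = 0)%E.
    by rewrite -[RHS]r0; apply: eq_integral => x _; rewrite gee0_abs// lee_fin sqr_ge0.
  by apply: filterS => x /(_ I) [] /eqP; rewrite sqrf_eq0 => /eqP.
have rE x : r x = f x - s x.
  by rewrite /r /s -sumrN; congr (_ + _); apply: eq_bigr => k _; rewrite mulNr.
move=> x; apply/eqP; rewrite eq_le; apply/andP; split.
- by apply: (ae_continuous_le cf cs _ x); apply: filterS aer => y; rewrite rE => /eqP; rewrite subr_eq0 => /eqP ->.
- by apply: (ae_continuous_le cs cf _ x); apply: filterS aer => y; rewrite rE => /eqP; rewrite subr_eq0 => /eqP ->.
Qed.

End orthonormal.
End square_integrable.

(** * The Feynman-Kac operator at time 1 on square-integrable functions *)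

Section semigroup_L2.
Context (R : realType) (d : nat) (disp : measure_display)
  (Omega : measurableType disp) (P : probability Omega R)
  (X : R -> Omega -> 'rV[R]_d).
Hypothesis hX : levy_process P X.
Local Notation E := 'rV[R]_d.
Local Notation leb := (lebesgue_rV R d).

Lemma kato_scale (c : R) (B : E -> R) : 0 <= c -> kato P X B -> kato P X (fun y => c * B y).
Proof.
move=> c0 [mB kB]; split; first exact: measurable_funM.
have hc := cvgeZl (y := c%:E) (isT : c%:E \is a fin_num) kB.
rewrite mule0 in hc; apply: cvg_trans hc; apply: near_eq_cvg.
near=> t.
have t0 : 0 <= t by [].
rewrite /= -ereal_supZl//; last by apply/set0P; exists (\int[P]_w \int[@lebesgue_measure R]_(s in `[0%R, t]) `|B (0 + X s w)%R|%:E)%E; exists 0.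
congr ereal_sup.
have e x : (\int[P]_w \int[@lebesgue_measure R]_(s in `[0%R, t]) `|c * B (x + X s w)|%:E =
    c%:E * \int[P]_w \int[@lebesgue_measure R]_(s in `[0%R, t]) `|B (x + X s w)|%:E)%E.
  have mnB : measurable_fun setT (fun y => (`|B y|)%:E) by apply/measurable_EFinP; exact: measurableT_comp.
  rewrite -ge0_integralZl//; last 2 first.
  - apply: (@measurable_levy_integral _ _ _ _ _ _ hX _ _ (fun=> 0) (fun=> t) (fun=> x) id (fun y => (`|B y|)%:E)) => //.
  - by move=> w _; apply: integral_ge0 => s _; rewrite lee_fin.
  apply: eq_integral => w _; rewrite -ge0_integralZl//.
  - by apply: eq_integral => s _; rewrite normrM ger0_norm.
  - apply/measurable_EFinP; exact: (@measurable_path _ _ _ _ P X hX x w t (fun y => `|B y|) (measurableT_comp (@normr_measurable R setT) mB)).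
apply/seteqP; split => u /=.
  by move=> [_ [x _ <-] <-]; exists x => //; exact: e.
by move=> [x _ <-]; eexists; [exists x; [by []|reflexivity]|exact: esym (e x)].
Unshelve. all: by end_near.
Qed.

Variable V : E -> R.
Hypothesis hV : kato_potential P X V.
Local Notation k := (fun x w => expR (- potential_integral X V 1 x w)).
Local Notation T := (feynman_kac P X V 1).

Let mX1 : measurable_fun setT (X 1). Proof. by case: hX => h _ _ _ _; exact: h. Qed.

Let mk x : measurable_fun setT (k x).
Proof.
apply: (measurableT_comp (@measurable_expR R)).
apply: (measurableT_comp (@oppr_measurable R setT)).
exact: (@measurable_potential_integral _ _ _ _ P X hX V hV).
Qed.

(** The squared weight is at most the exponential of the integral of twice the negative part of [V],
    which is again in the Kato class. *)
Lemma weight_second_moment : exists2 M, 0 < M & forall x, (\int[P]_w (k x w ^+ 2)%:E <= M%:E)%E.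
Proof.
have kn : kato P X V^\- by case: hV.
have n0 y : 0 <= 2 * V^\- y by rewrite mulr_ge0// Vneg_ge0.
have [M M0 hM] := @kato_expmoment _ _ _ _ P X hX _ (kato_scale (ler0n _ 2) kn) n0 1 ler01.
have mn : measurable_fun setT (fun y => 2 * V^\- y) by case: (kato_scale (ler0n _ 2) kn).
exists M => // x; apply: le_trans (hM x); rewrite /fk; under [leRHS]eq_integral do rewrite mule1.
apply: ae_ge0_le_integral => //.
- by apply/measurable_EFinP; apply: measurable_funX; exact: mk.
- by move=> w _; exact: fkw_ge0.
- exact: (@measurable_fkw _ _ _ _ _ _ hX _ _ (fun=> 0) (fun=> 1) (fun=> x) id (fun=> 0) (fun y => 2 * V^\- y)).
apply: filterS (ae_weight hX hV 0 ler01 x) => w; rewrite mul0r expR0 mul1r => hw _.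
have le1 : ((k x w)%:E <= expeR (\int[@lebesgue_measure R]_(u in `[0%R, 1%R]) (V^\- (x + X u w)%R)%:E))%E.
  rewrite -hw /fkw -[leRHS]mul1e; apply: lee_pmul; [exact: expeR_ge0|exact: expeR_ge0| |].
    rewrite -expeR0 lee_expeR oppe_le0; apply: integral_ge0 => u _.
    by rewrite lee_fin weight_pos_ge0.
  rewrite lee_expeR le_eqVlt; apply/orP; left; apply/eqP; apply: eq_integral => u _.
  by rewrite /weight_neg maxxx addr0.
have k0 : (0 <= (k x w)%:E)%E by rewrite lee_fin expR_ge0.
have := lee_pmul k0 k0 le1 le1; rewrite -EFinM -expr2 => h; apply: le_trans h _.
rewrite -expeRD /fkw integral0 oppe0 expeR0 mul1e lee_expeR.
have mv : measurable_fun (`[0, 1]%classic : set R) (fun u : R => (V^\- (x + X u w))%:E).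
  apply/measurable_EFinP; exact: (@measurable_path _ _ _ _ P X hX x w 1 V^\- (proj1 kn)).
rewrite -ge0_integralD//; last 2 first.
- by move=> u _; rewrite lee_fin Vneg_ge0.
- by move=> u _; rewrite lee_fin Vneg_ge0.
rewrite le_eqVlt; apply/orP; left; apply/eqP; apply: eq_integral => u _.
by rewrite -EFinD; congr EFin; ring.
Qed.

Let mfX (f : E -> R) x : measurable_fun setT f -> measurable_fun setT (fun w => f (x + X 1 w)).
Proof. by move=> mf; apply: (measurableT_comp mf); exact: measurable_funD_rV. Qed.

Lemma feynman_kac_integrable (f : E -> R) (M : R) x : measurable_fun setT f -> (forall y, `|f y| <= M) ->
  P.-integrable setT (EFin \o (fun w => k x w * f (x + X 1 w))).
Proof.
move=> mf fM; have [M2 M20 hM2] := weight_second_moment.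
have M0 : 0 <= M by apply: le_trans (fM 0).
have m2 : measurable_fun setT (fun w => (k x w ^+ 2)%:E : \bar R).
  by apply/measurable_EFinP; apply: measurable_funX; exact: mk.
apply/integrableP; split.
  by apply/measurable_EFinP; apply: measurable_funM; [exact: mk|exact: mfX].
apply: (@le_lt_trans _ _ (\int[P]_w (M%:E * (1 + (k x w ^+ 2)%:E)))%E).
  apply: ge0_le_integral_nomeas => w; first exact: abse_ge0.
  rewrite /= -EFinD -EFinM lee_fin normrM mulrC; apply: ler_pM => //.
  by rewrite ger0_norm ?expR_ge0//; have := sqr_ge0 (k x w - 2^-1); rewrite sqrrB; lra.
rewrite ge0_integralZl//; last 2 first.
- exact: emeasurable_funD.
- by move=> w _; rewrite adde_ge0// lee_fin sqr_ge0.
rewrite ge0_integralD//.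
rewrite integral_cst_prob; apply: (@le_lt_trans _ _ (M%:E * (1 + M2%:E))%E); last exact: ltry.
by apply: lee_wpmul2l => //; exact: leeD2l.
Qed.

Lemma feynman_kac_lin (f g : E -> R) (M N a : R) x : measurable_fun setT f -> measurable_fun setT g ->
  (forall y, `|f y| <= M) -> (forall y, `|g y| <= N) ->
  T (fun y => f y + a * g y) x = T f x + a * T g x.
Proof.
move=> mf mg fM gN; have i1 := feynman_kac_integrable x mf fM; have i2 := feynman_kac_integrable x mg gN.
rewrite /feynman_kac -RintegralZl//.
have i3 : P.-integrable setT (EFin \o (fun w => a * (k x w * g (x + X 1 w)))).
  by have := integrableZl measurableT a i2.
rewrite -[RHS](RintegralD measurableT i1 i3); apply: eq_Rintegral => w _.
rewrite /potential_integral; ring.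
Qed.

Lemma feynman_kac_sum (f : E -> R) (phi : nat -> E -> R) (a : nat -> R) N : measurable_fun setT f ->
  (forall m, measurable_fun setT (phi m)) -> (exists M, forall y, `|f y| <= M) ->
  (forall m, exists M, forall y, `|phi m y| <= M) ->
  [/\ measurable_fun setT (fun y => f y + \sum_(m < N) a m * phi m y),
     exists M, forall y, `|f y + \sum_(m < N) a m * phi m y| <= M &
     forall x, T (fun y => f y + \sum_(m < N) a m * phi m y) x = T f x + \sum_(m < N) a m * T (phi m) x].
Proof.
move=> mf mphi fM phiM; elim: N => [|N [IH1 [M IH2] IH3]].
  have e : (fun y => f y + \sum_(m < 0) a m * phi m y) = f by apply/funext => y; rewrite big_ord0 addr0.
  by split; [rewrite e|have [M hM] := fM; exists M => y; rewrite big_ord0 addr0|move=> x; rewrite e big_ord0 addr0].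
have e : (fun y => f y + \sum_(m < N.+1) a m * phi m y) = (fun y => (f y + \sum_(m < N) a m * phi m y) + a N * phi N y).
  by apply/funext => y; rewrite big_ord_recr/= addrA.
have [M' hM'] := phiM N; rewrite e; split.
- by apply: measurable_funD => //; exact: measurable_funM.
- exists (M + `|a N| * M') => y; rewrite big_ord_recr/= addrA; apply: le_trans (ler_normD _ _) _.
  by apply: lerD => //; rewrite normrM ler_wpM2l.
- by move=> x; rewrite (feynman_kac_lin _ _ IH1 (mphi N) IH2 hM') IH3 big_ord_recr/= addrA.
Qed.

(** Weighted arithmetic-geometric mean: [|g x| k |f (x + X_1)|] is at most [s / 2] times the square
    of [f (x + X_1)] plus [(2 s)^-1] times the square of [g x * k]. Translation invariance of
    Lebesgue measure evaluates the first term, [weight_second_moment] the second. With [s] free,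
    this serves as a continuity estimate when [f] is small. *)
Lemma feynman_kac_pair : exists2 M2, 0 < M2 & forall (f g u : E -> R) (s : R),
  measurable_fun setT f -> measurable_fun setT g -> measurable_fun setT u -> 0 < s ->
  {ae leb, forall x, T f x = u x} ->
  (\int[leb]_x (`|u x * g x|)%:E <= (s / 2)%:E * sqint f + (M2 / (2 * s))%:E * sqint g)%E.
Proof.
have [M2 M20 hM2] := weight_second_moment; exists M2 => // f g u s mf mg mu s0 Tu.
have s2 : 0 <= s / 2 by rewrite divr_ge0// ltW.
have c2 : 0 <= (2 * s)^-1 by rewrite invr_ge0 mulr_ge0// ltW.
have Ms : 0 <= M2 / (2 * s) by rewrite mulr_ge0// ltW.
pose F (z : E * Omega) : \bar R := (f (z.1 + X 1 z.2) ^+ 2)%:E.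
have mF : measurable_fun setT F.
  apply/measurable_EFinP; apply: measurable_funX; apply: (measurableT_comp mf); apply: measurable_funD_rV => //.
  exact: (measurableT_comp mX1 measurable_snd).
have F0 z : (0 <= F z)%E by rewrite lee_fin sqr_ge0.
pose A x := (\int[P]_w F (x, w))%E.
have mA : measurable_fun setT A by exact: (@measurable_fun_fubini_tonelli_F _ _ _ _ _ P F mF F0).
have A0 x : (0 <= A x)%E by apply: integral_ge0 => w _; exact: F0.
have mg2 : measurable_fun setT (fun x => (g x ^+ 2)%:E) by apply/measurable_EFinP; exact: measurable_funX.
have g20 x : (0 <= (g x ^+ 2)%:E)%E by rewrite lee_fin sqr_ge0.
have iA : (\int[leb]_x A x = sqint f)%E.
  have mf2 : measurable_fun setT (fun x => (f x ^+ 2)%:E) by apply/measurable_EFinP; exact: measurable_funX.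
  have := @tonelli_set _ _ _ _ _ leb P setT F measurableT mF F0; rewrite -/A => ->.
  rewrite -[RHS](@integral_cst_prob _ _ _ P); apply: eq_integral => w _.
  rewrite -[RHS](@ge0_integral_rV_addl R d (X 1 w) (fun x => (f x ^+ 2)%:E) mf2 (fun x => ltac:(by rewrite lee_fin sqr_ge0))).
  by apply: eq_integral => x _; rewrite /F /= addrC.
rewrite -iA /sqint -ge0_integralZl//.
rewrite -ge0_integralZl//.
rewrite -ge0_integralD//; last 4 first.
- by move=> x _; rewrite mule_ge0.
- exact: measurable_funeM.
- by move=> x _; rewrite mule_ge0.
- exact: measurable_funeM.
apply: ae_ge0_le_integral => //.
- by apply/measurable_EFinP; apply: measurableT_comp => //; exact: measurable_funM.
- by move=> x _; rewrite adde_ge0// mule_ge0.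
- by apply: emeasurable_funD; exact: measurable_funeM.
apply: filterS Tu => x <- _; rewrite normrM.
have mh : measurable_fun setT (fun w => (k x w * f (x + X 1 w))%:E).
  by apply/measurable_EFinP; apply: measurable_funM; [exact: mk|exact: mfX].
have mah : measurable_fun setT (fun w => `|(k x w * f (x + X 1 w))%:E|%E) by exact: measurableT_comp.
have mk2 : measurable_fun setT (fun w => (k x w ^+ 2)%:E : \bar R).
  by apply/measurable_EFinP; apply: measurable_funX; exact: mk.
have mFx : measurable_fun setT (fun w => F (x, w)).
  by apply/measurable_EFinP; apply: measurable_funX; exact: mfX.
have Tle : (`|T f x|%:E <= \int[P]_w `|(k x w * f (x + X 1 w))%:E|)%E.
  rewrite /feynman_kac /Rintegral; apply: le_trans (le_abse_integral P measurableT mh).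
  rewrite /potential_integral; by case: (integral _ _ _) => [r| |] //=; rewrite ?normr0 leey.
rewrite EFinM muleC; apply: le_trans (lee_wpmul2l _ Tle) _ => //.
rewrite -ge0_integralZl//.
apply: (@le_trans _ _ (\int[P]_w ((s / 2)%:E * F (x, w) + ((2 * s)^-1 * g x ^+ 2)%:E * (k x w ^+ 2)%:E))%E).
  apply: ge0_le_integral_nomeas => w; first by rewrite mule_ge0.
  rewrite /= -!EFinM -EFinD lee_fin normrM [`|k x w|]ger0_norm ?expR_ge0//.
  rewrite -[f _ ^+ 2]real_normK ?num_real// -[g x ^+ 2]real_normK ?num_real//.
  move: (k x w) (`|f (x + X 1 w)|) (`|g x|) => kk ff gg.
  have -> : s / 2 * ff ^+ 2 + (2 * s)^-1 * gg ^+ 2 * kk ^+ 2 = (2 * s)^-1 * ((s * ff - gg * kk) ^+ 2) + gg * (kk * ff).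
    by field; rewrite lt0r_neq0.
  by rewrite lerDr mulr_ge0// sqr_ge0.
have gs0 : 0 <= (2 * s)^-1 * g x ^+ 2 by rewrite mulr_ge0// sqr_ge0.
rewrite ge0_integralD//; last 4 first.
- by move=> w _; rewrite mule_ge0.
- exact: measurable_funeM.
- by move=> w _; rewrite mule_ge0// lee_fin sqr_ge0.
- exact: measurable_funeM.
rewrite ge0_integralZl//.
rewrite ge0_integralZl//.
apply: leeD => //; apply: le_trans (lee_wpmul2l _ (hM2 x)) _; first by rewrite lee_fin.
by rewrite -!EFinM lee_fin le_eqVlt; apply/orP; left; apply/eqP; ring.
Qed.

End semigroup_L2.

(** * Comparison of two eigensystems *)

Section eigenvalue_comparison.
Context (R : realType) (d : nat) (disp : measure_display)
  (Omega : measurableType disp) (P : probability Omega R)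
  (X : R -> Omega -> 'rV[R]_d).
Hypothesis hX : levy_process P X.
Local Notation E := 'rV[R]_d.
Local Notation leb := (lebesgue_rV R d).
Variable V : E -> R.
Hypothesis hV : kato_potential P X V.

Lemma eigenvalue_sorted lambda (phi : nat -> E -> R) i j : eigensystem P X V lambda phi ->
  (i <= j)%N -> lambda i <= lambda j.
Proof.
move=> h; elim: j => [|j IH]; first by rewrite leqn0 => /eqP ->.
rewrite leq_eqVlt => /orP[/eqP ->//|]; rewrite ltnS => /IH ij; apply: le_trans ij _.
by case: j {IH} => [|j]; [exact: ltW (eigen_gap h)|exact: (eigen_mono h (ltn0Sn _))].
Qed.

(** Let [r] be the remainder of the expansion of [f] after [N > m] terms. Its image is computed
    termwise, and the inner product of that image with [phi m] is [(mu - exp (- lambda m)) *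
    L2_inner f (phi m)] for every such [N]. As [r] tends to 0, [feynman_kac_pair] makes this product
    smaller than itself unless it is 0. *)
Lemma eigenvector_orthogonal lambda (phi : nat -> E -> R) (f : E -> R) (mu : R) m : eigensystem P X V lambda phi ->
  L2 f -> (exists M, forall y, `|f y| <= M) -> {ae leb, forall x, feynman_kac P X V 1 f x = mu * f x} ->
  mu != expR (- lambda m) -> L2_inner f (phi m) = 0.
Proof.
move=> h Lf fM feq mue; have basis := eigen_basis h.
have mphi k : measurable_fun setT (phi k) by case: basis => /(_ k) [].
have [mf _] := Lf; have sf := L2_sqint Lf.
pose c k := L2_inner f (phi k); pose e k := expR (- lambda k).
apply/eqP; apply: contraT => cm0; exfalso.
pose D := `|(mu - e m) * c m|.
have D0 : 0 < D by rewrite normr_gt0 mulf_neq0// subr_eq0.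
have [M2 M20 pair] := feynman_kac_pair hX hV.
(* With this [s] and the remainder below [D ^+ 2 / (2 * M2)], the two terms of the pairing bound are
   [D / 4] and [D / 2], together less than [D]. *)
pose s := M2 / D; have s0 : 0 < s by rewrite divr_gt0.
have eps0 : 0 < D ^+ 2 / (2 * M2) by rewrite divr_gt0 ?exprn_gt0// mulr_gt0.
have [N1 hN1] := basis_remainder basis Lf eps0.
pose N := maxn N1 m.+1; have mN : (m < N)%N by exact: leq_maxr.
have hr := hN1 N (leq_maxl _ _).
have [mr _ Tr] := feynman_kac_sum hX hV (fun k => - c k) N mf mphi fM (eigen_bounded h).
set r := (fun y => f y + _) in mr Tr.
(* [mu * f] is written as [f + (mu - 1) * f], the shape to which the linearity lemmas apply. *)
have mf' : measurable_fun setT (fun x => f x + (mu - 1) * f x).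
  by apply: measurable_funD => //; exact: measurable_funM.
have sf' := sqint_lin (mu - 1) mf mf sf sf.
have [mu' su iu] := L2_inner_sum basis (fun k => - (c k * e k)) N m mf' sf'.
set u := (fun y => f y + (mu - 1) * f y + _) in mu' su iu.
have sm : (sqint (phi m) < +oo)%E by rewrite (sqint_basis basis); exact: ltry.
have inner_u : L2_inner u (phi m) = (mu - e m) * c m.
  rewrite iu mN (L2_inner_lin (mu - 1) mf mf (mphi m) sf sf sm) -/(c m); ring.
have ae_phi : {ae leb, forall x, forall k, feynman_kac P X V 1 (phi k) x = e k * phi k x}.
  apply: ae_foralln => k; have := eigen_eq h k ltr01.
  by apply: filterS => x ->; rewrite mulr1.
have ae_u : {ae leb, forall x, feynman_kac P X V 1 r x = u x}.
  apply: filterS2 feq ae_phi => x h1 h2; rewrite Tr h1 /u; congr (_ + _); first ring.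
  by apply: eq_bigr => k _; rewrite h2 mulrA mulNr.
have := pair r (phi m) u s mr (mphi m) mu' s0 ae_u.
rewrite (sqint_basis basis) mule1 => h3.
have s2 : (0 <= (s / 2)%:E)%E by rewrite lee_fin divr_ge0// ltW.
have := le_trans (le_trans (L2_inner_le mu' (mphi m)) h3) (leeD2r _ (lee_wpmul2l s2 hr)).
rewrite inner_u -/D -EFinM -EFinD lee_fin.
have -> : s / 2 * (D ^+ 2 / (2 * M2)) + M2 / (2 * s) = D * (3 / 4).
  by rewrite /s; field; rewrite !lt0r_neq0.
lra.
Qed.

Lemma L2_inner_suml (psi : nat -> E -> R) (a : nat -> R) (h : E -> R) N :
  (forall k, measurable_fun setT (psi k)) -> (forall k, (sqint (psi k) < +oo)%E) ->
  measurable_fun setT h -> (sqint h < +oo)%E ->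
  L2_inner (fun x => \sum_(k < N) a k * psi k x) h = \sum_(k < N) a k * L2_inner (psi k) h.
Proof.
move=> mpsi spsi mh sh.
suff : [/\ measurable_fun setT (fun x => \sum_(k < N) a k * psi k x),
    (sqint (fun x => \sum_(k < N) a k * psi k x)%R < +oo)%E &
    L2_inner (fun x => \sum_(k < N) a k * psi k x) h = \sum_(k < N) a k * L2_inner (psi k) h] by case.
elim: N => [|N [IH1 IH2 IH3]].
  have -> : (fun x => \sum_(k < 0) a k * psi k x) = (fun=> 0) by apply/funext => x; rewrite big_ord0.
  split; first exact: measurable_cst.
    by rewrite /sqint expr0n/= integral0.
  by rewrite big_ord0 /L2_inner; under eq_Rintegral do rewrite mul0r; rewrite /Rintegral integral0.
have -> : (fun x => \sum_(k < N.+1) a k * psi k x) = (fun x => \sum_(k < N) a k * psi k x + a N * psi N x).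
  by apply/funext => x; rewrite big_ord_recr.
split; [by apply: measurable_funD => //; exact: measurable_funM|exact: sqint_lin|].
by rewrite L2_inner_lin// IH3 big_ord_recr.
Qed.

(** If [lambda n < lambda' n], the functions [phi 0], ..., [phi n] are orthogonal to all [phi' j]
    with [j >= n], hence combinations of [n] functions. The coefficient matrix then factors the
    identity of size [n + 1] through rank at most [n]. *)
Lemma eigenvalue_le lambda (phi : nat -> E -> R) lambda' (phi' : nat -> E -> R) n :
  eigensystem P X V lambda phi -> eigensystem P X V lambda' phi' -> lambda' n <= lambda n.
Proof.
move=> h h'; rewrite leNgt; apply/negP => ll'.
have basis := eigen_basis h; have basis' := eigen_basis h'.
have mphi k : measurable_fun setT (phi k) by case: basis => /(_ k) [].
have mphi' k : measurable_fun setT (phi' k) by case: basis' => /(_ k) [].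
have sphi k : (sqint (phi k) < +oo)%E by rewrite (sqint_basis basis); exact: ltry.
have sphi' k : (sqint (phi' k) < +oo)%E by rewrite (sqint_basis basis'); exact: ltry.
have Lphi k : L2 (phi k) by case: basis.
have inner0 i j : (i <= n)%N -> (n <= j)%N -> L2_inner (phi i) (phi' j) = 0.
  move=> ni nj; apply: (eigenvector_orthogonal h' (Lphi i) (eigen_bounded h i) (mu := expR (- lambda i))).
    by have := eigen_eq h i ltr01; apply: filterS => x ->; rewrite mulr1.
  rewrite (inj_eq (@expR_inj R)) (inj_eq oppr_inj) lt_eqF//.
  by apply: le_lt_trans (eigenvalue_sorted h ni) _; apply: lt_le_trans ll' (eigenvalue_sorted h' nj).
have cphi k : continuous (phi k) by case: h.
have cphi' k : continuous (phi' k) by case: h'.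
have expand i : (i <= n)%N -> phi i = (fun x => \sum_(j < n) L2_inner (phi i) (phi' j) * phi' j x).
  move=> ni; apply/funext => x; apply: (basis_finite basis' (cphi i) cphi' (Lphi i)).
  by move=> j; exact: inner0.
pose B : 'M[R]_(n.+1, n) := \matrix_(i, j) L2_inner (phi i) (phi' j).
have BB : B *m B^T = 1%:M.
  apply/matrixP => i k; rewrite !mxE; under eq_bigr do rewrite !mxE.
  have := @L2_inner_suml phi' (fun j => L2_inner (phi i) (phi' j)) (phi k) n mphi' sphi' (mphi k) (sphi k).
  rewrite -(expand i (leq_ord i)); case: basis => _ -> _ e.
  rewrite e; apply: eq_bigr => j _; congr (_ * _).
  by rewrite /L2_inner; apply: eq_Rintegral => x _; rewrite mulrC.
have := mxrankM_maxl B B^T; rewrite BB mxrank1 => h1.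
by have := leq_trans h1 (rank_leq_col B); rewrite ltnn.
Qed.

End eigenvalue_comparison.

(* Any other eigensystem is a finite linear combination, with coefficients at
   most 1, of a fixed one, so the constant does not depend on the eigensystem. *)
Theorem corollary2p1 (R : realType) (d : nat) (d_ge1 : (1 <= d)%N)
    (disp : measure_display) (Omega : measurableType disp)
    (P : probability Omega R) (X : R -> Omega -> 'rV[R]_d)
    (hX : regular_jump_levy_process P X)
    (V : 'rV[R]_d -> R) (hV : kato_potential P X V) (Vconf : confining V)
    (n : nat) (n_ge1 : (1 <= n)%N) :
  exists2 C10 : R, 0 < C10 &
    forall (lambda : nat -> R) (phi : nat -> 'rV[R]_d -> R),
      eigensystem P X V lambda phi ->
      forall x : 'rV[R]_d, `|phi n x| <= C10 * phi 0%N x.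
Proof.
(* The constant is built from one fixed eigensystem; if there is none, any constant will do. *)
have [[lambda [phi h]]|none] := pselect (exists lambda phi, eigensystem P X V lambda phi); last first.
  by exists 1 => // lambda phi h; exfalso; apply: none; exists lambda, phi.
have hL : levy_process P X by case: hX.
have /choice[C hC] : forall k, exists C, 0 < C /\ forall x, `|phi k x| <= C * phi 0%N x.
  by move=> k; have [C C0 hC] := eigenfunction_le_ground d_ge1 hX hV Vconf h k; exists C.
(* From [N] on the eigenvalues exceed [lambda n], which bounds the eigenvalue of index [n] of any
   other system, so only [phi k] with [k < N] occur in its eigenfunction. *)
have /cvgryPgt/(_ (lambda n)) [N _ hN] := eigen_cvg h.
have C0 k : 0 <= C k by apply: ltW; case: (hC k).
have S0 : 0 <= \sum_(k < N) C k by apply: sumr_ge0 => k _.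
exists (\sum_(k < N) C k + 1) => [|lambda' phi' h' x]; first by rewrite ltr_wpDl.
have basis := eigen_basis h; have basis' := eigen_basis h'.
have L2phi k : L2 (phi k) by case: basis.
have L2phi' k : L2 (phi' k) by case: basis'.
have cphi k : continuous (phi k) by case: h.
have cphi' k : continuous (phi' k) by case: h'.
have eig1 (l : nat -> R) (f : nat -> 'rV[R]_d -> R) k : eigensystem P X V l f ->
    {ae lebesgue_rV R d, forall y, feynman_kac P X V 1 (f k) y = expR (- l k) * f k y}.
  by move=> hf; have := eigen_eq hf k ltr01; apply: filterS => y ->; rewrite mulr1.
have gt0' : 0 < phi' 0%N x := ground_state_gt0 h' x.
have gt0 : 0 < phi 0%N x := ground_state_gt0 h x.
(* The lowest eigenvalues coincide and are separated from the rest by the gap, so [phi 0] is a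
   multiple of [phi' 0]; its coefficient is at most 1 by normalization. *)
have ground : phi 0%N x <= phi' 0%N x.
  have l0 : lambda 0%N = lambda' 0%N.
    by apply/eqP; rewrite eq_le (eigenvalue_le hL hV _ h' h) (eigenvalue_le hL hV _ h h').
  have o k : (1 <= k)%N -> L2_inner (phi 0%N) (phi' k) = 0.
    move=> k1; apply: (eigenvector_orthogonal hL hV h' (L2phi 0%N) (eigen_bounded h 0%N) (eig1 _ _ 0%N h)).
    rewrite (inj_eq (@expR_inj R)) (inj_eq oppr_inj) l0 lt_eqF//.
    exact: (lt_le_trans (eigen_gap h') (eigenvalue_sorted h' k1)).
  have := basis_finite basis' (cphi 0%N) cphi' (L2phi 0%N) o x.
  rewrite big_ord_recl big_ord0 addr0 => ->.
  have := L2_inner_le1 basis' 0%N (proj1 (L2phi 0%N)) (sqint_basis basis 0%N).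
  by move=> hle; rewrite ler_piMl ?(ltW gt0')//; exact: le_trans (ler_norm _) hle.
have o k : (N <= k)%N -> L2_inner (phi' n) (phi k) = 0.
  move=> Nk; apply: (eigenvector_orthogonal hL hV h (L2phi' n) (eigen_bounded h' n) (eig1 _ _ n h')).
  rewrite (inj_eq (@expR_inj R)) (inj_eq oppr_inj) lt_eqF//.
  by apply: le_lt_trans (eigenvalue_le hL hV n h h') _; exact: hN.
rewrite (basis_finite basis (cphi' n) cphi (L2phi' n) o x).
apply: le_trans (ler_norm_sum _ _ _) _.
apply: (@le_trans _ _ (\sum_(k < N) C k * phi 0%N x)).
  apply: ler_sum => k _; rewrite normrM -[leRHS]mul1r; apply: ler_pM => //.
    exact: (L2_inner_le1 basis k (proj1 (L2phi' n)) (sqint_basis basis' n)).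
  by case: (hC k).
rewrite -mulr_suml; apply: ler_pM => //; first exact: ltW.
by rewrite lerDl.
Qed.
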